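(* Let $q\ge 3$ and let $\chi$ be a non-principal Dirichlet character modulo $q$, and assume the Generalized Riemann Hypothesis for $L(s,\chi)$. Then there exists $\ell_\chi\in\mathbb C$, $\ell_\chi\ne 0$, such that for all $\varepsilon>0$ the natural density of the set \[\mathcal{E}_\chi:=\left\{x\ge 2\, :\, \left| (\log x)^{m_\chi} \prod_{p\le x}\left(1-\frac{\chi(p)}{p^{1/2}}\right)^{-1}-\ell_\chi \right|\le \frac{(\log \log x)^{3+\varepsilon}}{\log x} \right\}\] exists and equals $1$.
   Context: The product runs over primes $p\le x$. $m_\chi:=\mathrm{ord}_{s=1/2}L(s,\chi)$ is the order of vanishing of $L(s,\chi)$ at $s=1/2$. The natural density of a Borel set $A\subset[2,\infty)$ is $\lim_{X\to\infty}\frac1X\mathrm{meas}\{2\le x\le X: x\in A\}$ (Lebesgue measure), when the limit exists. *)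

(* Defs.v *)
From HB Require Import structures.
From mathcomp Require Import all_boot all_order all_algebra.
From mathcomp Require Import all_classical all_reals all_analysis.
From mathcomp Require Import complex.
Set Implicit Arguments. Unset Strict Implicit. Unset Printing Implicit Defensive.
Import Order.TTheory GRing.Theory Num.Theory numFieldTopology.Exports numFieldNormedType.Exports.
Local Open Scope classical_set_scope.
Local Open Scope ring_scope.
Local Open Scope complex_scope.

HB.instance Definition _ (R : rcfType) :=
  NormedModule.copy R[i] (R[i] : numClosedFieldType)^o.

Section Defs.
Variable R : realType.

Definition is_dirichlet_character (q : nat) (chi : nat -> R[i]) : Prop :=
  [/\ (0 < q)%N,
      chi 1%N = 1,
      (forall m n : nat, chi (m * n)%N = chi m * chi n),
      (forall n : nat, chi (n + q)%N = chi n) &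
      (forall n : nat, (chi n == 0) = ~~ coprime n q)].

Definition nonprincipal (q : nat) (chi : nat -> R[i]) : Prop :=
  exists n : nat, coprime n q /\ chi n != 1.

Definition npow_neg (n : nat) (s : R[i]) : R[i] :=
  (expR (- complex.Re s * ln (n%:R : R)) * cos (complex.Im s * ln (n%:R : R)))
    +i* (- (expR (- complex.Re s * ln (n%:R : R)) * sin (complex.Im s * ln (n%:R : R)))).

(* L(s, chi) given by its Dirichlet series sum_{n>=1} chi(n) n^(-s)
   (convergent for complex.Re s > 0 when chi is non-principal). *)
Definition Lfun (chi : nat -> R[i]) (s : R[i]) : R[i] :=
  lim ((fun N : nat => \sum_(1 <= n < N) chi n * npow_neg n s) @ \oo).

Definition GRH (chi : nat -> R[i]) : Prop :=
  forall s : R[i], 2^-1 < complex.Re s -> Lfun chi s != 0.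

Definition vanishing_order (chi : nat -> R[i]) (m : nat) : Prop :=
  exists2 c : R[i], c != 0 &
    (fun s : R[i] => Lfun chi s / (s - (2^-1 : R)%:C) ^+ m) x
      @[x --> ((2^-1 : R)%:C)^'] --> c.

Definition euler_prod (chi : nat -> R[i]) (x : R) : R[i] :=
  \prod_(0 <= p < (Num.truncn x).+1 | prime p)
     (1 - chi p / (Num.sqrt (p%:R : R))%:C)^-1.

Definition has_natural_density (A : set R) (d : R) : Prop :=
  (fun X : R => fine (lebesgue_measure (A `&` [set x | 2 <= x <= X])) / X)
    x @[x --> +oo] --> d.

Definition Eset (chi : nat -> R[i]) (m : nat) (l : R[i]) (eps : R) : set R :=
  [set x | 2 <= x /\
     `| ((ln x ^+ m)%:C * euler_prod chi x) - l |
        <= ((ln (ln x) `^ (3 + eps)) / ln x)%:C].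

End Defs.

(* Main.v *)
Require Import Defs.
From HB Require Import structures.
From mathcomp Require Import all_boot all_order all_algebra.
From mathcomp Require Import all_classical all_reals all_analysis.
From mathcomp Require Import complex.
From mathcomp Require Import ring lra zify.
Set Implicit Arguments. Unset Strict Implicit. Unset Printing Implicit Defensive.
Import Order.TTheory GRing.Theory Num.Theory numFieldTopology.Exports numFieldNormedType.Exports.
Local Open Scope classical_set_scope.
Local Open Scope ring_scope.
Local Open Scope complex_scope.

(** Let F(w) = - (L'/L)(1/2 + w) and c(n) = Lambda(n) chi(n) n^(-1/2), so that F(w) = sum c(n) n^(-w).
    By GRH F is holomorphic for Re w > 0 and F(w) + m/w tends to some G0 as w tends to 0.  The sums
    beta(n) = sum_(j <= n) c(j) + m log n - G0 are smoothed by a Poisson kernel: for large a, the k-th Taylor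
    coefficient at z = 0 of (F(w) + m/w - G0)/(1 - z), where w = a (1 - z), is a Poisson average of beta concentrated
    at log n = k/a.  Multiplying by a polynomial in z that damps high frequencies splits this series in two: on the
    circle |z| = 1 - 1/(a U) the smooth part has coefficients O((log U)^3), since F is a sum of at most O(log |t|)
    polar terms near height t, and the rest has small mean square by Parseval.  Hence beta(n) = O((log U)^3) for
    U <= log n < U + 1, outside a set of n of logarithmic mass O(1/U).

    The exceptional n have density 0, and Abel summation turns the bound into the convergence, at rate
    (log log n)^3 / log n, of sum_(j <= n) c(j)/log j + m log log n - beta(n)/log n.  This sum is the logarithm of the
    Euler product up to the squares of the primes in (sqrt n, n], whose contribution tends to a constant by Mertens'
    theorem for chi^2.  Everything is proved with polynomial approximation and averages over roots of unity in place
    of complex integration. *)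

(** With l = a log n and w = a (1 - z), the term n^(-w) equals e^(-l) e^(l z), whose Taylor
    coefficients in z are Poisson weights; an explicit-formula argument thus becomes a statement
    about the coefficients of one power series. The obstacle is that the Dirichlet series of F is
    under control only near z = 0, whereas GRH is exploited near |z| = 1. A single polynomial close
    to the series on the whole disc |z| <= 1 - 1/(a U) mediates: its coefficients are identified on
    |z| = 1/4 and estimated on the outer circle. The constants do not depend on a, which is taken as
    large as each block of n demands.

    The three logarithms come from the number of polar terms near a height at most about U^32, from
    averaging one polar term at distance at least 1/(2 U), and from summing 1/|w| over heights. The
    damping sets in at |w| = U^16; the powers 16 and 32 have to outweigh the factor U^2 in the crude
    bound for F near the imaginary axis. The polar terms sit at zeros of polynomials that
    approximate L, not at zeros of L. *)

Section Modulus.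
Variable R : realType.
Local Notation C := R[i].
Implicit Types (z w : C) (x y t : R).

(** The norm of [R[i]] takes values in [R[i]]; [cm] is the modulus as a real number. *)
Definition cm z : R := complex.Re `|z|.

Lemma cmE z : `|z| = (cm z)%:C.
Proof. by rewrite /cm normc_def. Qed.

Lemma cm_sqrt z : cm z = Num.sqrt (complex.Re z ^+ 2 + complex.Im z ^+ 2).
Proof. by rewrite /cm normc_def. Qed.

Lemma cm_ge0 z : 0 <= cm z.
Proof. by rewrite cm_sqrt sqrtr_ge0. Qed.

Lemma cm_sq z : cm z ^+ 2 = complex.Re z ^+ 2 + complex.Im z ^+ 2.
Proof. by rewrite cm_sqrt sqr_sqrtr // addr_ge0 // sqr_ge0. Qed.

Lemma cmM z w : cm (z * w) = cm z * cm w.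
Proof. by apply: (@complexI R); rewrite -cmE normrM !cmE rmorphM. Qed.

Lemma cm0 : cm 0 = 0.
Proof. by rewrite /cm normr0. Qed.

Lemma cm1 : cm 1 = 1.
Proof. by rewrite /cm normr1. Qed.

Lemma cm_eq0 z : (cm z == 0) = (z == 0).
Proof. by rewrite -(normr_eq0 z) cmE -(inj_eq (@complexI R)). Qed.

Lemma cm_gt0 z : (0 < cm z) = (z != 0).
Proof. by rewrite lt_neqAle eq_sym cm_eq0 cm_ge0 andbT. Qed.

Lemma cmN z : cm (- z) = cm z.
Proof. by rewrite /cm normrN. Qed.

Lemma cmB z w : cm (z - w) = cm (w - z).
Proof. by rewrite -cmN opprB. Qed.

Lemma cmV z : cm z^-1 = (cm z)^-1.
Proof. by apply: (@complexI R); rewrite -cmE normfV cmE fmorphV. Qed.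

Lemma cmX z n : cm (z ^+ n) = cm z ^+ n.
Proof. by elim: n => [|n IH]; rewrite ?cm1 // !exprS cmM IH. Qed.

Lemma cm_D z w : cm (z + w) <= cm z + cm w.
Proof. by rewrite -lecR rmorphD -!cmE ler_normD. Qed.

Lemma cm_subD z w : cm (z - w) <= cm z + cm w.
Proof. by rewrite -(cmN w) cm_D. Qed.

Lemma cm_tri z w u : cm (z - w) <= cm (z - u) + cm (u - w).
Proof. by have := cm_D (z - u) (u - w); rewrite addrA subrK. Qed.

Lemma cm_rev z w : cm z - cm w <= cm (z - w).
Proof. by rewrite lerBlDr (le_trans _ (cm_D _ _)) // subrK. Qed.

Lemma cm_real x : cm x%:C = `|x|.
Proof. by rewrite cm_sqrt /= expr0n addr0 sqrtr_sqr. Qed.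

Lemma cm_nat n : cm n%:R = n%:R.
Proof. by rewrite -(rmorph_nat (@real_complex_def R (Phant R))) cm_real normr_nat. Qed.

Lemma cm_Re z : `|complex.Re z| <= cm z.
Proof. by rewrite cm_sqrt -sqrtr_sqr ler_sqrt ?addr_ge0 ?sqr_ge0 // lerDl sqr_ge0. Qed.

Lemma cm_Im z : `|complex.Im z| <= cm z.
Proof. by rewrite cm_sqrt -sqrtr_sqr ler_sqrt ?addr_ge0 ?sqr_ge0 // lerDr sqr_ge0. Qed.

Lemma cm_le_ReIm z : cm z <= `|complex.Re z| + `|complex.Im z|.
Proof.
rewrite -(ler_pXn2r (n := 2)) ?nnegrE ?cm_ge0 ?addr_ge0 //.
rewrite cm_sq sqrrD !real_normK ?num_real //.
by have := mulr_ge0 (normr_ge0 (complex.Re z)) (normr_ge0 (complex.Im z)); lra.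
Qed.

Lemma cm_sum (I : Type) (r : seq I) (P : pred I) (F : I -> C) :
  cm (\sum_(i <- r | P i) F i) <= \sum_(i <- r | P i) cm (F i).
Proof.
elim/big_rec2: _ => [|i x z _ H]; first by rewrite cm0.
by apply: (le_trans (cm_D _ _)); rewrite lerD2l.
Qed.

Lemma cm_prod (I : Type) (r : seq I) (P : pred I) (F : I -> C) :
  cm (\prod_(i <- r | P i) F i) = \prod_(i <- r | P i) cm (F i).
Proof. by elim/big_rec2: _ => [|i x z _ H]; rewrite ?cm1 // cmM H. Qed.

Lemma reD z w : complex.Re (z + w) = complex.Re z + complex.Re w.
Proof. by case: z; case: w. Qed.
Lemma imD z w : complex.Im (z + w) = complex.Im z + complex.Im w.
Proof. by case: z; case: w. Qed.
Lemma reN z : complex.Re (- z) = - complex.Re z.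
Proof. by case: z. Qed.
Lemma imN z : complex.Im (- z) = - complex.Im z.
Proof. by case: z. Qed.
Lemma reM z w : complex.Re (z * w) = complex.Re z * complex.Re w - complex.Im z * complex.Im w.
Proof. by case: z; case: w. Qed.
Lemma imM z w : complex.Im (z * w) = complex.Re z * complex.Im w + complex.Im z * complex.Re w.
Proof. by case: z => a b; case: w => c d. Qed.
Lemma reMr x z : complex.Re (x%:C * z) = x * complex.Re z.
Proof. by rewrite reM /= mul0r subr0. Qed.
Lemma imMr x z : complex.Im (x%:C * z) = x * complex.Im z.
Proof. by rewrite imM /= mul0r addr0. Qed.
Lemma re_nat n : complex.Re (n%:R : C) = n%:R.
Proof. by rewrite -(rmorph_nat (@real_complex_def R (Phant R))). Qed.
Lemma im_nat n : complex.Im (n%:R : C) = 0.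
Proof. by rewrite -(rmorph_nat (@real_complex_def R (Phant R))). Qed.
Lemma re_sum (I : Type) (r : seq I) (P : pred I) (F : I -> C) :
  complex.Re (\sum_(i <- r | P i) F i) = \sum_(i <- r | P i) complex.Re (F i).
Proof. by elim/big_rec2: _ => [//|i x z _ <-]; rewrite reD. Qed.
Lemma complex_eq z w : complex.Re z = complex.Re w -> complex.Im z = complex.Im w -> z = w.
Proof. by case: z => a b; case: w => c d /= -> ->. Qed.

Lemma ccvgP (u : nat -> C) (l : C) :
  (forall e : R, 0 < e -> exists N : nat, forall n, (N <= n)%N -> cm (u n - l) <= e) ->
  u @ \oo --> l.
Proof.
move=> H; apply/cvgrPdist_le => e e0.
(* A positive element of [R[i]] is real, so the epsilon may be taken in [R]. *)
have eE : e = (complex.Re e)%:C by move: e0; case: e => a b; rewrite ltcE /= => /andP[/eqP -> _].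
have e0' : 0 < complex.Re e by move: e0; rewrite ltcE => /andP[_].
have [N HN] := H _ e0'.
exists N => // n /= Nn; rewrite eE cmE lecR cmB; exact: HN.
Qed.

Lemma ccvgE (u : nat -> C) (l : C) : u @ \oo --> l ->
  forall e : R, 0 < e -> exists N : nat, forall n, (N <= n)%N -> cm (u n - l) <= e.
Proof.
move=> /cvgrPdist_le H e e0.
have e0' : 0 < e%:C by rewrite ltcR.
have [N _ HN] := H _ e0'.
by exists N => n Nn; have := HN n Nn; rewrite /= cmE lecR cmB.
Qed.

Lemma ccvg_lim (u : nat -> C) (l : C) : u @ \oo --> l -> lim (u @ \oo) = l.
Proof. by move=> H; apply: cvg_lim => //; exact: norm_hausdorff. Qed.

Lemma rcvgE (u : nat -> R) (l : R) : u @ \oo --> l ->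
  forall e : R, 0 < e -> exists N : nat, forall n, (N <= n)%N -> `|u n - l| <= e.
Proof.
move=> /cvgrPdist_le H e e0; have [N _ HN] := H _ e0.
by exists N => n Nn; rewrite distrC; exact: HN.
Qed.

Lemma rcauchy (u : nat -> R) :
  (forall e : R, 0 < e -> exists N : nat, forall n m, (N <= n)%N -> (N <= m)%N -> `|u n - u m| <= e) ->
  exists l0 : R, u @ \oo --> l0.
Proof.
move=> H; suff : cvg (u @ \oo) by move=> Hc; exists (lim (u @ \oo)).
apply: cauchy_cvg; apply/cauchyP => e e0.
have [N HN] := H (e / 2) (divr_gt0 e0 (ltr0n _ 2)).
exists (u N); exists N => // n /= Nn.
rewrite /ball /= (le_lt_trans (HN N n (leqnn _) Nn)) //; lra.
Qed.

Lemma ccauchy (u : nat -> C) :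
  (forall e : R, 0 < e -> exists N : nat, forall n m, (N <= n)%N -> (N <= m)%N -> cm (u n - u m) <= e) ->
  exists l0 : C, u @ \oo --> l0.
Proof.
move=> H.
have [a Ha] : exists a : R, (fun n => complex.Re (u n)) @ \oo --> a.
  apply: rcauchy => e e0; have [N HN] := H e e0; exists N => n m Nn Nm.
  by apply: le_trans (HN n m Nn Nm); rewrite -reN -reD cm_Re.
have [b Hb] : exists b : R, (fun n => complex.Im (u n)) @ \oo --> b.
  apply: rcauchy => e e0; have [N HN] := H e e0; exists N => n m Nn Nm.
  by apply: le_trans (HN n m Nn Nm); rewrite -imN -imD cm_Im.
exists (a +i* b); apply: ccvgP => e e0.
have [N1 H1] := rcvgE Ha (divr_gt0 e0 (ltr0n _ 2)).
have [N2 H2] := rcvgE Hb (divr_gt0 e0 (ltr0n _ 2)).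
exists (maxn N1 N2) => n; rewrite geq_max => /andP[n1 n2].
apply: (le_trans (cm_le_ReIm _)); rewrite reD imD reN imN /=.
have := H1 _ n1; have := H2 _ n2; lra.
Qed.

End Modulus.

(** * Complex exponential and logarithm *)

Section CExp.
Variable R : realType.
Local Notation C := R[i].
Implicit Types (z w h : C) (x y t : R).

Lemma sin_abs_le y : `|sin y| <= `|y|.
Proof.
wlog y0 : y / 0 <= y.
  move=> H; have [/H //|/ltW y0] := leP 0 y.
  by have := H (- y); rewrite sinN !normrN; apply; rewrite oppr_ge0.
have [c _ E] := @MVT_segment R (@sin R) (@cos R) 0 y y0 (fun x _ => is_derive_sin x)
  (continuous_subspaceT (@continuous_sin R)).
move: E; rewrite sin0 !subr0 => ->; rewrite normrM ler_piMl //.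
exact: cos_max.
Qed.

Lemma cos_sub1_le y : `|cos y - 1| <= y ^+ 2.
Proof.
have -> : cos y - 1 = - (sin (y / 2) ^+ 2) * 2.
  have E : y = (y / 2) *+ 2 by rewrite mulr2n; lra.
  by rewrite {1}E cos_mulr2n cos2sin2 mulr2n; ring.
rewrite normrM normrN normrX.
have : `|sin (y / 2)| ^+ 2 <= `|y / 2| ^+ 2.
  by rewrite ler_pXn2r ?nnegrE ?normr_ge0 // sin_abs_le.
rewrite (real_normK (num_real (y / 2))) (ger0_norm (ler0n R 2)).
have := sqr_ge0 y; lra.
Qed.

Lemma sin_sub_le y : `|y| <= 1 -> `|sin y - y| <= y ^+ 2.
Proof.
wlog y0 : y / 0 <= y.
  move=> H; have [/H //|/ltW y0] := leP 0 y.
  by have := H (- y); rewrite sinN sqrrN -opprD !normrN; apply; rewrite oppr_ge0.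
rewrite ger0_norm // => y1.
have [c /itvP Hc E] := @MVT_segment R (@sin R) (@cos R) 0 y y0 (fun x _ => is_derive_sin x)
  (continuous_subspaceT (@continuous_sin R)).
move: E; rewrite sin0 !subr0 => ->.
have -> : cos c * y - y = (cos c - 1) * y by ring.
rewrite normrM (ger0_norm y0) expr2 ler_wpM2r //.
apply: (le_trans (cos_sub1_le c)).
have c0 : 0 <= c by rewrite Hc.
have cy : c <= y by rewrite Hc.
nra.
Qed.

Lemma expR_sub1_le x : `|x| <= 1 -> `|expR x - 1 - x| <= 2 * x ^+ 2.
Proof.
move=> x1; have := expR_ge1Dx x => L.
rewrite ger0_norm; last lra.
have half t : t <= 2^-1 -> expR t <= 1 + t + 2 * t ^+ 2.
  move=> t2; have := expR_ge1Dx (- t); rewrite expRN => H.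
  have e0 := expR_gt0 t.
  have : (1 - t) * expR t <= 1.
    by rewrite -ler_pdivlMr // div1r.
  nra.
(* Inverting [1 - t <= expR (- t)] works only for t <= 1/2; the rest of the range follows by
   squaring the estimate at x / 2. *)
have [x2|x2] := leP x 2^-1; first by have := half _ x2; lra.
have x1' : x <= 1 by move: x1; rewrite ler_norml => /andP[].
have h2 : x / 2 <= 2^-1 by lra.
have := half _ h2; have -> : expR x = expR (x / 2) ^+ 2.
  by rewrite -expRM_natl; congr expR; lra.
set e := expR (x / 2); have e0 : 0 < e by exact: expR_gt0.
move=> He; have e2 : e ^+ 2 <= (1 + x / 2 + 2 * (x / 2) ^+ 2) ^+ 2.
  by rewrite ler_pXn2r ?nnegrE //; lra.
apply: (@le_trans _ _ ((1 + x / 2 + 2 * (x / 2) ^+ 2) ^+ 2 - 1 - x)); first lra.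
have -> : (1 + x / 2 + 2 * (x / 2) ^+ 2) ^+ 2 - 1 - x = x ^+ 2 * (5/4 + x / 2 + x ^+ 2 / 4) by field.
have : 5/4 + x / 2 + x ^+ 2 / 4 <= 2 by nra.
have := sqr_ge0 x; nra.
Qed.

Definition cexp z : C :=
  (expR (complex.Re z) * cos (complex.Im z)) +i* (expR (complex.Re z) * sin (complex.Im z)).

Lemma cexpD z w : cexp (z + w) = cexp z * cexp w.
Proof.
by apply: complex_eq; rewrite ?reM ?imM /= reD imD expRD ?cosD ?sinD; ring.
Qed.

Lemma cexp0 : cexp 0 = 1.
Proof. by rewrite /cexp /= expR0 cos0 sin0 mul1r mulr0. Qed.

Lemma cm_cexp z : cm (cexp z) = expR (complex.Re z).
Proof.
by rewrite cm_sqrt /= !exprMn -mulrDr cos2Dsin2 mulr1 sqrtr_sqr ger0_norm // expR_ge0.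
Qed.

Lemma cexp_neq0 z : cexp z != 0.
Proof. by rewrite -cm_gt0 cm_cexp expR_gt0. Qed.

Lemma cexpN z : cexp (- z) = (cexp z)^-1.
Proof.
apply: (mulfI (cexp_neq0 z)); rewrite mulfV ?cexp_neq0 // -cexpD subrr; exact: cexp0.
Qed.

Lemma cexpMn n z : cexp (n%:R * z) = cexp z ^+ n.
Proof.
elim: n => [|n IH]; first by rewrite mul0r cexp0.
by rewrite -natr1 mulrDl mul1r cexpD IH exprSr.
Qed.

Lemma cexp_real x : cexp x%:C = (expR x)%:C.
Proof. by apply: complex_eq; rewrite /= ?cos0 ?sin0 ?mulr1 ?mulr0. Qed.

Lemma cexp_sum (I : Type) (r : seq I) (P : pred I) (F : I -> C) :
  cexp (\sum_(i <- r | P i) F i) = \prod_(i <- r | P i) cexp (F i).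
Proof. by elim/big_rec2: _ => [|i x z _ <-]; rewrite ?cexp0 // cexpD. Qed.

Lemma cm_cexp_le z : cm (cexp z) <= expR (cm z).
Proof. by rewrite cm_cexp ler_expR (le_trans (ler_norm _)) // cm_Re. Qed.

(* [move: h1 h2; drop; lra] hides all hypotheses but [h1] and [h2] from [lra], which is slow in large contexts.  The
   section variables must stay, because [lra] fails once one of them has been cleared. *)
Local Ltac drop := clear -R.

Lemma cexp_taylor1 h : cm h <= 1 -> cm (cexp h - 1 - h) <= 4 * cm h ^+ 2.
Proof.
move=> h1; have hx := le_trans (cm_Re h) h1; have hy := le_trans (cm_Im h) h1.
rewrite cm_sq; apply: (le_trans (cm_le_ReIm _)).
rewrite !(reD, imD, reN, imN) /=.
set x := complex.Re h in hx *; set y := complex.Im h in hy *.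
have e1 := expR_sub1_le hx; have c1 := cos_sub1_le y; have s1 := sin_sub_le hy.
have s2 := sin_abs_le y; have c2 := cos_max y.
have -> : expR x * cos y - 1 - x = (expR x - 1 - x) * cos y + (1 + x) * (cos y - 1) by ring.
have -> : expR x * sin y - 0 - y = (expR x - 1 - x) * sin y + x * sin y + (sin y - y) by ring.
have A1 : `|(expR x - 1 - x) * cos y + (1 + x) * (cos y - 1)| <= 2 * x ^+ 2 + 2 * y ^+ 2.
  apply: (le_trans (ler_normD _ _)); rewrite !normrM.
  apply: lerD; first by rewrite -[leRHS]mulr1 ler_pM.
  apply: ler_pM => //; apply: (le_trans (ler_normD _ _)); rewrite normr1; (move: hx; drop; lra).
have A2 : `|(expR x - 1 - x) * sin y + x * sin y + (sin y - y)| <= 2 * x ^+ 2 * `|y| + `|x| * `|y| + y ^+ 2.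
  apply: (le_trans (ler_normD _ _)); apply: lerD => //.
  apply: (le_trans (ler_normD _ _)); rewrite !normrM; apply: lerD; exact: ler_pM.
have X2 : x ^+ 2 = `|x| ^+ 2 by rewrite real_normK // num_real.
have Y2 : y ^+ 2 = `|y| ^+ 2 by rewrite real_normK // num_real.
rewrite X2 Y2 in A1 A2 *.
have p1 := normr_ge0 x; have p2 := normr_ge0 y.
have A3 : 2 * `|x| ^+ 2 * `|y| <= 2 * `|x| * `|y|.
  by rewrite expr2; have := mulr_ge0 p1 p2; (move: hx; drop; nra).
apply: (le_trans (lerD A1 A2)).
have := sqr_ge0 (`|x| - `|y|); (move: hx hy p1; drop; nra).
Qed.

Lemma cexp_sub1_small h : cm h <= 1 -> cm (cexp h - 1) <= 5 * cm h.
Proof.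
move=> h1; have := cexp_taylor1 h1; have := cm_D (cexp h - 1 - h) h; rewrite subrK.
have := cm_ge0 h; nra.
Qed.

Lemma cexp_sub1_neg z : 0 <= complex.Re z -> cm (1 - cexp (- z)) <= 5 * cm z.
Proof.
move=> z0; have [z1|z1] := leP (cm z) 1.
  by rewrite cmB -(cmN z) cexp_sub1_small // cmN.
apply: (le_trans (cm_subD _ _)); rewrite cm1 cm_cexp reN.
have : expR (- complex.Re z) <= 1 by rewrite expR_le1; lra.
lra.
Qed.

(** For [cm h > 1] the trivial bound is enough, because then [cm h ^+ 2 >= 1]. *)
Lemma cexp_taylor1_gen (H : R) h : cm h <= H -> cm (cexp h - 1 - h) <= (5 + H + expR H) * cm h ^+ 2.
Proof.
move=> hH; have h0 := cm_ge0 h; have e0 := expR_gt0 H.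
have [h1|/ltW h1] := leP (cm h) 1.
  apply: (le_trans (cexp_taylor1 h1)); apply: ler_wpM2r; first exact: sqr_ge0.
  lra.
have : cm (cexp h - 1 - h) <= expR H + 1 + H.
  apply: (le_trans (cm_subD _ _)); apply: lerD => //.
  apply: (le_trans (cm_subD _ _)); rewrite cm1 lerD2r.
  by apply: (le_trans (cm_cexp_le _)); rewrite ler_expR.
move=> /le_trans; apply.
have : 1 <= cm h ^+ 2 by rewrite expr_ge1.
nra.
Qed.

Lemma pow_diff (a b : C) (B : R) (M : nat) : cm a <= B -> cm b <= B ->
  cm (a ^+ M.+1 - b ^+ M.+1) <= M.+1%:R * B ^+ M * cm (a - b).
Proof.
move=> aB bB; have B0 := le_trans (cm_ge0 a) aB.
rewrite subrXX cmM mulrC ler_wpM2r ?cm_ge0 //.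
apply: (le_trans (cm_sum _ _ _)).
apply: (@le_trans _ _ (\sum_(i < M.+1) B ^+ M)).
  apply: ler_sum => i _; rewrite cmM !cmX /=.
  apply: (@le_trans _ _ (B ^+ (M - i) * B ^+ i)).
    by apply: ler_pM; rewrite ?exprn_ge0 ?cm_ge0 // lerXn2r ?nnegrE ?cm_ge0.
  by rewrite -exprD subnK // -ltnS.
rewrite sumr_const card_ord -[X in X <= _]mulr_natl; exact: lexx.
Qed.

(** Both sides are (M+1)-th powers, of [cexp h] and [1 + h] with h = z / (M+1), and these bases
    differ by O(h^2). This is the source of all polynomial approximations of exponentials. *)
Lemma cexp_limit z (M : nat) : cm z <= M.+1%:R ->
  cm (cexp z - (1 + M.+1%:R^-1 * z) ^+ M.+1) <= 4 * cm z ^+ 2 * expR (cm z) / M.+1%:R.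
Proof.
move=> zM; set m : R := M.+1%:R; have m0 : 0 < m by rewrite ltr0n.
have mC : (M.+1%:R : C) != 0 by rewrite pnatr_eq0.
set h : C := M.+1%:R^-1 * z.
have hc : cm h = cm z / m by rewrite /h cmM cmV cm_nat mulrC.
have h1 : cm h <= 1 by rewrite hc ler_pdivrMr // mul1r.
have -> : cexp z = cexp h ^+ M.+1 by rewrite -cexpMn /h mulrA divff // mul1r.
have B1 : cm (cexp h) <= expR (cm h) by exact: cm_cexp_le.
have B2 : cm (1 + h) <= expR (cm h).
  by apply: (le_trans (cm_D _ _)); rewrite cm1 expR_ge1Dx.
apply: (le_trans (pow_diff M B1 B2)); rewrite opprD addrA.
rewrite -/m.
have E : expR (cm h) ^+ M <= expR (cm z).
  rewrite -expRM_natl ler_expR hc mulrA ler_pdivrMr // mulrC ler_wpM2l ?cm_ge0 //.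
  by rewrite ler_nat.
apply: (@le_trans _ _ (m * expR (cm z) * (4 * cm h ^+ 2))).
  apply: ler_pM; rewrite ?mulr_ge0 ?exprn_ge0 ?expR_ge0 ?cm_ge0 ?(ltW m0) //.
    by rewrite ler_pM2l.
  exact: cexp_taylor1.
rewrite hc le_eqVlt; apply/orP; left; apply/eqP; field.
exact: lt0r_neq0.
Qed.

(* [g] is the derivative of [f] on [0, 1], with a uniform quadratic remainder: this is what makes the mean value
   inequality provable by telescoping. *)
Definition C1 (f g : R -> C) := exists K : R,
  [/\ 0 <= K, forall t, 0 <= t <= 1 -> cm (f t) <= K,
    forall t, 0 <= t <= 1 -> cm (g t) <= K &
    forall s t, 0 <= s <= 1 -> 0 <= t <= 1 -> cm (f s - f t - (s - t)%:C * g t) <= K * (s - t) ^+ 2].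

Lemma C1_const z : C1 (fun=> z) (fun=> 0).
Proof.
exists (cm z); split => [|t _|t _|s t _ _]; rewrite ?cm0 ?cm_ge0 //.
by rewrite mulr0 subrr subr0 cm0 mulr_ge0 ?cm_ge0 ?sqr_ge0.
Qed.

Lemma C1_id : C1 (fun t => t%:C) (fun=> 1).
Proof.
exists 1; split => // [t /andP[t0 t1]|t _|s t _ _]; rewrite ?cm1 //.
  by rewrite cm_real ger0_norm.
by rewrite mulr1 rmorphB subrr cm0 mul1r sqr_ge0.
Qed.

Lemma C1_D f g f' g' : C1 f f' -> C1 g g' -> C1 (fun t => f t + g t) (fun t => f' t + g' t).
Proof.
move=> [K [K0 f1 f2 f3]] [L [L0 g1 g2 g3]]; exists (K + L); split; first exact: addr_ge0.
- by move=> t Ht; apply: (le_trans (cm_D _ _)); apply: lerD; auto.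
- by move=> t Ht; apply: (le_trans (cm_D _ _)); apply: lerD; auto.
move=> s t Hs Ht.
have -> : f s + g s - (f t + g t) - (s - t)%:C * (f' t + g' t) =
  (f s - f t - (s - t)%:C * f' t) + (g s - g t - (s - t)%:C * g' t) by ring.
by apply: (le_trans (cm_D _ _)); rewrite mulrDl; apply: lerD; auto.
Qed.

Lemma C1_lip (f f' : R -> C) (K : R) s t : (forall t, 0 <= t <= 1 -> cm (f' t) <= K) ->
  (forall s t, 0 <= s <= 1 -> 0 <= t <= 1 -> cm (f s - f t - (s - t)%:C * f' t) <= K * (s - t) ^+ 2) ->
  0 <= s <= 1 -> 0 <= t <= 1 -> cm (f s - f t) <= 2 * K * `|s - t|.
Proof.
move=> H1 H2 Hs Ht; have := H2 s t Hs Ht => H.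
have := cm_D (f s - f t - (s - t)%:C * f' t) ((s - t)%:C * f' t); rewrite subrK => /le_trans; apply.
rewrite cmM cm_real; have K0 := le_trans (cm_ge0 _) (H1 t Ht).
have : `|s - t| <= 1 by rewrite ler_norml; apply/andP; split; lra.
have := H1 t Ht; move: H; rewrite -(real_normK (num_real (s - t))).
have := normr_ge0 (s - t); set d := `|s - t|; move=> d0 h1 h2 h3.
have : d * cm (f' t) <= d * K by rewrite ler_wpM2l.
have : K * d ^+ 2 <= K * d by rewrite expr2 ler_wpM2l // ler_piMl.
lra.
Qed.

Lemma C1_M f g f' g' : C1 f f' -> C1 g g' ->
  C1 (fun t => f t * g t) (fun t => f' t * g t + f t * g' t).
Proof.
move=> [K [K0 f1 f2 f3]] [L [L0 g1 g2 g3]]; exists (4 * (K * L)).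
have KL : 0 <= K * L by rewrite mulr_ge0.
split; first lra.
- move=> t Ht; rewrite cmM; have : cm (f t) * cm (g t) <= K * L by rewrite ler_pM ?cm_ge0; auto.
  lra.
- move=> t Ht; apply: (le_trans (cm_D _ _)); rewrite !cmM.
  have : cm (f' t) * cm (g t) <= K * L by rewrite ler_pM ?cm_ge0; auto.
  have : cm (f t) * cm (g' t) <= K * L by rewrite ler_pM ?cm_ge0; auto.
  lra.
move=> s t Hs Ht.
have -> : f s * g s - f t * g t - (s - t)%:C * (f' t * g t + f t * g' t) =
  (f s - f t - (s - t)%:C * f' t) * g s + (s - t)%:C * f' t * (g s - g t) + f t * (g s - g t - (s - t)%:C * g' t) by ring.
have G := C1_lip g2 g3 Hs Ht.
have q0 := sqr_ge0 (s - t).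
have A1 : cm ((f s - f t - (s - t)%:C * f' t) * g s) <= (K * (s - t) ^+ 2) * L.
  by rewrite cmM ler_pM ?cm_ge0; auto.
have A3 : cm (f t * (g s - g t - (s - t)%:C * g' t)) <= K * (L * (s - t) ^+ 2).
  by rewrite cmM ler_pM ?cm_ge0; auto.
have A2 : cm ((s - t)%:C * f' t * (g s - g t)) <= `|s - t| * K * (2 * L * `|s - t|).
  rewrite !cmM cm_real; apply: ler_pM; rewrite ?mulr_ge0 ?cm_ge0 //.
  by rewrite ler_wpM2l; auto.
apply: (le_trans (cm_D _ _)); apply: (le_trans (lerD (cm_D _ _) A3)).
apply: (le_trans (lerD (lerD A1 A2) (lexx _))).
have -> : `|s - t| * K * (2 * L * `|s - t|) = 2 * (K * L) * `|s - t| ^+ 2 by ring.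
rewrite (real_normK (num_real (s - t))).
by rewrite le_eqVlt; apply/orP; left; apply/eqP; ring.
Qed.

Lemma C1_exp f f' : C1 f f' -> C1 (fun t => cexp (f t)) (fun t => f' t * cexp (f t)).
Proof.
move=> [K [K0 f1 f2 f3]].
pose A := (5 + 2 * K + expR (2 * K)).
have A0 : 0 <= A by rewrite /A; have := expR_gt0 (2 * K); lra.
have eK := expR_gt0 K.
have E t : 0 <= t <= 1 -> cm (cexp (f t)) <= expR K.
  by move=> Ht; apply: (le_trans (cm_cexp_le _)); rewrite ler_expR; auto.
exists (expR K + K * expR K + (A * (2 * K) ^+ 2 * expR K + K * expR K)).
have P1 : 0 <= K * expR K by rewrite mulr_ge0 // ltW.
have P2 : 0 <= A * (2 * K) ^+ 2 * expR K by rewrite !mulr_ge0 ?sqr_ge0 // ltW.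
split; first lra.
- by move=> t Ht; have := E t Ht; lra.
- move=> t Ht; rewrite cmM; have : cm (f' t) * cm (cexp (f t)) <= K * expR K by rewrite ler_pM ?cm_ge0; auto.
  lra.
move=> s t Hs Ht.
have -> : cexp (f s) - cexp (f t) - (s - t)%:C * (f' t * cexp (f t)) =
  (cexp (f s - f t) - 1 - (f s - f t)) * cexp (f t) + (f s - f t - (s - t)%:C * f' t) * cexp (f t).
  by rewrite [in cexp (f s - f t)]cexpD cexpN; field; exact: cexp_neq0.
have G := C1_lip f2 f3 Hs Ht.
have G2 : cm (f s - f t) <= 2 * K.
  by apply: (le_trans (cm_subD _ _)); have := f1 s Hs; have := f1 t Ht; lra.
apply: (le_trans (cm_D _ _)); rewrite !cmM.
apply: (@le_trans _ _ (A * (2 * K * `|s - t|) ^+ 2 * expR K + K * (s - t) ^+ 2 * expR K)).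
  apply: lerD; apply: ler_pM; rewrite ?cm_ge0; auto.
  apply: (le_trans (cexp_taylor1_gen G2)); rewrite -/A ler_wpM2l //.
  by rewrite lerXn2r ?nnegrE ?cm_ge0 ?mulr_ge0.
rewrite exprMn (real_normK (num_real (s - t))).
have := sqr_ge0 (s - t); nra.
Qed.

Lemma C1_scale (a : C) f f' : C1 f f' -> C1 (fun t => a * f t) (fun t => a * f' t).
Proof.
move=> H; have := C1_M (C1_const a) H; congr C1.
by apply: funext => t; rewrite mul0r add0r.
Qed.

Lemma C1_pow k z : C1 (fun t => (t%:C * z) ^+ k) (fun t => k%:R * z * (t%:C * z) ^+ k.-1).
Proof.
elim: k => [|k IH].
  have := C1_const 1; congr C1; apply: funext => t; rewrite ?expr0 // !mul0r //.
have H1 : C1 (fun t => t%:C * z) (fun=> z).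
  have := C1_scale z C1_id; congr C1; apply: funext => t; rewrite ?mulr1 // mulrC //.
have := C1_M H1 IH; congr C1; apply: funext => t; rewrite ?exprS //=.
case: k {IH} => [|k]; first by rewrite !mul0r mulr0 addr0 mul1r mulrC.
by rewrite /= exprS -[in RHS]natr1; ring.
Qed.

Lemma C1_sum n (f f' : nat -> R -> C) : (forall i, C1 (f i) (f' i)) ->
  C1 (fun t => \sum_(i < n) f i t) (fun t => \sum_(i < n) f' i t).
Proof.
move=> H; elim: n => [|n IH].
  have := C1_const 0; congr C1; apply: funext => t; rewrite big_ord0 //.
have := C1_D IH (H n); congr C1; apply: funext => t; rewrite big_ord_recr //.
Qed.

Lemma telescope_cm (g : nat -> C) (B : R) M : (forall i, (i < M)%N -> cm (g i.+1 - g i) <= B) ->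
  cm (g M - g 0%N) <= M%:R * B.
Proof.
elim: M => [|M IH] H; first by rewrite subrr cm0 mul0r.
apply: (le_trans (cm_tri _ _ (g M))); rewrite -natr1 mulrDl mul1r addrC.
by apply: lerD; [apply: IH => i Hi; apply: H; rewrite ltnS ltnW | apply: H].
Qed.

(** Cutting [0, 1] into M+1 equal steps leaves a total remainder K / (M+1), which is at most e as
    soon as M+1 >= K / e. *)
Lemma mean_value_C1 f g (B : R) : C1 f g -> (forall t, 0 <= t <= 1 -> cm (g t) <= B) ->
  cm (f 1 - f 0) <= B.
Proof.
move=> [K [K0 _ _ H]] HB.
apply/ler_addgt0Pr => e e0.
have [M HM] : exists M : nat, K / e <= M.+1%:R.
  exists (Num.truncn (K / e)); rewrite -natr1.
  by have /andP[_ /ltW] := truncn_itv (divr_ge0 K0 (ltW e0)); rewrite natr1.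
set m : R := M.+1%:R in HM; have m0 : 0 < m by rewrite ltr0n.
have mi (i : nat) : (i <= M.+1)%N -> 0 <= i%:R / m <= 1.
  by move=> Hi; rewrite divr_ge0 ?ler0n //= ler_pdivrMr // mul1r ler_nat.
have := @telescope_cm (fun i => f (i%:R / m)) (B / m + e / m) M.+1.
rewrite mul0r divff ?lt0r_neq0 //.
have -> : m * (B / m + e / m) = B + e by field; exact: lt0r_neq0.
apply => i Hi.
have E : i.+1%:R / m - i%:R / m = 1 / m by rewrite -mulrBl -natr1; congr (_ / _); ring.
have h0 := mi _ (ltnW Hi); have h1 := mi _ Hi.
have := H _ _ h1 h0; rewrite E => H2.
have := cm_D (f (i.+1%:R / m) - f (i%:R / m) - (1 / m)%:C * g (i%:R / m)) ((1 / m)%:C * g (i%:R / m)).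
rewrite subrK => /le_trans; apply; rewrite addrC; apply: lerD.
  rewrite cmM cm_real ger0_norm ?divr_ge0 ?(ltW m0) // mul1r mulrC ler_wpM2r ?invr_ge0 ?(ltW m0) //.
  exact: HB.
apply: (le_trans H2).
have -> : K * (1 / m) ^+ 2 = K / m / m by field; exact: lt0r_neq0.
by rewrite ler_pM2r ?invr_gt0 // ler_pdivrMr // mulrC -ler_pdivrMr.
Qed.

(** Let E be the Taylor sum. The derivative of exp(-t z) E(t z) in t reduces to -exp(-t z) t^J
    z^(J+1) / J!, all other terms cancelling, and the mean value inequality on [0, 1] applies to
    it. *)
Lemma cexp_taylor z J :
  cm (cexp z - \sum_(j < J.+1) z ^+ j / j`!%:R) <= expR (2 * cm z) * cm z ^+ J.+1 / J`!%:R.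
Proof.
pose E t := \sum_(j < J.+1) (t%:C * z) ^+ j / j`!%:R : C.
pose E' t := \sum_(j < J.+1) j%:R * z * (t%:C * z) ^+ j.-1 / j`!%:R : C.
have CE : C1 E E'.
  rewrite /E /E'; have := @C1_sum J.+1 (fun j t => (j`!%:R)^-1 * (t%:C * z) ^+ j)
    (fun j t => (j`!%:R)^-1 * (j%:R * z * (t%:C * z) ^+ j.-1)) _.
  move=> /(_ (fun i => C1_scale _ (C1_pow i z))).
  by congr C1; apply: funext => t; apply: eq_bigr => j _; rewrite mulrC.
have Cz : C1 (fun t => (- z) * t%:C) (fun=> - z).
  by have := C1_scale (- z) C1_id; congr C1; apply: funext => t; rewrite mulr1.
have CP := C1_M (C1_exp Cz) CE.
have E'E t : E' t = z * (E t - (t%:C * z) ^+ J / J`!%:R).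
  rewrite /E /E' big_ord_recl /= !mul0r add0r [in RHS]big_ord_recr /= addrK mulr_sumr.
  apply: eq_bigr => j _; rewrite /bump /= add1n factS natrM.
  have n0 : (j.+1%:R : C) != 0 by rewrite pnatr_eq0.
  have f0 : (j`!%:R : C) != 0 by rewrite pnatr_eq0 -lt0n fact_gt0.
  have H (A D x y : C) : A != 0 -> D != 0 -> A * x * y / (A * D) = x * (y / D).
    by move=> A0 D0; field; rewrite A0 D0.
  by rewrite add0n; apply: H.
have z0 := cm_ge0 z.
have B t : 0 <= t <= 1 -> cm (- z * cexp (- z * t%:C) * E t + cexp (- z * t%:C) * E' t) <=
   expR (cm z) * cm z ^+ J.+1 / J`!%:R.
  move=> /andP[t0 t1]; rewrite E'E.
  have -> : - z * cexp (- z * t%:C) * E t + cexp (- z * t%:C) * (z * (E t - (t%:C * z) ^+ J / J`!%:R))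
    = - (cexp (- z * t%:C) * (t%:C ^+ J * z ^+ J.+1 / J`!%:R)) by rewrite exprMn exprS; ring.
  rewrite cmN !cmM cmV cm_nat !cmX cm_real (ger0_norm t0).
  have f0 : 0 < J`!%:R^-1 :> R by rewrite invr_gt0 ltr0n fact_gt0.
  rewrite mulrA; apply: ler_pM; rewrite ?mulr_ge0 ?cm_ge0 ?exprn_ge0 ?(ltW f0) //.
  apply: ler_pM; rewrite ?mulr_ge0 ?cm_ge0 ?exprn_ge0 //.
    apply: (le_trans (cm_cexp_le _)); rewrite ler_expR cmM cmN cm_real (ger0_norm t0).
    by rewrite ler_piMr.
  by rewrite ler_piMl ?exprn_ge0 // exprn_ile1.
have := mean_value_C1 CP B.
rewrite /E !mul1r !mulr1 !mulr0 cexp0 mul1r.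
have -> : \sum_(j < J.+1) (0%:C * z) ^+ j / j`!%:R = 1 :> C.
  rewrite big_ord_recl /= expr0 fact0 divr1 big1 ?addr0 // => j _.
  by rewrite /bump /= mul0r exprS !mul0r.
set S := \sum_(j < J.+1) z ^+ j / j`!%:R => H.
have -> : cexp z - S = - (cexp z * (cexp (- z) * S - 1)) by rewrite cexpN; field; exact: cexp_neq0.
rewrite cmN cmM.
have -> : expR (2 * cm z) * cm z ^+ J.+1 / J`!%:R = expR (cm z) * (expR (cm z) * cm z ^+ J.+1 / J`!%:R).
  by rewrite !mulrA -expRD; congr (expR _ * _ * _); ring.
by apply: ler_pM; rewrite ?cm_ge0 // cm_cexp_le.
Qed.

(* Truncation of - log (1 - z). *)
Definition logser (K : nat) z : C := \sum_(k < K) z ^+ k.+1 / k.+1%:R.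

Lemma geo_le (x : R) K : 0 <= x -> x < 1 -> \sum_(k < K) x ^+ k.+1 <= x / (1 - x).
Proof.
move=> x0 x1; have d : 0 < 1 - x by lra.
rewrite ler_pdivlMr //.
have -> : \sum_(k < K) x ^+ k.+1 = x * \sum_(k < K) x ^+ k.
  by rewrite mulr_sumr; apply: eq_bigr => k _; rewrite exprS.
have -> : x * (\sum_(k < K) x ^+ k) * (1 - x) = x * (1 - x ^+ K).
  rewrite -mulrA; congr (_ * _); elim: K => [|K IH]; first by rewrite big_ord0 mul0r subrr.
  by rewrite big_ord_recr /= mulrDl IH exprS; ring.
have : 0 <= x * x ^+ K by rewrite mulr_ge0 // exprn_ge0.
lra.
Qed.

Lemma cm_logser K z : cm z < 1 -> cm (logser K z) <= cm z / (1 - cm z).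
Proof.
move=> z1; apply: le_trans (geo_le K (cm_ge0 z) z1).
apply: (le_trans (cm_sum _ _ _)); apply: ler_sum => k _.
rewrite cmM cmV cm_nat cmX ler_piMr ?exprn_ge0 ?cm_ge0 //.
by rewrite invf_le1 ?ltr0n // ler1n.
Qed.

(** The derivative in t of (1 - t z) exp([logser] K (t z)) reduces to -exp([logser] K (t z)) t^K
    z^(K+1), since the geometric sum telescopes against 1 - t z. *)
Lemma logser_exp K z : cm z < 1 ->
  cm ((1 - z) * cexp (logser K z) - 1) <= expR (cm z / (1 - cm z)) * cm z ^+ K.+1.
Proof.
move=> z1; have z0 := cm_ge0 z.
have C2 : C1 (fun t => logser K (t%:C * z)) (fun t => \sum_(k < K) z * (t%:C * z) ^+ k).
  have := @C1_sum K (fun k t => (k.+1%:R)^-1 * (t%:C * z) ^+ k.+1)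
    (fun k t => (k.+1%:R)^-1 * (k.+1%:R * z * (t%:C * z) ^+ k)) _.
  move=> /(_ (fun i => C1_scale _ (C1_pow i.+1 z))).
  congr C1; apply: funext => t; apply: eq_bigr => k _; first by rewrite mulrC.
  by rewrite !mulrA mulVf ?mul1r // pnatr_eq0.
have C3 : C1 (fun t => 1 + (- z) * t%:C) (fun=> - z).
  have := C1_D (C1_const 1) (C1_scale (- z) C1_id); congr C1; apply: funext => t.
  by rewrite add0r mulr1.
have CP := C1_M C3 (C1_exp C2).
have B t : 0 <= t <= 1 -> cm (- z * cexp (logser K (t%:C * z)) + (1 + - z * t%:C) *
   ((\sum_(k < K) z * (t%:C * z) ^+ k) * cexp (logser K (t%:C * z)))) <= expR (cm z / (1 - cm z)) * cm z ^+ K.+1.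
  move=> /andP[t0 t1].
  have -> : - z * cexp (logser K (t%:C * z)) + (1 + - z * t%:C) *
   ((\sum_(k < K) z * (t%:C * z) ^+ k) * cexp (logser K (t%:C * z))) =
    - (cexp (logser K (t%:C * z)) * (t%:C ^+ K * z ^+ K.+1)).
    have -> : \sum_(k < K) z * (t%:C * z) ^+ k = z * \sum_(k < K) (t%:C * z) ^+ k by rewrite mulr_sumr.
    have S : (1 - t%:C * z) * \sum_(k < K) (t%:C * z) ^+ k = 1 - (t%:C * z) ^+ K.
      elim: K {C2 CP} => [|K' IH]; first by rewrite big_ord0 mulr0 subrr.
      by rewrite big_ord_recr /= mulrDr IH exprS; ring.
    have -> : (1 + - z * t%:C) * (z * (\sum_(k < K) (t%:C * z) ^+ k) * cexp (logser K (t%:C * z))) =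
       z * cexp (logser K (t%:C * z)) * ((1 - t%:C * z) * (\sum_(k < K) (t%:C * z) ^+ k)) by ring.
    by rewrite S exprMn exprS; ring.
  have tz : cm (t%:C * z) <= cm z by rewrite cmM cm_real (ger0_norm t0) ler_piMl.
  rewrite cmN !cmM !cmX cm_real (ger0_norm t0).
  apply: ler_pM; rewrite ?mulr_ge0 ?cm_ge0 ?exprn_ge0 //.
    apply: (le_trans (cm_cexp_le _)); rewrite ler_expR.
    apply: (le_trans (cm_logser K (le_lt_trans tz z1))).
    apply: ler_pM; rewrite ?cm_ge0 ?invr_ge0 //; first by lra.
    by rewrite lef_pV2 ?posrE; (move: z1 tz; drop; lra).
  by rewrite ler_piMl ?exprn_ge0 // exprn_ile1.
have := mean_value_C1 CP B.
rewrite mul1r mulr0 mulr1 mul0r addr0 mul1r.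
have -> : logser K 0 = 0 by rewrite /logser big1 // => k _; rewrite exprS !mul0r.
by rewrite cexp0.
Qed.

Lemma small_pow (x e : R) : 0 <= x -> x < 1 -> 0 < e -> exists N : nat, forall n, (N <= n)%N -> x ^+ n <= e.
Proof.
move=> x0 x1 e0; have H : (fun n => x ^+ n) @ \oo --> (0 : R).
  by apply: cvg_expr; rewrite ger0_norm.
have [N HN] := rcvgE H e0; exists N => n Nn; have := HN n Nn.
by rewrite subr0 ger0_norm // exprn_ge0.
Qed.

Lemma logser_diff K n z : cm z < 1 -> cm (logser (K + n) z - logser K z) <= cm z ^+ K.+1 / (1 - cm z).
Proof.
move=> z1; rewrite /logser big_split_ord /= addrAC subrr add0r.
have -> : cm z ^+ K.+1 / (1 - cm z) = cm z ^+ K * (cm z / (1 - cm z)) by rewrite exprSr mulrA.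
apply: (@le_trans _ _ (cm z ^+ K * \sum_(k < n) cm z ^+ k.+1)); last first.
  by rewrite ler_wpM2l ?exprn_ge0 ?cm_ge0 // geo_le ?cm_ge0.
rewrite mulr_sumr; apply: (le_trans (cm_sum _ _ _)); apply: ler_sum => k _.
rewrite cmM cmV cm_nat cmX -exprD addnS ler_piMr ?exprn_ge0 ?cm_ge0 //.
by rewrite invf_le1 ?ltr0n // ler1n.
Qed.

(** The limit of the truncated series plays the role of -log (1 - z): one value for each z takes the
    place of a branch of the complex logarithm. *)
Lemma clog_exists z : cm z < 1 -> exists y : C, cexp y = (1 - z)^-1 /\
  forall K, cm (y - logser K z) <= cm z ^+ K.+1 / (1 - cm z).
Proof.
move=> z1; have z0 := cm_ge0 z; have d0 : 0 < 1 - cm z by lra.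
have nz : 1 - z != 0.
  by rewrite -cm_gt0; have := cm_rev 1 z; rewrite cm1; lra.
have [y Hy] : exists y : C, (fun K => logser K z) @ \oo --> y.
  apply: ccauchy => e e0.
  have [N HN] := small_pow z0 z1 (mulr_gt0 (divr_gt0 e0 (ltr0n _ 2)) d0).
  have HN' k : cm (logser (N + k) z - logser N z) <= e / 2.
    apply: (le_trans (logser_diff _ _ z1)); rewrite ler_pdivrMr //.
    by apply: HN.
  exists N => n m Nn Nm; rewrite -(subnKC Nn) -(subnKC Nm).
  apply: (le_trans (cm_tri _ _ (logser N z))).
  by rewrite [X in _ + X]cmB; have := HN' (n - N)%N; have := HN' (m - N)%N; lra.
have Hyy := ccvgE Hy.
have B K : cm (y - logser K z) <= cm z ^+ K.+1 / (1 - cm z).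
  apply/ler_addgt0Pr => e e0; have [N HN] := Hyy _ e0.
  apply: (le_trans (cm_tri _ _ (logser (K + N) z))); rewrite addrC lerD //.
    exact: logser_diff.
  by rewrite cmB HN // leq_addl.
exists y; split => //.
apply: (mulfI nz); rewrite mulfV //; apply/eqP; rewrite -subr_eq0 -cm_eq0 eq_le cm_ge0 andbT.
(* The error is at most W |z|^K for every K, with W independent of K, hence it is zero. *)
have W : exists W : R, 0 < W /\ forall K, cm ((1 - z) * cexp y - 1) <= W * cm z ^+ K.
  pose H := (1 - cm z)^-1.
  have H0 : 0 < H by rewrite invr_gt0.
  exists ((1 + cm z) * (expR (cm z / (1 - cm z)) * ((5 + H + expR H) * H ^+ 2 + H)) + expR (cm z / (1 - cm z))).
  have e1 := expR_gt0 (cm z / (1 - cm z)); have e2 := expR_gt0 H; have H2 := exprn_gt0 2 H0.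
  split.
    apply: addr_gt0 => //; rewrite mulr_gt0 //; first (move: z0; drop; lra).
    by rewrite mulr_gt0 // addr_gt0 // mulr_gt0 //; (move: H0 e2; drop; lra).
  move=> K; set q := cm z ^+ K.
  have q0 : 0 <= q by rewrite exprn_ge0.
  have q1 : q <= 1 by rewrite exprn_ile1 // ltW.
  have zq : cm z ^+ K.+1 <= q by rewrite exprS ler_piMl // ltW.
  have E : (1 - z) * cexp y - 1 = (1 - z) * cexp (logser K z) * (cexp (y - logser K z) - 1)
     + ((1 - z) * cexp (logser K z) - 1).
    by rewrite cexpD cexpN; field; exact: cexp_neq0.
  rewrite E; apply: (le_trans (cm_D _ _)); rewrite [leRHS]mulrDl; apply: lerD; last first.
    apply: (le_trans (logser_exp K z1)); rewrite ler_wpM2l // ltW //.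
  rewrite !cmM -!mulrA; apply: ler_pM; rewrite ?mulr_ge0 ?cm_ge0 //.
    by apply: (le_trans (cm_subD _ _)); rewrite cm1.
  apply: ler_pM; rewrite ?mulr_ge0 ?cm_ge0 //.
    by apply: (le_trans (cm_cexp_le _)); rewrite ler_expR; exact: cm_logser.
  have Bq : cm (y - logser K z) <= H * q.
    by apply: (le_trans (B K)); rewrite mulrC ler_pM2l.
  have BH : cm (y - logser K z) <= H by apply: (le_trans Bq); rewrite ler_piMr // ltW.
  have := cm_D (cexp (y - logser K z) - 1 - (y - logser K z)) (y - logser K z); rewrite subrK.
  move=> /le_trans; apply; rewrite mulrDl; apply: lerD => //.
  apply: (le_trans (cexp_taylor1_gen BH)); rewrite -mulrA ler_wpM2l //; first (move: H0 e2; drop; lra).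
  apply: (@le_trans _ _ ((H * q) ^+ 2)); first by rewrite lerXn2r ?nnegrE ?cm_ge0 // mulr_ge0 // ltW.
  by rewrite exprMn ler_wpM2l ?exprn_ge0 // ?(ltW H0) // expr2 ler_piMl.
have [W0 [W1 W2]] := W.
apply/ler_addgt0Pr => e e0; rewrite add0r.
have [N HN] := small_pow z0 z1 (divr_gt0 e0 W1).
apply: (le_trans (W2 N)); rewrite mulrC -ler_pdivlMr //; exact: HN.
Qed.

Lemma ln_cm_1sub z K : cm z < 1 ->
  `|ln (cm (1 - z)) + complex.Re (logser K z)| <= cm z ^+ K.+1 / (1 - cm z).
Proof.
move=> z1; have [y [Ey Hy]] := clog_exists z1.
have -> : ln (cm (1 - z)) = - complex.Re y.
  have -> : 1 - z = (cexp y)^-1 by rewrite Ey invrK.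
  by rewrite cmV cm_cexp -expRN expRK.
by rewrite -normrN opprD opprK -reN -reD (le_trans (cm_Re _)).
Qed.

End CExp.

Lemma le_eq (R : numDomainType) (a b : R) : a = b -> a <= b.
Proof. by move=> ->. Qed.

(** * Averages over roots of unity *)

Section Roots.
Variable R : realType.
Local Notation C := R[i].
Local Notation cj := (@conjc R).
Implicit Types (z w h : C) (x y t r : R).

(** With x = y / 2 one has sin x >= x cos x, so sin y = 2 sin x cos x >= 2 x cos^2 x = (1 + cos y) y
    / 2. *)
Lemma sin_ge_half y : 0 <= y -> y <= pi / 2 -> y / 2 <= sin y.
Proof.
move=> y0 y1; have p0 := @pi_gt0 R.
set x := y / 2.
have x0 : 0 <= x by rewrite /x; lra.
have [c /itvP Hc E] := @MVT_segment R (@sin R) (@cos R) 0 x x0 (fun x _ => is_derive_sin x)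
  (continuous_subspaceT (@continuous_sin R)).
have c0 : 0 <= c by rewrite Hc.
have cx : c <= x by rewrite Hc.
have cosx : cos x <= cos c.
  have [->//|nc] := eqVneq c x.
  have xI : x \in `[0, pi] by rewrite in_itv /=; apply/andP; split; rewrite /x; lra.
  have cI : c \in `[0, pi] by rewrite in_itv /=; apply/andP; split; rewrite /x in cx *; lra.
  by apply: ltW; rewrite (ltr_cos cI xI) lt_neqAle nc.
have cx0 : 0 <= cos x by apply: cos_ge0_pihalf; apply/andP; split; rewrite /x; lra.
have cy0 : 0 <= cos y by apply: cos_ge0_pihalf; apply/andP; split; lra.
have Ey : y = x *+ 2 by rewrite /x mulr2n; lra.
have Es : sin y = 2 * (cos x * sin x) by rewrite Ey sin_mulr2n mulr2n; ring.
have Ec : cos y = 2 * cos x ^+ 2 - 1 by rewrite Ey cos_mulr2n mulr2n; ring.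
move: E; rewrite sin0 !subr0 => E.
have : cos x * x <= sin x by rewrite E ler_wpM2r.
move=> H; rewrite Es.
have : cos x * (cos x * x) <= cos x * sin x by rewrite ler_wpM2l.
have -> : cos x * (cos x * x) = (1 + cos y) / 2 * x by rewrite Ec; field.
have := mulr_ge0 cy0 x0; lra.
Qed.

Definition om (N : nat) : C := cexp (0 +i* (pi *+ 2 / N%:R)).

Lemma cm_om N : cm (om N) = 1.
Proof. by rewrite cm_cexp expR0. Qed.

Lemma cm_omX N j : cm (om N ^+ j) = 1.
Proof. by rewrite cmX cm_om expr1n. Qed.

Lemma om_neq0 N : om N != 0. Proof. exact: cexp_neq0. Qed.

Lemma omXE N j : om N ^+ j = cexp (0 +i* (j%:R * (pi *+ 2 / N%:R))).
Proof.
rewrite /om -cexpMn; congr cexp; apply: complex_eq.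
  by rewrite reM re_nat im_nat /=; ring.
by rewrite imM re_nat im_nat /=; ring.
Qed.

Lemma omN N : (0 < N)%N -> om N ^+ N = 1.
Proof.
move=> N0; rewrite omXE mulrC divfK ?pnatr_eq0 -?lt0n //.
by rewrite /cexp /= expR0 cos2pi sin2pi mulr1 mulr0.
Qed.

Lemma cm_om_sub1 N d : cm (om N ^+ d - 1) = 2 * `|sin (d%:R * pi / N%:R)|.
Proof.
apply/eqP; rewrite -(eqrXn2 (n := 2)) ?cm_ge0 ?mulr_ge0 //; apply/eqP.
rewrite cm_sq omXE reD imD reN imN /= !expR0 !mul1r [RHS]exprMn (real_normK (num_real _)).
set u := d%:R * pi / N%:R.
have -> : d%:R * (pi *+ 2 / N%:R) = u *+ 2 by rewrite /u !mulr2n; ring.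
rewrite cos_mulr2n sin_mulr2n !mulr2n.
have := cos2Dsin2 u; set c := cos u; set s := sin u => H.
have -> : c ^+ 2 = 1 - s ^+ 2 by lra.
have -> : (c * s + c * s - 0) ^+ 2 = 4 * (c ^+ 2) * s ^+ 2 by ring.
have -> : c ^+ 2 = 1 - s ^+ 2 by lra.
ring.
Qed.

Lemma om_dist_le N d : (0 < N)%N -> (d <= N)%N -> (2 * d <= N)%N -> 2 * d%:R / N%:R <= cm (om N ^+ d - 1).
Proof.
move=> N0 dN d2; rewrite cm_om_sub1.
have p2 := @pi_ge2 R; have n0 : 0 < N%:R :> R by rewrite ltr0n.
have d0 : 0 <= d%:R :> R by rewrite ler0n.
set u := d%:R * pi / N%:R.
have u0 : 0 <= u by rewrite /u divr_ge0 ?mulr_ge0 ?(ltW n0) //; lra.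
have u1 : u <= pi / 2.
  rewrite /u ler_pdivrMr //.
  have : 2 * d%:R <= N%:R :> R by rewrite -natrM ler_nat.
  nra.
have := sin_ge_half u0 u1; have := ler_norm (sin u).
have : 2 * d%:R / N%:R <= u.
  by rewrite /u ler_pM2r ?invr_gt0 // mulrC ler_wpM2l.
lra.
Qed.

Definition cdist (N j k : nat) : nat :=
  let d := ((j - k) + (k - j))%N in minn d (N - d).

Lemma om_dist N j k : (j < N)%N -> (k < N)%N ->
  2 * (cdist N j k)%:R / N%:R <= cm (om N ^+ j - om N ^+ k).
Proof.
wlog kj : j k / (k <= j)%N.
  move=> H jN kN; case/orP: (leq_total k j) => h; first exact: H.
  have Ec : cdist N j k = cdist N k j by rewrite /cdist addnC.
  by rewrite cmB Ec; exact: H.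
move=> jN kN; have N0 : (0 < N)%N by apply: leq_ltn_trans jN.
have Ek : (k - j = 0)%N by apply/eqP.
rewrite /cdist Ek addn0; set d := (j - k)%N.
have dN : (d <= N)%N by rewrite /d; lia.
have E1 : cm (om N ^+ j - om N ^+ k) = cm (om N ^+ d - 1).
  have -> : om N ^+ j - om N ^+ k = om N ^+ k * (om N ^+ d - 1).
    by rewrite mulrBr -exprD mulr1 /d addnC subnK.
  by rewrite cmM cm_omX mul1r.
rewrite E1; have [h|h] := leqP (2 * d) N.
  have -> : minn d (N - d) = d by apply/minn_idPl; lia.
  exact: om_dist_le.
have -> : minn d (N - d) = (N - d)%N by apply/minn_idPr; lia.
have -> : cm (om N ^+ d - 1) = cm (om N ^+ (N - d) - 1).
  have -> : om N ^+ d - 1 = - (om N ^+ d * (om N ^+ (N - d) - 1)).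
    by rewrite mulrBr -exprD subnKC // omN // mulr1; ring.
  by rewrite cmN cmM cm_omX mul1r.
by apply: om_dist_le; lia.
Qed.

Lemma om_neq1 N e : (0 < e < N)%N -> om N ^+ e != 1.
Proof.
move=> /andP[e0 eN]; rewrite -subr_eq0 -cm_gt0.
have N0 : (0 < N)%N by apply: leq_ltn_trans eN.
have := om_dist eN N0; rewrite expr0; apply: lt_le_trans.
rewrite divr_gt0 ?ltr0n // mulr_gt0 // ltr0n /cdist subn0 sub0n addn0 leq_min e0 /=; lia.
Qed.

Lemma sum_om N e : (0 < N)%N -> \sum_(l < N) (om N ^+ l) ^+ e = (if (N %| e)%N then N%:R else 0) :> C.
Proof.
move=> N0.
have E l : (om N ^+ l) ^+ e = (om N ^+ (e %% N)) ^+ l.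
  rewrite -exprM mulnC exprM; congr (_ ^+ l).
  by rewrite {1}(divn_eq e N) exprD mulnC exprM omN // expr1n mul1r.
under eq_bigr do rewrite E.
have [h|h] := boolP (N %| e)%N.
  move: h; rewrite /dvdn => /eqP ->; rewrite expr0.
  under eq_bigr do rewrite expr1n.
  by rewrite sumr_const card_ord.
set q := om N ^+ (e %% N).
have q1 : q != 1 by rewrite /q om_neq1 // ltn_mod N0 andbT lt0n.
have : (1 - q) * (\sum_(l < N) q ^+ l) = 0.
  by rewrite -[1 - q]opprB mulNr -subrX1 /q -exprM mulnC exprM omN // expr1n subrr oppr0.
by move/eqP; rewrite mulf_eq0 subr_eq0 eq_sym (negbTE q1) => /eqP.
Qed.

(** Discrete Cauchy formula. The factor with exponent N - k stands for the power -k, and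
    orthogonality keeps only the k-th coefficient; [size p <= N] rules out aliasing, so the formula
    is exact. *)
Lemma coef_mean N (p : {poly C}) z k : (0 < N)%N -> (size p <= N)%N -> (k < N)%N ->
  \sum_(l < N) p.[z * om N ^+ l] * (om N ^+ l) ^+ (N - k) = N%:R * (p`_k * z ^+ k).
Proof.
move=> N0 sp kN.
under eq_bigr => l _ do rewrite (horner_coef_wide _ sp) mulr_suml.
rewrite exchange_big /= (bigD1 (Ordinal kN)) //= [X in _ + X]big1 ?addr0; last first.
  move=> j jk.
  under eq_bigr => l _ do rewrite exprMn mulrA -mulrA -exprD.
  rewrite -mulr_sumr sum_om // ifF ?mulr0 //; apply/negbTE/negP => /dvdnP [m Hm].
  move: jk; rewrite -val_eqE /= => /eqP; have := ltn_ord j; move: Hm kN.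
  case: m => [|[|m]]; rewrite ?mul0n ?mul1n ?mulSn; nia.
under eq_bigr => l _ do rewrite exprMn mulrA -mulrA -exprD.
by rewrite -mulr_sumr sum_om // /= subnKC ?(ltnW kN) // dvdnn mulrC.
Qed.

Lemma coef_le_mean N (p : {poly C}) r k : (0 < N)%N -> (size p <= N)%N -> (k < N)%N -> 0 <= r ->
  cm p`_k * r ^+ k <= N%:R^-1 * \sum_(l < N) cm p.[r%:C * om N ^+ l].
Proof.
move=> N0 sp kN r0; have n0 : 0 < N%:R :> R by rewrite ltr0n.
rewrite [leRHS]mulrC ler_pdivlMr // mulrC.
have -> : N%:R * (cm p`_k * r ^+ k) = cm (N%:R * (p`_k * r%:C ^+ k)).
  by rewrite !cmM cm_nat cmX cm_real (ger0_norm r0).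
rewrite -(coef_mean _ N0 sp kN); apply: (le_trans (cm_sum _ _ _)); apply: ler_sum => l _.
by rewrite cmM [X in _ * X]cmX cm_omX expr1n mulr1.
Qed.

Lemma coef_le_sup (p : {poly C}) r M k : 0 <= r -> (forall z, cm z = r -> cm p.[z] <= M) ->
  cm p`_k * r ^+ k <= M.
Proof.
move=> r0 H; set N := (maxn (size p) k).+1.
have sp : (size p <= N)%N by rewrite leqW // leq_maxl.
have kN : (k < N)%N by rewrite ltnS leq_maxr.
apply: (le_trans (coef_le_mean _ sp kN r0)) => //.
rewrite ler_pdivrMl ?ltr0n //.
apply: (@le_trans _ _ (\sum_(l < N) M)); last by rewrite sumr_const card_ord -[X in X <= _]mulr_natl.
by apply: ler_sum => l _; apply: H; rewrite cmM cm_real cm_omX mulr1 ger0_norm.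
Qed.

(** The value at the centre is the coefficient 0 of the translated polynomial. This is the form in
    which the maximum principle is used. *)
Lemma center_le_sup (p : {poly C}) z0 r M : 0 <= r -> (forall z, cm (z - z0) = r -> cm p.[z] <= M) ->
  cm p.[z0] <= M.
Proof.
move=> r0 H; have := @coef_le_sup (p \Po ('X + z0%:P)) r M 0 r0.
rewrite expr0 mulr1 -horner_coef0 horner_comp !hornerE; apply => z Hz.
by rewrite horner_comp !hornerE; apply: H; rewrite addrK.
Qed.

Lemma conj_cm z : z * cj z = (cm z ^+ 2)%:C.
Proof.
by apply: complex_eq; rewrite ?reM ?imM cm_sq; case: z => a b /=; ring.
Qed.

Lemma conjM z w : cj (z * w) = cj z * cj w.
Proof. exact: rmorphM. Qed.

Lemma conj_sum (I : Type) (r : seq I) (P : pred I) (F : I -> C) :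
  cj (\sum_(i <- r | P i) F i) = \sum_(i <- r | P i) cj (F i).
Proof. exact: rmorph_sum. Qed.

Lemma conjX z n : cj (z ^+ n) = cj z ^+ n.
Proof. exact: rmorphXn. Qed.

Lemma conj_om N l : (0 < N)%N -> cj (om N ^+ l) = (om N ^+ l) ^+ (N - 1).
Proof.
move=> N0; set w := om N ^+ l.
have w0 : w != 0 by rewrite expf_neq0 // om_neq0.
apply: (mulfI w0); rewrite conj_cm cm_omX expr1n -exprS subn1 prednK //.
by rewrite /w -exprM mulnC exprM omN // expr1n.
Qed.

Lemma parseval N (p : {poly C}) r : (0 < N)%N -> (size p <= N)%N -> 0 <= r ->
  \sum_(k < N) (cm p`_k * r ^+ k) ^+ 2 = N%:R^-1 * \sum_(l < N) cm p.[r%:C * om N ^+ l] ^+ 2.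
Proof.
move=> N0 sp r0; apply: (@complexI R); rewrite rmorphM !rmorph_sum /=.
have n0 : (N%:R : C) != 0 by rewrite pnatr_eq0 -lt0n.
apply: (mulfI n0); rewrite mulrA.
have -> : (N%:R : C) * (N%:R^-1 : R)%:C = 1.
  by rewrite fmorphV /= rmorph_nat mulfV.
rewrite mul1r mulr_sumr.
have -> : \sum_(l < N) (cm p.[r%:C * om N ^+ l] ^+ 2)%:C =
   \sum_(l < N) \sum_(k < N) cj p`_k * r%:C ^+ k * (p.[r%:C * om N ^+ l] * (om N ^+ l) ^+ (N - k)).
  apply: eq_bigr => l _; rewrite -conj_cm.
  rewrite [in X in _ * X](horner_coef_wide _ sp) conj_sum mulr_sumr.
  apply: eq_bigr => k _; rewrite conjM conjX conjM conj_om // conjc_real exprMn.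
  have -> : ((om N ^+ l) ^+ (N - 1)) ^+ k = (om N ^+ l) ^+ (N - k).
    have w0 : (om N ^+ l) ^+ k != 0 by rewrite !expf_neq0 // om_neq0.
    apply: (mulfI w0); rewrite -exprMn -exprS subn1 prednK // -exprD subnKC ?(ltnW (ltn_ord k)) //.
    have -> : (om N ^+ l) ^+ N = 1 by rewrite -exprM mulnC exprM omN // expr1n.
    by rewrite expr1n.
  ring.
rewrite exchange_big /=; apply: eq_bigr => k _.
rewrite -mulr_sumr coef_mean //.
have -> : ((cm p`_k * r ^+ k) ^+ 2)%:C = (p`_k * cj p`_k) * (r%:C ^+ k) ^+ 2.
  by rewrite conj_cm exprMn rmorphM; congr (_ * _); rewrite !rmorphXn.
ring.
Qed.

Lemma Re_mulJ z w : complex.Re z * complex.Re w = (complex.Re (z * w) + complex.Re (z * cj w)) / 2.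
Proof. by case: z => a b; case: w => c d /=; field. Qed.

Lemma cm_conj z : cm (cj z) = cm z.
Proof. by rewrite !cm_sqrt; case: z => a b /=; rewrite sqrrN. Qed.

Local Ltac drop := clear -R.

(** Re S is averaged against the nonnegative weight 1 - Re v, where v is unimodular and proportional
    to z^(-k). The weight has mean 1, S has mean 0, and the phase c of v is chosen so that what
    remains is half of |S_k| r^k. An upper bound for Re S therefore suffices. *)
Lemma caratheodory (S : {poly C}) r B k : 0 <= r -> S`_0 = 0 ->
  (forall z, cm z = r -> complex.Re S.[z] <= B) -> (0 < k)%N -> cm S`_k * r ^+ k <= 2 * B.
Proof.
move=> r0 S0 H k0; set K := maxn (size S) k; set N := (2 * K + 2)%N.
have sK : (size S <= K)%N by rewrite leq_maxl.
have kK : (k <= K)%N by rewrite leq_maxr.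
have N0 : (0 < N)%N by rewrite /N; lia.
have sN : (size S <= N)%N by rewrite /N; lia.
have kN : (k < N)%N by rewrite /N; lia.
(* If the coefficient vanishes, the claim is 0 <= B, which holds because Re S has mean 0 on the
   circle. *)
have [->|Sk0] := eqVneq S`_k 0.
  rewrite cm0 mul0r.
  have := @coef_le_sup 0 r 0 0 r0.
  have M0 : \sum_(l < N) complex.Re S.[r%:C * om N ^+ l] <= \sum_(l < N) B.
    by apply: ler_sum => l _; apply: H; rewrite cmM cm_real cm_omX mulr1 ger0_norm.
  have := coef_mean r%:C N0 sN N0; rewrite S0 mul0r mulr0 subn0.
  under eq_bigr => l _ do rewrite -exprM mulnC exprM omN // expr1n mulr1.
  move=> E _; move: M0; rewrite -re_sum E /= sumr_const card_ord.
  rewrite pmulrn_lge0 ?N0 //; lra.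
pose c := - (cj S`_k / (cm S`_k)%:C) : C.
have cmS : 0 < cm S`_k by rewrite cm_gt0.
have c1 : cm c = 1.
  by rewrite /c cmN cmM cmV cm_conj cm_real ger0_norm ?cm_ge0 // divff // lt0r_neq0.
pose v l := c * (om N ^+ l) ^+ (N - k) : C.
have v1 l : cm (v l) = 1 by rewrite /v cmM c1 cmX cm_omX expr1n mulr1.
have I1 : \sum_(l < N) complex.Re S.[r%:C * om N ^+ l] * (1 + complex.Re (- v l)) <= \sum_(l < N) B * (1 + complex.Re (- v l)).
  apply: ler_sum => l _; apply: ler_wpM2r.
    by have := cm_Re (v l); rewrite v1 reN ler_norml => /andP[_]; (drop; lra).
  by apply: H; rewrite cmM cm_real cm_omX mulr1 ger0_norm.
have sv : \sum_(l < N) v l = 0.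
  rewrite -mulr_sumr sum_om // ifF ?mulr0 //; apply/negbTE/negP => /dvdnP [m Hm].
  case: m Hm => [|m]; rewrite ?mulSn; nia.
have R1 : \sum_(l < N) B * (1 + complex.Re (- v l)) = N%:R * B.
  rewrite -mulr_sumr big_split /= sumr_const card_ord.
  have -> : \sum_(l < N) complex.Re (- v l) = 0.
    by rewrite -re_sum sumrN sv oppr0.
  by rewrite addr0 mulrC.
have L1 : \sum_(l < N) complex.Re S.[r%:C * om N ^+ l] * (1 + complex.Re (- v l)) =
    N%:R * (cm S`_k * r ^+ k) / 2.
  have -> : \sum_(l < N) complex.Re S.[r%:C * om N ^+ l] * (1 + complex.Re (- v l)) =
    complex.Re (\sum_(l < N) S.[r%:C * om N ^+ l]) - (complex.Re (\sum_(l < N) S.[r%:C * om N ^+ l] * v l) +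
      complex.Re (\sum_(l < N) S.[r%:C * om N ^+ l] * cj (v l))) / 2.
    rewrite !re_sum -big_split /= mulr_suml -sumrB; apply: eq_bigr => l _.
    by rewrite mulrDr mulr1 reN mulrN Re_mulJ.
  have -> : \sum_(l < N) S.[r%:C * om N ^+ l] = 0.
    have E := coef_mean r%:C N0 sN N0; rewrite S0 mul0r mulr0 subn0 in E; rewrite -[RHS]E.
    by apply: eq_bigr => l _; rewrite -exprM mulnC exprM omN // expr1n mulr1.
  have -> : \sum_(l < N) S.[r%:C * om N ^+ l] * v l = c * (N%:R * (S`_k * r%:C ^+ k)).
    by rewrite -coef_mean // mulr_sumr; apply: eq_bigr => l _; rewrite /v; ring.
  (* This average selects the coefficient of index N - k, which lies beyond [size S] because N = 2 K
     + 2. *)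
  have -> : \sum_(l < N) S.[r%:C * om N ^+ l] * cj (v l) = 0.
    have kk : (N - k < N)%N by lia.
    have := coef_mean r%:C N0 sN kk.
    rewrite nth_default ?mul0r ?mulr0; last by apply: (leq_trans sK); rewrite /N; lia.
    have -> : (N - (N - k) = k)%N by lia.
    move=> E0.
    suff -> : \sum_(l < N) S.[r%:C * om N ^+ l] * cj (v l) = cj c * \sum_(l < N) S.[r%:C * om N ^+ l] * (om N ^+ l) ^+ k by rewrite E0 mulr0.
    rewrite mulr_sumr; apply: eq_bigr => l _.
    rewrite /v conjM conjX conj_om // -exprM.
    have -> : ((N - 1) * (N - k) = N * (N - k - 1) + k)%N by nia.
    rewrite exprD exprM [(om N ^+ l) ^+ N]( _ : _ = 1) ?expr1n ?mul1r; last first.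
      by rewrite -exprM mulnC exprM omN // expr1n.
    ring.
  have -> : c * (N%:R * (S`_k * r%:C ^+ k)) = - (N%:R * (cm S`_k * r ^+ k))%:C.
    rewrite /c !rmorphM rmorphXn rmorph_nat /=.
    have -> : - (cj S`_k / (cm S`_k)%:C) * (N%:R * (S`_k * r%:C ^+ k)) =
      - ((S`_k * cj S`_k) / (cm S`_k)%:C * (N%:R * r%:C ^+ k)) by ring.
    rewrite conj_cm rmorphXn /= expr2 mulfK; last first.
      by rewrite (inj_eq (@complexI R)) lt0r_neq0.
    ring.
  by rewrite reN /=; (drop; lra).
move: I1; rewrite L1 R1 => I1.
have n0 : 0 < N%:R :> R by rewrite ltr0n.
have : N%:R * (cm S`_k * r ^+ k) <= N%:R * (2 * B) by (move: I1; drop; lra).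
by rewrite ler_pM2l.
Qed.

End Roots.

(** * Borel-Caratheodory and local factorization *)

Section BC.
Variable R : realType.
Local Notation C := R[i].
Implicit Types (z w h : C) (x y t r : R) (rs : seq C).

Definition rpoly rs : {poly C} := \prod_(a <- rs) ('X - a%:P).

Lemma rpolyE rs z : (rpoly rs).[z] = \prod_(a <- rs) (z - a).
Proof. by rewrite horner_prod; apply: eq_bigr => a _; rewrite !hornerE. Qed.

Lemma rpoly_cons a rs : rpoly (a :: rs) = ('X - a%:P) * rpoly rs.
Proof. by rewrite /rpoly big_cons. Qed.

Lemma rpoly_logderiv rs z : (rpoly rs).[z] != 0 ->
  (rpoly rs)^`().[z] / (rpoly rs).[z] = \sum_(a <- rs) (z - a)^-1.
Proof.
elim: rs => [|a rs IH] H; first by rewrite /rpoly !big_nil derivC horner0 mul0r.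
move: H; rewrite rpoly_cons hornerM mulf_eq0 negb_or => /andP[H1 H2].
rewrite big_cons -IH // derivM derivXsubC mul1r hornerD hornerM.
move: H1; rewrite !hornerE => H1; field; exact/andP.
Qed.

Lemma ln_prod (I : eqType) (s : seq I) (F : I -> R) : (forall i, i \in s -> 0 < F i) ->
  ln (\prod_(i <- s) F i) = \sum_(i <- s) ln (F i).
Proof.
elim: s => [|i s IH] H; first by rewrite !big_nil ln1.
have Hs j : j \in s -> 0 < F j by move=> js; apply: H; rewrite in_cons js orbT.
have P : 0 < \prod_(j <- s) F j by rewrite big_seq; apply: prodr_gt0.
by rewrite !big_cons lnM ?posrE ?H ?mem_head // IH.
Qed.

Lemma sum_seq_le (I : eqType) (s : seq I) (F G : I -> R) : (forall i, i \in s -> F i <= G i) ->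
  \sum_(i <- s) F i <= \sum_(i <- s) G i.
Proof. by move=> H; rewrite big_seq [leRHS]big_seq; apply: ler_sum. Qed.

Lemma sum_seq_const (I : Type) (s : seq I) (c : R) : \sum_(i <- s) c = (size s)%:R * c.
Proof. by rewrite big_const_seq count_predT iter_addr_0 mulr_natl. Qed.

(** One ratio q < 1 for all roots makes the truncated expansions below converge; q does not survive
    in the final bounds. *)
Lemma seq_ratio rs r : 0 < r -> (forall a, a \in rs -> r < cm a) ->
  exists q, [/\ 0 < q, q < 1 & forall a, a \in rs -> r / cm a <= q].
Proof.
move=> r0; elim: rs => [|a rs IH] H; first by exists 2^-1; split => //; lra.
have [|q [q0 q1 Hq]] := IH; first by move=> b bs; apply: H; rewrite in_cons bs orbT.
have ra := H a (mem_head _ _).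
exists (Num.max q (r / cm a)); split.
- by rewrite lt_max q0.
- by rewrite gt_max q1 ltr_pdivrMr ?mul1r // (lt_trans r0).
move=> b; rewrite in_cons => /orP[/eqP->|bs]; first by rewrite le_max lexx orbT.
by rewrite le_max Hq.
Qed.

Lemma sum_kx (x : R) K : 0 <= x -> x < 1 -> \sum_(k < K) k.+1%:R * x ^+ k <= (1 - x) ^- 2.
Proof.
move=> x0 x1; have d : 0 < 1 - x by lra.
have E : (1 - x) ^+ 2 * (\sum_(k < K) k.+1%:R * x ^+ k) = 1 - x ^+ K * (1 + K%:R * (1 - x)).
  elim: K => [|K IH]; first by rewrite big_ord0; ring.
  by rewrite big_ord_recr /= mulrDr IH [x ^+ K.+1]exprS -[K.+1%:R]natr1; ring.
rewrite -[leRHS]mul1r ler_pdivlMr ?exprn_gt0 // mulrC E gerBl mulr_ge0 ?exprn_ge0 //.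
by rewrite addr_ge0 // mulr_ge0 // ltW.
Qed.

(** * Polynomials without zeros in a disc *)

Section Zerofree.
Variables (rs : seq C) (c : C) (r M : R).
Hypothesis r0 : 0 < r.
Hypothesis c0 : c != 0.
Hypothesis far : forall a, a \in rs -> r < cm a.
Let g := c *: rpoly rs.
Hypothesis gM : forall z, cm z = r -> cm g.[z] <= M.

Let A := ln (M / cm g.[0]).

Let a0 a : a \in rs -> a != 0.
Proof. by move=> H; rewrite -cm_gt0 (lt_trans r0) // far. Qed.

Let q_ex := seq_ratio r0 far.

(* [zf_S K] is the Taylor polynomial of log (g z / g 0). *)
Definition zf_coef k : C := \sum_(a <- rs) a ^- k.
Definition zf_S K : {poly C} := - \sum_(k < K) (zf_coef k.+1 / k.+1%:R) *: 'X^(k.+1).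

Lemma zf_SE K z : (zf_S K).[z] = - \sum_(a <- rs) logser K (z / a).
Proof.
rewrite /zf_S hornerN horner_sum; congr (- _).
rewrite exchange_big /=; apply: eq_bigr => k _.
rewrite hornerZ hornerXn /zf_coef !mulr_suml; apply: eq_bigr => a _.
by rewrite exprMn exprVn; ring.
Qed.

Lemma zf_S0 K : (zf_S K)`_0 = 0.
Proof.
by rewrite -horner_coef0 zf_SE big1 ?oppr0 // => a _; rewrite mul0r /logser big1 // => k _; rewrite exprS !mul0r.
Qed.

Lemma zf_Sk K k : (k < K)%N -> (zf_S K)`_k.+1 = - (zf_coef k.+1 / k.+1%:R).
Proof.
move=> kK; rewrite /zf_S coefN coef_sum (bigD1 (Ordinal kK)) //= coefZ coefXn eqxx mulr1.
rewrite big1 ?addr0 // => j jk; rewrite coefZ coefXn eqSS eq_sym.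
by move: jk; rewrite -val_eqE /= => /negbTE ->; rewrite mulr0.
Qed.

Lemma zf_g z : g.[z] = c * \prod_(a <- rs) (z - a).
Proof. by rewrite /g hornerZ rpolyE. Qed.

Lemma zf_neq0 z : cm z <= r -> g.[z] != 0.
Proof.
move=> zr; rewrite zf_g mulf_neq0 // prodf_seq_neq0; apply/allP => a /far H /=.
rewrite -cm_gt0; have := cm_rev a z; rewrite cmB; lra.
Qed.

Lemma zf_ln z : cm z <= r -> ln (cm g.[z] / cm g.[0]) = \sum_(a <- rs) ln (cm (1 - z / a)).
Proof.
move=> zr; rewrite -ln_prod; last first.
  move=> a ars; rewrite cm_gt0 subr_eq0 eq_sym; apply/negP => /eqP E.
  have : cm z = cm a by rewrite -[in RHS](mul1r a) -E divfK // a0.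
  by have := far ars; lra.
congr ln; rewrite !zf_g !cmM !cm_prod invfM.
have cc : cm c != 0 by rewrite cm_eq0.
rewrite mulrACA divff // mul1r -prodfV -big_split /=; rewrite big_seq [RHS]big_seq.
apply: eq_bigr => a ars; rewrite sub0r cmN -cmV -cmM.
have an := a0 ars.
have -> : 1 - z / a = - ((z - a) / a) by field.
by rewrite cmN.
Qed.

Lemma zf_err q K z : 0 < q -> q < 1 -> (forall a, a \in rs -> r / cm a <= q) -> cm z <= r ->
  `|ln (cm g.[z] / cm g.[0]) - complex.Re (zf_S K).[z]| <= (size rs)%:R * (q ^+ K.+1 / (1 - q)).
Proof.
move=> q0 q1 Hq zr; rewrite zf_ln // zf_SE reN re_sum opprK -big_split /=.
rewrite -sum_seq_const; apply: (le_trans (ler_norm_sum _ _ _)); apply: sum_seq_le => a ars.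
have zq : cm (z / a) <= q.
  rewrite cmM cmV; apply: le_trans (Hq a ars); rewrite ler_pM2r // invr_gt0 cm_gt0; exact: a0.
apply: (le_trans (ln_cm_1sub K (le_lt_trans zq q1))).
have d : 0 < 1 - q by lra.
apply: ler_pM; rewrite ?exprn_ge0 ?cm_ge0 ?invr_ge0 //; first lra.
  by rewrite lerXn2r ?nnegrE ?cm_ge0 // ltW.
by rewrite lef_pV2 ?posrE; lra.
Qed.

Lemma zf_M0 : 0 < M.
Proof.
apply: lt_le_trans (gM (z := r%:C) _); last by rewrite cm_real ger0_norm // ltW.
by rewrite cm_gt0 zf_neq0 // cm_real ger0_norm // ltW.
Qed.

Lemma zf_A z : cm z = r -> ln (cm g.[z] / cm g.[0]) <= A.
Proof.
move=> zr; have g0 : 0 < cm g.[0] by rewrite cm_gt0 zf_neq0 // cm0 ltW.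
have gz : 0 < cm g.[z] by rewrite cm_gt0 zf_neq0 // zr.
by rewrite ler_ln ?posrE ?divr_gt0 ?zf_M0 // ler_pM2r ?invr_gt0 // gM.
Qed.

Lemma zf_eps (q e : R) : 0 < q -> q < 1 -> 0 < e -> exists N : nat, forall K, (N <= K)%N ->
  (size rs)%:R * (q ^+ K.+1 / (1 - q)) <= e.
Proof.
move=> q0 q1 e0; have d : 0 < 1 - q by lra.
have n0 : 0 < (size rs).+1%:R :> R by rewrite ltr0n.
have [N HN] := small_pow (ltW q0) q1 (mulr_gt0 (divr_gt0 e0 n0) d).
exists N => K NK; rewrite mulrA ler_pdivrMr //.
have := HN K.+1 (leqW NK); rewrite -/(_ ^+ _).
set Q := q ^+ K.+1; have Q0 : 0 <= Q by rewrite exprn_ge0 // ltW.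
move=> H; apply: (@le_trans _ _ ((size rs).+1%:R * Q)); first by rewrite ler_wpM2r // ler_nat.
rewrite mulrC -ler_pdivlMr //; apply: (le_trans H); apply: le_eq; ring.
Qed.

(** For large K the real part of [zf_S K] is within e' of log |g / g(0)|, so Caratheodory's
    inequality applies with A + e' in place of A, and e' is arbitrary. *)
Lemma zf_coef_le k : cm (zf_coef k.+1) * r ^+ k.+1 <= k.+1%:R * (2 * A).
Proof.
have [q [q0 q1 Hq]] := q_ex.
apply/ler_addgt0Pr => e e0; have k0 : 0 < k.+1%:R :> R by rewrite ltr0n.
pose e' := e / (2 * k.+1%:R).
have e'0 : 0 < e' by rewrite divr_gt0 // mulr_gt0.
have [N HN] := zf_eps q0 q1 e'0.
set K := maxn N k.+1; have NK : (N <= K)%N by rewrite leq_maxl.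
have kK : (k < K)%N by rewrite leq_maxr.
have B z : cm z = r -> complex.Re (zf_S K).[z] <= A + e'.
  move=> zr; have zr' : cm z <= r by rewrite zr.
  have := zf_err K q0 q1 Hq zr'; have := HN K NK; have := zf_A zr.
  rewrite ler_norml => h1 h2 /andP[h3 _]; lra.
have := caratheodory (ltW r0) (zf_S0 K) B (ltn0Sn k).
rewrite zf_Sk // cmN cmM cmV cm_nat => H.
have : cm (zf_coef k.+1) / k.+1%:R * r ^+ k.+1 * k.+1%:R <= 2 * (A + e') * k.+1%:R.
  by rewrite ler_pM2r.
have -> : cm (zf_coef k.+1) / k.+1%:R * r ^+ k.+1 * k.+1%:R = cm (zf_coef k.+1) * r ^+ k.+1.
  by field; exact: lt0r_neq0.
move/le_trans; apply; apply: le_eq; rewrite /e'; field; exact: lt0r_neq0.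
Qed.

Lemma zf_A0 : 0 <= A.
Proof.
have := zf_coef_le 0; rewrite mul1r => /(le_trans _) H.
have : 0 <= cm (zf_coef 1) * r ^+ 1 by rewrite mulr_ge0 ?cm_ge0 // expr1 ltW.
by move/H; lra.
Qed.

Local Ltac drop := clear -R rs c r M r0 c0 far gM.

(** The coefficient bound turns the series of log (g / g(0)) into a geometric series in |z| / r. *)
Lemma zf_lower z : cm z < r -> cm g.[0] * expR (- (2 * A * cm z / (r - cm z))) <= cm g.[z].
Proof.
move=> zr; have [q [q0 q1 Hq]] := q_ex; have z0 := cm_ge0 z.
have g0 : 0 < cm g.[0] by rewrite cm_gt0 zf_neq0 // cm0 ltW.
have gz : 0 < cm g.[z] by rewrite cm_gt0 zf_neq0 // ltW.
rewrite mulrC -ler_pdivlMr // -[leRHS]lnK ?posrE ?divr_gt0 // ler_expR.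
have A0 := zf_A0.
apply/ler_addgt0Pr => e e0; have [K HK] := zf_eps q0 q1 e0.
have := zf_err K q0 q1 Hq (ltW zr); have := HK K (leqnn _).
rewrite ler_norml => h1 /andP[h2 _].
suff : - (2 * A * cm z / (r - cm z)) <= complex.Re (zf_S K).[z] by (move: h1 h2; drop; lra).
suff : cm (zf_S K).[z] <= 2 * A * cm z / (r - cm z).
  by have := cm_Re (zf_S K).[z]; rewrite ler_norml => /andP[]; (drop; lra).
rewrite /zf_S hornerN cmN horner_sum; apply: (le_trans (cm_sum _ _ _)).
have x0 : 0 <= cm z / r by rewrite divr_ge0 // ltW.
have x1 : cm z / r < 1 by rewrite ltr_pdivrMr // mul1r.
have -> : 2 * A * cm z / (r - cm z) = 2 * A * ((cm z / r) / (1 - cm z / r)).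
  by field; rewrite subr_eq0 (gt_eqF zr) (gt_eqF r0).
apply: (@le_trans _ _ (2 * A * \sum_(k < K) (cm z / r) ^+ k.+1)); last first.
  by rewrite ler_wpM2l ?geo_le //; (move: gz A0; drop; lra).
rewrite mulr_sumr; apply: ler_sum => k _.
rewrite hornerZ hornerXn !cmM cmV cm_nat cmX expr_div_n.
have k0 : 0 < k.+1%:R :> R by rewrite ltr0n.
have rk : 0 < r ^+ k.+1 by rewrite exprn_gt0.
have := zf_coef_le k => H.
have -> : 2 * A * (cm z ^+ k.+1 / r ^+ k.+1) = k.+1%:R * (2 * A) / (k.+1%:R * r ^+ k.+1) * cm z ^+ k.+1.
  by field; rewrite !lt0r_neq0.
apply: ler_wpM2r; first by rewrite exprn_ge0.
rewrite ler_pdivlMr ?mulr_gt0 //.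
have -> // : cm (zf_coef k.+1) / k.+1%:R * (k.+1%:R * r ^+ k.+1) = cm (zf_coef k.+1) * r ^+ k.+1.
by field; exact: lt0r_neq0.
Qed.

Lemma zf_logderiv z : cm z < r -> cm (g^`().[z] / g.[z]) <= 2 * A * r / (r - cm z) ^+ 2.
Proof.
move=> zr; have [q [q0 q1 Hq]] := q_ex; have z0 := cm_ge0 z.
have gz : g.[z] != 0 by rewrite zf_neq0 // ltW.
have A0 := zf_A0.
have -> : g^`().[z] / g.[z] = \sum_(a <- rs) (z - a)^-1.
  have pz : (rpoly rs).[z] != 0 by move: gz; rewrite /g hornerZ mulf_eq0 negb_or => /andP[].
  rewrite -rpoly_logderiv // /g derivZ !hornerZ; field; exact/andP.
apply/ler_addgt0Pr => e e0; have [K HK] := zf_eps q0 q1 (mulr_gt0 e0 r0).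
have x0 : 0 <= cm z / r by rewrite divr_ge0 // ltW.
have x1 : cm z / r < 1 by rewrite ltr_pdivrMr // mul1r.
(* Each 1 / (z - a) is expanded to K+1 terms with its exact remainder, which is small because |z /
   a| <= q. *)
have E : \sum_(a <- rs) (z - a)^-1 = - (\sum_(k < K.+1) zf_coef k.+1 * z ^+ k) +
   \sum_(a <- rs) ((z / a) ^+ K.+1 * (z - a)^-1).
  have -> : \sum_(k < K.+1) zf_coef k.+1 * z ^+ k = \sum_(a <- rs) \sum_(k < K.+1) a ^- k.+1 * z ^+ k.
    by rewrite exchange_big; apply: eq_bigr => k _; rewrite /zf_coef mulr_suml.
  rewrite -sumrN -big_split /= big_seq [RHS]big_seq; apply: eq_bigr => a ars.
  have an := a0 ars.
  have zan : z - a != 0 by move: (far ars); rewrite -cm_gt0; have := cm_rev a z; rewrite cmB; (move: zr; drop; lra).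
  have -> : \sum_(k < K.+1) a ^- k.+1 * z ^+ k = a^-1 * \sum_(k < K.+1) (z / a) ^+ k.
    by rewrite mulr_sumr; apply: eq_bigr => k _; rewrite exprMn exprVn exprS invfM; ring.
  have S : (1 - z / a) * \sum_(k < K.+1) (z / a) ^+ k = 1 - (z / a) ^+ K.+1.
    by rewrite -[1 - z / a]opprB mulNr -subrX1 opprB.
  have zan' : 1 - z / a != 0 by have -> : 1 - z / a = - ((z - a) / a) by [field]; rewrite oppr_eq0 mulf_neq0 // invr_eq0.
  have -> : \sum_(k < K.+1) (z / a) ^+ k = (1 - (z / a) ^+ K.+1) / (1 - z / a) by apply: (mulfI zan'); rewrite S mulrCA mulfV // mulr1.
  set W := (z / a) ^+ K.+1.
  have -> : 1 - z / a = - ((z - a) / a) by field.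
  by field; rewrite zan an.
rewrite E; apply: (le_trans (cm_D _ _)); rewrite cmN; apply: lerD.
  apply: (le_trans (cm_sum _ _ _)).
  have -> : 2 * A * r / (r - cm z) ^+ 2 = 2 * A / r * (1 - cm z / r) ^- 2.
    by field; rewrite subr_eq0 (gt_eqF zr) (gt_eqF r0).
  apply: (@le_trans _ _ (2 * A / r * \sum_(k < K.+1) k.+1%:R * (cm z / r) ^+ k)); last first.
    by rewrite ler_wpM2l ?sum_kx // divr_ge0 ?(ltW r0) //; (move: A0 e0; drop; lra).
  rewrite mulr_sumr; apply: ler_sum => k _; rewrite cmM cmX.
  have -> : 2 * A / r * (k.+1%:R * (cm z / r) ^+ k) = k.+1%:R * (2 * A) / r ^+ k.+1 * cm z ^+ k.
    by rewrite expr_div_n exprS; field; do ?[apply/andP; split]; rewrite ?expf_neq0 ?lt0r_neq0.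
  apply: ler_wpM2r; first by rewrite exprn_ge0.
  by rewrite ler_pdivlMr ?exprn_gt0 // zf_coef_le.
apply: (le_trans (cm_sum _ _ _)).
have := HK K (leqnn _) => H.
suff : \sum_(a <- rs) cm ((z / a) ^+ K.+1 * (z - a)^-1) <= (size rs)%:R * (q ^+ K.+1 / (1 - q)) / r.
  by move/le_trans; apply; rewrite ler_pdivrMr.
rewrite -mulrA -sum_seq_const; apply: sum_seq_le => a ars.
have zq : cm (z / a) <= q.
  rewrite cmM cmV; apply: le_trans (Hq a ars); rewrite ler_pM2r ?(ltW zr) // invr_gt0 cm_gt0; exact: a0.
have d : 0 < 1 - q by (move: zr q1; drop; lra).
have ca : 0 < cm a by rewrite cm_gt0 a0.
rewrite cmM cmX cmV -mulrA; apply: ler_pM; rewrite ?exprn_ge0 ?cm_ge0 ?invr_ge0 ?cm_ge0 //.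
  by rewrite lerXn2r ?nnegrE ?cm_ge0 // ltW.
rewrite -invfM lef_pV2 ?posrE ?mulr_gt0 //; last first.
  by have := far ars; have := cm_rev a z; rewrite cmB; (move: zr; drop; lra).
have h1 := Hq a ars; rewrite ler_pdivrMr // in h1.
have h2 : cm z <= q * cm a by apply: le_trans h1; exact: ltW.
have := cm_rev a z; rewrite cmB => h3; have := far ars; (move: d h2 h3; drop; nra).
Qed.

End Zerofree.

Lemma poly_factor (p : {poly C}) : exists rs, p = lead_coef p *: rpoly rs.
Proof. by have [rs E] := closed_field_poly_normal p; exists rs. Qed.

Lemma BC_logderiv (p : {poly C}) r M : 0 < r -> (forall z, cm z <= r -> p.[z] != 0) ->
  (forall z, cm z = r -> cm p.[z] <= M) ->
  [/\ 0 <= ln (M / cm p.[0]),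
   forall z, cm z < r -> cm (p^`().[z] / p.[z]) <= 2 * ln (M / cm p.[0]) * r / (r - cm z) ^+ 2 &
   forall z, cm z < r -> cm p.[0] * expR (- (2 * ln (M / cm p.[0]) * cm z / (r - cm z))) <= cm p.[z]].
Proof.
move=> r0 nz pM; have [rs E] := poly_factor p.
have p0 : p != 0.
  apply/negP => /eqP p0; have := nz 0; rewrite cm0 p0 horner0 eqxx => /(_ (ltW r0)) //.
have c0 : lead_coef p != 0 by rewrite lead_coef_eq0.
have far a : a \in rs -> r < cm a.
  move=> ars; rewrite ltNge; apply/negP => /nz; rewrite E hornerZ rpolyE.
  rewrite mulf_eq0 negb_or => /andP[_]; rewrite prodf_seq_neq0 => /allP /(_ a ars) /=.
  by rewrite subrr eqxx.
have [c [cn Ec]] : exists c, c != 0 /\ p = c *: rpoly rs by exists (lead_coef p).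
subst p; split; first exact: (zf_A0 r0 cn far pM).
  by move=> z zr; apply: (zf_logderiv r0 cn far pM zr).
by move=> z zr; apply: (zf_lower r0 cn far pM zr).
Qed.

Local Ltac drop := clear -R.

(** Let g be p without its n zeros of modulus at most Rad / 4. On |z| = Rad each removed factor is
    at least 3 Rad / 4, at 0 at most Rad / 4; comparing g(0) with the circle gives 3^n <= M /
    |p(0)|, hence the count. The logarithmic derivative of g, which is zero-free on |z| <= Rad / 8,
    is bounded by [BC_logderiv]. *)
Lemma local_zeros (p : {poly C}) (Rad M : R) : 0 < Rad ->
  (forall z, cm z <= Rad -> cm p.[z] <= M) -> p.[0] != 0 ->
  exists rs, [/\ (size rs)%:R <= 2 * ln (M / cm p.[0]),
    forall a, a \in rs -> p.[a] = 0 /\ cm a <= Rad / 4 &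
    forall z, cm z <= Rad / 16 -> p.[z] != 0 ->
      cm (p^`().[z] / p.[z] - \sum_(a <- rs) (z - a)^-1) <= 64 * ln (M / cm p.[0]) / Rad].
Proof.
move=> R0 pM p0; have [as_ E] := poly_factor p.
have pn0 : p != 0 by apply/negP => /eqP q; rewrite q horner0 eqxx in p0.
have c0 : lead_coef p != 0 by rewrite lead_coef_eq0.
set c := lead_coef p in E c0.
pose near := [seq a <- as_ | cm a <= Rad / 4].
pose far := [seq a <- as_ | ~~ (cm a <= Rad / 4)].
pose g := c *: rpoly far.
have Ep z : p.[z] = g.[z] * (rpoly near).[z].
  rewrite E /g !hornerZ !rpolyE -mulrA; congr (_ * _).
  by rewrite mulrC [LHS](bigID (fun a => cm a <= Rad / 4)) /near /far !big_filter.
have root a : a \in near -> p.[a] = 0 /\ cm a <= Rad / 4.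
  move=> an; split; last by move: an; rewrite mem_filter => /andP[].
  rewrite Ep [X in _ * X](_ : _ = 0) ?mulr0 //.
  rewrite rpolyE; apply/eqP; rewrite prodf_seq_eq0; apply/hasP; exists a => //=.
  by rewrite subrr.
set n := size near.
have nb (B : R) z : 0 <= B -> (forall a, a \in near -> B <= cm (z - a)) -> B ^+ n <= cm (rpoly near).[z].
  move=> B0; rewrite rpolyE cm_prod /n; elim: (near) => [|a s IH] H; first by rewrite big_nil.
  rewrite big_cons /= exprS; apply: ler_pM; rewrite ?exprn_ge0 ?H ?mem_head //.
  by apply: IH => b bs; apply: H; rewrite in_cons bs orbT.
have nu : cm (rpoly near).[0] <= (Rad / 4) ^+ n.
  have : forall a, a \in near -> cm a <= Rad / 4 by move=> a /root [].
  rewrite rpolyE cm_prod /n; elim: (near) => [|a s IH] H; first by rewrite big_nil.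
  rewrite big_cons /= exprS; apply: ler_pM; rewrite ?cm_ge0 ?prodr_ge0 //.
  - by move=> i _; exact: cm_ge0.
  - by rewrite sub0r cmN H ?mem_head.
  by apply: IH => b bs; apply: H; rewrite in_cons bs orbT.
have M0 : 0 < M by apply: lt_le_trans (pM 0 _); rewrite ?cm_gt0 // cm0 ltW.
have gbound z B : 0 < B -> cm z <= Rad -> (forall a, a \in near -> B <= cm (z - a)) -> cm g.[z] <= M / B ^+ n.
  move=> B0 zR H; rewrite ler_pdivlMr ?exprn_gt0 //; apply: le_trans (pM z zR).
  by rewrite Ep cmM ler_wpM2l ?cm_ge0 // nb // ltW.
have cp0 : 0 < cm p.[0] by rewrite cm_gt0.
have r4 : 0 < Rad / 4 by lra.
have g0 : cm p.[0] / (Rad / 4) ^+ n <= cm g.[0].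
  by rewrite ler_pdivrMr ?exprn_gt0 // Ep cmM ler_wpM2l ?cm_ge0.
have cg0 : 0 < cm g.[0] by apply: lt_le_trans g0; rewrite divr_gt0 // exprn_gt0.
have gz z : cm z <= Rad / 8 -> g.[z] != 0.
  move=> zr; rewrite /g hornerZ mulf_neq0 // rpolyE prodf_seq_neq0; apply/allP => a /=.
  rewrite mem_filter -ltNge => /andP[h _]; rewrite -cm_gt0.
  by have := cm_rev a z; rewrite cmB; (move: r4 zr h; drop; lra).
have near_dist z : Rad / 2 <= cm z -> forall a, a \in near -> Rad / 4 <= cm (z - a).
  by move=> h a /root [_ h2]; have := cm_rev z a; (move: h h2; drop; lra).
(* The circle of radius 3 Rad / 4 about z lies in the annulus between Rad / 2 and Rad, where every
   removed factor is at least Rad / 4. *)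
have gM z : cm z = Rad / 8 -> cm g.[z] <= M / (Rad / 4) ^+ n.
  move=> zr; apply: (@center_le_sup _ g z (3 * Rad / 4)); first (move: r4; drop; lra).
  move=> w wz; apply: gbound => //.
    by have := cm_D (w - z) z; rewrite subrK; (move: r4 zr wz; drop; lra).
  by apply: near_dist; have := cm_rev (w - z) (- z); rewrite cmN opprK subrK; (move: r4 zr wz; drop; lra).
have r8 : 0 < Rad / 8 by (move: r4; drop; lra).
have [A0 HA _] := BC_logderiv r8 gz gM.
set A := ln (M / cm p.[0]).
have AA : ln (M / (Rad / 4) ^+ n / cm g.[0]) <= A.
  rewrite ler_ln ?posrE ?divr_gt0 ?exprn_gt0 // -mulrA -invfM ler_pM2l //.
  rewrite lef_pV2 ?posrE ?mulr_gt0 ?exprn_gt0 //.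
  by move: g0; rewrite ler_pdivrMr ?exprn_gt0 // mulrC.
exists near; split => //.
- rewrite -/n.
  have gR : cm g.[0] <= M / (3 * Rad / 4) ^+ n.
    apply: (@center_le_sup _ g 0 Rad); first exact: ltW.
    move=> z; rewrite subr0 => zR; apply: gbound; [(move: r8; drop; lra)|by rewrite zR|].
    by move=> a /root [_ h2]; have := cm_rev z a; (move: zR h2; drop; lra).
  have H3 : 3 ^+ n <= M / cm p.[0].
    rewrite ler_pdivlMr //; have := le_trans g0 gR.
    rewrite ler_pdivrMr ?exprn_gt0 // => h; have := ler_wpM2l (exprn_ge0 n (ler0n R 3)) h.
    move=> /le_trans; apply; apply: le_eq.
    have -> : (3 * Rad / 4) ^+ n = 3 ^+ n * (Rad / 4) ^+ n by rewrite -exprMn mulrA.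
    by field; rewrite !expf_neq0 // ?lt0r_neq0.
  have e2 : expR 2^-1 <= 3 :> R.
    have := expR_ge1Dx (- 2^-1 : R); rewrite expRN; have := expR_gt0 (2^-1 : R).
    set E2 := expR _ => E0 h; have : (1 - 2^-1) * E2 <= 1 by rewrite -ler_pdivlMr // div1r.
    (drop; lra).
  have : n%:R / 2 <= A.
    rewrite /A -[leLHS]expRK ler_ln ?posrE ?expR_gt0 ?divr_gt0 //.
    by apply: le_trans H3; rewrite expRM_natl lerXn2r ?nnegrE ?expR_ge0.
  (drop; lra).
move=> z zr pz.
have [gzn nzn] : g.[z] != 0 /\ (rpoly near).[z] != 0.
  by move: pz; rewrite Ep mulf_eq0 negb_or => /andP.
have -> : p^`().[z] / p.[z] - \sum_(a <- near) (z - a)^-1 = g^`().[z] / g.[z].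
  rewrite -rpoly_logderiv //.
  have -> : p = g * rpoly near.
    rewrite E /g -scalerAl; congr (_ *: _).
    by rewrite mulrC /rpoly [LHS](bigID (fun a => cm a <= Rad / 4)) /near /far !big_filter.
  by rewrite derivM hornerD !hornerM; field; exact/andP.
apply: (le_trans (HA z _)); first (move: r8 zr; drop; lra).
have c0z := cm_ge0 z.
set A' := ln _ in A0 AA *.
apply: (@le_trans _ _ (2 * A' * (Rad / 8) / (Rad / 16) ^+ 2)).
  apply: ler_wpM2l; first by rewrite !mulr_ge0 // ltW.
  rewrite lef_pV2 ?posrE ?exprn_gt0 //; [|(move: r4 zr; drop; lra)|(move: r4; drop; lra)].
  by rewrite lerXn2r ?nnegrE; (move: zr c0z; drop; lra).
have -> : 2 * A' * (Rad / 8) / (Rad / 16) ^+ 2 = 64 * A' / Rad by field; exact: lt0r_neq0.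
by rewrite ler_pM2r ?invr_gt0 // ler_pM2l.
Qed.

End BC.

(** * Limits of polynomials on discs *)

Section Holo.
Variable R : realType.
Local Notation C := R[i].
Implicit Types (z w h : C) (x y t r e : R) (f g : C -> C).

(* [Pap r f]: [f] is a uniform limit of polynomials on the disc of radius [r].  [Hol r f g]: so is its derivative [g],
   along the same polynomials.  These replace holomorphy. *)
Definition Pap r f := forall e, 0 < e -> exists p : {poly C}, forall z, cm z <= r -> cm (p.[z] - f z) <= e.
Definition Hol r f g := forall e, 0 < e -> exists p : {poly C}, forall z, cm z <= r ->
  cm (p.[z] - f z) <= e /\ cm (p^`().[z] - g z) <= e.

Lemma Hol_Pap r f g : Hol r f g -> Pap r f.
Proof. by move=> H e /H [p Hp]; exists p => z /Hp []. Qed.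

Lemma Pap_ext r f f' : (forall z, cm z <= r -> f z = f' z) -> Pap r f -> Pap r f'.
Proof. by move=> E H e /H [p Hp]; exists p => z zr; rewrite -E // Hp. Qed.

Lemma Pap_poly r (p : {poly C}) : Pap r (fun z => p.[z]).
Proof. by move=> e e0; exists p => z _; rewrite subrr cm0 ltW. Qed.

Lemma poly_bound (p : {poly C}) r : 0 <= r -> exists M, 0 <= M /\ forall z, cm z <= r -> cm p.[z] <= M.
Proof.
move=> r0; exists (\sum_(k < size p) cm p`_k * r ^+ k); split.
  by apply: sumr_ge0 => k _; rewrite mulr_ge0 ?cm_ge0 ?exprn_ge0.
move=> z zr; rewrite horner_coef; apply: (le_trans (cm_sum _ _ _)); apply: ler_sum => k _.
by rewrite cmM cmX ler_wpM2l ?cm_ge0 // lerXn2r ?nnegrE ?cm_ge0.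
Qed.

Lemma Pap_bound r f : 0 <= r -> Pap r f -> exists M, 0 <= M /\ forall z, cm z <= r -> cm (f z) <= M.
Proof.
move=> r0 /(_ 1 ltr01) [p Hp]; have [M [M0 HM]] := poly_bound p r0.
exists (M + 1); split; first lra.
move=> z zr; have := HM z zr; have := Hp z zr; have := cm_rev (f z) p.[z].
rewrite (cmB (f z)); lra.
Qed.

Lemma Hol_bound r f g : 0 <= r -> Hol r f g ->
  exists M, 0 <= M /\ forall z, cm z <= r -> cm (f z) <= M /\ cm (g z) <= M.
Proof.
move=> r0 /(_ 1 ltr01) [p Hp]; have [M [M0 HM]] := poly_bound p r0.
have [M' [M0' HM']] := poly_bound p^`() r0.
exists (M + M' + 1); split; first lra.
move=> z zr; have [h1 h2] := Hp z zr.
have := HM z zr; have := cm_rev (f z) p.[z]; have := HM' z zr; have := cm_rev (g z) p^`().[z].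
rewrite !(cmB _ (horner _ _)); lra.
Qed.

Lemma Pap_add r f f' : Pap r f -> Pap r f' -> Pap r (fun z => f z + f' z).
Proof.
move=> H H' e e0; have e2 : 0 < e / 2 by lra.
have [p Hp] := H _ e2; have [q Hq] := H' _ e2.
exists (p + q) => z zr; rewrite hornerD opprD addrACA; apply: (le_trans (cm_D _ _)).
by have := Hp z zr; have := Hq z zr; lra.
Qed.

Lemma Pap_mul r f f' : 0 <= r -> Pap r f -> Pap r f' -> Pap r (fun z => f z * f' z).
Proof.
move=> r0 H H' e e0.
have [M [M0 HM]] := Pap_bound r0 H; have [M' [M0' HM']] := Pap_bound r0 H'.
pose e1 := Num.min 1 (e / (M + M' + 1)).
have d0 : 0 < M + M' + 1 by lra.
have e10 : 0 < e1 by rewrite lt_min ltr01 divr_gt0.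
have [p Hp] := H _ e10; have [q Hq] := H' _ e10.
exists (p * q) => z zr; rewrite hornerM.
have -> : p.[z] * q.[z] - f z * f' z = (p.[z] - f z) * q.[z] + f z * (q.[z] - f' z) by ring.
have hp := Hp z zr; have hq := Hq z zr; have hM := HM z zr; have hM' := HM' z zr.
have q1 : cm q.[z] <= M' + 1.
  have := cm_rev q.[z] (f' z); have : e1 <= 1 by rewrite ge_min lexx.
  lra.
have e1e : e1 * (M + M' + 1) <= e by rewrite -ler_pdivlMr // ge_min lexx orbT.
apply: (le_trans (cm_D _ _)); rewrite !cmM.
have : cm (p.[z] - f z) * cm q.[z] <= e1 * (M' + 1) by rewrite ler_pM ?cm_ge0.
have : cm (f z) * cm (q.[z] - f' z) <= M * e1 by rewrite ler_pM ?cm_ge0.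
nra.
Qed.

Lemma Pap_const r c : Pap r (fun=> c).
Proof. by apply: Pap_ext (Pap_poly r c%:P) => z _; rewrite hornerC. Qed.

Lemma Pap_opp r f : Pap r f -> Pap r (fun z => - f z).
Proof. by move=> H e /H [p Hp]; exists (- p) => z zr; rewrite hornerN -opprD cmN; exact: Hp. Qed.

Lemma Pap_lim r f : (forall e, 0 < e -> exists f', Pap r f' /\ forall z, cm z <= r -> cm (f' z - f z) <= e) -> Pap r f.
Proof.
move=> H e e0; have e2 : 0 < e / 2 by lra.
have [f' [/(_ _ e2) [p Hp] Hf]] := H _ e2; exists p => z zr.
by apply: (le_trans (cm_tri _ _ (f' z))); have := Hp z zr; have := Hf z zr; lra.
Qed.

Lemma Hol_lim r f g : (forall e, 0 < e -> exists f' g', Hol r f' g' /\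
  forall z, cm z <= r -> cm (f' z - f z) <= e /\ cm (g' z - g z) <= e) -> Hol r f g.
Proof.
move=> H e e0; have e2 : 0 < e / 2 by lra.
have [f' [g' [/(_ _ e2) [p Hp] Hf]]] := H _ e2; exists p => z zr.
have [h1 h2] := Hp z zr; have [h3 h4] := Hf z zr; split.
  by apply: (le_trans (cm_tri _ _ (f' z))); lra.
by apply: (le_trans (cm_tri _ _ (g' z))); lra.
Qed.

Lemma Hol_const r c : Hol r (fun=> c) (fun=> 0).
Proof. by move=> e e0; exists c%:P => z _; rewrite derivC !hornerC !subrr cm0 ltW. Qed.

Lemma Hol_add r f g f' g' : Hol r f g -> Hol r f' g' -> Hol r (fun z => f z + f' z) (fun z => g z + g' z).
Proof.
move=> H H' e e0; have e2 : 0 < e / 2 by lra.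
have [p Hp] := H _ e2; have [q Hq] := H' _ e2.
exists (p + q) => z zr; have [h1 h2] := Hp z zr; have [h3 h4] := Hq z zr.
rewrite derivD !hornerD !opprD !(addrACA _ (horner _ z)).
by split; apply: (le_trans (cm_D _ _)); lra.
Qed.

Lemma Hol_scale r c f g : Hol r f g -> Hol r (fun z => c * f z) (fun z => c * g z).
Proof.
move=> H e e0; have d0 : 0 < cm c + 1 by have := cm_ge0 c; lra.
have [p Hp] := H _ (divr_gt0 e0 d0); exists (c *: p) => z zr; have [h1 h2] := Hp z zr.
rewrite derivZ !hornerZ -!mulrBr !cmM.
have E (y : R) : 0 <= y -> y <= e / (cm c + 1) -> cm c * y <= e.
  move=> y0 hy; apply: (@le_trans _ _ ((cm c + 1) * y)); first by rewrite ler_wpM2r // lerDl.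
  by rewrite mulrC -ler_pdivlMr.
by split; apply: E; rewrite ?cm_ge0.
Qed.

Lemma Hol_sum r (F G : nat -> C -> C) m n : (forall k, Hol r (F k) (G k)) ->
  Hol r (fun z => \sum_(m <= k < n) F k z) (fun z => \sum_(m <= k < n) G k z).
Proof.
move=> H; elim: (index_iota m n) => [|k s IH].
  have E (D : nat -> C -> C) : (fun z => \sum_(k <- [::]) D k z) = fun=> 0.
    by apply: funext => z; rewrite big_nil.
  by rewrite !E; exact: Hol_const.
have E (D : nat -> C -> C) : (fun z => \sum_(j <- k :: s) D j z) = fun z => D k z + \sum_(j <- s) D j z.
  by apply: funext => z; rewrite big_cons.
by rewrite !E; exact: Hol_add.
Qed.

Lemma big_nat_ex (x : R) : exists M : nat, x <= M.+1%:R.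
Proof.
exists (Num.truncn x).
have [x0|x0] := leP 0 x; first by have /andP[_ /ltW] := truncn_itv x0.
by apply: (le_trans (ltW x0)); rewrite ler0n.
Qed.

(** The polynomials (1 + l z / (M+1))^(M+1) converge together with their derivatives, which differ
    from l times the polynomial only by one missing factor 1 + O(1/M). *)
Lemma Hol_exp r (l : C) : 0 <= r -> Hol r (fun z => cexp (l * z)) (fun z => l * cexp (l * z)).
Proof.
move=> r0 e e0; set B := cm l * r.
have B0 : 0 <= B by rewrite mulr_ge0 ?cm_ge0.
have l0 := cm_ge0 l; have eB := expR_gt0 B.
pose K := 4 * B ^+ 2 * expR B.
have K0 : 0 <= K by rewrite !mulr_ge0 ?sqr_ge0 // ltW.
pose K2 := K + cm l * K + cm l * (expR B * B).
have K20 : 0 <= K2 by rewrite /K2 !addr_ge0 // !mulr_ge0 // ltW.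
have [M HM] := big_nat_ex (B + K2 / e).
set m : R := M.+1%:R in HM; have m0 : 0 < m by rewrite ltr0n.
have Bm : B <= m by have := divr_ge0 K20 (ltW e0); lra.
have Km : K2 / m <= e.
  rewrite ler_pdivrMr // mulrC -ler_pdivrMr //; lra.
pose q : {poly C} := 1 + (M.+1%:R^-1 * l) *: 'X.
have qz z : q.[z] = 1 + M.+1%:R^-1 * (l * z) by rewrite /q !hornerE ?mulrA.
have dq : q^`() = (M.+1%:R^-1 * l)%:P.
  by rewrite /q derivD derivZ derivX -[1]/(1%:P) derivC add0r -mul_polyC mulr1.
exists (q ^+ M.+1) => z zr.
have lz : cm (l * z) <= B by rewrite cmM ler_wpM2l.
have lzm : cm (l * z) <= m by apply: le_trans Bm.
have A1 : cm ((1 + M.+1%:R^-1 * (l * z)) ^+ M.+1 - cexp (l * z)) <= K / m.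
  rewrite cmB; apply: (le_trans (cexp_limit lzm)); rewrite ler_pM2r ?invr_gt0 //.
  apply: ler_pM; rewrite ?expR_ge0 ?mulr_ge0 ?sqr_ge0 ?cm_ge0 //; last by rewrite ler_expR.
  by rewrite ler_pM2l // lerXn2r ?nnegrE ?cm_ge0.
have E : K2 / m = K / m + cm l * (K / m) + cm l * (expR B * B / m).
  by rewrite /K2; field; exact: lt0r_neq0.
have p1 : 0 <= cm l * (K / m) by rewrite mulr_ge0 // divr_ge0 // ltW.
have p2 : 0 <= cm l * (expR B * B / m) by rewrite mulr_ge0 // divr_ge0 ?mulr_ge0 // ltW.
have p3 : 0 <= K / m by rewrite divr_ge0 // ltW.
split.
  rewrite horner_exp qz; apply: (le_trans A1); apply: le_trans Km.
  by rewrite E -addrA lerDl addr_ge0.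
rewrite deriv_exp dq /= hornerMn hornerM hornerC horner_exp qz.
set h := M.+1%:R^-1 * (l * z).
have mC : (M.+1%:R : C) != 0 by rewrite pnatr_eq0.
have -> : M.+1%:R^-1 * l * (1 + h) ^+ M *+ M.+1 = l * (1 + h) ^+ M.
  by rewrite -mulr_natl !mulrA mulfV // mul1r.
have -> : l * (1 + h) ^+ M - l * cexp (l * z) =
   l * ((1 + h) ^+ M.+1 - cexp (l * z)) - l * ((1 + h) ^+ M * h) by rewrite exprS; ring.
have hB : cm h <= B / m by rewrite /h cmM cmV cm_nat mulrC ler_pM2r ?invr_gt0.
apply: (le_trans (cm_subD _ _)); rewrite 2!(cmM l) (cmM _ h).
have : cm l * cm ((1 + h) ^+ M.+1 - cexp (l * z)) <= cm l * (K / m) by rewrite ler_wpM2l.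
have : cm l * (cm ((1 + h) ^+ M) * cm h) <= cm l * (expR B * B / m).
  rewrite ler_wpM2l // -mulrA; apply: ler_pM; rewrite ?cm_ge0 // cmX.
  have h1 : cm (1 + h) <= expR (B / m).
    by apply: (le_trans (cm_D _ _)); rewrite cm1; apply: (le_trans (expR_ge1Dx _)); rewrite ler_expR.
  apply: (@le_trans _ _ (expR (B / m) ^+ M)); first by rewrite lerXn2r ?nnegrE ?cm_ge0 ?expR_ge0.
  rewrite -expRM_natl ler_expR mulrA ler_pdivrMr // mulrC ler_wpM2l //.
  by rewrite ler_nat.
move=> hY hX; apply: le_trans Km; rewrite E; apply: (le_trans (lerD hX hY)).
by rewrite lerD2r lerDr.
Qed.

Lemma C1_horner (q : {poly C}) : C1 (fun t => q.[t%:C]) (fun t => q^`().[t%:C]).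
Proof.
have := @C1_sum R (size q) (fun k t => q`_k * (t%:C * 1) ^+ k)
   (fun k t => q`_k * (k%:R * 1 * (t%:C * 1) ^+ k.-1)) (fun k => C1_scale _ (C1_pow k 1)).
congr C1; apply: funext => t.
  by rewrite horner_coef; apply: eq_bigr => k _; rewrite mulr1.
rewrite -[q in RHS]coefK poly_def raddf_sum /= horner_sum; apply: eq_bigr => k _.
by rewrite derivZ derivXn hornerZ hornerMn hornerXn !mulr1 mulr_natl.
Qed.

(** The segment from w to z stays in the disc by convexity, and the mean value inequality is applied
    along it. *)
Lemma poly_lip (p : {poly C}) r B z w : (forall z, cm z <= r -> cm p^`().[z] <= B) ->
  cm z <= r -> cm w <= r -> cm (p.[z] - p.[w]) <= B * cm (z - w).
Proof.
move=> HB zr wr; pose q := p \Po (w%:P + (z - w) *: 'X).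
have Eq (t : C) : q.[t] = p.[w + (z - w) * t] by rewrite /q horner_comp !hornerE.
have Edq (t : C) : q^`().[t] = p^`().[w + (z - w) * t] * (z - w).
  have dq : (w%:P + (z - w) *: 'X)^`() = (z - w)%:P.
    by rewrite derivD derivC add0r derivZ derivX -mul_polyC mulr1.
  by rewrite /q deriv_comp dq hornerM hornerC horner_comp !hornerE.
have := mean_value_C1 (B := B * cm (z - w)) (C1_horner q).
have E1 : w + (z - w) = z by ring.
rewrite !Eq mulr1 mulr0 addr0 E1; apply => t /andP[t0 t1].
rewrite Edq cmM ler_wpM2r ?cm_ge0 //; apply: HB.
have -> : w + (z - w) * t%:C = (1 - t)%:C * w + t%:C * z by rewrite rmorphB; ring.
apply: (le_trans (cm_D _ _)); rewrite !cmM !cm_real !ger0_norm //; last lra.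
nra.
Qed.

Lemma Hol_lip r f g : 0 <= r -> Hol r f g -> exists K, 0 <= K /\
  forall z w, cm z <= r -> cm w <= r -> cm (f z - f w) <= K * cm (z - w).
Proof.
move=> r0 H; have [M [M0 HM]] := Hol_bound r0 H.
exists (M + 1); split; first lra.
move=> z w zr wr; apply/ler_addgt0Pr => e e0.
pose e1 := Num.min 1 (e / 2); have e10 : 0 < e1 by rewrite lt_min ltr01; lra.
have e11 : e1 <= 1 by rewrite ge_min lexx.
have e12 : e1 <= e / 2 by rewrite ge_min lexx orbT.
have [p Hp] := H _ e10.
have HB v : cm v <= r -> cm p^`().[v] <= M + 1.
  by move=> vr; have [_ h] := Hp v vr; have [_ h2] := HM v vr; have := cm_rev p^`().[v] (g v); lra.
have := poly_lip HB zr wr => L.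
have [h1 _] := Hp z zr; have [h2 _] := Hp w wr.
have := cm_tri (f z) (f w) p.[z]; have := cm_tri p.[z] (f w) p.[w]; rewrite (cmB (f z) p.[z]); lra.
Qed.

Local Ltac drop := clear -R.

(** A compactness argument: the extreme value theorem is applied to the points of the plane written
    as row vectors. Closedness of Z is given as openness of its complement in terms of [cm], the
    form in which it can be checked for half-planes. *)
Lemma disc_min f r K : 0 <= r -> (forall z w, cm z <= r -> cm w <= r -> cm (f z - f w) <= K * cm (z - w)) ->
  forall Z : set C, (forall z, ~ Z z -> exists d, 0 < d /\ forall w, cm (w - z) < d -> ~ Z w) ->
  (forall z, cm z <= r -> Z z -> f z != 0) ->
  exists d, 0 < d /\ forall z, cm z <= r -> Z z -> d <= cm (f z).
Proof.
move=> r0 lip Z Zc nz.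
pose tc (v : 'rV[R]_2) : C := v ord0 ord0 +i* v ord0 ord_max.
pose A : set 'rV[R]_2 := [set v | cm (tc v) <= r /\ Z (tc v)].
have [A0|A0] := pselect (A !=set0); last first.
  exists 1; split => // z zr Zz; exfalso; apply: A0.
  exists (\row_(j < 2) (if j == ord0 then complex.Re z else complex.Im z)).
  have E : tc (\row_j (if j == ord0 then complex.Re z else complex.Im z)) = z.
    by apply: complex_eq; rewrite /tc /= mxE.
  by rewrite /A /= E.
have tcD (v w : 'rV[R]_2) (e : R) : ball v e w -> cm (tc w - tc v) < 2 * e.
  move=> [e0 Hb]; have h1 := Hb ord0 ord0; have h2 := Hb ord0 ord_max.
  apply: (le_lt_trans (cm_le_ReIm _)).
  have -> : 2 * e = e + e by ring.
  by rewrite ltrD //= distrC.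
have cA : compact A.
  apply: bounded_closed_compact.
    exists r; split; first exact: num_real.
    move=> M rM v [vr _] /=; rewrite [leLHS](_ : _ = mx_norm v) // mx_normrE.
    apply/bigmax_leP; split => /=; first exact: (le_trans r0 (ltW rM)).
    move=> [i j] _ /=; rewrite (ord1 i).
    have := cm_Re (tc v); have := cm_Im (tc v) => /= h1 h2.
    have [->|->] : j = ord0 \/ j = ord_max.
    - by case: j => [[|[|j]] Hj] //; [left|right]; apply: val_inj.
    - by apply: (le_trans h2); apply: (le_trans vr); exact: ltW.
    by apply: (le_trans h1); apply: (le_trans vr); exact: ltW.
  rewrite closedE => v Hv; apply: contrapT => nA; apply: Hv.
  apply/nbhs_ballP.
  have [vr|vr] := leP (cm (tc v)) r.
    have nZ : ~ Z (tc v) by move=> Zv; apply: nA.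
    have [d [d0 Hd]] := Zc _ nZ; exists (d / 2) => /=; first lra.
    by move=> w /tcD; rewrite mulrC divfK // => h [_ Zw]; apply: (Hd _ h).
  exists ((cm (tc v) - r) / 2) => /=; first lra.
  move=> w /tcD; rewrite mulrC divfK // => h [h2 _].
  by have := cm_rev (tc v) (tc w); rewrite cmB; lra.
have [|c /set_mem [cr cZ] Hc] := @EVT_min_rV R 2 (fun v => cm (f (tc v))) A A0 cA.
  apply/subspace_continuousP => v [vr vZ]; apply/cvgrPdist_le => e e0.
  have k0 : 0 < 2 * (`|K| + 1) by have := normr_ge0 K; lra.
  rewrite near_withinE; apply/nbhs_ballP; exists (e / (2 * (`|K| + 1))) => /=; first exact: divr_gt0.
  move=> w /tcD h [wr wZ].
  have L := lip _ _ vr wr.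
  apply: (@le_trans _ _ (cm (f (tc v) - f (tc w)))).
    by rewrite ler_norml lerBlDr; have := cm_rev (f (tc v)) (f (tc w)); have := cm_rev (f (tc w)) (f (tc v)); rewrite (cmB (f (tc w))); (drop; lra).
  apply: (le_trans L); rewrite cmB.
  apply: (@le_trans _ _ ((`|K| + 1) * cm (tc w - tc v))).
    by rewrite ler_wpM2r ?cm_ge0 //; have := ler_norm K; (drop; lra).
  have k1 : 0 < `|K| + 1 by have := normr_ge0 K; (drop; lra).
  rewrite mulrC -ler_pdivlMr //; apply: (le_trans (ltW h)); apply: le_eq; field; exact: lt0r_neq0.
exists (cm (f (tc c))); split; first by rewrite cm_gt0 nz.
move=> z zr Zz.
have E : tc (\row_j (if j == ord0 then complex.Re z else complex.Im z)) = z.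
  by apply: complex_eq; rewrite /tc /= mxE.
by have := Hc (\row_j (if j == ord0 then complex.Re z else complex.Im z)); rewrite E; apply; apply/mem_set; rewrite /A /= E.
Qed.

Lemma quot_close (f g p q : C) (d B e : R) : 0 < d -> d <= cm f -> d <= cm p -> cm f <= B -> cm g <= B ->
  cm (p - f) <= e -> cm (q - g) <= e -> cm (q / p - g / f) <= 2 * B * e / d ^+ 2.
Proof.
move=> d0 df dp fB gB h1 h2.
have f0 : f != 0 by rewrite -cm_gt0 (lt_le_trans d0).
have p0 : p != 0 by rewrite -cm_gt0 (lt_le_trans d0).
have -> : q / p - g / f = (f * (q - g) - g * (p - f)) / (p * f) by field; rewrite f0 p0.
rewrite cmM cmV cmM; apply: ler_pM; rewrite ?cm_ge0 ?invr_ge0 ?mulr_ge0 ?cm_ge0 //.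
  apply: (le_trans (cm_subD _ _)); rewrite !cmM.
  have : cm f * cm (q - g) <= B * e by rewrite ler_pM ?cm_ge0.
  have : cm g * cm (p - f) <= B * e by rewrite ler_pM ?cm_ge0.
  lra.
rewrite lef_pV2 ?posrE ?exprn_gt0 // ?mulr_gt0 //; [|exact: lt_le_trans dp|exact: lt_le_trans df].
by rewrite expr2 ler_pM // ltW.
Qed.

Lemma Hol_approx r f g d (e : R) : 0 <= r -> Hol r f g -> 0 < d -> 0 < e ->
  exists p : {poly C}, forall z, cm z <= r -> cm (p.[z] - f z) <= d / 2 /\
    (d <= cm (f z) -> cm (p^`().[z] / p.[z] - g z / f z) <= e).
Proof.
move=> r0 H d0 e0; have [M [M0 HM]] := Hol_bound r0 H.
pose e1 := Num.min (d / 2) (e * (d / 2) ^+ 2 / (2 * (M + 1))).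
have d2 : 0 < d / 2 by lra.
have M1 : 0 < 2 * (M + 1) by lra.
have e10 : 0 < e1 by rewrite lt_min d2 /= divr_gt0 // mulr_gt0 // exprn_gt0.
have [p Hp] := H _ e10; exists p => z zr; have [h1 h2] := Hp z zr; have [h3 h4] := HM z zr.
have ed : e1 <= d / 2 by rewrite ge_min lexx.
split; first exact: (le_trans h1).
move=> fd.
have f2 : d / 2 <= cm (f z) by lra.
have p2 : d / 2 <= cm p.[z] by have := cm_rev (f z) p.[z]; rewrite cmB; lra.
have h5 : cm (f z) <= M + 1 by lra.
have h6 : cm (g z) <= M + 1 by (move: h4; drop; lra).
apply: (le_trans (quot_close d2 f2 p2 h5 h6 h1 h2)).
rewrite ler_pdivrMr ?exprn_gt0 // mulrC -ler_pdivlMr // ge_min lexx orbT //.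
Qed.

(** The bounds pass from an approximating polynomial p to f. The 4 arises because p may reach 2 M on
    the circle while |p(0)| may drop to about |f(0)| / 2. *)
Lemma Hol_BC r f g M : 0 < r -> Hol r f g -> (forall z, cm z <= r -> f z != 0 /\ cm (f z) <= M) ->
  [/\ 0 <= ln (4 * M / cm (f 0)),
  forall z, cm z < r -> cm (g z / f z) <= 2 * ln (4 * M / cm (f 0)) * r / (r - cm z) ^+ 2 &
  forall z, cm z < r -> cm (f 0) / 4 * expR (- (2 * ln (4 * M / cm (f 0)) * cm z / (r - cm z))) <= cm (f z)].
Proof.
move=> r0 H Hf; have r0' := ltW r0.
have [K [K0 lip]] := Hol_lip r0' H.
have [|z zr _|d [d0 Hd]] := @disc_min f r K r0' lip setT; first by move=> z; case.
  by have [] := Hf z zr.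
have z0 : cm (0 : C) <= r by rewrite cm0.
have [f0 fM] := Hf 0 z0; have cf0 : 0 < cm (f 0) by rewrite cm_gt0.
have dd := Hd 0 z0 I.
have key e : 0 < e -> exists p : {poly C}, [/\ forall z, cm z <= r -> p.[z] != 0,
   0 <= ln (2 * M / cm p.[0]) /\ ln (2 * M / cm p.[0]) <= ln (4 * M / cm (f 0)),
   forall z, cm z < r -> cm (p^`().[z] / p.[z]) <= 2 * ln (2 * M / cm p.[0]) * r / (r - cm z) ^+ 2,
   forall z, cm z < r -> cm p.[0] * expR (- (2 * ln (2 * M / cm p.[0]) * cm z / (r - cm z))) <= cm p.[z] &
   forall z, cm z <= r -> cm (p^`().[z] / p.[z] - g z / f z) <= e /\ cm (p.[z] - f z) <= cm (f z) / 2].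
  move=> e0; have [p Hp] := Hol_approx r0' H d0 e0; exists p.
  have pf z : cm z <= r -> cm (p.[z] - f z) <= cm (f z) / 2.
    by move=> zr; have [h _] := Hp z zr; have := Hd z zr I; (move: h; drop; lra).
  have pz z : cm z <= r -> p.[z] != 0.
    move=> zr; rewrite -cm_gt0; have := pf z zr; have := cm_rev (f z) p.[z]; rewrite cmB.
    by have := Hd z zr I; (move: d0; drop; lra).
  have pM z : cm z = r -> cm p.[z] <= 2 * M.
    move=> zr; have zr' : cm z <= r by rewrite zr.
    have := pf z zr'; have := cm_rev p.[z] (f z); have [_] := Hf z zr'.
    by have := Hd z zr' I; (move: d0; drop; lra).
  have [A0 h1 h2] := BC_logderiv r0 pz pM.
  split => //; last by move=> z zr; split; [have [_] := Hp z zr; apply; exact: Hd|exact: pf].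
  split => //; have p0 : 0 < cm p.[0] by rewrite cm_gt0 pz.
  rewrite ler_ln ?posrE ?divr_gt0 ?mulr_gt0 //; [|(move: fM cf0; drop; lra)|(move: fM cf0; drop; lra)].
  rewrite ler_pdivrMr //; have := pf 0 z0; have := cm_rev (f 0) p.[0]; rewrite cmB => a1 a2.
  have -> : 4 * M / cm (f 0) * cm p.[0] = 2 * M * (2 * cm p.[0] / cm (f 0)) by ring.
  by rewrite ler_peMr ?ler_pdivlMr //; (move: fM cf0 a1 a2; drop; lra).
have [p1 [_ [A1 A2] _ _ _]] := key 1 ltr01.
split; first exact: le_trans A2.
  move=> z zr; apply/ler_addgt0Pr => e e0; have [p [_ [B1 B2] h1 _ h2]] := key e e0.
  have [h3 _] := h2 z (ltW zr); have h4 := h1 z zr.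
  have := cm_rev (g z / f z) (p^`().[z] / p.[z]); rewrite cmB => h5.
  suff : 2 * ln (2 * M / cm p.[0]) * r / (r - cm z) ^+ 2 <= 2 * ln (4 * M / cm (f 0)) * r / (r - cm z) ^+ 2 by (move: h3 h4 h5; drop; lra).
  by rewrite ler_pM2r ?invr_gt0 ?exprn_gt0 ?subr_gt0 // ler_pM2r // ler_pM2l.
move=> z zr; have [p [_ [B1 B2] _ h1 h2]] := key 1 ltr01.
have [_ h3] := h2 z (ltW zr); have h4 := h1 z zr; have [_ h5] := h2 0 z0.
have := cm_rev p.[z] (f z); have := cm_rev (f 0) p.[0]; rewrite (cmB (f 0)) => h6 h7.
apply: (@le_trans _ _ (2^-1 * (cm (f 0) / 2 * expR (- (2 * ln (4 * M / cm (f 0)) * cm z / (r - cm z)))))).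
  by apply: le_eq; rewrite [RHS]mulrA; congr (_ * _); field.
apply: (@le_trans _ _ (2^-1 * cm p.[z])); last by have := cm_ge0 p.[z]; (move: h3 h7; drop; lra).
rewrite ler_pM2l ?invr_gt0 //; apply: le_trans h4; apply: ler_pM; rewrite ?expR_ge0 //; [(move: cf0; drop; lra)|(move: h5 h6; drop; lra)|].
by rewrite ler_expR lerN2 ler_pM2r ?invr_gt0 ?subr_gt0 // ler_wpM2r ?cm_ge0 // ler_pM2l.
Qed.

(** The list [rs] consists of zeros of a polynomial close to f. They avoid Z because |f| >= d on Z
    and the polynomial is within d / 2 of f. The function f may vanish outside Z. *)
Lemma Hol_local Rad f g M d (Z : set C) : 0 < Rad -> Hol Rad f g -> (forall z, cm z <= Rad -> cm (f z) <= M) ->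
  f 0 != 0 -> 0 < d -> (forall z, cm z <= Rad -> Z z -> d <= cm (f z)) ->
  exists rs : seq C, [/\ (size rs)%:R <= 2 * ln (4 * M / cm (f 0)),
    forall a, a \in rs -> ~ Z a /\ cm a <= Rad / 4 &
    forall z, cm z <= Rad / 16 -> Z z ->
      cm (g z / f z - \sum_(a <- rs) (z - a)^-1) <= 64 * ln (4 * M / cm (f 0)) / Rad + 1].
Proof.
move=> R0 H Hf f0 d0 Hd; have R0' := ltW R0.
have z0 : cm (0 : C) <= Rad by rewrite cm0.
have cf0 : 0 < cm (f 0) by rewrite cm_gt0.
pose d' := Num.min d (cm (f 0)).
have d'0 : 0 < d' by rewrite lt_min d0.
have dd : d' <= d by rewrite ge_min lexx.
have df : d' <= cm (f 0) by rewrite ge_min lexx orbT.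
have [p Hp] := Hol_approx R0' H d'0 ltr01.
have M0 := lt_le_trans cf0 (Hf 0 z0).
have pM z : cm z <= Rad -> cm p.[z] <= 2 * M.
  move=> zr; have [h _] := Hp z zr; have := cm_rev p.[z] (f z); have := Hf z zr; have := Hf 0 z0; (move: cf0 df h; drop; lra).
have [h0 _] := Hp 0 z0; have p0' : cm (f 0) / 2 <= cm p.[0].
  by have := cm_rev (f 0) p.[0]; rewrite cmB; (move: df h0; drop; lra).
have p0 : 0 < cm p.[0] by (move: d'0 df p0'; drop; lra).
have pn0 : p.[0] != 0 by rewrite -cm_gt0.
have [rs [s1 s2 s3]] := local_zeros R0 pM pn0.
have AA : ln (2 * M / cm p.[0]) <= ln (4 * M / cm (f 0)).
  rewrite ler_ln ?posrE ?divr_gt0 ?mulr_gt0 // ler_pdivrMr //.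
  have -> : 4 * M / cm (f 0) * cm p.[0] = 2 * M * (2 * cm p.[0] / cm (f 0)) by ring.
  by rewrite ler_peMr ?ler_pdivlMr //; (move: M0 p0'; drop; lra).
exists rs; split; first (move: s1 AA; drop; lra).
  move=> a /s2 [pa ca]; split => // Za; have ca' : cm a <= Rad by (move: R0 ca; drop; lra).
  have [h _] := Hp a ca'; have := Hd a ca' Za; move: h; rewrite pa sub0r cmN; (move: d'0 dd; drop; lra).
move=> z zr Zz; have zr' : cm z <= Rad by (move: R0 zr; drop; lra).
have fz := Hd z zr' Zz; have [h1 h2] := Hp z zr'.
have pz : p.[z] != 0 by rewrite -cm_gt0; have := cm_rev (f z) p.[z]; rewrite cmB; (move: d'0 dd fz h1; drop; lra).
have h3 := s3 z zr pz; have h4 := h2 (le_trans dd fz).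
apply: (le_trans (cm_tri _ _ (p^`().[z] / p.[z]))); rewrite cmB addrC; apply: lerD => //.
apply: (le_trans h3); rewrite ler_pM2r ?invr_gt0 //; (move: AA; drop; lra).
Qed.

End Holo.

(** * Powers n^(-s) and elementary sums over integers *)

Section Pow.
Variable R : realType.
Local Notation C := R[i].
Implicit Types (s z : C) (x y t e : R).

(* n^(-t); [npw 0 t = 1] since [ln 0 = 0]. *)
Definition npw (n : nat) t : R := expR (- (t * ln (n%:R : R))).

Lemma npw_gt0 n t : 0 < npw n t. Proof. exact: expR_gt0. Qed.

Lemma npw_ge0 n t : 0 <= npw n t. Proof. exact: expR_ge0. Qed.

Lemma npw1 t : npw 1 t = 1. Proof. by rewrite /npw ln1 mulr0 oppr0 expR0. Qed.

Lemma npwD n t u : npw n (t + u) = npw n t * npw n u.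
Proof. by rewrite /npw -expRD; congr expR; ring. Qed.

Lemma npw_inv n : (0 < n)%N -> npw n 1 = n%:R^-1.
Proof. by move=> n0; rewrite /npw mul1r expRN lnK // posrE ltr0n. Qed.

Lemma npw_sq n : (0 < n)%N -> npw n 2 = n%:R^-1 ^+ 2.
Proof. by move=> n0; have -> : 2 = 1 + 1 :> R by []; rewrite npwD npw_inv // expr2. Qed.

Lemma ln_nat_ge0 n : 0 <= ln (n%:R : R).
Proof.
case: n => [|n]; first by rewrite ln0.
by rewrite ln_ge0 // ler1n.
Qed.

Lemma npw_le n t u : t <= u -> npw n u <= npw n t.
Proof. by move=> tu; rewrite /npw ler_expR lerN2 ler_wpM2r // ln_nat_ge0. Qed.

Lemma npw_le1 n t : 0 <= t -> npw n t <= 1.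
Proof. by move=> t0; rewrite /npw expR_le1 oppr_le0 mulr_ge0 // ln_nat_ge0. Qed.

Lemma npw_anti n m t : 0 <= t -> (0 < n)%N -> (n <= m)%N -> npw m t <= npw n t.
Proof.
move=> t0 n0 nm; rewrite /npw ler_expR lerN2 ler_wpM2l // ler_ln ?posrE ?ltr0n ?ler_nat //.
exact: leq_trans nm.
Qed.

Lemma npw_small t e : 0 < t -> 0 < e -> exists N0 : nat, forall N, (N0 <= N)%N -> npw N t <= e.
Proof.
move=> t0 e0; have [M HM] := big_nat_ex (expR (- ln e / t)).
exists M.+1 => N MN; rewrite /npw -[leRHS]lnK ?posrE // ler_expR.
have N0 : 0 < N%:R :> R by rewrite ltr0n (leq_trans _ MN).
have : - ln e / t <= ln N%:R.
  by rewrite -[leLHS]expRK ler_ln ?posrE ?expR_gt0 //; apply: (le_trans HM); rewrite ler_nat.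
rewrite ler_pdivrMr // => H; lra.
Qed.

Lemma ln_le_npw n t : 0 < t -> ln (n%:R : R) <= t^-1 * npw n (- t).
Proof.
move=> t0; rewrite ler_pdivlMl // /npw mulNr opprK; have := expR_ge1Dx (t * ln (n%:R : R)); lra.
Qed.

Lemma ln_succ_le n : (0 < n)%N -> ln (n.+1%:R : R) - ln n%:R <= n%:R^-1.
Proof.
move=> n0; have p : 0 < n%:R :> R by rewrite ltr0n.
rewrite -ln_div ?posrE ?ltr0n //.
have -> : n.+1%:R / n%:R = 1 + n%:R^-1 :> R by rewrite -natr1; field; exact: lt0r_neq0.
have i0 : 0 < n%:R^-1 :> R by rewrite invr_gt0.
by apply: le_ln1Dx; lra.
Qed.

Lemma ln_succ_ge n : (0 < n)%N -> n.+1%:R^-1 <= ln (n.+1%:R : R) - ln n%:R.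
Proof.
move=> n0; have p : 0 < n%:R :> R by rewrite ltr0n.
have p1 : 0 < n.+1%:R :> R by rewrite ltr0n.
have -> : ln (n.+1%:R : R) - ln n%:R = - (ln n%:R - ln n.+1%:R) by ring.
rewrite -ln_div ?posrE //.
have -> : n%:R / n.+1%:R = 1 + - n.+1%:R^-1 :> R by rewrite -natr1; field; rewrite natr1 lt0r_neq0.
have : ln (1 + - n.+1%:R^-1 : R) <= - n.+1%:R^-1.
  apply: le_ln1Dx; rewrite ltrN2 invf_lt1 // ltr1n; lia.
by move=> h; rewrite lerNr.
Qed.

(** The discrete substitute for comparing a sum of n^(-1-t) with an integral: the right-hand sides
    telescope. *)
Lemma npw_tail_step n t : 0 < t -> (0 < n)%N -> t * npw n.+1 (1 + t) <= npw n t - npw n.+1 t.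
Proof.
move=> t0 n0; rewrite npwD npw_inv //.
have -> : npw n t = npw n.+1 t * expR (t * (ln n.+1%:R - ln n%:R)).
  by rewrite /npw -expRD; congr expR; ring.
have := expR_ge1Dx (t * (ln (n.+1%:R : R) - ln n%:R)).
have := ln_succ_ge n0; have := npw_gt0 n.+1 t.
set w := npw _ _; set l := ln _ - ln _; set E := expR _; set v := n.+1%:R^-1 => w0 vl E1.
have : t * v <= t * l by rewrite ler_wpM2l // ltW.
move=> h; have : w * (t * v) <= w * (E - 1) by rewrite ler_wpM2l ?(ltW w0) //; lra.
lra.
Qed.

Lemma npw_tail t N M : 0 < t -> (0 < N)%N ->
  \sum_(N <= n < M) npw n (1 + t) <= (1 + t^-1) * npw N t.
Proof.
move=> t0 N0; have ti : 0 < t^-1 by rewrite invr_gt0.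
have [NM|MN] := leqP N M; last first.
  by rewrite big_geq ?(ltnW MN) // mulr_ge0 ?npw_ge0 //; lra.
suff H : forall k, \sum_(N <= n < N + k.+1) npw n (1 + t) <= npw N (1 + t) + t^-1 * (npw N t - npw (N + k) t).
  have H2 : npw N (1 + t) <= npw N t by rewrite npw_le //; lra.
  move: NM; rewrite leq_eqVlt => /orP[/eqP <-|NM].
    by rewrite big_geq // mulr_ge0 ?npw_ge0 //; lra.
  have -> : M = (N + (M - N).-1.+1)%N by lia.
  apply: (le_trans (H _)); rewrite mulrDl mul1r; apply: lerD => //.
  by rewrite ler_wpM2l ?(ltW ti) // gerBl npw_ge0.
elim=> [|k IH]; first by rewrite addn0 subrr mulr0 addr0 addn1 big_nat1.
rewrite !addnS in IH *; rewrite big_nat_recr /=; last by lia.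
have := @npw_tail_step (N + k) t t0 (leq_trans N0 (leq_addr _ _)).
rewrite -ler_pdivlMl // => h; lra.
Qed.

(** What counts is that the bound is less than 1: it keeps L away from 0 in [L_lower]. The terms 1/4
    and 1/9 are computed, the rest is compared with a telescoping sum. *)
Lemma sum_inv_sq M : \sum_(2 <= n < M) npw n (2:R) <= 7 / 10.
Proof.
have H k : \sum_(2 <= n < k + 4) npw n (2:R) <= 7/10 - (k + 3)%:R^-1.
  elim: k => [|k IH].
    rewrite 2?big_nat_recl // big_geq // !npw_sq //.
    have -> : (0 + 3)%:R = 3 :> R by []. lra.
  rewrite addSn (big_nat_recr (k + 4)) /=; last by lia.
  apply: (le_trans (lerD IH (lexx _))).
  rewrite npw_sq; last by lia.
  have -> : (k.+1 + 3 = (k + 3).+1)%N by [].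
  have a0 : 0 < (k + 3)%:R :> R by rewrite ltr0n addn3.
  have -> : (k + 4)%:R = (k + 3)%:R + 1 :> R by rewrite natr1 addnS.
  have -> : (k + 3).+1%:R = (k + 3)%:R + 1 :> R by rewrite natr1.
  set a := (k + 3)%:R in a0 *.
  have b0 : 0 < a + 1 by lra.
  have : (a + 1)^-1 ^+ 2 <= a^-1 - (a + 1)^-1.
    have -> : a^-1 - (a + 1)^-1 = (a * (a + 1))^-1 by field; rewrite !lt0r_neq0.
    rewrite exprVn lef_pV2 ?posrE ?exprn_gt0 ?mulr_gt0 // expr2 ler_pM2r //; lra.
  lra.
apply: (@le_trans _ _ (\sum_(2 <= n < M + 4) npw n 2)); last first.
  apply: (le_trans (H M)); have : 0 <= (M + 3)%:R^-1 :> R by rewrite invr_ge0.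
  lra.
have [M2|M2] := leqP M 2.
  by rewrite big_geq // sumr_ge0 // => i _; exact: npw_ge0.
rewrite [leRHS](big_cat_nat (n := M)) ?leq_addr ?(ltnW M2) //= lerDl.
by apply: sumr_ge0 => i _; exact: npw_ge0.
Qed.

Lemma npow_negE n s : npow_neg n s = cexp (- (s * (ln n%:R)%:C)).
Proof.
apply: complex_eq; rewrite /npow_neg /cexp /= reN imN (mulrC s) reMr imMr.
  by rewrite cosN; congr (expR _ * cos _); ring.
by rewrite sinN mulrN; congr (- (expR _ * sin _)); ring.
Qed.

Lemma cm_npow n s : cm (npow_neg n s) = npw n (complex.Re s).
Proof. by rewrite npow_negE cm_cexp reN (mulrC s) reMr /npw; congr expR; ring. Qed.

Lemma npow1 s : npow_neg 1 s = 1.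
Proof. by rewrite npow_negE ln1 mulr0 oppr0 cexp0. Qed.

Lemma npowM n m s : (0 < n)%N -> (0 < m)%N -> npow_neg (n * m) s = npow_neg n s * npow_neg m s.
Proof.
move=> n0 m0; rewrite !npow_negE -cexpD; congr cexp.
by rewrite natrM lnM ?posrE ?ltr0n // rmorphD; ring.
Qed.

Lemma npowD n s z : npow_neg n (s + z) = npow_neg n s * npow_neg n z.
Proof. by rewrite !npow_negE -cexpD; congr cexp; ring. Qed.

Lemma npow_diff n s : (0 < n)%N -> 0 <= complex.Re s ->
  cm (npow_neg n.+1 s - npow_neg n s) <= 5 * cm s * npw n (1 + complex.Re s).
Proof.
move=> n0 s0; rewrite cmB.
have -> : npow_neg n s - npow_neg n.+1 s = npow_neg n s * (1 - cexp (- (s * (ln n.+1%:R - ln n%:R)%:C))).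
  by rewrite mulrBr mulr1 !npow_negE -cexpD; congr (_ - cexp _); rewrite rmorphB; ring.
rewrite cmM cm_npow npwD npw_inv //.
have l0 : 0 <= ln (n.+1%:R : R) - ln n%:R.
  by apply: le_trans (ln_succ_ge n0); rewrite invr_ge0.
have h1 : 0 <= complex.Re (s * (ln n.+1%:R - ln n%:R)%:C) by rewrite mulrC reMr mulr_ge0.
have := cexp_sub1_neg h1; rewrite cmM cm_real (ger0_norm l0) => h2.
have h3 : 5 * (cm s * (ln (n.+1%:R : R) - ln n%:R)) <= 5 * (cm s * n%:R^-1).
  by rewrite ler_pM2l // ler_wpM2l ?cm_ge0 // ln_succ_le.
have := ler_wpM2l (npw_ge0 n (complex.Re s)) (le_trans h2 h3) => /le_trans; apply.
apply: le_eq; ring.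
Qed.

End Pow.

(** * Dirichlet series with periodic coefficients *)

Section Periodic.
Variable R : realType.
Local Notation C := R[i].
Variables (q : nat) (psi : nat -> C).
Hypothesis q0 : (0 < q)%N.
Hypothesis psiq : forall n, psi (n + q)%N = psi n.
Hypothesis psi1 : forall n, cm (psi n) <= 1.
Hypothesis psi0 : \sum_(k < q) psi k = 0.

Lemma period_sum N : \sum_(N <= n < N + q) psi n = 0.
Proof.
elim: N => [|N IH]; first by rewrite add0n big_mkord.
have : \sum_(N <= n < (N + q).+1) psi n = 0 + psi N by rewrite big_nat_recr ?leq_addr //= IH psiq.
rewrite big_ltn ?ltnS ?leq_addr // add0r -addSn => E.
by apply: (addrI (psi N)); rewrite E addr0.
Qed.

(** Full periods contribute 0, which leaves fewer than q terms of modulus at most 1. *)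
Lemma partial_bound N M : (N <= M)%N -> cm (\sum_(N <= n < M) psi n) <= q%:R.
Proof.
move=> NM; rewrite -(subnKC NM); move: (M - N)%N => d {M NM}; elim/ltn_ind: d N => d IH N.
have [dq|qd] := ltnP d q.
  apply: (le_trans (cm_sum _ _ _)); apply: (@le_trans _ _ (\sum_(N <= n < N + d) 1)).
    by apply: ler_sum_nat => i _.
  by rewrite sumr_const_nat addKn ler_nat ltnW.
rewrite (big_cat_nat (n := (N + q)%N)) ?leq_addr ?leq_add2l //= period_sum add0r.
have -> : (N + d = N + q + (d - q))%N by lia.
apply: IH; lia.
Qed.

Lemma abel_id (f g : nat -> C) N k :
  \sum_(N <= n < N + k) f n * g n = (\sum_(N <= n < N + k) f n) * g (N + k)%N -
   \sum_(N <= n < N + k) (\sum_(N <= j < n.+1) f j) * (g n.+1 - g n).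
Proof.
elim: k => [|k IH]; first by rewrite addn0 !big_geq // mul0r subrr.
rewrite addnS !big_nat_recr ?leq_addr //= IH; ring.
Qed.

Lemma abel_bound (g : nat -> C) N M : (N <= M)%N ->
  cm (\sum_(N <= n < M) psi n * g n) <= q%:R * (cm (g M) + \sum_(N <= n < M) cm (g n.+1 - g n)).
Proof.
move=> NM; rewrite -(subnKC NM) abel_id; set k := (M - N)%N.
apply: (le_trans (cm_subD _ _)); rewrite mulrDr; apply: lerD.
  by rewrite cmM ler_wpM2r ?cm_ge0 // partial_bound // leq_addr.
rewrite mulr_sumr; apply: (le_trans (cm_sum _ _ _)).
rewrite big_nat [leRHS]big_nat; apply: ler_sum => n /andP[Nn _].
by rewrite cmM ler_wpM2r ?cm_ge0 // partial_bound // leqW.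
Qed.

Variables (g : nat -> C) (K t : R).
Hypothesis t0 : 0 < t.
Hypothesis K0 : 0 <= K.
Hypothesis gK : forall n, (0 < n)%N -> cm (g n) <= K * npw n t.
Hypothesis gD : forall n, (0 < n)%N -> cm (g n.+1 - g n) <= K * npw n (1 + t).

(** Abel summation against bounded partial sums needs differences of [g] that decay by a factor n
    faster than [g]. The lemma serves n^(-s), -n^(-s) log n and (log n)^2 / n. *)
Lemma dser_tail N M : (0 < N)%N -> (N <= M)%N ->
  cm (\sum_(N <= n < M) psi n * g n) <= q%:R * K * (2 + t^-1) * npw N t.
Proof.
move=> N0 NM; apply: (le_trans (abel_bound g NM)).
rewrite -!mulrA ler_wpM2l //.
have h1 : cm (g M) <= K * npw N t.
  by apply: (le_trans (gK (leq_trans N0 NM))); rewrite ler_wpM2l // npw_anti // ltW.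
have h2 : \sum_(N <= n < M) cm (g n.+1 - g n) <= K * ((1 + t^-1) * npw N t).
  apply: (@le_trans _ _ (K * \sum_(N <= n < M) npw n (1 + t))); last by rewrite ler_wpM2l // npw_tail.
  rewrite mulr_sumr big_nat [leRHS]big_nat; apply: ler_sum => n /andP[Nn _].
  by apply: gD; apply: leq_trans Nn.
apply: (le_trans (lerD h1 h2)); apply: le_eq; ring.
Qed.

Lemma dser_cvg : exists l : C, (fun N => \sum_(1 <= n < N) psi n * g n) @ \oo --> l /\
  forall N, (0 < N)%N -> cm (l - \sum_(1 <= n < N) psi n * g n) <= q%:R * K * (2 + t^-1) * npw N t.
Proof.
set D := q%:R * K * (2 + t^-1).
have D0 : 0 <= D by rewrite !mulr_ge0 // addr_ge0 // invr_ge0 ltW.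
have T N M : (0 < N)%N -> (N <= M)%N ->
    cm (\sum_(1 <= n < M) psi n * g n - \sum_(1 <= n < N) psi n * g n) <= D * npw N t.
  move=> N0 NM; rewrite (big_cat_nat (n := N)) //= addrAC subrr add0r; exact: dser_tail.
have [l Hl] : exists l : C, (fun N => \sum_(1 <= n < N) psi n * g n) @ \oo --> l.
  apply: ccauchy => e e0.
  have D1 : 0 < D + 1 by lra.
  have [N0 HN] := npw_small t0 (divr_gt0 e0 (mulr_gt0 (ltr0n R 2) D1)).
  have HN' : D * npw N0.+1 t <= e / 2.
    apply: (@le_trans _ _ ((D + 1) * (e / (2 * (D + 1))))).
      by apply: ler_pM; rewrite ?npw_ge0 ?HN ?leqW //; lra.
    by apply: le_eq; field; exact: lt0r_neq0.
  exists N0.+1 => n m Nn Nm; apply: (le_trans (cm_tri _ _ (\sum_(1 <= k < N0.+1) psi k * g k))).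
  rewrite [X in _ + X]cmB; have := T N0.+1 n (ltn0Sn _) Nn; have := T N0.+1 m (ltn0Sn _) Nm; lra.
exists l; split => // N N0; apply/ler_addgt0Pr => e e0; have [M HM] := ccvgE Hl e0.
apply: (le_trans (cm_tri _ _ (\sum_(1 <= n < maxn M N) psi n * g n))); rewrite addrC; apply: lerD.
  by apply: T => //; rewrite leq_maxr.
by rewrite cmB; apply: HM; rewrite leq_maxl.
Qed.

End Periodic.

(** * The L-function and its derivative in the half-plane of convergence *)

Section LFunction.
Variable R : realType.
Local Notation C := R[i].
Variables (q : nat) (psi : nat -> C).
Hypothesis q0 : (0 < q)%N.
Hypothesis psiq : forall n, psi (n + q)%N = psi n.
Hypothesis psi1 : forall n, cm (psi n) <= 1.
Hypothesis psi0 : \sum_(k < q) psi k = 0.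
Implicit Types (s z : C) (x y t e : R).

Definition lnpow n s : C := - (ln n%:R)%:C * npow_neg n s.

(* L'(s). *)
Definition L1fun s : C := lim ((fun N : nat => \sum_(1 <= n < N) psi n * lnpow n s) @ \oo).

Definition Lpart N s : C := \sum_(1 <= n < N) psi n * npow_neg n s.
Definition L1part N s : C := \sum_(1 <= n < N) psi n * lnpow n s.

Lemma L_tail s sg : 0 < sg -> sg <= complex.Re s -> forall N, (0 < N)%N ->
  cm (Defs.Lfun psi s - Lpart N s) <= q%:R * (1 + 5 * cm s) * (2 + sg^-1) * npw N sg.
Proof.
move=> s0 ss N N0; have c0 := cm_ge0 s; have s0' : 0 <= complex.Re s by lra.
have K0 : 0 <= 1 + 5 * cm s by lra.
have [|n n0|l [Hl Hb]] := @dser_cvg R q psi q0 psiq psi1 psi0 (fun n => npow_neg n s) (1 + 5 * cm s) sg s0 K0.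
- move=> n n0; rewrite cm_npow; apply: (le_trans (npw_le n ss)).
  by rewrite ler_peMl ?npw_ge0 //; lra.
- apply: (le_trans (npow_diff n0 s0')).
  apply: ler_pM; rewrite ?npw_ge0 ?mulr_ge0 //; first by lra.
  by apply: npw_le; lra.
by rewrite /Defs.Lfun (ccvg_lim Hl); exact: Hb.
Qed.

Local Ltac drop := clear -R q psi q0 psiq psi1 psi0.

(** Half of the exponent pays for the logarithm: log n <= (2 / sg) n^(sg/2). *)
Lemma L1_tail s sg : 0 < sg -> sg <= complex.Re s -> forall N, (0 < N)%N ->
  cm (L1fun s - L1part N s) <= q%:R * (1 + (2 + 10 * cm s) / sg) * (2 + (sg / 2)^-1) * npw N (sg / 2).
Proof.
move=> s0 ss N N0; have c0 := cm_ge0 s; have s0' : 0 <= complex.Re s by lra.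
have i0 : 0 < sg^-1 by rewrite invr_gt0.
have K0 : 0 <= 1 + (2 + 10 * cm s) / sg by rewrite addr_ge0 // divr_ge0 ?(ltW s0) //; lra.
have s2 : 0 < sg / 2 by lra.
have lnb n : ln (n%:R : R) <= 2 / sg * npw n (- (sg / 2)).
  by have := @ln_le_npw R n (sg / 2) s2; rewrite invf_div.
have [|n n0|l [Hl Hb]] := @dser_cvg R q psi q0 psiq psi1 psi0 (fun n => lnpow n s) _ _ s2 K0.
- move=> n n0; rewrite /lnpow cmM cmN cm_real (ger0_norm (ln_nat_ge0 _ _)) cm_npow.
  apply: (@le_trans _ _ (2 / sg * npw n (- (sg / 2)) * npw n sg)).
    by apply: ler_pM; rewrite ?npw_ge0 ?ln_nat_ge0 ?lnb // npw_le.
  rewrite -mulrA -npwD; have -> : - (sg / 2) + sg = sg / 2 by lra.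
  rewrite ler_wpM2r ?npw_ge0 //; have := mulr_ge0 c0 (ltW i0); lra.
- have -> : lnpow n.+1 s - lnpow n s = - ((ln n%:R)%:C * (npow_neg n.+1 s - npow_neg n s) +
     (ln n.+1%:R - ln n%:R)%:C * npow_neg n.+1 s) by rewrite /lnpow rmorphB; ring.
  rewrite cmN; apply: (le_trans (cm_D _ _)); rewrite !cmM !cm_real (ger0_norm (ln_nat_ge0 _ _)) cm_npow.
  have l0 : 0 <= ln (n.+1%:R : R) - ln n%:R by apply: le_trans (ln_succ_ge R n0); rewrite invr_ge0.
  rewrite (ger0_norm l0).
  have A1 : ln (n%:R : R) * cm (npow_neg n.+1 s - npow_neg n s) <=
      2 / sg * npw n (- (sg / 2)) * (5 * cm s * npw n (1 + sg)).
    apply: ler_pM; rewrite ?cm_ge0 ?ln_nat_ge0 ?lnb //.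
    apply: (le_trans (npow_diff n0 s0')); rewrite ler_wpM2l ?mulr_ge0 //.
    by apply: npw_le; lra.
  have A2 : (ln (n.+1%:R : R) - ln n%:R) * npw n.+1 (complex.Re s) <= npw n 1 * npw n (sg / 2).
    apply: ler_pM; rewrite ?npw_ge0 //; first by rewrite npw_inv // ln_succ_le.
    apply: (@le_trans _ _ (npw n.+1 (sg / 2))); first by apply: npw_le; (move: s0 ss; drop; lra).
    by apply: npw_anti => //; (move: s2; drop; lra).
  apply: (le_trans (lerD A1 A2)).
  have -> : 2 / sg * npw n (- (sg / 2)) * (5 * cm s * npw n (1 + sg)) =
     10 * cm s / sg * npw n (1 + sg / 2).
    have -> : 1 + sg / 2 = - (sg / 2) + (1 + sg) by (drop; lra).
    by rewrite [in RHS]npwD; ring.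
  rewrite -npwD -[X in _ + X]mul1r -mulrDl ler_wpM2r ?npw_ge0 //.
  have := ltW i0; (drop; lra).
by rewrite /L1fun (ccvg_lim Hl); exact: Hb.
Qed.

Lemma L_bound s sg : 0 < sg -> sg <= complex.Re s ->
  cm (Defs.Lfun psi s) <= q%:R * (1 + 5 * cm s) * (2 + sg^-1).
Proof.
move=> s0 ss; have := L_tail s0 ss (ltn0Sn 0).
by rewrite /Lpart big_geq // subr0 npw1 mulr1.
Qed.

(** Around s0 the partial sums of both series are combinations of exponentials, which [Hol_exp]
    handles, and the tails are uniform because Re s >= sg on the disc. *)
Lemma L_Hol s0 r : 0 <= r -> r < complex.Re s0 ->
  Hol r (fun z => Defs.Lfun psi (s0 + z)) (fun z => L1fun (s0 + z)).
Proof.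
move=> r0 rs; pose sg := complex.Re s0 - r; have sg0 : 0 < sg by rewrite /sg; lra.
have i0 : 0 < sg^-1 by rewrite invr_gt0.
have ssg z : cm z <= r -> sg <= complex.Re (s0 + z).
  by move=> zr; rewrite reD /sg; have := cm_Re z; rewrite ler_norml => /andP[]; lra.
pose B := cm s0 + r; have c0 := cm_ge0 s0.
have sB z : cm z <= r -> cm (s0 + z) <= B by move=> zr; apply: (le_trans (cm_D _ _)); rewrite /B; lra.
pose D := q%:R * (1 + 5 * B) * (2 + sg^-1) + q%:R * (1 + (2 + 10 * B) / sg) * (2 + (sg / 2)^-1).
have B0 : 0 <= B by rewrite /B; lra.
have t1 : 0 <= q%:R * (1 + 5 * B) * (2 + sg^-1) by rewrite !mulr_ge0 //; (move: i0 B0; drop; lra).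
have j0 : 0 <= (2 + 10 * B) / sg by rewrite divr_ge0 ?(ltW sg0) //; lra.
have j1 : 0 <= (sg / 2)^-1 by rewrite invr_ge0; lra.
have t2 : 0 <= q%:R * (1 + (2 + 10 * B) / sg) * (2 + (sg / 2)^-1) by rewrite !mulr_ge0 //; (move: j0 j1; drop; lra).
apply: Hol_lim => e e0.
have D1 : 0 < D + 1 by rewrite /D; (move: t1 t2; drop; lra).
have s2 : 0 < sg / 2 by (move: sg0; drop; lra).
have [N0 HN] := npw_small s2 (divr_gt0 e0 D1).
exists (fun z => Lpart N0.+1 (s0 + z)), (fun z => L1part N0.+1 (s0 + z)); split.
  apply: (@Hol_sum R r (fun n z => psi n * npow_neg n (s0 + z)) (fun n z => psi n * lnpow n (s0 + z))) => n.
  apply: Hol_scale.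
  have := Hol_scale (npow_neg n s0) (@Hol_exp R r (- (ln n%:R)%:C) r0).
  congr Hol; apply: funext => z.
    by rewrite npowD (npow_negE n z); congr (_ * cexp _); ring.
  have -> : - (ln n%:R)%:C * z = - (z * (ln n%:R)%:C) by ring.
  by rewrite -npow_negE /lnpow npowD mulrCA.
move=> z zr; have h1 := ssg z zr; have h2 := sB z zr; have z0 := cm_ge0 (s0 + z).
have HN' : D * npw N0.+1 (sg / 2) <= e.
  apply: (@le_trans _ _ ((D + 1) * (e / (D + 1)))).
    by apply: ler_pM; rewrite ?npw_ge0 ?HN //; rewrite /D; (move: t1 t2; drop; lra).
  by rewrite mulrC divfK // lt0r_neq0.
rewrite !(cmB (_ N0.+1 _)); split.
  apply: (le_trans (L_tail sg0 h1 (ltn0Sn _))); apply: le_trans HN'.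
  apply: ler_pM; rewrite ?npw_ge0 //; last by apply: npw_le; (move: s2; drop; lra).
    by rewrite !mulr_ge0 //; (move: j1 z0; drop; lra).
  rewrite /D; apply: (@le_trans _ _ (q%:R * (1 + 5 * B) * (2 + sg^-1))); last (move: t2; drop; lra).
  by rewrite ler_wpM2r ?ler_wpM2l //; (move: j1 h2; drop; lra).
apply: (le_trans (L1_tail sg0 h1 (ltn0Sn _))); apply: le_trans HN'.
rewrite ler_wpM2r ?npw_ge0 // /D.
apply: (@le_trans _ _ (q%:R * (1 + (2 + 10 * B) / sg) * (2 + (sg / 2)^-1))); last (move: t1; drop; lra).
rewrite ler_wpM2r ?addr_ge0 // ler_wpM2l // lerD2l ler_pM2r //; (move: h2; drop; lra).
Qed.

Hypothesis psi_one : psi 1%N = 1.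

Lemma L_lower s : 2 <= complex.Re s -> 3/10 <= cm (Defs.Lfun psi s).
Proof.
move=> s2.
suff : cm (Defs.Lfun psi s - 1) <= 7/10.
  by have := cm_rev 1 (Defs.Lfun psi s); rewrite cm1 cmB; lra.
apply/ler_addgt0Pr => e e0.
have s0 : 0 < complex.Re s by lra.
set D := q%:R * (1 + 5 * cm s) * (2 + (complex.Re s)^-1).
have D0 : 0 <= D.
  by rewrite !mulr_ge0 // addr_ge0 ?mulr_ge0 ?cm_ge0 ?invr_ge0 //; lra.
have D1 : 0 < D + 1 by lra.
have [N HN] := npw_small s0 (divr_gt0 e0 D1).
have := L_tail s0 (lexx _) (ltn0Sn N.+1); rewrite -/D => h1.
have h2 : D * npw N.+2 (complex.Re s) <= e.
  apply: (@le_trans _ _ ((D + 1) * (e / (D + 1)))).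
    by apply: ler_pM; rewrite ?npw_ge0 //; [lra|apply: HN; lia].
  by rewrite mulrC divfK // lt0r_neq0.
apply: (le_trans (cm_tri _ _ (Lpart N.+2 s))); rewrite addrC; apply: lerD; last lra.
rewrite /Lpart big_nat_recl // psi_one npow1 mulr1 addrAC subrr add0r.
apply: le_trans (sum_inv_sq R N.+2); rewrite [leRHS]big_add1 /=.
apply: (le_trans (cm_sum _ _ _)); apply: ler_sum_nat => n _.
rewrite cmM cm_npow -[leRHS]mul1r; apply: ler_pM; rewrite ?cm_ge0 ?npw_ge0 //.
exact: npw_le.
Qed.

End LFunction.

(** * Logarithmic derivatives *)

Section Mangoldt.
Variable R : realType.
Local Notation C := R[i].

(* The von Mangoldt function. *)
Definition vM (n : nat) : R :=
  \sum_(0 <= p < n.+1 | prime p) \sum_(1 <= k < n.+1) (if n == (p ^ k)%N then ln p%:R else 0).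

(** Enlarging the ranges gives every n <= N the same double sum, so that sums over n can be
    exchanged with sums over p and k. *)
Lemma vM_wide n N : (0 < n)%N -> (n <= N)%N ->
  vM n = \sum_(0 <= p < N.+1 | prime p) \sum_(1 <= k < N.+1) (if n == (p ^ k)%N then ln p%:R else 0).
Proof.
move=> n0 nN; rewrite /vM [RHS](big_cat_nat (n := n.+1)) //= [X in _ + X]big1_seq ?addr0; last first.
  move=> p /andP[pp]; rewrite mem_index_iota => /andP[np _].
  rewrite big1_seq // => k /andP[_]; rewrite mem_index_iota => /andP[k1 _].
  rewrite ifF //; apply/negP => /eqP E; move: np; rewrite E.
  by rewrite ltnNge -[X in (X <= _)%N]expn1 leq_pexp2l // prime_gt0.
apply: eq_bigr => p pp; rewrite [RHS](big_cat_nat (n := n.+1)) //= [X in _ + X]big1_seq ?addr0 //.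
move=> k /andP[_]; rewrite mem_index_iota => /andP[nk _].
rewrite ifF //; apply/negP => /eqP E; move: nk; rewrite ltnNge => /negP; apply.
by rewrite E ltnW // ltn_expl // prime_gt1.
Qed.

Lemma vM_ge0 n : 0 <= vM n.
Proof.
by apply: sumr_ge0 => p _; apply: sumr_ge0 => k _; case: ifP => // _; exact: ln_nat_ge0.
Qed.

Lemma ln_decomp n : (0 < n)%N -> ln (n%:R : R) = \sum_(0 <= p < n.+1 | prime p) (logn p n)%:R * ln p%:R.
Proof.
move=> n0; rewrite -{1}(partnT n0) /partn natr_prod.
have -> : \prod_(0 <= p < n.+1 | p \in predT) ((p ^ logn p n)%N%:R : R) =
    \prod_(0 <= p < n.+1 | prime p) (p ^ logn p n)%N%:R.
  rewrite [LHS](bigID prime) /= [X in _ * X]big1 ?mulr1; last first.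
    by move=> p /negbTE np; rewrite lognE np.
  by apply: eq_bigl => p.
elim: (index_iota 0 n.+1) => [|p s IH]; first by rewrite !big_nil ln1.
rewrite !big_cons; case: ifP => // pp; rewrite lnM ?posrE; last first.
- by apply: prodr_gt0 => i pi; rewrite ltr0n expn_gt0 prime_gt0.
- by rewrite ltr0n expn_gt0 prime_gt0.
by rewrite IH natrX lnXn ?ltr0n ?prime_gt0 // mulr_natl.
Qed.

Lemma vM_sum N (h : nat -> C) : \sum_(1 <= n < N.+1) (vM n)%:C * h n =
  \sum_(0 <= p < N.+1 | prime p) \sum_(1 <= k < N.+1 | (p ^ k <= N)%N) (ln p%:R)%:C * h (p ^ k)%N.
Proof.
have E n : (1 <= n < N.+1)%N -> (vM n)%:C * h n = \sum_(0 <= p < N.+1 | prime p)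
    \sum_(1 <= k < N.+1) (if n == (p ^ k)%N then (ln p%:R)%:C * h n else 0).
  move=> /andP[n0 nN]; rewrite (vM_wide n0 nN) rmorph_sum mulr_suml; apply: eq_bigr => p pp.
  rewrite rmorph_sum mulr_suml; apply: eq_bigr => k _.
  by case: ifP => _ //; rewrite rmorph0 mul0r.
rewrite (eq_big_nat _ _ E) exchange_big /=; apply: eq_bigr => p pp.
rewrite exchange_big /= [RHS]big_mkcond /=; apply: eq_bigr => k _.
have pk : (0 < p ^ k)%N by rewrite expn_gt0 prime_gt0.
case: ifP => pkN.
  rewrite (bigD1_seq (p ^ k)%N) /= ?mem_index_iota ?pk ?iota_uniq // eqxx big1 ?addr0 //.
  by move=> n /negbTE ->.
rewrite big1_seq // => n /andP[_]; rewrite mem_index_iota => /andP[_ nN].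
by rewrite ifF //; apply/negP => /eqP E2; rewrite -E2 -ltnS nN in pkN.
Qed.

Lemma vM_sumR N (h : nat -> R) : \sum_(1 <= n < N.+1) vM n * h n =
  \sum_(0 <= p < N.+1 | prime p) \sum_(1 <= k < N.+1 | (p ^ k <= N)%N) ln p%:R * h (p ^ k)%N.
Proof.
apply: (@complexI R); rewrite !rmorph_sum /=.
under eq_bigr => n _ do rewrite rmorphM.
rewrite (vM_sum N (fun n => (h n)%:C)); apply: eq_bigr => p _; rewrite rmorph_sum.
by apply: eq_bigr => k _; rewrite rmorphM.
Qed.

Lemma sum_leq_const (L N : nat) : (L <= N)%N -> \sum_(1 <= k < N.+1 | (k <= L)%N) (1 : R) = L%:R.
Proof.
move=> LN; rewrite (big_cat_nat (n := L.+1)) //= [X in _ + X]big_nat_cond [X in _ + X]big1 ?addr0; last by move=> i; lia.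
rewrite big_nat_cond (eq_bigl (fun i => (1 <= i < L.+1)%N && true)); last by move=> i; apply/idP/idP; lia.
by rewrite -big_nat_cond sumr_const_nat subn1.
Qed.

Lemma ln_vM n N : (0 < n)%N -> (n <= N)%N ->
  ln (n%:R : R) = \sum_(1 <= d < N.+1 | (d %| n)%N) vM d.
Proof.
move=> n0 nN; rewrite big_mkcond /=.
have -> : \sum_(1 <= d < N.+1) (if (d %| n)%N then vM d else 0) =
   \sum_(1 <= d < N.+1) vM d * (if (d %| n)%N then 1 else 0).
  by apply: eq_bigr => d _; case: ifP; rewrite ?mulr1 ?mulr0.
rewrite vM_sumR ln_decomp // [RHS](big_cat_nat (n := n.+1)) //= [X in _ + X]big1_seq ?addr0; last first.
  move=> p /andP[pp]; rewrite mem_index_iota => /andP[np _]; apply: big1_seq => k /andP[_].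
  rewrite mem_index_iota => /andP[k1 _]; rewrite ifF ?mulr0 //; apply/negP => /(dvdn_leq n0).
  apply/negP; rewrite -ltnNge; apply: (leq_trans np).
  by rewrite -[X in (X <= _)%N]expn1 leq_pexp2l // prime_gt0.
apply: eq_bigr => p pp.
have LN : (logn p n <= N)%N by apply: leq_trans nN; rewrite ltnW // ltn_logl.
rewrite -(sum_leq_const LN) mulr_suml [LHS]big_mkcond [RHS]big_mkcond /=; apply: eq_bigr => k _.
rewrite pfactor_dvdn //; case: (leqP k (logn p n)) => h; last by rewrite mulr0 if_same.
rewrite ifT; first by rewrite mulr1 mul1r.
by apply: leq_trans nN; rewrite dvdn_leq // pfactor_dvdn.
Qed.

Lemma vM_le n : vM n <= ln n%:R.
Proof.
case: n => [|n]; first by rewrite ln0 // /vM big_mkcond big_nat1 /=.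
rewrite (@ln_vM n.+1 n.+1) // big_mkcond (bigD1_seq n.+1) ?iota_uniq ?mem_index_iota ?ltnSn //= dvdnn lerDl.
by apply: sumr_ge0 => d _; case: ifP => // _; exact: vM_ge0.
Qed.

Lemma sum_dvd d N (F : nat -> C) : (0 < d)%N ->
  \sum_(1 <= n < N.+1 | (d %| n)%N) F n = \sum_(1 <= m < (N %/ d).+1) F (d * m)%N.
Proof.
move=> d0; elim: N => [|N IH]; first by rewrite div0n !big_geq.
rewrite [LHS]big_mkcond big_nat_recr //= -big_mkcond IH divnS //.
case: ifP => h; last by rewrite add0n addr0.
rewrite add1n [RHS]big_nat_recr //=; congr (_ + F _).
by rewrite -[in LHS](divnK h) mulnC divnS // h add1n.
Qed.

Lemma sum_conv N (a F : nat -> C) :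
  \sum_(1 <= n < N.+1) (\sum_(1 <= d < N.+1 | (d %| n)%N) a d) * F n =
  \sum_(1 <= d < N.+1) a d * \sum_(1 <= m < (N %/ d).+1) F (d * m)%N.
Proof.
under eq_bigr => n _ do rewrite mulr_suml.
rewrite (exchange_big_dep_nat predT) //=; apply: eq_big_nat => d /andP[d0 _].
by rewrite -sum_dvd // mulr_sumr.
Qed.

(** The identity log = [vM] * 1 in summed form; it is the finite version of -L' = L times the
    Dirichlet series of the logarithmic derivative. *)
Lemma sum_conv_vM N (F : nat -> C) :
  \sum_(1 <= n < N.+1) (ln n%:R)%:C * F n =
  \sum_(1 <= d < N.+1) (vM d)%:C * \sum_(1 <= m < (N %/ d).+1) F (d * m)%N.
Proof.
rewrite -sum_conv; apply: eq_big_nat => n /andP[n0 nN].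
by rewrite (ln_vM n0 nN) rmorph_sum.
Qed.

End Mangoldt.

(** * The Dirichlet series of the logarithmic derivative, far to the right *)

Section LogDeriv.
Variable R : realType.
Local Notation C := R[i].
Variables (q : nat) (psi : nat -> C).
Hypothesis q0 : (0 < q)%N.
Hypothesis psiq : forall n, psi (n + q)%N = psi n.
Hypothesis psi1 : forall n, cm (psi n) <= 1.
Hypothesis psi0 : \sum_(k < q) psi k = 0.
Hypothesis psi_one : psi 1%N = 1.
Hypothesis psiM : forall m n, psi (m * n)%N = psi m * psi n.
Implicit Types (s z : C) (x y t e : R).

Definition Fpart N s : C := \sum_(1 <= n < N.+1) (vM R n)%:C * (psi n * npow_neg n s).

Lemma npw_ratio N d t : 0 <= t -> (0 < d)%N -> (0 < N)%N -> npw (N %/ d).+1 t <= npw d (- t) * npw N t.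
Proof.
move=> t0 d0 N0; rewrite /npw -expRD ler_expR.
have H : ln (N%:R : R) - ln d%:R <= ln (N %/ d).+1%:R.
  rewrite -ln_div ?posrE ?ltr0n // ler_ln ?posrE ?divr_gt0 ?ltr0n //.
  rewrite ler_pdivrMr ?ltr0n // -natrM ler_nat ltnW // ltn_ceil //.
have := ler_wpM2l t0 H; lra.
Qed.

Lemma ln_le_nat n : ln (n%:R : R) <= n%:R.
Proof.
case: n => [|n]; first by rewrite ln0.
by apply: ltW; apply: ln_sublinear; rewrite ltr0n.
Qed.

Lemma vM_npow_le n s : (0 < n)%N -> 3 <= complex.Re s ->
  cm ((vM R n)%:C * (psi n * npow_neg n s)) <= npw n 2.
Proof.
move=> n0 s3; rewrite !cmM cm_real (ger0_norm (vM_ge0 _ _)) cm_npow.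
have h1 : vM R n <= n%:R by apply: (le_trans (vM_le _ _)); exact: ln_le_nat.
have -> : npw n (2 : R) = n%:R * (1 * npw n 3).
  have -> : 3 = 1 + 2 :> R by ring.
  rewrite [npw n (1 + 2)]npwD npw_inv // mul1r mulrA mulfV ?mul1r // pnatr_eq0 -lt0n //.
apply: ler_pM; rewrite ?vM_ge0 ?mulr_ge0 ?cm_ge0 ?npw_ge0 //.
by apply: ler_pM; rewrite ?cm_ge0 ?npw_ge0 // npw_le.
Qed.

Lemma Fpart_bound N s : 3 <= complex.Re s -> cm (Fpart N s) <= 2.
Proof.
move=> s3; apply: (le_trans (cm_sum _ _ _)).
apply: (@le_trans _ _ (\sum_(1 <= n < N.+2) npw n 2)).
  rewrite [leRHS]big_nat_recr //= -[leLHS]addr0; apply: lerD; last exact: npw_ge0.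
  by rewrite big_nat [leRHS]big_nat; apply: ler_sum => n /andP[n0 _]; exact: vM_npow_le.
rewrite big_ltn // npw1; have := sum_inv_sq R N.+2; lra.
Qed.

Local Ltac drop := clear -R q psi q0 psiq psi1 psi0 psi_one psiM.

(** Truncating log = [vM] * 1 at N leaves the errors L - [Lpart] (N %/ d), each O((d / N)^(1/2)),
    weighted by at most d^(-2). They sum to O(N^(-1/2)), and |L| >= 3/10 allows the division. *)
Lemma F_tail (B : R) : exists D, 0 <= D /\ forall s N, (0 < N)%N -> 3 <= complex.Re s -> cm s <= B ->
  cm (Fpart N s + L1fun psi s / Defs.Lfun psi s) <= D * npw N (2^-1).
Proof.
have B0' : 0 <= `|B| by [].
pose D1 : R := q%:R * (1 + 5 * `|B|) * (2 + (2^-1)^-1).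
pose D2 : R := q%:R * (1 + (2 + 10 * `|B|) / 1) * (2 + (1 / 2)^-1).
have D10 : 0 <= D1 by rewrite !mulr_ge0 //; lra.
have D20 : 0 <= D2 by rewrite !mulr_ge0 //; lra.
exists ((3 * D1 + D2) * 4); split; first lra.
move=> s N N0 s3 sB.
have Bn := ler_norm B; have z0 := cm_ge0 s.
have lower := @L_lower R q psi q0 psiq psi1 psi0 psi_one s.
have Ln : 3/10 <= cm (Defs.Lfun psi s) by apply: lower; lra.
have Lnz : Defs.Lfun psi s != 0 by rewrite -cm_gt0; (move: Ln; drop; lra).
have T1 M : (0 < M)%N -> cm (Defs.Lfun psi s - Lpart psi M s) <= D1 * npw M 2^-1.
  move=> M0; apply: (le_trans (@L_tail R q psi q0 psiq psi1 psi0 s 2^-1 _ _ M M0)); [(drop; lra)|(move: s3; drop; lra)|].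
  by rewrite ler_wpM2r ?npw_ge0 // /D1 ler_wpM2r ?ler_wpM2l //; (move: sB Bn; drop; lra).
have T2 : cm (L1fun psi s - L1part psi N.+1 s) <= D2 * npw N 2^-1.
  apply: (le_trans (@L1_tail R q psi q0 psiq psi1 psi0 s 1 _ _ N.+1 _)) => //; [(move: s3; drop; lra)|].
  have -> : 1 / 2 = 2^-1 :> R by rewrite div1r.
  have a0 : 0 <= q%:R * (1 + (2 + 10 * cm s) / 1) * (2 + 2^-1^-1) by rewrite !mulr_ge0 //; (move: z0; drop; lra).
  apply: ler_pM; rewrite ?npw_ge0 //; last by apply: npw_anti => //; lra.
  by rewrite /D2 div1r ler_wpM2r ?ler_wpM2l //; (move: sB Bn; drop; lra).
have E : - L1part psi N.+1 s = \sum_(1 <= d < N.+1) (vM R d)%:C * (psi d * npow_neg d s) * Lpart psi (N %/ d).+1 s.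
  have := sum_conv_vM N (fun n => psi n * npow_neg n s) => H.
  rewrite /L1part /lnpow -sumrN.
  have -> : \sum_(1 <= i < N.+1) - (psi i * (- (ln i%:R)%:C * npow_neg i s)) = \sum_(1 <= n < N.+1) (ln n%:R)%:C * (psi n * npow_neg n s).
    by apply: eq_bigr => n _; ring.
  rewrite H; apply: eq_big_nat => d /andP[d0 _]; rewrite -mulrA; congr (_ * _).
  rewrite /Lpart mulr_sumr; apply: eq_big_nat => m /andP[m0 _].
  by rewrite psiM npowM //; ring.
have T3 : cm (Fpart N s * Defs.Lfun psi s + L1part psi N.+1 s) <= 3 * D1 * npw N 2^-1.
  have -> : Fpart N s * Defs.Lfun psi s + L1part psi N.+1 s =
     \sum_(1 <= d < N.+1) (vM R d)%:C * (psi d * npow_neg d s) * (Defs.Lfun psi s - Lpart psi (N %/ d).+1 s).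
    rewrite -[L1part _ _ _]opprK E /Fpart mulr_suml -sumrB; apply: eq_bigr => d _; ring.
  apply: (le_trans (cm_sum _ _ _)).
  apply: (@le_trans _ _ (D1 * npw N 2^-1 * \sum_(1 <= d < N.+1) npw d (1 + 2^-1))); last first.
    have := @npw_tail R 2^-1 1 N.+1 _ (ltn0Sn _); rewrite npw1 mulr1 => H.
    have H2 : \sum_(1 <= d < N.+1) npw d (1 + 2^-1) <= 3 :> R by apply: (le_trans (H _)); (drop; lra).
    have := ler_wpM2l (mulr_ge0 D10 (npw_ge0 N 2^-1)) H2; (drop; lra).
  rewrite mulr_sumr big_nat [leRHS]big_nat; apply: ler_sum => d /andP[d0 _].
  rewrite cmM; apply: (@le_trans _ _ (npw d 2 * (D1 * (npw d (- 2^-1) * npw N 2^-1)))).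
    apply: ler_pM; rewrite ?cm_ge0 ?vM_npow_le //.
    apply: (le_trans (T1 _ (ltn0Sn _))); rewrite ler_wpM2l // npw_ratio //; lra.
  have -> : 1 + 2^-1 = 2 + - 2^-1 :> R by (drop; lra).
  rewrite [npw d (2 + _)]npwD; apply: le_eq; ring.
have -> : Fpart N s + L1fun psi s / Defs.Lfun psi s =
   ((Fpart N s * Defs.Lfun psi s + L1part psi N.+1 s) + (L1fun psi s - L1part psi N.+1 s)) / Defs.Lfun psi s.
  by field.
rewrite cmM cmV; have w0 := npw_ge0 N (2^-1 : R).
have Li : (cm (Defs.Lfun psi s))^-1 <= 4.
  have : (cm (Defs.Lfun psi s))^-1 <= (3/10)^-1 by rewrite lef_pV2 ?posrE; (move: Ln; drop; lra).
  (drop; lra).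
have -> : (3 * D1 + D2) * 4 * npw N 2^-1 = ((3 * D1 + D2) * npw N 2^-1) * 4 by ring.
apply: ler_pM; rewrite ?cm_ge0 ?invr_ge0 ?cm_ge0 //.
by apply: (le_trans (cm_D _ _)); rewrite mulrDl lerD.
Qed.

Lemma F_bound s : 3 <= complex.Re s -> cm (L1fun psi s / Defs.Lfun psi s) <= 2.
Proof.
move=> s3; have [D [D0 HD]] := F_tail (cm s).
apply/ler_addgt0Pr => e e0; have D1 : 0 < D + 1 by lra.
have h2 : 0 < 2^-1 :> R by lra.
have [N HN] := npw_small h2 (divr_gt0 e0 D1).
have := HD s N.+1 (ltn0Sn _) s3 (lexx _) => h.
have h3 : D * npw N.+1 2^-1 <= e.
  apply: (@le_trans _ _ ((D + 1) * (e / (D + 1)))).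
    by apply: ler_pM; rewrite ?npw_ge0 ?HN //; lra.
  by rewrite mulrC divfK // lt0r_neq0.
have := Fpart_bound N.+1 s3; have := cm_rev (L1fun psi s / Defs.Lfun psi s) (- Fpart N.+1 s).
rewrite cmN opprK (addrC (L1fun _ _ / _)); lra.
Qed.

End LogDeriv.

(** * The function F under GRH *)

Section Taylor.
Variable R : realType.
Local Notation C := R[i].
Implicit Types (z w : C) (x y t e r : R) (f g : C -> C).

Lemma geo0_le x n : 0 <= x -> x <= 1/2 -> \sum_(i < n) x ^+ i <= 2.
Proof.
move=> x0 x1; suff : \sum_(i < n) x ^+ i <= 2 - 2 * x ^+ n.
  by move=> h; have := exprn_ge0 n x0; lra.
elim: n => [|n IH]; first by rewrite big_ord0 expr0; lra.
rewrite big_ord_recr /= exprS; have := exprn_ge0 n x0; nra.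
Qed.

Local Ltac drop := clear -R.

Lemma poly_tail (p : {poly C}) r M k z : 0 < r -> (forall z, cm z = r -> cm p.[z] <= M) -> cm z <= r / 2 ->
  cm (p.[z] - \sum_(j < k) p`_j * z ^+ j) <= 2 * M * (cm z / r) ^+ k /\
  cm (p^`().[z] - \sum_(j < k) j.+1%:R * p`_j.+1 * z ^+ j) <= 4 * k.+1%:R * M / r * (cm z / r) ^+ k.
Proof.
move=> r0 HM zr; set x := cm z / r; have r0' := ltW r0.
have x0 : 0 <= x by rewrite divr_ge0 ?cm_ge0.
have x1 : x <= 1/2 by rewrite ler_pdivrMr //; lra.
have M0 : 0 <= M.
  apply: le_trans (HM r%:C _); first exact: cm_ge0.
  by rewrite cm_real ger0_norm.
have pj j : cm p`_j * r ^+ j <= M by apply: coef_le_sup.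
have pz j : cm p`_j * cm z ^+ j <= M * x ^+ j.
  rewrite /x expr_div_n mulrA ler_pdivlMr ?exprn_gt0 // mulrAC.
  by rewrite ler_wpM2r ?exprn_ge0 ?cm_ge0.
split.
  have sp : (size p <= k + size p)%N by rewrite leq_addl.
  rewrite (horner_coef_wide _ sp) big_split_ord /= addrAC subrr add0r.
  apply: (le_trans (cm_sum _ _ _)).
  apply: (@le_trans _ _ (M * x ^+ k * \sum_(i < size p) x ^+ i)).
    rewrite mulr_sumr; apply: ler_sum => i _; rewrite cmM cmX -mulrA -exprD; exact: pz.
  have := geo0_le (size p) x0 x1; have : 0 <= M * x ^+ k by rewrite mulr_ge0 ?exprn_ge0.
  (drop; nra).
have sp : (size p^`() <= k + size p^`())%N by rewrite leq_addl.
rewrite (horner_coef_wide _ sp) big_split_ord /=.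
have -> : \sum_(i < k) p^`()`_i * z ^+ i = \sum_(j < k) j.+1%:R * p`_j.+1 * z ^+ j.
  by apply: eq_bigr => i _; rewrite coef_deriv mulr_natl.
rewrite addrAC subrr add0r; apply: (le_trans (cm_sum _ _ _)).
apply: (@le_trans _ _ (k.+1%:R * M / r * x ^+ k * \sum_(i < size p^`()) i.+1%:R * x ^+ i)).
  rewrite mulr_sumr; apply: ler_sum => i _; rewrite coef_deriv -[p`__ *+ _]mulr_natl !cmM cmX cm_nat.
  have h : cm p`_(k + i).+1 * cm z ^+ (k + i) <= M / r * x ^+ (k + i).
    rewrite /x expr_div_n mulrA ler_pdivlMr ?exprn_gt0 // mulrAC ler_wpM2r ?exprn_ge0 ?cm_ge0 //.
    by rewrite ler_pdivlMr // -mulrA -exprSr.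
  have h2 : (k + i).+1%:R <= k.+1%:R * i.+1%:R :> R by rewrite -natrM ler_nat; nia.
  rewrite -mulrA; apply: (@le_trans _ _ (k.+1%:R * i.+1%:R * (M / r * x ^+ (k + i)))).
    by apply: ler_pM; rewrite ?mulr_ge0 ?cm_ge0 ?exprn_ge0 ?cm_ge0.
  by rewrite exprD; apply: le_eq; ring.
have x1' : x < 1 by lra.
have H := sum_kx (size p^`()) x0 x1'.
have H2 : (1 - x) ^- 2 <= 4.
  have : (1/2) ^+ 2 <= (1 - x) ^+ 2 by rewrite lerXn2r ?nnegrE; (move: x1; drop; lra).
  have e4 : 4 = ((1/2) ^+ 2)^-1 :> R by rewrite expr2; field.
  rewrite e4 lef_pV2 ?posrE ?exprn_gt0 //; (move: x1'; drop; lra).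
have : 0 <= k.+1%:R * M / r * x ^+ k by rewrite mulr_ge0 ?exprn_ge0 // divr_ge0 // mulr_ge0.
set Y := k.+1%:R * M / r * x ^+ k => Y0.
apply: (@le_trans _ _ (Y * 4)); first by rewrite ler_wpM2l // (le_trans H).
by apply: le_eq; rewrite /Y; ring.
Qed.

Definition invS (n : nat) : R := n.+1%:R^-1.

Lemma invS_gt0 n : 0 < invS n.
Proof. by rewrite invr_gt0 ltr0n. Qed.

Lemma invS_le n m : (n <= m)%N -> invS m <= invS n.
Proof. by move=> nm; rewrite /invS lef_pV2 ?posrE ?ltr0n // ler_nat. Qed.

Lemma invS0 : invS 0 = 1.
Proof. by rewrite /invS invr1. Qed.

(** The j-th coefficients of polynomials approximating f within 1/(n+1) form a Cauchy sequence, and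
    their limits are the Taylor coefficients. The tail estimates of [poly_tail] are uniform in n and
    pass to the limit. *)
Lemma Hol_taylor r f g : 0 < r -> Hol r f g -> exists (c : nat -> C) (M : R), 0 <= M /\
  forall k z, cm z <= r / 2 ->
  cm (f z - \sum_(j < k) c j * z ^+ j) <= M * (cm z / r) ^+ k /\
  cm (g z - \sum_(j < k) j.+1%:R * c j.+1 * z ^+ j) <= k.+1%:R * M * (cm z / r) ^+ k.
Proof.
move=> r0 H; have r0' := ltW r0.
have [M [M0 HM]] := Hol_bound r0' H.
have e0 := invS_gt0.
pose P n : {poly C} := sval (cid (H _ (e0 n))).
have HP n z : cm z <= r -> cm ((P n).[z] - f z) <= invS n /\ cm ((P n)^`().[z] - g z) <= invS n.
  by rewrite /P; case: (cid _) => p /= Hp; exact: Hp.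
have Hn (n m : nat) : (n <= m)%N -> invS m <= invS n :> R.
  exact: invS_le.
have cauchy j n m : (n <= m)%N -> cm ((P n)`_j - (P m)`_j) * r ^+ j <= 2 * invS n.
  move=> nm; rewrite -coefB; apply: coef_le_sup => // z zr; rewrite hornerD hornerN.
  have zr' : cm z <= r by rewrite zr.
  have [h1 _] := HP n z zr'; have [h2 _] := HP m z zr'; have := Hn n m nm.
  have := cm_tri (P n).[z] (P m).[z] (f z); rewrite (cmB (f z) (P m).[z]); (move: h1 h2; drop; lra).
have small e : 0 < e -> exists N : nat, invS N <= e.
  move=> ep; have [N HN] := big_nat_ex e^-1; exists N.
  by rewrite /invS -[leRHS]invrK lef_pV2 ?posrE ?invr_gt0 // ltr0n.
have lim j : exists l : C, forall n, cm ((P n)`_j - l) * r ^+ j <= 2 * invS n.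
  have rj : 0 < r ^+ j by rewrite exprn_gt0.
  have [l Hl] : exists l : C, (fun n => (P n)`_j) @ \oo --> l.
    apply: ccauchy => e ep; have [N HN] := small _ (mulr_gt0 (divr_gt0 ep (ltr0n _ 4)) rj).
    exists N => n m Nn Nm.
    have a1 := cauchy j N n Nn; have a2 := cauchy j N m Nm.
    apply: (le_trans (cm_tri _ _ (P N)`_j)); rewrite (cmB (P n)`_j).
    rewrite -(ler_pM2r rj); (move: HN a1 a2; drop; lra).
  exists l => n; apply/ler_addgt0Pr => e ep.
  have [N HN] := ccvgE Hl (divr_gt0 ep rj).
  have := cauchy j n (maxn n N) (leq_maxl _ _); have := HN (maxn n N) (leq_maxr _ _).
  rewrite ler_pdivlMr // => a1 a2.
  have := cm_tri (P n)`_j l (P (maxn n N))`_j; rewrite -(ler_pM2r rj); (move: a1 a2; drop; lra).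
pose c j := sval (cid (lim j)).
have Hc j n : cm ((P n)`_j - c j) * r ^+ j <= 2 * invS n.
  by rewrite /c; case: (cid _) => l /= Hl; exact: Hl.
have PM n z : cm z = r -> cm (P n).[z] <= M + 1.
  move=> zr; have zr' : cm z <= r by rewrite zr.
  have [h1 _] := HP n z zr'; have [h2 _] := HM z zr'; have := Hn 0%N n (leq0n _).
  rewrite invS0; have := cm_rev (P n).[z] (f z); (move: h1 h2; drop; lra).
exists c, (2 * (M + 1) + 4 * (M + 1) / r); split.
  by rewrite addr_ge0 ?divr_ge0 ?mulr_ge0 //; lra.
move=> k z zr; set x := cm z / r.
have x0 : 0 <= x by rewrite divr_ge0 ?cm_ge0.
have x1 : x <= 1/2 by rewrite ler_pdivrMr //; (move: zr; drop; lra).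
have zr' : cm z <= r by lra.
have xk := exprn_ge0 k x0.
have cz j n : cm ((P n)`_j - c j) * cm z ^+ j <= 2 * invS n * x ^+ j.
  rewrite /x expr_div_n mulrA ler_pdivlMr ?exprn_gt0 // mulrAC.
  by rewrite ler_wpM2r ?exprn_ge0 ?cm_ge0.
have k1 : 1 <= k.+1%:R :> R by rewrite ler1n.
split; apply/ler_addgt0Pr => e ep.
  have [n Hnn] := small (e / 5) (divr_gt0 ep (ltr0n _ 5)).
  have [t1 _] := poly_tail k r0 (PM n) zr; have [h1 _] := HP n z zr'.
  have h2 : cm (\sum_(j < k) (P n)`_j * z ^+ j - \sum_(j < k) c j * z ^+ j) <= 4 * invS n.
    rewrite -sumrB; apply: (le_trans (cm_sum _ _ _)).
    apply: (@le_trans _ _ (2 * invS n * \sum_(j < k) x ^+ j)).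
      by rewrite mulr_sumr; apply: ler_sum => j _; rewrite -mulrBl cmM cmX.
    have := geo0_le k x0 x1; have := e0 n; (drop; nra).
  have := cm_tri (f z) (\sum_(j < k) c j * z ^+ j) (P n).[z].
  have := cm_tri (P n).[z] (\sum_(j < k) c j * z ^+ j) (\sum_(j < k) (P n)`_j * z ^+ j).
  rewrite (cmB (f z) (P n).[z]) -/x in t1 *.
  have : 0 <= 4 * (M + 1) / r * x ^+ k by rewrite mulr_ge0 // divr_ge0 //; lra.
  rewrite -/x in t1; (move: Hnn h1 h2 t1; drop; lra).
pose D : R := 1 + 8 / r.
have D0 : 0 < D by rewrite /D addr_gt0 // divr_gt0.
have [n Hnn] := small _ (divr_gt0 ep D0).
have [_ t1] := poly_tail k r0 (PM n) zr; have [_ h1] := HP n z zr'.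
have h2 : cm (\sum_(j < k) j.+1%:R * (P n)`_j.+1 * z ^+ j - \sum_(j < k) j.+1%:R * c j.+1 * z ^+ j) <= 8 / r * invS n.
  rewrite -sumrB; apply: (le_trans (cm_sum _ _ _)).
  apply: (@le_trans _ _ (2 * invS n / r * \sum_(j < k) j.+1%:R * x ^+ j)).
    rewrite mulr_sumr; apply: ler_sum => j _; rewrite -mulrBl -mulrBr !cmM cmX cm_nat.
    have h : cm ((P n)`_j.+1 - c j.+1) * cm z ^+ j <= 2 * invS n / r * x ^+ j.
      rewrite /x expr_div_n mulrA ler_pdivlMr ?exprn_gt0 // mulrAC ler_wpM2r ?exprn_ge0 ?cm_ge0 //.
      by rewrite ler_pdivlMr // -mulrA -exprSr.
    rewrite -mulrA; apply: le_trans (ler_wpM2l (ler0n R j.+1) h) _; apply: le_eq; ring.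
  have x1' : x < 1 by lra.
  have H1 := sum_kx k x0 x1'.
  have H2 : (1 - x) ^- 2 <= 4.
    have : (1/2) ^+ 2 <= (1 - x) ^+ 2 by rewrite lerXn2r ?nnegrE; (move: x1; drop; lra).
    have e4 : 4 = ((1/2) ^+ 2)^-1 :> R by rewrite expr2; field.
    rewrite e4 lef_pV2 ?posrE ?exprn_gt0 //; (move: x1'; drop; lra).
  apply: (@le_trans _ _ (2 * invS n / r * 4)); last by apply: le_eq; ring.
  rewrite ler_wpM2l ?(le_trans H1) // divr_ge0 ?mulr_ge0 //; exact: ltW.
have := cm_tri (g z) (\sum_(j < k) j.+1%:R * c j.+1 * z ^+ j) (P n)^`().[z].
have := cm_tri (P n)^`().[z] (\sum_(j < k) j.+1%:R * c j.+1 * z ^+ j) (\sum_(j < k) j.+1%:R * (P n)`_j.+1 * z ^+ j).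
rewrite (cmB (g z) (P n)^`().[z]) => a1 a2.
have b1 : D * invS n <= e by rewrite mulrC -ler_pdivlMr.
have b2 : 4 * k.+1%:R * (M + 1) / r * (cm z / r) ^+ k <= k.+1%:R * (2 * (M + 1) + 4 * (M + 1) / r) * x ^+ k.
  rewrite -/x ler_wpM2r // -subr_ge0.
  have -> : k.+1%:R * (2 * (M + 1) + 4 * (M + 1) / r) - 4 * k.+1%:R * (M + 1) / r = 2 * k.+1%:R * (M + 1) by ring.
  by rewrite !mulr_ge0 //; lra.
move: b1; rewrite /D mulrDl mul1r; (move: t1 h1 h2 a1 a2 b2; drop; lra).
Qed.

End Taylor.

(** * Bounds for F in Re w > 0: crude, near a given height, and near 0 *)

Section Analytic.
Variable R : realType.
Local Notation C := R[i].
Variables (q : nat) (psi : nat -> C).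
Hypothesis q0 : (0 < q)%N.
Hypothesis psiq : forall n, psi (n + q)%N = psi n.
Hypothesis psi1 : forall n, cm (psi n) <= 1.
Hypothesis psi0 : \sum_(k < q) psi k = 0.
Hypothesis psi_one : psi 1%N = 1.
Hypothesis psiM : forall m n, psi (m * n)%N = psi m * psi n.
Hypothesis grh : forall s : C, 2^-1 < complex.Re s -> Defs.Lfun psi s != 0.
Implicit Types (s z w : C) (x y t e : R).
Local Notation LL := (@Defs.Lfun R psi).
Local Notation LD := (@L1fun R psi).

Definition hlf : C := (2^-1 : R)%:C.
Definition Fw w : C := - (LD (hlf + w) / LL (hlf + w)).
(** The shift by 4 > e makes this at least 1. *)
Definition lg t : R := ln (`|t| + 4).

Lemma exp1_le4 : expR 1 <= 4 :> R.
Proof.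
have := expR_ge1Dx (- 2^-1 : R); rewrite expRN; have := expR_gt0 (2^-1 : R).
have -> : expR 1 = expR 2^-1 ^+ 2 :> R by rewrite -expRM_natl mulfV.
set E2 := expR _ => E0 h; have : (1 - 2^-1) * E2 <= 1 by rewrite -ler_pdivlMr // div1r.
nra.
Qed.

Lemma lg_ge1 t : 1 <= lg t.
Proof.
have h := normr_ge0 t; have e4 := exp1_le4.
rewrite /lg -[leLHS]expRK ler_ln ?posrE ?expR_gt0 //; lra.
Qed.

(** Four times the upper bound 30 q (|t| + 4) on the discs, divided by the lower bound 3/10 at the
    centre, is 400 q (|t| + 4). *)
Definition A0 : R := ln (20 * 20 * q%:R) + 1.

Lemma A0_ge1 : 1 <= A0.
Proof.
have h : 1 <= q%:R :> R by rewrite ler1n.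
by rewrite /A0 lerDr ln_ge0 //; move: h; set Q := q%:R; lra.
Qed.

Lemma q1 : 1 <= q%:R :> R.
Proof. by rewrite ler1n. Qed.

(* Discs around 2 + i t, where L is bounded below by its Euler product, reach the line Re s > 1/2. *)
Definition ctr t : C := 2 +i* t.

Local Ltac drop := clear -R q psi q0 psiq psi1 psi0 psi_one psiM grh.

Lemma ctr_bound t r : 0 <= r -> r <= 3/2 -> forall z, cm z <= r -> cm (LL (ctr t + z)) <= 30 * q%:R * (`|t| + 4).
Proof.
move=> r0 r1 z zr; have h := cm_Re z; move: (h); rewrite ler_norml => /andP[h1 _].
have s2 : 0 < 2^-1 :> R by lra.
have s1 : 2^-1 <= complex.Re (ctr t + z) by rewrite reD /=; lra.
apply: (le_trans (@L_bound R q psi q0 psiq psi1 psi0 _ _ s2 s1)).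
have cb : cm (ctr t + z) <= `|t| + 4.
  apply: (le_trans (cm_D _ _)); have := cm_le_ReIm (ctr t); rewrite /= ger0_norm //; lra.
have t0 : 4 <= `|t| + 4 by rewrite lerDr.
have -> : 2 + 2^-1^-1 = 4 :> R by rewrite invrK; ring.
move: q1 t0 cb; set Q := q%:R; set T := `|t| + 4; set c := cm _; (drop; nra).
Qed.

Lemma ctr_lower t : 3/10 <= cm (LL (ctr t + 0)).
Proof. by rewrite addr0; apply: (@L_lower R q psi q0 psiq psi1 psi0 psi_one). Qed.

Lemma ctr_A t : ln (4 * (30 * q%:R * (`|t| + 4)) / cm (LL (ctr t + 0))) <= A0 * lg t.
Proof.
have L0 := ctr_lower t; have t0 := normr_ge0 t; have l1 := lg_ge1 t.
have qp : 0 < q%:R :> R by rewrite ltr0n.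
have T0 : 0 < `|t| + 4 by lra.
have QT : 0 < q%:R * (`|t| + 4) :> R by rewrite mulr_gt0.
have B0 : 0 < 4 * (30 * q%:R * (`|t| + 4)) :> R by rewrite -[30 * _ * _]mulrA; move: QT; set X := _ * _; lra.
have P00 : 0 < 20 * 20 * q%:R :> R by move: qp; set X := q%:R; lra.
have P0 : 0 < 20 * 20 * q%:R * (`|t| + 4) :> R by rewrite mulr_gt0.
apply: (@le_trans _ _ (ln (20 * 20 * q%:R * (`|t| + 4)))).
  rewrite ler_ln ?posrE ?divr_gt0 //; last (move: L0; drop; lra).
  rewrite ler_pdivrMr; last (move: L0; drop; lra).
  have h := ler_wpM2l (ltW P0) L0; apply: le_trans h.
  have -> : 4 * (30 * q%:R * (`|t| + 4)) = 120 * (q%:R * (`|t| + 4)) :> R by ring.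
  have -> : 20 * 20 * q%:R * (`|t| + 4) * (3/10) = 120 * (q%:R * (`|t| + 4)) :> R by field.
  exact: lexx.
rewrite lnM ?posrE //.
rewrite -/(lg t); have := A0_ge1; rewrite /A0; nra.
Qed.

Lemma split_w w (x : R) : hlf + w = (x +i* complex.Im w) + (2^-1 + complex.Re w - x)%:C.
Proof. by apply: complex_eq; rewrite !(reD, imD) /=; ring. Qed.

Lemma ctr_BC t r : 0 < r -> r < 3/2 ->
  [/\ 0 <= ln (4 * (30 * q%:R * (`|t| + 4)) / cm (LL (ctr t + 0))),
   forall z, cm z < r -> cm (LD (ctr t + z) / LL (ctr t + z)) <= 2 * (A0 * lg t) * r / (r - cm z) ^+ 2 &
   forall z, cm z < r -> 3/40 * expR (- (2 * (A0 * lg t) * cm z / (r - cm z))) <= cm (LL (ctr t + z))].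
Proof.
move=> r0 r1; have r0' := ltW r0.
have H : Hol r (fun z => LL (ctr t + z)) (fun z => LD (ctr t + z)).
  by apply: (@L_Hol R q psi q0 psiq psi1 psi0) => //=; lra.
have [z zr|] := @Hol_BC R r _ _ (30 * q%:R * (`|t| + 4)) r0 H.
  split; last by exact: (@ctr_bound t r r0' (ltW r1) z zr).
  by apply: grh; rewrite reD /=; have := cm_Re z; rewrite ler_norml => /andP[]; lra.
move=> P1 P2 P3; split=> // z zr; have d0 : 0 < r - cm z by (move: zr; drop; lra).
  apply: (le_trans (P2 z zr)).
  by rewrite ler_pM2r ?invr_gt0 ?exprn_gt0 // ler_pM2r // ler_pM2l // ctr_A.
apply: le_trans (P3 z zr); apply: ler_pM; rewrite ?expR_ge0 //; first by have := ctr_lower t; (drop; lra).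
by rewrite ler_expR lerN2 ler_pM2r ?invr_gt0 // ler_wpM2r ?cm_ge0 // ler_pM2l // ctr_A.
Qed.

(** Let sg = Re w. For sg >= 5/2 the Dirichlet series gives a constant. For sg <= 3/2 the disc about
    2 + i t of radius 3/2 - sg/2 contains the point with a gap sg/2, whose square is the source of
    sg^(-2). In between the radius 5/4 leaves a gap of at least 1/4. *)
Lemma F_crude : exists K, 0 <= K /\ forall w, 0 < complex.Re w ->
  cm (Fw w) <= K * lg (complex.Im w) * (1 + (complex.Re w) ^- 2).
Proof.
have a1 := A0_ge1; exists (40 * A0 + 2); split; first lra.
move=> w w0; set sg := complex.Re w in w0 *; set t := complex.Im w.
have l1 := lg_ge1 t.
have i0 : 0 <= sg ^- 2 by rewrite invr_ge0 sqr_ge0.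
have Al : 1 <= A0 * lg t by nra.
have [big|small] := leP (5/2) sg.
  rewrite /Fw cmN; have h3 : 3 <= complex.Re (hlf + w) by rewrite reD /= -/sg; lra.
  have := @F_bound R q psi q0 psiq psi1 psi0 psi_one psiM _ h3 => /le_trans; apply.
  have : 2 <= (40 * A0 + 2) * lg t by nra.
  set X := (40 * A0 + 2) * lg t => X2; rewrite mulrDr mulr1.
  have : 0 <= X * sg ^- 2 by rewrite mulr_ge0 //; (move: X2; drop; lra).
  (move: X2; drop; lra).
rewrite /Fw cmN (split_w w 2) -/sg -/t -/(ctr t).
have E : cm ((2^-1 + sg - 2)%:C : C) = `|sg - 3/2| by rewrite cm_real; congr `|_|; lra.
have [s1|s1] := leP sg (3/2).
  have r0 : 0 < 3/2 - sg / 2 by lra.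
  have r1 : 3/2 - sg / 2 < 3/2 by lra.
  have [_ H _] := ctr_BC t r0 r1.
  have E2 : cm ((2^-1 + sg - 2)%:C : C) = 3/2 - sg.
    by rewrite E ler0_norm; (move: s1; drop; lra).
  have zr : cm ((2^-1 + sg - 2)%:C : C) < 3/2 - sg / 2 by rewrite E2; (move: r1; drop; lra).
  apply: (le_trans (H _ zr)); rewrite E2.
  have -> : 3/2 - sg / 2 - (3/2 - sg) = sg / 2 by (drop; lra).
  have -> : 2 * (A0 * lg t) * (3/2 - sg / 2) / (sg / 2) ^+ 2 = 8 * (A0 * lg t) * (3/2 - sg/2) * sg ^- 2.
    by rewrite expr_div_n; field; exact: lt0r_neq0.
  have b1 : 8 * (A0 * lg t) * (3/2 - sg/2) <= (40 * A0 + 2) * lg t by (move: w0 l1 Al; drop; nra).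
  have := ler_wpM2r i0 b1; set X := (40 * A0 + 2) * lg t.
  have : 0 <= X by rewrite /X; (move: a1 l1; drop; nra).
  (drop; lra).
have r0 : 0 < 5/4 :> R by lra.
have r1 : 5/4 < 3/2 :> R by lra.
have [_ H _] := ctr_BC t r0 r1.
have E2 : cm ((2^-1 + sg - 2)%:C : C) <= 1 by rewrite E ger0_norm; (move: small s1; drop; lra).
have zr : cm ((2^-1 + sg - 2)%:C : C) < 5/4 by (move: E2; drop; lra).
apply: (le_trans (H _ zr)).
have b2 : (5/4 - cm ((2^-1 + sg - 2)%:C : C)) ^- 2 <= 16.
  have e4 : 16 = ((1/4) ^+ 2)^-1 :> R by rewrite expr2; field.
  rewrite e4 lef_pV2 ?posrE ?exprn_gt0 //; try (move: E2; drop; lra).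
  by rewrite lerXn2r ?nnegrE; (move: E2; drop; lra).
apply: (@le_trans _ _ (2 * (A0 * lg t) * (5/4) * 16)); first by rewrite ler_wpM2l //; (move: a1 l1; drop; nra).
rewrite mulrDr mulr1; set X := (40 * A0 + 2) * lg t.
have x1 : 2 * (A0 * lg t) * (5/4) * 16 <= X by rewrite /X; (move: l1; drop; nra).
have : 0 <= X * sg ^- 2 by rewrite mulr_ge0 // /X; (move: a1 l1; drop; nra).
(move: x1; drop; lra).
Qed.

(** The disc of radius 1/2 about this point stays in Re s >= 1/64, where L is bounded by its series,
    while the disc of radius 1/32 already contains all 1/2 + w with 0 < Re w <= 1/64 and |Im w - t|
    <= 1/64. *)
Definition loc t : C := (2^-1 + 64^-1) +i* t.

(** The point is at distance 3/2 - 1/64 from 2 + i t, inside a zero-free disc of radius 3/2 - 1/128.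
    The gap 1/128 yields an exponent below 2 * 128 * (3/2) = 384 times [A0] lg t. *)
Lemma loc_lower t : 3/40 * expR (- (384 * (A0 * lg t))) <= cm (LL (loc t)).
Proof.
have r0 : 0 < 3/2 - 128^-1 :> R by lra.
have r1 : 3/2 - 128^-1 < 3/2 :> R by lra.
have [_ _ H] := ctr_BC t r0 r1.
have E : loc t = ctr t + (- (3/2 - 64^-1))%:C.
  by apply: complex_eq; rewrite !(reD, imD) /=; (drop; lra).
have E2 : cm ((- (3/2 - 64^-1))%:C : C) = 3/2 - 64^-1 by rewrite cm_real normrN ger0_norm; (drop; lra).
have zr : cm ((- (3/2 - 64^-1))%:C : C) < 3/2 - 128^-1 by rewrite E2; lra.
rewrite E; apply: le_trans (H _ zr); rewrite ler_wpM2l //.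
rewrite ler_expR lerN2 E2.
have -> : 3/2 - 128^-1 - (3/2 - 64^-1) = 128^-1 :> R by (drop; lra).
rewrite invrK; have a1 := A0_ge1; have l1 := lg_ge1 t; have : 0 <= A0 * lg t by (move: a1 l1; drop; nra).
(drop; lra).
Qed.

(** The poles [cs] depend on sg: they are zeros of a polynomial approximating L, and GRH keeps them
    to the left of sg/2 because L is bounded below on the part of the disc with Re s >= 1/2 + sg/2.
    Points with Re w >= sg are thus at distance at least sg/2 from every pole. *)
Lemma F_local : exists K, 0 <= K /\ forall t sg, 0 < sg -> exists cs : seq C,
  [/\ (size cs)%:R <= K * lg t,
   forall c, c \in cs -> complex.Re c <= sg / 2,
   forall w c, c \in cs -> 0 < complex.Re w -> complex.Re w <= 64^-1 -> `|complex.Im w - t| <= 64^-1 -> cm (w - c) <= 1 &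
   forall w, sg <= complex.Re w -> complex.Re w <= 64^-1 -> `|complex.Im w - t| <= 64^-1 ->
     cm (Fw w) <= \sum_(c <- cs) (cm (w - c))^-1 + K * lg t].
Proof.
have a1 := A0_ge1.
pose K1 : R := ln (200 * 200 * q%:R) + 1 + 384 * A0.
have K10 : 0 <= K1.
  have : 0 <= ln (200 * 200 * q%:R : R) by rewrite ln_ge0 //; have := q1; set Q := q%:R; lra.
  rewrite /K1; lra.
exists (128 * K1 + 1); split; first lra.
move=> t sg sg0; have l1 := lg_ge1 t; have t0 := normr_ge0 t.
have R0 : 0 < 2^-1 :> R by lra.
have R0' := ltW R0.
have H : Hol 2^-1 (fun z => LL (loc t + z)) (fun z => LD (loc t + z)).
  by apply: (@L_Hol R q psi q0 psiq psi1 psi0) => //=; (drop; lra).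
have Mb z : cm z <= 2^-1 -> cm (LL (loc t + z)) <= 500 * q%:R * (`|t| + 4).
  move=> zr; have := cm_Re z; rewrite ler_norml => /andP[h1 _].
  have s2 : 0 < 64^-1 :> R by (drop; lra).
  have s1 : 64^-1 <= complex.Re (loc t + z) by rewrite reD /=; (move: zr h1; drop; lra).
  apply: (le_trans (@L_bound R q psi q0 psiq psi1 psi0 _ _ s2 s1)).
  have cb : cm (loc t + z) <= `|t| + 4.
    apply: (le_trans (cm_D _ _)); have := cm_le_ReIm (loc t); rewrite /= ger0_norm; (move: zr; drop; lra).
  have -> : 2 + 64^-1^-1 = 66 :> R by rewrite invrK; ring.
  have t4 : 4 <= `|t| + 4 by rewrite lerDr.
  move: q1 t4 cb; set Q := q%:R; set T := `|t| + 4; set cc := cm _; (drop; nra).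
have lowL := loc_lower t.
have L0 : 0 < cm (LL (loc t + 0)).
  by rewrite addr0; apply: lt_le_trans lowL; rewrite mulr_gt0 ?expR_gt0 //; lra.
have Ln0 : LL (loc t + 0) != 0 by rewrite -cm_gt0.
pose Z : set C := [set z | 2^-1 + sg / 2 <= complex.Re (loc t + z)].
have [lipK [_ lip]] := Hol_lip R0' H.
have [z nZ|z zr Zz|d [d0 Hd]] := @disc_min R (fun z => LL (loc t + z)) 2^-1 lipK R0' lip Z.
- have {}nZ : complex.Re (loc t + z) < 2^-1 + sg / 2 by rewrite ltNge; apply/negP.
  exists (2^-1 + sg / 2 - complex.Re (loc t + z)); split; first (move: nZ; drop; lra).
  move=> w h Zw; have := cm_Re (w - z); rewrite reD reN ler_norml => /andP[_ h2].
  by move: Zw nZ h; rewrite /Z /= !reD; (move: h2; drop; lra).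
- by apply: grh; move: Zz; rewrite /Z /=; (move: sg0; drop; lra).
have [rs [s1 s2 s3]] := Hol_local R0 H Mb Ln0 d0 Hd.
have AA : ln (4 * (500 * q%:R * (`|t| + 4)) / cm (LL (loc t + 0))) <= K1 * lg t.
  have T0 : 0 < `|t| + 4 by (move: t0; drop; lra).
  have QT : 0 < q%:R * (`|t| + 4) :> R by rewrite mulr_gt0 // ltr0n.
  have P1 : 0 < 4 * (500 * q%:R * (`|t| + 4)) :> R by rewrite -(mulrA _ q%:R); move: QT; set X := _ * _; (drop; lra).
  have P2 : 0 < 200 * 200 * q%:R :> R by have := q1; set X := q%:R; (drop; lra).
  set EE := expR (384 * (A0 * lg t)); have e0 : 0 < EE := expR_gt0 _.
  have P3 : 0 < 200 * 200 * q%:R * (`|t| + 4) :> R by rewrite mulr_gt0.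
  have P4 : 0 < 200 * 200 * q%:R * (`|t| + 4) * EE :> R by rewrite mulr_gt0.
  apply: (@le_trans _ _ (ln (200 * 200 * q%:R * (`|t| + 4) * EE))).
    rewrite ler_ln; [|by rewrite posrE; exact: divr_gt0|by rewrite posrE; exact: P4].
    rewrite ler_pdivrMr //.
    have h : 200 * 200 * q%:R * (`|t| + 4) * EE * (3/40 * EE^-1) <= 200 * 200 * q%:R * (`|t| + 4) * EE * cm (LL (loc t + 0)).
      by rewrite addr0; apply: ler_wpM2l; [exact: ltW|rewrite /EE -expRN].
    apply: le_trans h.
    have -> : 200 * 200 * q%:R * (`|t| + 4) * EE * (3/40 * EE^-1) = 200 * 15 * (q%:R * (`|t| + 4)).
      by field; exact: lt0r_neq0.
    rewrite -(mulrA _ q%:R); move: QT; set X := q%:R * _; (drop; lra).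
  rewrite lnM ?posrE // /EE expRK lnM ?posrE //.
  rewrite -/(lg t) /K1.
  have : 0 <= ln (200 * 200 * q%:R : R) by rewrite ln_ge0 //; have := q1; set Q := q%:R; (drop; lra).
  set W := ln (200 * 200 * q%:R); (move: l1; drop; nra).
set LA := ln _ in s1 s3 AA.
(* Zeros are found in the coordinate centred at [loc t]; adding [sh] moves them to the coordinate w
   = s - 1/2. *)
pose sh : C := loc t - hlf.
have shE : hlf + sh = loc t by rewrite /sh addrC subrK.
exists [seq a + sh | a <- rs]; split.
- rewrite size_map; apply: (le_trans s1); have : 0 <= K1 * lg t by rewrite mulr_ge0 //; (move: l1; drop; lra).
  (move: l1 AA; drop; nra).
- move=> c /mapP [a /s2 [nZ _] ->].
  have {}nZ : complex.Re (loc t + a) < 2^-1 + sg / 2 by rewrite ltNge; apply/negP.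
  by move: nZ; rewrite !(reD, reN) /=; (drop; lra).
- move=> w c /mapP [a /s2 [_ ca] ->] w0 w1 wt.
  have -> : w - (a + sh) = (w - sh) - a by ring.
  apply: (le_trans (cm_subD _ _)); have : cm (w - sh) <= 32^-1.
    apply: (le_trans (cm_le_ReIm _)); rewrite !(reD, imD, reN, imN) /= oppr0 addr0.
    have : `|complex.Re w - (2^-1 + 64^-1 - 2^-1)| <= 64^-1 by rewrite ler_norml; apply/andP; split; (move: w0 w1; drop; lra).
    (move: wt; drop; lra).
  (move: ca; drop; lra).
move=> w w0 w1 wt.
have zr : cm (w - sh) <= 2^-1 / 16.
  apply: (le_trans (cm_le_ReIm _)); rewrite !(reD, imD, reN, imN) /= oppr0 addr0.
  have : `|complex.Re w - (2^-1 + 64^-1 - 2^-1)| <= 64^-1 by rewrite ler_norml; apply/andP; split; (move: sg0 w0 w1; drop; lra).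
  (move: wt; drop; lra).
have Ew : loc t + (w - sh) = hlf + w by rewrite -shE; ring.
have Zz : Z (w - sh) by rewrite /Z /= Ew reD /=; (move: sg0 w0; drop; lra).
have := s3 _ zr Zz; rewrite Ew => h.
rewrite /Fw cmN big_map.
have h2 : cm (\sum_(a <- rs) (w - sh - a)^-1) <= \sum_(a <- rs) (cm (w - (a + sh)))^-1.
  apply: (le_trans (cm_sum _ _ _)); apply: ler_sum => a _; rewrite cmV.
  by have -> : w - (a + sh) = w - sh - a by ring.
have := cm_rev (LD (hlf + w) / LL (hlf + w)) (\sum_(a <- rs) (w - sh - a)^-1).
have : 64 * LA / 2^-1 = 128 * LA by rewrite invrK; ring.
have : 0 <= K1 * lg t by rewrite mulr_ge0 //; (move: l1; drop; lra).
(move: l1 AA h h2; drop; nra).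
Qed.

(** Writing L(1/2 + z) = a z^m + b z^(m+1) + ... with a nonzero, L'/L equals m/z + b/a + O(z), hence
    G0 = -b/a. *)
Lemma F_zero : exists (m : nat) (G0 : C) (w0 K : R), [/\ 0 < w0, w0 <= 1, 0 <= K, vanishing_order psi m &
  forall w, 0 < complex.Re w -> cm w <= w0 -> cm (Fw w + m%:R / w - G0) <= K * cm w].
Proof.
have r0 : 0 < 4^-1 :> R by lra.
have H : Hol 4^-1 (fun z => LL (hlf + z)) (fun z => LD (hlf + z)).
  by apply: (@L_Hol R q psi q0 psiq psi1 psi0) => //=; lra.
have [c [M [M0 HT]]] := Hol_taylor r0 H.
(* If every Taylor coefficient vanished, L would vanish at 1/2 + 1/16, against GRH. *)
have ex : exists j, c j != 0.
  apply: contrapT => nex.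
  have c0 j : c j = 0 by apply/eqP; apply: contrapT => /negP cj; apply: nex; exists j.
  pose z : C := (16^-1 : R)%:C.
  have cz : cm z = 16^-1 by rewrite cm_real ger0_norm //; lra.
  have zr : cm z <= 4^-1 / 2 by rewrite cz; lra.
  have : LL (hlf + z) != 0 by apply: grh; rewrite reD /=; lra.
  rewrite -cm_gt0 => L0.
  have q4 : 0 <= 1/4 :> R by lra.
  have q41 : 1/4 < 1 :> R by lra.
  have M1 : 0 < M + 1 by lra.
  have [k Hk] := small_pow q4 q41 (divr_gt0 L0 (mulr_gt0 (ltr0n R 2) M1)).
  have [h _] := HT k z zr.
  have S0 : \sum_(j < k) c j * z ^+ j = 0 by apply: big1 => j _; rewrite c0 mul0r.
  rewrite S0 subr0 cz in h; have E : 16^-1 / 4^-1 = 1/4 :> R by field.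
  rewrite E in h; have h2 := Hk k (leqnn _).
  have p0 : 0 <= (1/4 : R) ^+ k by rewrite exprn_ge0.
  rewrite ler_pdivlMr ?mulr_gt0 // in h2; (move: L0 h p0 h2; drop; nra).
have [m cm0' mmin] := ex_minnP ex.
have cj j : (j < m)%N -> c j = 0.
  by move=> jm; apply/eqP; apply: contraTT jm => /mmin; rewrite -leqNgt.
pose a := c m; pose b := c m.+1.
have a0 : 0 < cm a by rewrite cm_gt0.
pose N4 := (4 : R) ^+ m.+2.
pose K1 := m.+2%:R * M * N4.
have N40 : 0 <= N4 by rewrite exprn_ge0.
have K10 : 0 <= K1 by rewrite /K1 mulr_ge0 // mulr_ge0.
have x4 (z : C) k : (cm z / 4^-1) ^+ k = 4 ^+ k * cm z ^+ k by rewrite invrK exprMn mulrC.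
have m1 : 1 <= m.+2%:R :> R by rewrite ler1n.
have f2 z : cm z <= 8^-1 -> cm (LL (hlf + z) - (a * z ^+ m + b * z ^+ m.+1)) <= K1 * cm z ^+ m.+2.
  move=> zr; have zr' : cm z <= 4^-1 / 2 by (move: zr; drop; lra).
  have [h _] := HT m.+2 z zr'; rewrite !big_ord_recr /= big1 ?add0r in h; last by move=> j _; rewrite cj ?mul0r.
  apply: (le_trans h); rewrite x4 /K1 mulrA ler_wpM2r ?exprn_ge0 ?cm_ge0 //.
  by rewrite ler_wpM2r // ler_peMl.
have f1 z : cm z <= 8^-1 -> cm (z * LD (hlf + z) - (m%:R * a * z ^+ m + m.+1%:R * b * z ^+ m.+1)) <= K1 * cm z ^+ m.+2.
  move=> zr; have zr' : cm z <= 4^-1 / 2 by (move: zr; drop; lra).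
  have [_ h] := HT m.+1 z zr'.
  have E : m%:R * a * z ^+ m + m.+1%:R * b * z ^+ m.+1 = z * \sum_(j < m.+1) j.+1%:R * c j.+1 * z ^+ j.
    rewrite big_ord_recr /= mulrDr [z ^+ m.+1]exprS; congr (_ + _); last by rewrite /b; ring.
    rewrite /a; case: (m) cj => [|m'] cj; first by rewrite big_ord0 mulr0 !mul0r.
    rewrite big_ord_recr /= big1 ?add0r; first by rewrite exprS; ring.
    by move=> j _; rewrite cj ?mulr0 ?mul0r // ltnS.
  rewrite E -mulrBr cmM exprS.
  have -> : K1 * (cm z * cm z ^+ m.+1) = cm z * (K1 * cm z ^+ m.+1) by ring.
  rewrite ler_wpM2l ?cm_ge0 //; apply: (le_trans h); rewrite x4 /K1 mulrA.
  rewrite ler_wpM2r ?exprn_ge0 ?cm_ge0 // ler_wpM2l ?mulr_ge0 //.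
  by rewrite /N4 ler_eXn2l // ltr1n.
pose W := cm b + K1.
have W0 : 0 <= W by rewrite addr_ge0 ?cm_ge0.
have f0 z : cm z <= 8^-1 -> cm (LL (hlf + z) - a * z ^+ m) <= W * cm z ^+ m.+1.
  move=> zr; have zp := exprn_ge0 m.+1 (cm_ge0 z).
  have := cm_tri (LL (hlf + z)) (a * z ^+ m) (a * z ^+ m + b * z ^+ m.+1).
  have -> : a * z ^+ m + b * z ^+ m.+1 - a * z ^+ m = b * z ^+ m.+1 by ring.
  move/le_trans; apply; rewrite cmM cmX /W mulrDl addrC lerD2l; apply: (le_trans (f2 z zr)).
  by rewrite ler_wpM2l // exprS ler_piMl //; (move: zr; drop; lra).
pose w0 := Num.min 8^-1 (cm a / (2 * (W + 1))).
have W1 : 0 < 2 * (W + 1) by (move: W0; drop; lra).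
have w00 : 0 < w0 by rewrite lt_min divr_gt0 // andbT; (drop; lra).
have w08 : w0 <= 8^-1 by rewrite ge_min lexx.
have w0a : w0 * (2 * (W + 1)) <= cm a by rewrite -ler_pdivlMr // ge_min lexx orbT.
have low z : cm z <= w0 -> cm a / 2 * cm z ^+ m <= cm (LL (hlf + z)).
  move=> zr; have z8 : cm z <= 8^-1 by (move: w08 zr; drop; lra).
  have := f0 z z8; have := cm_rev (a * z ^+ m) (LL (hlf + z)); rewrite cmB cmM cmX exprS.
  have zp := exprn_ge0 m (cm_ge0 z); have z0 := cm_ge0 z.
  have : W * cm z <= cm a / 2.
    have : (W + 1) * cm z <= (W + 1) * w0 by rewrite ler_wpM2l //; (move: W1; drop; lra).
    (move: w0a z0; drop; lra).
  set X := cm z ^+ m => h1 h2 h3.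
  have h4 : W * (cm z * X) <= cm a / 2 * X by rewrite mulrA ler_wpM2r.
  have E4 : cm a * X = cm a / 2 * X + cm a / 2 * X by field.
  (move: h2 h3 h4; drop; lra).
pose G0 := - (b / a).
pose K2 := K1 + m%:R * K1 + cm (b * b / a) + cm (b / a) * K1.
have K20 : 0 <= K2 by rewrite /K2 !addr_ge0 ?cm_ge0 // mulr_ge0 // cm_ge0.
exists m, G0, w0, (2 * K2 / cm a); split => //; first (move: w08; drop; lra).
- by rewrite divr_ge0 ?cm_ge0 // mulr_ge0.
- exists a => //; apply/cvgrPdist_le => e e0.
  have eE : e = (complex.Re e)%:C by move: e0; case: e => u v; rewrite ltcE /= => /andP[/eqP -> _].
  have e0' : 0 < complex.Re e by move: e0; rewrite ltcE => /andP[_].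
  pose d := Num.min 8^-1 (complex.Re e / (W + 1)).
  have W2 : 0 < W + 1 by (move: W0; drop; lra).
  have d0 : 0 < d by rewrite lt_min divr_gt0 // andbT; (drop; lra).
  apply/nbhs_ballP; exists d%:C => /=; first by rewrite ltcR.
  move=> s; rewrite /ball /= => sd sn.
  have {}sd : cm (s - hlf) < d by move: sd; rewrite distrC cmE ltcR.
  have sn0 : s - hlf != 0 by rewrite subr_eq0.
  have Es : s = hlf + (s - hlf) by ring.
  have s8 : cm (s - hlf) <= 8^-1 by apply: (le_trans (ltW sd)); rewrite ge_min lexx.
  have := f0 _ s8; rewrite -Es => h.
  rewrite eE cmE lecR cmB.
  have zm : (s - hlf) ^+ m != 0 by rewrite expf_neq0.
  have -> : LL s / (s - (2^-1)%:C) ^+ m - a = (LL s - a * (s - hlf) ^+ m) / (s - hlf) ^+ m by field.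
  rewrite cmM cmV cmX ler_pdivrMr ?exprn_gt0 ?cm_gt0 //.
  apply: (le_trans h); rewrite exprS mulrA ler_wpM2r ?exprn_ge0 ?cm_ge0 //.
  have : cm (s - hlf) <= complex.Re e / (W + 1) by apply: (le_trans (ltW sd)); rewrite ge_min lexx orbT.
  rewrite ler_pdivlMr // => h2; have := cm_ge0 (s - hlf); (move: h2; drop; nra).
move=> w wre ww; have w8 : cm w <= 8^-1 by (move: w08 ww; drop; lra).
have wn : w != 0 by apply/eqP => w00'; rewrite w00' /= ltxx in wre.
have cw : 0 < cm w by rewrite cm_gt0.
have Ln : LL (hlf + w) != 0 by apply: grh; rewrite reD /=; (move: wre; drop; lra).
have an : a != 0 by rewrite -cm_gt0.
set f := LL (hlf + w) in Ln; set g := LD (hlf + w).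
pose E1 := w * g - (m%:R * a * w ^+ m + m.+1%:R * b * w ^+ m.+1).
pose E2 := f - (a * w ^+ m + b * w ^+ m.+1).
have e1 : cm E1 <= K1 * cm w ^+ m.+2 by exact: f1.
have e2 : cm E2 <= K1 * cm w ^+ m.+2 by exact: f2.
(* The terms of order m and m + 1 in the numerator cancel by the choice of G0; what is left has
   order m + 2, one more than the denominator. *)
have ID : Fw w + m%:R / w - G0 = (- E1 + m%:R * E2 + b * b / a * w ^+ m.+2 + b / a * w * E2) / (w * f).
  rewrite /Fw -/f -/g /G0 /E1 /E2 -[m.+1%:R]natr1 !exprS; field.
  by rewrite Ln wn an.
have low' := low w ww; rewrite -/f in low'.
rewrite ID cmM cmV ler_pdivrMr ?cm_gt0 ?mulf_neq0 //.
apply: (@le_trans _ _ (K2 * cm w ^+ m.+2)).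
  apply: (le_trans (cm_D _ _)); apply: (le_trans (lerD (cm_D _ _) (lexx _))).
  apply: (le_trans (lerD (lerD (cm_D _ _) (lexx _)) (lexx _))).
  rewrite cmN (cmM m%:R) cm_nat (cmM (b * b / a)) cmX (cmM (b / a * w)) (cmM (b / a)) /K2 !mulrDl.
  have p0 : 0 <= cm w ^+ m.+2 by rewrite exprn_ge0 ?cm_ge0.
  apply: lerD; [apply: lerD; [apply: lerD|]|] => //.
    by rewrite -mulrA ler_wpM2l.
  rewrite -mulrA; apply: (@le_trans _ _ (cm (b / a) * (1 * (K1 * cm w ^+ m.+2)))).
    rewrite ler_wpM2l ?cm_ge0 //; apply: ler_pM; rewrite ?cm_ge0 //; (move: w8; drop; lra).
  by apply: le_eq; ring.
rewrite cmM.
have -> : K2 * cm w ^+ m.+2 = 2 * K2 / cm a * cm w * (cm w * (cm a / 2 * cm w ^+ m)).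
  by rewrite !exprS; field; exact: lt0r_neq0.
apply: ler_wpM2l; first by rewrite mulr_ge0 ?cm_ge0 // divr_ge0 ?cm_ge0 // mulr_ge0.
by apply: ler_wpM2l => //; exact: cm_ge0.
Qed.

End Analytic.

(** * Sums over a circle *)

Section PapInverse.
Variable R : realType.
Local Notation C := R[i].
Implicit Types (z w c : C) (x y t e r : R) (f g : C -> C).

Lemma Pap_inv_linear (a : C) r : 0 <= r -> r < cm a -> Pap r (fun z => (z - a)^-1).
Proof.
move=> r0 ra e e0; have a0 : 0 < cm a by lra.
have an : a != 0 by rewrite -cm_gt0.
have x0 : 0 <= r / cm a by rewrite divr_ge0 // ltW.
have x1 : r / cm a < 1 by rewrite ltr_pdivrMr // mul1r.
have d0 : 0 < cm a - r by lra.
have [n /(_ n (leqnn n)) Hn] := small_pow x0 x1 (mulr_gt0 e0 d0).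
exists (- a^-1 *: \sum_(k < n) (a^-1 *: 'X) ^+ k) => z zr.
rewrite hornerZ horner_sum.
have -> : \sum_(i < n) ((a^-1 *: 'X) ^+ i).[z] = \sum_(i < n) (z / a) ^+ i.
  by apply: eq_bigr => i _; rewrite horner_exp hornerZ hornerX mulrC.
have za : z - a != 0 by apply/eqP => /subr0_eq h; rewrite h in zr; lra.
have E := subrX1 (z / a) n.
set S := \sum_(i < n) _ in E *.
have -> : - a^-1 * S - (z - a)^-1 = - ((z / a) ^+ n / (z - a)).
  have -> : (z / a) ^+ n = (z / a - 1) * S + 1 by rewrite -E subrK.
  by field; rewrite an za.
rewrite cmN cmM cmV cmX cmM cmV ler_pdivrMr ?cm_gt0 //.
have h1 : (cm z / cm a) ^+ n <= (r / cm a) ^+ n.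
  by rewrite lerXn2r ?nnegrE ?divr_ge0 ?cm_ge0 // ler_pM2r // invr_gt0.
apply: (le_trans h1); apply: (le_trans Hn); rewrite ler_pM2l // cmB.
have := cm_rev a z; lra.
Qed.

Lemma Pap_inv_rpoly (rs : seq C) r : 0 <= r -> (forall a, a \in rs -> r < cm a) ->
  Pap r (fun z => (rpoly rs).[z]^-1).
Proof.
move=> r0; elim: rs => [|a rs IH] far.
  by apply: Pap_ext (@Pap_const R r 1) => z _; rewrite rpolyE big_nil invr1.
have h1 : Pap r (fun z => (z - a)^-1) by apply: Pap_inv_linear => //; apply: far; rewrite mem_head.
have h2 : Pap r (fun z => (rpoly rs).[z]^-1).
  by apply: IH => b brs; apply: far; rewrite inE brs orbT.
apply: Pap_ext (Pap_mul r0 h1 h2) => z _.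
by rewrite !rpolyE big_cons invfM.
Qed.

Lemma Pap_inv_poly (p : {poly C}) r : 0 <= r -> (forall z, cm z <= r -> p.[z] != 0) -> Pap r (fun z => p.[z]^-1).
Proof.
move=> r0 nz; have [rs E] := poly_factor p.
have far a : a \in rs -> r < cm a.
  move=> ars; rewrite ltNge; apply/negP => ar; have := nz a ar.
  by rewrite E hornerZ rpolyE (big_rem a) //= subrr mul0r mulr0 eqxx.
apply: Pap_ext (Pap_mul r0 (@Pap_const R r (lead_coef p)^-1) (Pap_inv_rpoly r0 far)) => z _.
by rewrite -invfM -hornerZ -E.
Qed.

(** The inverse is approximated by 1/p for a polynomial p without zeros in the disc, and 1/p is a
    product of factors 1 / (z - a), each the sum of a geometric series. *)
Lemma Hol_inv r f g : 0 <= r -> Hol r f g -> (forall z, cm z <= r -> f z != 0) -> Pap r (fun z => (f z)^-1).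
Proof.
move=> r0 H nz; have [K [K0 lip]] := Hol_lip r0 H.
have [z nZ|z zr _|d [d0 Hd]] := @disc_min R f r K r0 lip setT; [by case: nZ|exact: nz|].
apply: Pap_lim => e e0.
pose e1 := Num.min (d / 2) (e * (d ^+ 2 / 2)).
have dd : 0 < d ^+ 2 / 2 by rewrite divr_gt0 // exprn_gt0.
have e10 : 0 < e1 by rewrite lt_min divr_gt0 //= mulr_gt0.
have [p Hp] := Hol_Pap H e10.
have pd z : cm z <= r -> d / 2 <= cm p.[z].
  move=> zr; have h1 := Hp z zr; have h2 := Hd z zr I; have h3 := cm_rev (f z) p.[z].
  have : e1 <= d / 2 by rewrite ge_min lexx.
  rewrite (cmB p.[z] (f z)) in h1; lra.
have pn z : cm z <= r -> p.[z] != 0.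
  by move=> zr; rewrite -cm_gt0; apply: lt_le_trans (pd z zr); rewrite divr_gt0.
exists (fun z => p.[z]^-1); split; first exact: Pap_inv_poly.
move=> z zr; have fz := nz z zr; have pz := pn z zr.
have -> : p.[z]^-1 - (f z)^-1 = (f z - p.[z]) / (p.[z] * f z) by field; rewrite pz fz.
rewrite cmM cmV cmM cmB ler_pdivrMr ?mulr_gt0 ?cm_gt0 //.
apply: (le_trans (Hp z zr)); apply: (@le_trans _ _ (e * (d ^+ 2 / 2))); first by rewrite ge_min lexx orbT.
rewrite ler_pM2l // expr2 mulrAC; apply: ler_pM; rewrite ?divr_ge0 ?(ltW d0) //; [exact: pd|exact: Hd].
Qed.

End PapInverse.

(** * Counting indices by their distance on a cycle *)

Section Counting.
Variable R : realType.
Local Notation C := R[i].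
Implicit Types (x y t e r L : R).

Lemma count_interval x y K : x <= y -> \sum_(k < K) ((x <= k%:R <= y)%R%:R : R) <= y - x + 1.
Proof.
(* The induction on K needs the bound for the interval cut off at the last index. *)
move=> xy; suff : \sum_(k < K) ((x <= k%:R <= y)%R%:R : R) <= Num.max 0 (Num.min (K%:R - 1) y - x + 1).
  move=> h; apply: (le_trans h); rewrite ge_max; apply/andP; split; first lra.
  by rewrite lerD2r lerD2r ge_min lexx orbT.
elim: K => [|K IH]; first by rewrite big_ord0 le_max lexx.
rewrite big_ord_recr /= -natr1 addrK; case: (boolP (x <= K%:R <= y)) => [/andP[h1 h2]|_].
  rewrite /= (min_l h2) le_max; apply/orP; right; rewrite lerD2r.
  apply: (le_trans IH); rewrite ge_max; apply/andP; split; first lra.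
  have : Num.min (K%:R - 1) y <= K%:R - 1 by rewrite ge_min lexx.
  lra.
rewrite /= addr0; apply: (le_trans IH); rewrite ge_max !le_max lexx /=; apply/orP; right.
rewrite lerD2r lerD2r le_min !ge_min; apply/andP; split; last by rewrite lexx orbT.
by apply/orP; left; lra.
Qed.

Lemma cdist_cases N j j0 : (j < N)%N -> (j0 < N)%N ->
  [\/ cdist N j j0 = j - j0 /\ (j0 <= j),
      cdist N j j0 = j0 - j /\ (j <= j0),
      (cdist N j j0 + j = j0 + N) |
      (cdist N j j0 + j0 = j + N)]%N.
Proof.
move=> jN j0N; rewrite /cdist.
have [h|h] := leqP (j - j0 + (j0 - j)) (N - (j - j0 + (j0 - j))).
  by have [h2|h2] := leqP j0 j; [apply: Or41|apply: Or42]; split; lia.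
by have [h2|h2] := leqP j0 j; [apply: Or43|apply: Or44]; lia.
Qed.

(** Four intervals occur: j before or after j0, reached directly or around the cycle. *)
Lemma count_cdist N j0 x y : (j0 < N)%N -> x <= y ->
  \sum_(j < N) ((x <= (cdist N j j0)%:R <= y)%R%:R : R) <= 4 * (y - x + 1).
Proof.
move=> j0N xy.
have h1 := count_interval N (_ : j0%:R + x <= j0%:R + y).
have h2 := count_interval N (_ : j0%:R - y <= j0%:R - x).
have h3 := count_interval N (_ : j0%:R + N%:R - y <= j0%:R + N%:R - x).
have h4 := count_interval N (_ : j0%:R - N%:R + x <= j0%:R - N%:R + y).
have {}h1 := h1 (ltac:(lra)); have {}h2 := h2 (ltac:(lra)); have {}h3 := h3 (ltac:(lra)); have {}h4 := h4 (ltac:(lra)).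
have : \sum_(j < N) ((x <= (cdist N j j0)%:R <= y)%R%:R : R) <=
  \sum_(j < N) ((j0%:R + x <= j%:R <= j0%:R + y)%R%:R : R) + \sum_(j < N) ((j0%:R - y <= j%:R <= j0%:R - x)%R%:R : R) +
  \sum_(j < N) ((j0%:R + N%:R - y <= j%:R <= j0%:R + N%:R - x)%R%:R : R) +
  \sum_(j < N) ((j0%:R - N%:R + x <= j%:R <= j0%:R - N%:R + y)%R%:R : R).
  rewrite -!big_split /=; apply: ler_sum => j _.
  have [h|h] := boolP (x <= (cdist N j j0)%:R <= y); last by rewrite !addr_ge0.
  move/andP: h => [a b].
  have g0 (u : bool) : 0 <= (u%:R : R) by [].
  case: (cdist_cases (ltn_ord j) j0N) => [[E jj]|[E jj]|E|E].
  - rewrite E natrB // in a b.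
    have -> : (j0%:R + x <= j%:R <= j0%:R + y) = true :> bool by apply/andP; split; lra.
    by rewrite -!addrA lerDl !addr_ge0.
  - rewrite E natrB // in a b.
    have -> : (j0%:R - y <= j%:R <= j0%:R - x) = true :> bool by apply/andP; split; lra.
    by rewrite -!addrA addrCA lerDl !addr_ge0.
  - have {}E : (cdist N j j0)%:R + j%:R = j0%:R + N%:R :> R by rewrite -!natrD E.
    have -> : (j0%:R + N%:R - y <= j%:R <= j0%:R + N%:R - x) = true :> bool by apply/andP; split; lra.
    by rewrite addrAC lerDr !addr_ge0.
  - have {}E : (cdist N j j0)%:R + j0%:R = j%:R + N%:R :> R by rewrite -!natrD E.
    have -> : (j0%:R - N%:R + x <= j%:R <= j0%:R - N%:R + y) = true :> bool by apply/andP; split; lra.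
    by rewrite lerDr !addr_ge0.
lra.
Qed.

(** The indices are sorted by the integer part of their cyclic distance divided by L; one class has
    at most 4 (L + 1) <= 8 L members. *)
Lemma circ_classes N j0 L K (P : pred nat) (G gam : nat -> R) : (j0 < N)%N -> 1 <= L -> (forall k, 0 <= gam k) ->
  (forall j, (j < N)%N -> P j -> forall k, k%:R * L <= (cdist N j j0)%:R -> (k < K)%N /\ G j <= gam k) ->
  \sum_(j < N | P j) G j <= 8 * L * \sum_(k < K) gam k.
Proof.
move=> j0N L1 g0 H.
apply: (@le_trans _ _ (\sum_(j < N) \sum_(k < K) gam k * ((k%:R * L <= (cdist N j j0)%:R <= k%:R * L + L)%R%:R))).
  rewrite big_mkcond /=; apply: ler_sum => j _.
  have s0 : 0 <= \sum_(k < K) gam k * (k%:R * L <= (cdist N j j0)%:R <= k%:R * L + L)%R%:R.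
    by apply: sumr_ge0 => k _; rewrite mulr_ge0.
  case: ifP => // Pj.
  pose d : R := (cdist N j j0)%:R / L.
  have L0 : 0 < L by lra.
  have d0 : 0 <= d by rewrite divr_ge0 // ltW.
  have /andP[k1 k2] := truncn_itv d0.
  set k := Num.truncn d in k1 k2.
  rewrite ler_pdivlMr // in k1.
  rewrite ltr_pdivrMr // in k2.
  have [kK Gk] := H j (ltn_ord j) Pj k k1.
  apply: (le_trans Gk); rewrite (bigD1 (Ordinal kK)) //= k1 /=.
  have -> : (cdist N j j0)%:R <= k%:R * L + L.
    by apply: ltW; move: k2; rewrite -natr1 mulrDl mul1r.
  rewrite mulr1 lerDl; apply: sumr_ge0 => i _; by rewrite mulr_ge0.
rewrite exchange_big /= mulr_sumr; apply: ler_sum => k _; rewrite -mulr_sumr mulrC ler_wpM2r //.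
apply: (le_trans (count_cdist j0N _)); lra.
Qed.

Lemma harmonic_le K : \sum_(k < K.+1) (k.+1%:R^-1 : R) <= 1 + ln K.+1%:R.
Proof.
elim: K => [|K IH]; first by rewrite big_ord_recr big_ord0 /= invr1 ln1; lra.
rewrite big_ord_recr /=; have := @ln_succ_ge R K.+1 isT.
set S := \sum_(_ < _) _ in IH *; set u := ln _ in IH *; set v := ln _; set w := _^-1; lra.
Qed.

End Counting.

(** * Sums over the points w_j of the circle *)

Section Circle.
Variable R : realType.
Local Notation C := R[i].
Variables (a rho : R) (N : nat).
Hypothesis a0 : 0 < a.
Hypothesis rho0 : 2^-1 <= rho.
Hypothesis rho1 : rho <= 1.
Hypothesis N0 : (0 < N)%N.
Implicit Types (c : C) (d : R).

Lemma rho_ge0 : 0 <= rho.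
Proof. by apply: le_trans rho0; rewrite invr_ge0. Qed.

(* The point w = a (1 - z) for z on the circle of radius [rho]. *)
Definition cpt (j : nat) : C := a%:C * (1 - rho%:C * om R N ^+ j).

Lemma cpt_Re j : a * (1 - rho) <= complex.Re (cpt j).
Proof.
rewrite reMr ler_pM2l // reD reN reMr /=; have := cm_Re (om R N ^+ j); rewrite cm_omX ler_norml => /andP[_ h].
by rewrite lerD2l lerN2 ler_piMr // rho_ge0.
Qed.

Lemma cpt_dist j k : (j < N)%N -> (k < N)%N -> a * (cdist N j k)%:R / N%:R <= cm (cpt j - cpt k).
Proof.
move=> jN kN; have -> : cpt j - cpt k = (- (a * rho))%:C * (om R N ^+ j - om R N ^+ k).
  by rewrite /cpt rmorphN rmorphM /=; ring.
rewrite cmM cm_real normrN ger0_norm; last by rewrite mulr_ge0 ?rho_ge0 // ltW.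
have h := @om_dist R N j k jN kN.
apply: (@le_trans _ _ (a * rho * (2 * (cdist N j k)%:R / N%:R))); last by rewrite ler_wpM2l // mulr_ge0 ?rho_ge0 // ltW.
have D0 : 0 <= (cdist N j k)%:R / N%:R :> R by rewrite divr_ge0.
have r2 : 1 <= rho * 2 by rewrite -ler_pdivrMr // div1r.
have -> : a * rho * (2 * (cdist N j k)%:R / N%:R) = (rho * 2) * (a * ((cdist N j k)%:R / N%:R)) by ring.
by rewrite -[a * _ / _]mulrA ler_peMl // mulr_ge0 // ltW.
Qed.

Local Ltac drop := clear -R a rho N a0 rho0 rho1 N0.

(* O(d N / a) of the points [cpt j] have their distance to [c] in a given interval of length d. *)
Lemma circ_gen c d K (P : pred nat) (G gam : nat -> R) : 0 < d -> a / d <= N%:R -> (forall k, 0 <= gam k) ->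
  (forall j, (j < N)%N -> P j -> forall k, d * k%:R / 2 <= cm (cpt j - c) -> (k < K)%N /\ G j <= gam k) ->
  a / N%:R * \sum_(j < N | P j) G j <= 8 * d * \sum_(k < K) gam k.
Proof.
move=> d0 Nd g0 H.
have NR : 0 < N%:R :> R by rewrite ltr0n.
(* Let j0 be the index of the point nearest to c. Then |w_j - c| is at least half of |w_j - w_j0|,
   so the cyclic distance to j0 controls the distance to c. *)
case: (@arg_minP _ _ _ (Ordinal N0) xpredT (fun j : 'I_N => cm (cpt j - c)) isT) => j0 _ jmin.
pose L := N%:R * d / a.
have L1 : 1 <= L by rewrite ler_pdivlMr // mul1r -ler_pdivrMr.
have h := @circ_classes R N j0 L K P G gam (ltn_ord j0) L1 g0.
apply: (@le_trans _ _ (a / N%:R * (8 * L * \sum_(k < K) gam k))).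
  rewrite ler_wpM2l ?divr_ge0 ?(ltW a0) //; apply: h => j jN Pj k kd; apply: H => //.
  have h1 := cpt_dist jN (ltn_ord j0).
  have h2 := jmin (Ordinal jN) isT; rewrite /= in h2.
  have h3 := cm_tri (cpt j) (cpt j0) c; rewrite (cmB c) in h3.
  have : d * k%:R <= a * (cdist N j j0)%:R / N%:R.
    rewrite ler_pdivlMr //; move: kd; rewrite /L mulrA ler_pdivrMr // => kd.
    by apply: le_trans (_ : _ <= (cdist N j j0)%:R * a) _; [apply: le_trans kd; apply: le_eq; ring|rewrite mulrC].
  (move: h1 h2 h3; drop; lra).
apply: le_eq; rewrite /L; field; rewrite lt0r_neq0 //=; exact: lt0r_neq0.
Qed.

Lemma circ_near c (P : pred nat) : a <= N%:R -> (forall j, (j < N)%N -> P j -> cm (cpt j - c) <= 1) ->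
  a / N%:R * \sum_(j < N | P j) 1 <= 24.
Proof.
move=> Na H.
have := @circ_gen c 1 3 P (fun=> 1) (fun=> 1) ltr01; rewrite divr1 => /(_ Na (fun=> ler01)) h.
apply: (le_trans (h _)).
  move=> j jN Pj k; rewrite mul1r => hk; split => //.
  have h2 := H j jN Pj; have : k%:R <= 2 :> R by lra.
  by rewrite ler_nat.
rewrite sumr_const card_ord; lra.
Qed.

(** In the k-th class the distance is at least max(d, d k / 2) >= d (k+1) / 4, and distances up to 1
    leave about 2/d classes: a harmonic sum, hence the logarithm of 1/d. *)
Lemma circ_inv c d (P : pred nat) : 0 < d -> d <= 1 -> a / d <= N%:R ->
  (forall j, (j < N)%N -> P j -> d <= cm (cpt j - c) /\ cm (cpt j - c) <= 1) ->
  a / N%:R * \sum_(j < N | P j) (cm (cpt j - c))^-1 <= 32 * (1 + ln (4 / d)).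
Proof.
move=> d0 d1 Nd H.
pose K := Num.truncn (2 / d).
have di : 0 <= 2 / d by rewrite divr_ge0 // ltW.
have /andP[K1 K2] := truncn_itv di.
have g0 (k : nat) : 0 <= 4 / (d * k.+1%:R) :> R by rewrite divr_ge0 // mulr_ge0 // ltW.
apply: (le_trans (@circ_gen c d K.+2 P (fun j => (cm (cpt j - c))^-1) (fun k => 4 / (d * k.+1%:R)) d0 Nd g0 _)).
  move=> j jN Pj k hk; have [h1 h2] := H j jN Pj.
  have kd : k%:R <= 2 / d by rewrite ler_pdivlMr // mulrC; (move: hk h2; drop; lra).
  split.
    by rewrite -(ltr_nat R); apply: le_lt_trans kd (lt_trans K2 _); rewrite ltr_nat.
  have c0 : 0 < cm (cpt j - c) by (move: d0 h1; drop; lra).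
  rewrite -[leLHS]div1r ler_pdivrMr // mulrAC ler_pdivlMr ?mulr_gt0 // mul1r -natr1.
  move: hk h1; set x := cm _; set kk := k%:R; (move: c0; drop; lra).
have -> : \sum_(k < K.+2) 4 / (d * k.+1%:R) = 4 / d * \sum_(k < K.+2) k.+1%:R^-1.
  by rewrite mulr_sumr; apply: eq_bigr => k _; rewrite invfM mulrA.
have -> : 8 * d * (4 / d * \sum_(k < K.+2) (k.+1%:R^-1 : R)) = 32 * \sum_(k < K.+2) k.+1%:R^-1.
  by field; exact: lt0r_neq0.
rewrite ler_pM2l //; apply: (le_trans (harmonic_le R K.+1)); rewrite lerD2l ler_ln ?posrE ?ltr0n ?divr_gt0 //.
apply: (@le_trans _ _ (2 / d + 2)); first by rewrite -[K.+2]addn2 natrD lerD2r.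
rewrite ler_pdivlMr // mulrDl divfK ?lt0r_neq0 //; lra.
Qed.

End Circle.

(** * Mean and mean square of the filtered function on the circle *)

Section LowHigh.
Variable R : realType.
Local Notation C := R[i].
Variables (F : C -> C) (mm G0 : C) (w0 KF KL K0 : R).
Implicit Types (w c : C) (t u a rho : R).
Hypothesis w00 : 0 < w0.
Hypothesis w01 : w0 <= 1.
Hypothesis KF0 : 0 <= KF.
Hypothesis crude : forall w, 0 < complex.Re w -> cm (F w) <= KF * lg (complex.Im w) * (1 + (complex.Re w) ^- 2).
Hypothesis KL0 : 0 <= KL.
Hypothesis local : forall t sg, 0 < sg -> exists cs : seq C,
  [/\ (size cs)%:R <= KL * lg t,
   forall c, c \in cs -> complex.Re c <= sg / 2,
   forall w c, c \in cs -> 0 < complex.Re w -> complex.Re w <= 64^-1 -> `|complex.Im w - t| <= 64^-1 -> cm (w - c) <= 1 &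
   forall w, sg <= complex.Re w -> complex.Re w <= 64^-1 -> `|complex.Im w - t| <= 64^-1 ->
     cm (F w) <= \sum_(c <- cs) (cm (w - c))^-1 + KL * lg t].
Hypothesis K00 : 0 <= K0.
Hypothesis zero : forall w, 0 < complex.Re w -> cm w <= w0 -> cm (F w + mm / w - G0) <= K0 * cm w.

(** Up to the factor a this is the function [hh a], read in the variable w = a (1 - z). *)
Definition HH w : C := (F w + mm / w - G0) / w.
(** The eighth root of |w|. It dominates log |w| and turns all exponents into integers; in
    particular [vv w ^- 10] is |w|^(-5/4), which is summable along the circle. *)
Definition vv w : R := expR (ln (cm w) / 8).

Lemma vv_gt0 w : 0 < vv w. Proof. exact: expR_gt0. Qed.

Lemma vv8 w : 0 < cm w -> vv w ^+ 8 = cm w.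
Proof. by move=> w0'; rewrite /vv -expRM_natl mulrC divfK ?pnatr_eq0 // lnK // posrE. Qed.

Lemma vv_ge w : w0 <= cm w -> w0 <= vv w.
Proof.
have w00' := w00; have w01' := w01.
move=> h; have c0 : 0 < cm w by lra.
have l1 : ln w0 <= ln (cm w) by rewrite ler_ln ?posrE.
have l0 : ln w0 <= 0 by rewrite -ln1 ler_ln ?posrE.
rewrite -[leLHS](lnK (_ : w0 \is Num.pos)) ?posrE // /vv ler_expR; lra.
Qed.

Definition Kv : R := ln (1 + 4 / w0) / w0 + 8.

Lemma Kv_ge0 : 0 <= Kv.
Proof.
have w00' := w00; have w01' := w01.
have : 0 <= ln (1 + 4 / w0) / w0.
  apply: divr_ge0; last exact: ltW.
  by rewrite ln_ge0 // lerDl divr_ge0 // ltW.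
rewrite /Kv; lra.
Qed.

Lemma lg_vv w : w0 <= cm w -> lg (complex.Im w) <= Kv * vv w.
Proof.
have w00' := w00; have w01' := w01.
move=> h; have c0 : 0 < cm w by lra.
have i0 : 0 < 4 / w0 by rewrite divr_gt0.
have i1 : 0 < 1 + 4 / w0 by lra.
have p0 : 0 < `|complex.Im w| + 4 by have := normr_ge0 (complex.Im w); lra.
apply: (@le_trans _ _ (ln ((1 + 4 / w0) * cm w))).
  rewrite /lg ler_ln ?posrE ?mulr_gt0 // mulrDl mul1r; apply: lerD; first exact: cm_Im.
  by rewrite mulrAC ler_pdivlMr // ler_pM2l.
rewrite lnM ?posrE // /Kv [leRHS]mulrDl; apply: lerD.
  rewrite mulrAC -mulrA ler_peMr ?ln_ge0 ?lerDl ?(ltW i0) //.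
  by rewrite ler_pdivlMr // mul1r vv_ge.
have := expR_ge1Dx (ln (cm w) / 8); rewrite /vv; lra.
Qed.

Definition KH : R := 2 * KF * Kv + (cm mm / w0 + cm G0) / w0.

Lemma KH_ge0 : 0 <= KH.
Proof.
have w00' := w00; have w01' := w01.
rewrite /KH addr_ge0 // ?mulr_ge0 ?Kv_ge0 // ?invr_ge0 ?(ltW w00) //.
by rewrite addr_ge0 ?cm_ge0 // divr_ge0 ?cm_ge0 // ltW.
Qed.

Lemma small_part w : w0 <= cm w -> cm (HH w) <= (cm (F w) + (cm mm / w0 + cm G0)) / cm w.
Proof.
have w00' := w00; have w01' := w01.
move=> h; have c0 : 0 < cm w by lra.
rewrite /HH cmM cmV ler_pM2r ?invr_gt0 //.
apply: (le_trans (cm_subD _ _)); rewrite addrA lerD2r.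
apply: (le_trans (cm_D _ _)); rewrite lerD2l cmM cmV.
by rewrite ler_wpM2l ?cm_ge0 // lef_pV2 ?posrE.
Qed.

Lemma HH_crude u w : 1 <= u -> u^-1 <= complex.Re w -> w0 <= cm w -> cm (HH w) <= KH * u ^+ 2 * vv w / cm w.
Proof.
have w00' := w00; have w01' := w01.
move=> u1 wr h; have c0 : 0 < cm w by lra.
have ui : 0 < u^-1 by rewrite invr_gt0; lra.
have r0 : 0 < complex.Re w by lra.
apply: (le_trans (small_part h)); rewrite ler_pM2r ?invr_gt0 //.
have v0 := vv_gt0 w; have vw := vv_ge h; have l := lg_vv h; have kv := Kv_ge0.
have u2 : 1 <= u ^+ 2 by rewrite expr_ge1 //; lra.
have hr : (complex.Re w) ^- 2 <= u ^+ 2.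
  rewrite -exprVn lerXn2r ?nnegrE ?invr_ge0 //; try lra.
  by rewrite -[leRHS]invrK lef_pV2 ?posrE.
set Z := cm mm / w0 + cm G0.
have Z0 : 0 <= Z by rewrite addr_ge0 ?cm_ge0 // divr_ge0 ?cm_ge0 // ltW.
have e1 : cm (F w) <= KF * (Kv * vv w) * (2 * u ^+ 2).
  apply: (le_trans (crude r0)); apply: ler_pM => //; last lra.
  - by rewrite mulr_ge0 // (le_trans ler01) // lg_ge1.
  - by rewrite addr_ge0 // invr_ge0 sqr_ge0.
  - by rewrite ler_wpM2l.
have e2 : Z <= Z / w0 * (u ^+ 2 * vv w).
  rewrite -mulrA ler_peMr // mulrC ler_pdivlMr // mul1r.
  by apply: (le_trans vw); rewrite ler_peMl // ltW.
have -> : KH * u ^+ 2 * vv w = KF * (Kv * vv w) * (2 * u ^+ 2) + Z / w0 * (u ^+ 2 * vv w) by rewrite /KH -/Z; ring.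
lra.
Qed.

(** One third of the first hypothesis plus two thirds of the second, as w0 <= 1. The second has the
    shape in which [circ_gen] supplies it for d = 1. *)
Lemma class_low (k : nat) w : w0 <= cm w -> 1 * k%:R / 2 <= cm w -> w0 / 3 * k.+1%:R <= cm w.
Proof.
have w00' := w00; have w01' := w01.
rewrite mul1r -[k.+1%:R]natr1 => h1 h2; have : w0 * k%:R <= k%:R by rewrite ler_piMl.
lra.
Qed.

(** This is (w0 / 3)^(-5/4). *)
Definition Kd : R := expR (- (5 / 4 * ln (w0 / 3))).

Lemma vv_decay (k : nat) w : w0 <= cm w -> 1 * k%:R / 2 <= cm w -> vv w ^- 10 <= Kd * npw k.+1 (1 + 4^-1).
Proof.
have w00' := w00; have w01' := w01.
move=> h1 h2; have h3 := class_low h1 h2; have c0 : 0 < cm w by lra.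
have w3 : 0 < w0 / 3 by lra.
rewrite /vv -expRM_natl -expRN /Kd /npw -expRD ler_expR.
have : ln (w0 / 3) + ln k.+1%:R <= ln (cm w).
  by rewrite -lnM ?posrE ?ltr0n // ler_ln ?posrE // mulr_gt0 // ltr0n.
lra.
Qed.

Definition Cbl : R := 60 * 100 * KL.
Definition Cw : R := 3 * 64 / w0.

Lemma Cbl_ge0 : 0 <= Cbl.
Proof. by apply: mulr_ge0 => //; apply: mulr_ge0. Qed.

Lemma Cw_ge0 : 0 <= Cw.
Proof. by apply: divr_ge0; [exact: mulr_ge0|exact: ltW]. Qed.

Section Fixed.
Variables (u a rho : R) (N : nat).
Hypothesis a0 : 0 < a.
Hypothesis rho0 : 2^-1 <= rho.
Hypothesis rho1 : rho <= 1.
Hypothesis N0 : (0 < N)%N.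
Hypothesis arho : a * (1 - rho) = u^-1.
Local Notation W := (cpt a rho N).

Lemma W_Re j : u^-1 <= complex.Re (W j).
Proof. by rewrite -arho; apply: cpt_Re => //. Qed.

Lemma W_pos j : 1 <= u -> 0 < complex.Re (W j).
Proof. by move=> u1; apply: lt_le_trans (W_Re j); rewrite invr_gt0; lra. Qed.

Lemma W_le j : cm (W j) <= 2 * a.
Proof.
have w00' := w00; have w01' := w01; have a0' := a0; have rho1' := rho1.
rewrite /cpt cmM cm_real ger0_norm ?(ltW a0) // mulrC ler_pM2r //.
apply: (le_trans (cm_subD _ _)); rewrite cm1 cmM cm_omX mulr1 cm_real ger0_norm; last by apply: rho_ge0 rho0.
lra.
Qed.

Local Ltac drop := clear -R F mm G0 w0 KF KL K0 w00 w01 KF0 crude KL0 local K00 zero u a rho N a0 rho0 rho1 N0 arho.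

Lemma decay_sum (P : pred nat) : a <= N%:R -> (forall j, (j < N)%N -> P j -> w0 <= cm (W j)) ->
  a / N%:R * \sum_(j < N | P j) vv (W j) ^- 10 <= 40 * Kd.
Proof.
have w00' := w00; have w01' := w01; have a0' := a0; have rho1' := rho1.
move=> Na HP.
have Na' : a / 1 <= N%:R by rewrite divr1.
pose K := (Num.truncn (4 * a)).+1.
have g0 k : 0 <= Kd * npw k.+1 (1 + 4^-1) by rewrite mulr_ge0 ?expR_ge0.
apply: (le_trans (@circ_gen R a rho N a0 rho0 N0 0 1 K P (fun j => vv (W j) ^- 10) (fun k => Kd * npw k.+1 (1 + 4^-1)) ltr01 Na' g0 _)).
  move=> j jN Pj k; rewrite subr0 => hk; have h := HP j jN Pj; split; last exact: vv_decay.
  have a4 : 0 <= 4 * a by lra.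
  have /andP[_ K2] := truncn_itv a4.
  rewrite -(ltr_nat R); apply: le_lt_trans K2; have := W_le j; (move: hk; drop; lra).
rewrite -mulr_sumr -(big_mkord xpredT (fun k => npw k.+1 (1 + 4^-1))).
rewrite -(big_add1 _ _ 0 K.+1 xpredT (fun k => npw k (1 + 4^-1))).
have q4 : 0 < 4^-1 :> R by lra.
have := @npw_tail R 4^-1 1 K.+1 q4 isT.
rewrite {2}/npw ln1 mulr0 oppr0 expR0 invrK.
set S := \sum_(_ <= _ < _) _ => h; have := expR_gt0 (- (5 / 4 * ln (w0 / 3))); rewrite -/Kd => kd.
have : Kd * S <= Kd * ((1 + 4) * 1) by rewrite ler_wpM2l // ltW.
lra.
Qed.

(** [Bv] stands for |1 - filter|, which vanishes linearly at w = 0. For |w| <= w0 the function [HH]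
    is bounded by K0 and the linear factor suffices; elsewhere the crude bound is used. *)
Lemma high_bound (Bv : nat -> R) : 1 <= u -> a <= N%:R -> (forall j, 0 <= Bv j) -> (forall j, Bv j <= 2) ->
  (forall j, Bv j <= cm (W j) / u ^+ 16) ->
  a / N%:R * \sum_(j < N) cm (HH (W j)) ^+ 2 * Bv j ^+ 2 <= (24 * K0 ^+ 2 + 160 * Kd * KH ^+ 2) * u ^- 4.
Proof.
have w00' := w00; have w01' := w01; have a0' := a0; have rho1' := rho1.
move=> u1 Na B0 B2 Bw; have u0 : 0 < u by lra.
have aN : 0 <= a / N%:R by rewrite divr_ge0 // ltW.
have ui4 : 0 < u ^- 4 by rewrite invr_gt0 exprn_gt0.
rewrite (bigID (fun j : 'I_N => cm (W j) <= w0)) /= mulrDr mulrDl; apply: lerD.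
  have h : a / N%:R * \sum_(j < N | cm (W j) <= w0) 1 <= 24.
    apply: (@circ_near R a rho N a0 rho0 N0 0 (fun j => cm (W j) <= w0)) => // j _ /=; rewrite subr0; (move: w01'; drop; lra).
  apply: (@le_trans _ _ (a / N%:R * ((K0 ^+ 2 * u ^- 4) * \sum_(j < N | cm (W j) <= w0) 1))).
    rewrite ler_wpM2l // mulr_sumr; apply: ler_sum => j hj; rewrite mulr1.
    have wp := W_pos j u1; have wc : 0 < cm (W j) by apply: lt_le_trans (cm_Re _); rewrite normr_gt0 lt0r_neq0.
    apply: ler_pM; rewrite ?sqr_ge0 //.
      rewrite lerXn2r ?nnegrE ?cm_ge0 // /HH cmM cmV ler_pdivrMr //; exact: zero.
    have b1 : Bv j <= u ^- 2.
      apply: (le_trans (Bw j)); rewrite ler_pdivrMr ?exprn_gt0 //.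
      have -> : u ^- 2 * u ^+ 16 = u ^+ 14 by field; rewrite lt0r_neq0.
      have : 1 <= u ^+ 14 by rewrite expr_ge1 //; (move: u0; drop; lra).
      (move: w01' hj; drop; lra).
    have -> : u ^- 4 = (u ^- 2) ^+ 2 by rewrite -!exprVn -exprM.
    by rewrite lerXn2r ?nnegrE ?invr_ge0 ?exprn_ge0 // ltW.
  rewrite mulrCA; have : 0 <= K0 ^+ 2 * u ^- 4 by rewrite mulr_ge0 ?sqr_ge0 // ltW.
  set X := K0 ^+ 2 * _ => X0; apply: (le_trans (ler_wpM2l X0 h)); apply: le_eq; rewrite /X; ring.
have h : a / N%:R * \sum_(j < N | ~~ (cm (W j) <= w0)) vv (W j) ^- 10 <= 40 * Kd.
  apply: (@decay_sum (fun j => ~~ (cm (W j) <= w0))) => // j _; rewrite -ltNge; exact: ltW.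
apply: (@le_trans _ _ (a / N%:R * ((4 * KH ^+ 2 * u ^- 4) * \sum_(j < N | ~~ (cm (W j) <= w0)) vv (W j) ^- 10))).
  rewrite ler_wpM2l // mulr_sumr; apply: ler_sum => j; rewrite -ltNge => hj.
  have wc : 0 < cm (W j) by (move: w00' hj; drop; lra).
  have v0 := vv_gt0 (W j); have v8 := vv8 wc.
  set v := vv (W j) in v0 v8 *.
  have e1 := HH_crude u1 (W_Re j) (ltW hj); rewrite -/v -v8 in e1.
  pose y := v / u ^+ 2.
  have y0 : 0 < y by rewrite divr_gt0 // exprn_gt0.
  (* B is at most 2 and at most y^8, where y = v / u^2. Against the square of the crude bound, KH^2
     u^4 v^(-14), the factor 4 y^4 leaves exactly 4 KH^2 u^(-4) v^(-10). *)
  have e2 : Bv j ^+ 2 <= 4 * y ^+ 4.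
    have b8 : Bv j <= y ^+ 8.
      by apply: (le_trans (Bw j)); rewrite -v8 /y expr_div_n -exprM.
    have [yl|yg] := leP y 1.
      apply: (@le_trans _ _ ((y ^+ 8) ^+ 2)); first by rewrite lerXn2r ?nnegrE ?exprn_ge0 // ltW.
      rewrite -exprM (_ : (8 * 2)%N = (4 + 12)%N) // exprD.
      have : y ^+ 12 <= 1 by rewrite exprn_ile1 // ltW.
      have : 0 < y ^+ 4 by rewrite exprn_gt0.
      set p := y ^+ 4; set r := y ^+ 12; (drop; nra).
    have : 1 <= y ^+ 4 by rewrite expr_ge1 // ltW.
    have := B0 j; have := B2 j; set p := y ^+ 4; set b := Bv j; (drop; nra).
  apply: (@le_trans _ _ ((KH * u ^+ 2 * v / v ^+ 8) ^+ 2 * (4 * y ^+ 4))).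
    by apply: ler_pM; rewrite ?sqr_ge0 // lerXn2r ?nnegrE ?cm_ge0 // (le_trans (cm_ge0 _) e1).
  apply: le_eq; rewrite /y; field; rewrite !lt0r_neq0 //.
rewrite mulrCA; have : 0 <= 4 * KH ^+ 2 * u ^- 4.
  by apply: mulr_ge0; [apply: mulr_ge0 => //; exact: sqr_ge0|exact: ltW].
set X := 4 * _ * _ => X0; apply: (le_trans (ler_wpM2l X0 h)); apply: le_eq; rewrite /X; ring.
Qed.

Hypothesis u4 : 4 <= u.
Hypothesis Nau : 2 * a * u <= N%:R.

Lemma u1 : 1 <= u. Proof. by apply: le_trans u4; rewrite ler1n. Qed.

Lemma Na : a <= N%:R.
Proof. by apply: le_trans Nau; rewrite -mulrA mulrCA ler_peMr ?(ltW a0) //; have := u4; lra. Qed.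

Lemma lnu1 : 1 <= ln u.
Proof.
have w00' := w00; have w01' := w01; have a0' := a0; have u4' := u4.
rewrite -[leLHS]expRK ler_ln ?posrE ?expR_gt0 //; last by have := u4; lra.
by apply: le_trans u4; exact: exp1_le4.
Qed.

Lemma ln_upow x n : 0 < x -> x <= u ^+ n -> ln x <= n%:R * ln u.
Proof.
have w00' := w00; have w01' := w01; have a0' := a0; have u4' := u4.
move=> x0 xn; have u0 : 0 < u by have := u4; lra.
by rewrite mulr_natl -lnXn // ler_ln ?posrE // exprn_gt0.
Qed.

Lemma lg_Y t : `|t| <= u ^+ 32 + 1 -> lg t <= 33 * ln u.
Proof.
have w00' := w00; have w01' := w01; have a0' := a0; have u4' := u4.
move=> ht; apply: (@ln_upow _ 33); first by have := normr_ge0 t; lra.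
have y4 : 4 <= u ^+ 32 by apply: le_trans u4 _; rewrite -{1}[u]expr1 ler_weXn2l //; exact: u1.
rewrite (exprS u 32); set y := u ^+ 32 in ht y4 *.
have : 4 * y <= u * y by rewrite ler_wpM2r //; lra.
lra.
Qed.

Local Ltac drop' := clear -R F mm G0 w0 KF KL K0 w00 w01 KF0 crude KL0 local K00 zero u a rho N a0 rho0 rho1 N0 arho u4 Nau.

(** There are O(log u) polar terms, and each has mean O(log u) over the block, because the points
    keep distance at least 1/(2 u) from every pole. *)
Lemma block_bound t : `|t| <= u ^+ 32 + 1 ->
  a / N%:R * \sum_(j < N | (complex.Re (W j) <= 64^-1) && (`|complex.Im (W j) - t| <= 64^-1)) cm (F (W j)) <=
  Cbl * ln u ^+ 2.
Proof.
have w00' := w00; have w01' := w01; have a0' := a0; have u4' := u4.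
move=> ht; have lt := lg_Y ht; have l1 := lnu1; have u0 : 0 < u by have := u4; lra.
have ui : 0 < u^-1 by rewrite invr_gt0.
have aN : 0 <= a / N%:R by rewrite divr_ge0 // ltW.
have [cs [s1 s2 s3 s4]] := local t ui.
pose P j := (complex.Re (W j) <= 64^-1) && (`|complex.Im (W j) - t| <= 64^-1).
rewrite -[in leLHS]/(P _).
have lg0 : 0 <= KL * lg t by rewrite mulr_ge0 // (le_trans ler01) // lg_ge1.
have ne : a / N%:R * \sum_(j < N | P j) 1 <= 24.
  apply: (@circ_near R a rho N a0 rho0 N0 (Complex 0 t) P Na) => j _ /andP[p1 p2].
  apply: (le_trans (cm_le_ReIm _)); rewrite reD imD reN imN /= subr0.
  have := W_pos j u1 => p3; rewrite ger0_norm ?(ltW p3) //; (move: p1 p2; drop'; lra).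
have ec c : c \in cs -> a / N%:R * \sum_(j < N | P j) (cm (W j - c))^-1 <= 32 * (1 + 3 * ln u).
  move=> ccs; have d0 : 0 < u^-1 / 2 by rewrite divr_gt0.
  have d1 : u^-1 / 2 <= 1.
    have : u^-1 <= 1 by rewrite invf_le1 // u1.
    (move: lg0; drop'; lra).
  have dN : a / (u^-1 / 2) <= N%:R by apply: le_trans Nau; rewrite invf_div invrK; apply: le_eq; ring.
  apply: (le_trans (@circ_inv R a rho N a0 rho0 N0 c _ P d0 d1 dN _)).
    move=> j _ /andP[p1 p2]; split; last by apply: s3 => //; exact: (W_pos j u1).
    apply: le_trans (le_trans (ler_norm _) (cm_Re _)); rewrite reD reN; have := W_Re j; have := s2 c ccs; (drop'; lra).
  rewrite ler_pM2l // lerD2l; apply: (@ln_upow _ 3).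
    by rewrite divr_gt0.
  rewrite invf_div invrK !exprS expr0 mulr1; have := u4; (move: ccs; drop'; nra).
apply: (@le_trans _ _ (a / N%:R * \sum_(j < N | P j) (\sum_(c <- cs) (cm (W j - c))^-1 + KL * lg t * 1))).
  rewrite ler_wpM2l //; apply: ler_sum => j /andP[p1 p2]; rewrite mulr1; apply: s4 => //; exact: W_Re.
rewrite big_split /= exchange_big /= mulrDr.
apply: (@le_trans _ _ (\sum_(c <- cs) (32 * (1 + 3 * ln u)) + KL * lg t * 24)).
  apply: lerD; first by rewrite mulr_sumr; apply: sum_seq_le => c; exact: ec.
  by rewrite -mulr_sumr mulrCA; apply: ler_wpM2l.
rewrite sum_seq_const.
have Kl : KL * lg t <= KL * (33 * ln u) by rewrite ler_wpM2l.
apply: (@le_trans _ _ (KL * (33 * ln u) * (32 * (1 + 3 * ln u)) + KL * (33 * ln u) * 24)).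
  apply: lerD; last by rewrite ler_wpM2r.
  apply: ler_wpM2r; last exact: le_trans s1 Kl.
  by apply: mulr_ge0 => //; (move: ht l1; drop'; lra).
have : 0 <= KL * ln u by rewrite mulr_ge0 //; (move: ht l1; drop'; lra).
rewrite /Cbl expr2; move: l1; set x := ln u => l1 y0.
have : KL * x <= KL * x * x by rewrite ler_peMr.
(move: y0; drop'; lra).
Qed.

Lemma inv_sum (P : pred nat) : (forall j, (j < N)%N -> P j -> w0 <= cm (W j) /\ cm (W j) <= u ^+ 32) ->
  a / N%:R * \sum_(j < N | P j) (cm (W j))^-1 <= 24 / w0 * (35 * ln u).
Proof.
have w00' := w00; have w01' := w01; have a0' := a0; have u4' := u4.
move=> HP; have l1 := lnu1; have u0 : 0 < u by have := u4; lra.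
pose K := Num.truncn (2 * u ^+ 32).
have Y0 : 1 <= u ^+ 32 by rewrite expr_ge1 //; have := u1; (move: HP; drop'; lra).
have Y2 : 0 <= 2 * u ^+ 32 by lra.
have /andP[K1 K2] := truncn_itv Y2.
have g0 (k : nat) : 0 <= 3 / w0 * k.+1%:R^-1 by rewrite mulr_ge0 // divr_ge0 // ltW.
have Na' : a / 1 <= N%:R by rewrite divr1; exact: Na.
apply: (le_trans (@circ_gen R a rho N a0 rho0 N0 0 1 K.+2 P (fun j => (cm (W j))^-1) (fun k => 3 / w0 * k.+1%:R^-1) ltr01 Na' g0 _)).
  move=> j jN Pj k; rewrite subr0 => hk; have [h1 h2] := HP j jN Pj; split.
    rewrite -(ltr_nat R); apply: (@lt_trans _ _ K.+1%:R); last by rewrite ltr_nat.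
    apply: le_lt_trans K2; (move: hk h2; drop'; lra).
  have h3 := class_low h1 hk; have w3 : 0 < w0 / 3 * k.+1%:R by rewrite mulr_gt0 ?ltr0n // divr_gt0.
  have -> : 3 / w0 * k.+1%:R^-1 = (w0 / 3 * k.+1%:R)^-1 by rewrite invfM invf_div.
  by rewrite lef_pV2 ?posrE //; (move: h3 w3; drop'; lra).
rewrite -mulr_sumr mulr1 mulrA [8 * _]mulrA -[8 * 3]natrM.
rewrite ler_wpM2l ?divr_ge0 // ?(ltW w00) //; apply: (le_trans (harmonic_le R K.+1)).
have : ln K.+2%:R <= 34 * ln u.
  apply: (@ln_upow _ 34); first by rewrite ltr0n.
  rewrite -[K.+2]addn2 natrD; rewrite -/K in K1.
  rewrite (exprD u 2 32) expr2; move: K1 u4 Y0; set y := u ^+ 32; set k := K%:R => k1 v4 y1.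
  have : 16 * y <= u * u * y by rewrite ler_wpM2r; (move: v4 y1; drop'; nra).
  (move: k1 y1; drop'; lra).
(move: l1; drop'; lra).
Qed.

(** The strip is covered by boxes of height 1/32 centred at heights n/64 and -n/64. On such a box
    1/|w| is at most [Cw] / (n+1), so the sum over n contributes a third logarithm. *)
Lemma strip_sum : a / N%:R * \sum_(j < N | (complex.Re (W j) <= 64^-1) && (w0 < cm (W j) <= u ^+ 32)) cm (F (W j)) / cm (W j) <=
  Cw * (2 * (Cbl * ln u ^+ 2)) * (40 * ln u).
Proof.
have w00' := w00; have w01' := w01; have a0' := a0; have u4' := u4.
have l1 := lnu1; have u0 : 0 < u by have := u4; lra.
have aN : 0 <= a / N%:R by rewrite divr_ge0 // ltW.
pose M := Num.truncn (64 * u ^+ 32).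
have Y0 : 1 <= u ^+ 32 by rewrite expr_ge1 //; have := u1; (drop'; lra).
have Y2 : 0 <= 64 * u ^+ 32 by lra.
have /andP[M1 M2] := truncn_itv Y2.
pose t (n : nat) (b : bool) : R := (-1) ^+ b * (n%:R / 64).
pose box n b j := (complex.Re (W j) <= 64^-1) && (`|complex.Im (W j) - t n b| <= 64^-1).
have cw := Cw_ge0; have cb := Cbl_ge0.
have q0 (n : nat) : 0 <= Cw * n.+1%:R^-1 :> R by rewrite mulr_ge0.
apply: (@le_trans _ _ (a / N%:R * \sum_(j < N) \sum_(n < M.+1) \sum_(b : bool) (if box n b j then Cw * n.+1%:R^-1 * cm (F (W j)) else 0))).
  rewrite ler_wpM2l // big_mkcond /=; apply: ler_sum => j _.
  have i0 n b : 0 <= (if box n b j then Cw * n.+1%:R^-1 * cm (F (W j)) else 0).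
    by case: ifP => // _; rewrite mulr_ge0 ?cm_ge0.
  case: ifP => [/andP[p1 /andP[p2 p3]]|_]; last by apply: sumr_ge0 => n _; apply: sumr_ge0.
  set y := complex.Im (W j); pose n := Num.truncn (64 * `|y|).
  have yc : `|y| <= cm (W j) := cm_Im _.
  have y0 : 0 <= 64 * `|y| by have := normr_ge0 y; (drop'; lra).
  have /andP[n1 n2] := truncn_itv y0; rewrite -/n -[n.+1%:R]natr1 in n1 n2.
  have nM : (n < M.+1)%N.
    rewrite -(ltr_nat R); apply: le_lt_trans M2; rewrite -/n; (move: p3 yc n1; drop'; lra).
  (* The sign of the imaginary part selects the boolean index, its size the index n. *)
  have bx : box n (y < 0) j.
    rewrite /box p1 /= /t -/y; case: (ltrP y 0) => hy.
      rewrite ltr0_norm // in n1 n2; rewrite expr1 ler_norml; apply/andP; split; (move: n1 n2; drop'; lra).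
    rewrite ger0_norm // in n1 n2; rewrite expr0 ler_norml; apply/andP; split; (move: n1 n2; drop'; lra).
  rewrite (bigD1 (Ordinal nM)) //= (bigD1 (y < 0)) //= bx -addrA.
  have c0 : 0 < cm (W j) by (move: w00' p2; drop'; lra).
  have e1 : (cm (W j))^-1 <= Cw * n.+1%:R^-1.
    have -> : Cw * n.+1%:R^-1 = (w0 / (3 * 64) * n.+1%:R)^-1 by rewrite /Cw invfM invf_div.
    rewrite lef_pV2 ?posrE //; last by rewrite mulr_gt0 ?ltr0n // divr_gt0.
    rewrite -[n.+1%:R]natr1; have : w0 * n%:R <= n%:R by rewrite ler_piMl.
    (move: p2 yc y0 n1; drop'; lra).
  apply: (@le_trans _ _ (Cw * n.+1%:R^-1 * cm (F (W j)))).
    by rewrite mulrC ler_wpM2r ?cm_ge0.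
  rewrite lerDl addr_ge0 //; first by apply: sumr_ge0.
  by apply: sumr_ge0 => k _; apply: sumr_ge0.
rewrite exchange_big /= mulr_sumr.
apply: (@le_trans _ _ (\sum_(n < M.+1) Cw * (2 * (Cbl * ln u ^+ 2)) * n.+1%:R^-1)).
  apply: ler_sum => n _; rewrite exchange_big /= mulr_sumr.
  have -> : Cw * (2 * (Cbl * ln u ^+ 2)) * n.+1%:R^-1 = \sum_(b : bool) (Cw * n.+1%:R^-1 * (Cbl * ln u ^+ 2)).
    by rewrite big_bool /=; ring.
  apply: ler_sum => b _; rewrite -big_mkcond /= -mulr_sumr mulrCA ler_wpM2l //.
  apply: block_bound; rewrite /t normrM normrX normrN1 expr1n mul1r ger0_norm ?divr_ge0 //.
  have : n%:R <= M%:R :> R by rewrite ler_nat -ltnS ltn_ord.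
  rewrite -/M in M1; (move: M1; drop'; lra).
rewrite -mulr_sumr; apply: ler_wpM2l; first by apply: mulr_ge0 => //; apply: mulr_ge0 => //; apply: mulr_ge0 => //; exact: sqr_ge0.
apply: (le_trans (harmonic_le R M)).
have : ln M.+1%:R <= 36 * ln u.
  apply: (@ln_upow _ 36); first by rewrite ltr0n.
  rewrite -[M.+1%:R]natr1; rewrite -/M in M1.
  rewrite (exprD u 4 32); move: M1 Y0; set y := u ^+ 32; set k := M%:R => k1 y1.
  have : 4 ^+ 4 <= u ^+ 4 by rewrite lerXn2r ?nnegrE //; have := u4; (move: k1; drop'; lra).
  rewrite !exprS expr0; set z := u * _ => z1.
  have : (4 * (4 * (4 * (4 * 1)))) * y <= z * y by rewrite ler_wpM2r //; (move: y1; drop'; lra).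
  (move: k1 y1; drop'; lra).
(move: l1; drop'; lra).
Qed.

(** [Av] stands for |filter|. Four regions are summed: |w| <= w0, where [HH] is bounded; |w| > u^32,
    where crude bound and filter together are summable; and the range between, where Re w > 1/64
    costs two logarithms and the strip Re w <= 1/64 three. *)
Lemma low_bound (Av : nat -> R) : (forall j, 0 <= Av j) -> (forall j, Av j <= 1) ->
  (forall j, Av j * cm (W j) <= 4 * u ^+ 16) ->
  a / N%:R * \sum_(j < N) cm (HH (W j)) * Av j <=
   (24 * K0 + 160 * KH * Kd + 24 / w0 * 35 * (KF * 33 * (1 + 64 ^+ 2) + (cm mm / w0 + cm G0)) +
    Cw * (2 * (Cbl)) * 40) * ln u ^+ 3.
Proof.
have w00' := w00; have w01' := w01; have a0' := a0; have u4' := u4.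
move=> A0' A1 Aw; have l1 := lnu1; have u0 : 0 < u by have := u4; lra.
have aN : 0 <= a / N%:R by rewrite divr_ge0 // ltW.
set Z := cm mm / w0 + cm G0.
have Z0 : 0 <= Z by rewrite addr_ge0 ?cm_ge0 // divr_ge0 ?cm_ge0 // ltW.
have kh := KH_ge0; have kd : 0 <= Kd := expR_ge0 _.
pose P1 j := cm (W j) <= w0.
pose P2 j := u ^+ 32 < cm (W j).
pose P3 j := w0 < cm (W j) <= u ^+ 32.
pose P4 j := (complex.Re (W j) <= 64^-1) && (w0 < cm (W j) <= u ^+ 32).
have Y0 : 1 <= u ^+ 32 by rewrite expr_ge1 //; have := u1; (move: Z0; drop'; lra).
have wpos j : 0 < cm (W j) by apply: lt_le_trans (cm_Re _); rewrite normr_gt0 lt0r_neq0 // W_pos //; exact: u1.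
pose B := (KF * 33 * (1 + 64 ^+ 2) + Z) * ln u.
have n5 : 0 <= (1 + 64 ^+ 2) :> R by apply: addr_ge0 => //; exact: sqr_ge0.
have B00 : 0 <= KF * 33 * (1 + 64 ^+ 2) + Z by apply: addr_ge0 => //; apply: mulr_ge0 => //; apply: mulr_ge0.
have B0 : 0 <= B by apply: mulr_ge0 => //; (move: A1 l1; drop'; lra).
apply: (@le_trans _ _ (a / N%:R * \sum_(j < N) ((if P1 j then K0 else 0) + (if P2 j then 4 * KH * vv (W j) ^- 10 else 0) +
    (if P3 j then B * (cm (W j))^-1 else 0) + (if P4 j then cm (F (W j)) / cm (W j) else 0)))).
  rewrite ler_wpM2l //; apply: ler_sum => j _.
  have i2 : 0 <= (if P2 j then 4 * KH * vv (W j) ^- 10 else 0).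
    by case: ifP => // _; rewrite !mulr_ge0 // invr_ge0 exprn_ge0 // expR_ge0.
  have i3 : 0 <= (if P3 j then B * (cm (W j))^-1 else 0).
    by case: ifP => // _; rewrite mulr_ge0 // invr_ge0 cm_ge0.
  have i4 : 0 <= (if P4 j then cm (F (W j)) / cm (W j) else 0).
    by case: ifP => // _; rewrite divr_ge0 ?cm_ge0.
  have i1 : 0 <= (if P1 j then K0 else 0) by case: ifP.
  have hA : cm (HH (W j)) * Av j <= cm (HH (W j)) by rewrite ler_piMr ?cm_ge0.
  have [h1|h1] := leP (cm (W j)) w0.
    have : cm (HH (W j)) <= K0.
      by rewrite /HH cmM cmV ler_pdivrMr //; apply: zero => //; apply: W_pos; exact: u1.
    rewrite {1}/P1 h1; (move: i2 i3 i4 hA; drop'; lra).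
  have [h2|h2] := leP (cm (W j)) (u ^+ 32).
    have e := small_part (ltW h1); rewrite -/Z in e.
    have [h3|h3] := leP (complex.Re (W j)) (64^-1).
      have : P4 j by rewrite /P4 h3 h1 h2.
      have : P3 j by rewrite /P3 h1 h2.
      move=> -> ->.
      have : Z / cm (W j) <= B * (cm (W j))^-1.
        rewrite ler_pM2r ?invr_gt0 //; apply: (@le_trans _ _ (KF * 33 * (1 + 64 ^+ 2) + Z)).
          by rewrite lerDr; apply: mulr_ge0 => //; apply: mulr_ge0.
        by rewrite /B ler_peMr.
      rewrite mulrDl in e; (move: i2 i1 hA e; drop'; lra).
    have : P3 j by rewrite /P3 h1 h2.
    move=> ->.
    have : cm (HH (W j)) <= B * (cm (W j))^-1.
      apply: (le_trans e); rewrite ler_pM2r ?invr_gt0 // /B mulrDl; apply: lerD; last by rewrite ler_peMr.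
      apply: (le_trans (crude (W_pos j u1))).
      have lY : lg (complex.Im (W j)) <= 33 * ln u.
        by apply: lg_Y; apply: (le_trans (cm_Im _)); (move: h2; drop'; lra).
      have r2 : (complex.Re (W j)) ^- 2 <= 64 ^+ 2.
        have wp := W_pos j u1; have i64 : (complex.Re (W j))^-1 <= 64.
          by rewrite -[leRHS]invrK lef_pV2 ?posrE ?invr_gt0 //; exact: ltW.
        by rewrite -exprVn lerXn2r ?nnegrE ?invr_ge0 // ltW.
      have -> : KF * 33 * (1 + 64 ^+ 2) * ln u = KF * (33 * ln u) * (1 + 64 ^+ 2) by ring.
      apply: ler_pM; last by rewrite expr2 in r2; (move: r2; drop'; lra).
      - by rewrite mulr_ge0 // (le_trans ler01) // lg_ge1.
      - by rewrite addr_ge0 // invr_ge0 sqr_ge0.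
      - by rewrite ler_wpM2l.
    (move: i2 i4 i1 hA; drop'; lra).
  have : P2 j by [].
  move=> ->.
  have v0 := vv_gt0 (W j); have v8 := vv8 (wpos j).
  have e1 := HH_crude u1 (W_Re j) (ltW h1).
  set v := vv (W j) in v0 v8 e1 *.
  have vu : u ^+ 4 <= v.
    rewrite leNgt; apply/negP => vl; move: h2; rewrite -v8 ltNge; apply/negP/negPn.
    by rewrite (_ : 32 = 4 * 8)%N // exprM lerXn2r ?nnegrE ?exprn_ge0 // ltW.
  have e2 : cm (HH (W j)) * Av j <= KH * u ^+ 2 * v / v ^+ 8 * (4 * u ^+ 16 / v ^+ 8).
    apply: ler_pM; rewrite ?cm_ge0 //; first by rewrite v8.
    by rewrite ler_pdivlMr ?exprn_gt0 // v8.
  (* Since |w| > u^32 means v > u^4, the power u^18 is absorbed by v^5, and the summable v^(-10)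
     remains. *)
  have e3 : KH * u ^+ 2 * v / v ^+ 8 * (4 * u ^+ 16 / v ^+ 8) = 4 * KH * v ^- 10 * (u ^+ 18 / v ^+ 5).
    by field; rewrite lt0r_neq0.
  have e4 : u ^+ 18 / v ^+ 5 <= 1.
    rewrite ler_pdivrMr ?exprn_gt0 // mul1r; apply: (@le_trans _ _ ((u ^+ 4) ^+ 5)).
      by rewrite -exprM ler_weXn2l //; exact: u1.
    by rewrite lerXn2r ?nnegrE ?exprn_ge0 // ltW.
  have : 4 * KH * v ^- 10 * (u ^+ 18 / v ^+ 5) <= 4 * KH * v ^- 10.
    by rewrite ler_piMr // !mulr_ge0 // invr_ge0 exprn_ge0 // ltW.
  (move: i3 i4 i1 e2 e3; drop'; lra).
rewrite !big_split /= -!big_mkcond /= -!mulr_sumr.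
have dist (x s1 s2 s3 s4 : R) : x * (s1 + s2 + s3 + s4) = x * s1 + x * s2 + x * s3 + x * s4 by ring.
rewrite dist.
have s1 : a / N%:R * \sum_(j < N | P1 j) K0 <= 24 * K0.
  have h : a / N%:R * \sum_(j < N | P1 j) 1 <= 24.
    apply: (@circ_near R a rho N a0 rho0 N0 0 P1 Na) => j _; rewrite /P1 subr0; have := w01; (drop'; lra).
  have -> : \sum_(j < N | P1 j) K0 = K0 * \sum_(j < N | P1 j) 1 by rewrite mulr_sumr; apply: eq_bigr => j _; rewrite mulr1.
  by rewrite mulrCA mulrC ler_wpM2r.
have s2 : a / N%:R * (4 * KH * \sum_(j < N | P2 j) vv (W j) ^- 10) <= 4 * KH * (40 * Kd).
  rewrite mulrCA ler_wpM2l ?mulr_ge0 //; apply: decay_sum; first exact: Na.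
  move=> j _; rewrite /P2; have := w01; (move: Y0; drop'; lra).
have s3 : a / N%:R * (B * \sum_(j < N | P3 j) (cm (W j))^-1) <= B * (24 / w0 * (35 * ln u)).
  by rewrite mulrCA ler_wpM2l //; apply: inv_sum => j _ /andP[h1 h2]; split => //; exact: ltW.
have s4 := strip_sum; rewrite -/(P4 _) in s4.
have l2 : 1 <= ln u ^+ 2 by rewrite expr_ge1 //; (move: l1 Z0; drop'; lra).
have l3 : ln u ^+ 2 <= ln u ^+ 3 by rewrite ler_weXn2l.
have l13 : 1 <= ln u ^+ 3 by (move: s3 l2 l3; drop'; lra).
have t1 : 24 * K0 <= 24 * K0 * ln u ^+ 3 by rewrite ler_peMr // mulr_ge0.
have t2 : 160 * KH * Kd <= 160 * KH * Kd * ln u ^+ 3.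
  have KK0 : 0 <= 160 * KH * Kd.
    by apply: mulr_ge0; [apply: mulr_ge0; [exact: ler0n|exact: KH_ge0]|exact: expR_ge0].
  exact: ler_peMr KK0 l13.
have t3 : B * (24 / w0 * (35 * ln u)) <= 24 / w0 * 35 * (KF * 33 * (1 + 64 ^+ 2) + Z) * ln u ^+ 3.
  have -> : B * (24 / w0 * (35 * ln u)) = 24 / w0 * 35 * (KF * 33 * (1 + 64 ^+ 2) + Z) * ln u ^+ 2 by rewrite /B; ring.
  apply: ler_wpM2l => //; apply: mulr_ge0 => //; apply: mulr_ge0 => //.
  by apply: divr_ge0 => //; exact: ltW.
have E4 : Cw * (2 * (Cbl * ln u ^+ 2)) * (40 * ln u) = Cw * (2 * (Cbl)) * 40 * ln u ^+ 3.
  by rewrite (exprS _ 2); ring.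
rewrite E4 in s4.
have E5 : 4 * KH * (40 * Kd) = 160 * KH * Kd by ring.
rewrite E5 in s2.
apply: (le_trans (lerD (lerD (lerD (le_trans s1 t1) (le_trans s2 t2)) (le_trans s3 t3)) s4)).
by rewrite -!mulrDl.
Qed.

End Fixed.
End LowHigh.

(** * Poisson averages *)

Section Poisson.
Variable R : realType.
Local Notation C := R[i].
Implicit Types (l x y e : R) (i k I K M n : nat).

Definition pois l i : R := expR (- l) * (l ^+ i / i`!%:R).
(* Distribution function of the Poisson law of mean [l]. *)
Definition poisQ l k : R := \sum_(i < k.+1) pois l i.

Lemma pois_ge0 l i : 0 <= l -> 0 <= pois l i.
Proof. by move=> l0; rewrite mulr_ge0 ?expR_ge0 // divr_ge0 ?exprn_ge0. Qed.

Lemma exp_partial_le x K : 0 <= x -> \sum_(i < K) x ^+ i / i`!%:R <= expR x.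
Proof.
move=> x0; have h := @nondecreasing_cvgn_le R (series (exp_coeff x)).
have := h _ (is_cvg_series_exp_coeff x) K; rewrite /series /= big_mkord; apply.
apply/nondecreasing_seqP => n; rewrite /series /= big_nat_recr //= lerDl.
exact: exp_coeff_ge0.
Qed.

Lemma exp_partial_lim x e : 0 < e -> exists I0, forall I, (I0 <= I)%N ->
  `|\sum_(i < I) x ^+ i / i`!%:R - expR x| <= e.
Proof.
move=> e0; have h : series (exp_coeff x) @ \oo --> expR x by exact: is_cvg_series_exp_coeff.
have [N HN] := rcvgE h e0; exists N => I NI; have := HN I NI.
by rewrite /series /= big_mkord.
Qed.

Lemma fact_small x e : 0 <= x -> 0 < e -> exists I0, forall I, (I0 <= I)%N -> x ^+ I.+1 / I`!%:R <= e.
Proof.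
move=> x0 e0; have d0 : 0 < e / (x + 1) by rewrite divr_gt0 //; lra.
have [N HN] := rcvgE (cvg_exp_coeff x) d0; exists N => I NI; have := HN I NI.
rewrite subr0 ger0_norm; last exact: exp_coeff_ge0.
rewrite /exp_coeff /= ler_pdivlMr; last lra.
have : 0 <= x ^+ I / I`!%:R by rewrite divr_ge0 ?exprn_ge0.
rewrite exprS -mulrA; set y := _ / _; nra.
Qed.

Lemma poisQE l k : poisQ l k = expR (- l) * \sum_(i < k.+1) l ^+ i / i`!%:R.
Proof. by rewrite /poisQ mulr_sumr. Qed.

Lemma poisQ_le1 l k : 0 <= l -> poisQ l k <= 1.
Proof.
move=> l0; rewrite poisQE expRN mulrC ler_pdivrMr ?expR_gt0 // mul1r.
exact: exp_partial_le.
Qed.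

Lemma poisQ_ge0 l k : 0 <= l -> 0 <= poisQ l k.
Proof. by move=> l0; apply: sumr_ge0 => i _; exact: pois_ge0. Qed.

Lemma poisQ_lim l e : 0 <= l -> 0 < e -> exists I0, forall I, (I0 <= I)%N -> 1 - e <= poisQ l I.
Proof.
move=> l0 e0; have [N HN] := @exp_partial_lim l e e0; exists N => I NI.
have := HN I.+1 (leq_trans NI (leqnSn I)); rewrite ler_norml => /andP[h _].
rewrite poisQE expRN mulrC ler_pdivlMr ?expR_gt0 //.
have := expR_ge1Dx l; move: h; set S := \sum_(_ < _) _; set E := expR l; nra.
Qed.

Lemma pois_step l i : i.+1%:R * pois l i.+1 = l * pois l i.
Proof.
have f0 : i`!%:R != 0 :> R by rewrite pnatr_eq0 -lt0n fact_gt0.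
have s0 : i.+1%:R != 0 :> R by rewrite pnatr_eq0.
by rewrite /pois factS natrM exprS; field; rewrite f0 addrC natr1 s0.
Qed.

Definition poisV l M : R := \sum_(i < M.+1) pois l i * (i%:R - l) ^+ 2.

(** The recurrence [pois_step] makes the truncated variance telescope; the full variance l
    corresponds to M tending to infinity. *)
Lemma poisVE l M : poisV l M = l * poisQ l M - l * pois l M * (M%:R + 1 - l).
Proof.
elim: M => [|M IH].
  by rewrite /poisV /poisQ !big_ord_recr !big_ord0 /=; ring.
rewrite /poisV /poisQ !(big_ord_recr M.+1) /= -/(poisV l M) -/(poisQ l M) IH.
have h := pois_step l M; rewrite -[M.+1%:R]natr1 in h *.
have -> : l * pois l M * (M%:R + 1 - l) = (M%:R + 1) * pois l M.+1 * (M%:R + 1 - l) by rewrite h.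
ring.
Qed.

Lemma poisV_mono l M n : 0 <= l -> poisV l M <= poisV l (M + n).
Proof.
move=> l0; elim: n => [|n IH]; first by rewrite addn0.
apply: (le_trans IH); rewrite addnS /poisV [leRHS]big_ord_recr /= lerDl.
by rewrite mulr_ge0 ?sqr_ge0 ?pois_ge0.
Qed.

(** The truncated variance grows with M, and beyond the mean the term subtracted in [poisVE] is
    nonnegative. *)
Lemma poisV_le l M : 0 <= l -> poisV l M <= l.
Proof.
move=> l0; pose n := Num.truncn l; have /andP[_ n2] := truncn_itv l0.
apply: (le_trans (@poisV_mono l M n l0)); rewrite poisVE.
have h1 := poisQ_le1 (M + n) l0; have h2 := pois_ge0 (M + n) l0.
have h3 : 0 <= (M + n)%:R + 1 - l.
  have : n.+1%:R <= (M + n)%:R + 1 :> R by rewrite natr1 ler_nat ltnS leq_addl.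
  lra.
have : 0 <= l * pois l (M + n) * ((M + n)%:R + 1 - l) by rewrite mulr_ge0 // mulr_ge0.
have : l * poisQ l (M + n) <= l by rewrite ler_piMr.
lra.
Qed.

Local Ltac drop := clear -R.

(** Chebyshev's inequality. For k below the mean [poisQ] is itself the tail probability; above it,
    the complementary tail is reached through the finite sums [poisQ l (k + I)]. *)
Lemma pois_dev l k : 0 <= l -> `|poisQ l k - (l <= k%:R)%R%:R| * (k%:R - l) ^+ 2 <= l.
Proof.
move=> l0; have q0 := poisQ_ge0 k l0; have q1 := poisQ_le1 k l0.
have [h|h] := leP l k%:R; last first.
  rewrite /= subr0 ger0_norm // mulr_suml; apply: le_trans (poisV_le k l0).
  apply: ler_sum => i _; apply: ler_wpM2l; first exact: pois_ge0.
  have : i%:R <= k%:R :> R by rewrite ler_nat -ltnS ltn_ord.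
  rewrite -(sqrrN (k%:R - l)) -(sqrrN (i%:R - l)) !opprB => ik.
  rewrite lerXn2r ?nnegrE; (move: h ik; drop; lra).
rewrite /= distrC ger0_norm; last by rewrite subr_ge0.
apply/ler_addgt0Pr => e e0.
pose D := (k%:R - l) ^+ 2; have D0 : 0 <= D := sqr_ge0 _.
have e10 : 0 < e / (D + 1) by rewrite divr_gt0 //; lra.
have [I0 HI] := poisQ_lim l0 e10.
have HI' := HI (k + I0)%N (leq_addl _ _).
have : (poisQ l (k + I0) - poisQ l k) * D <= l.
  apply: le_trans (poisV_le (k + I0) l0).
  elim: (I0) => [|I IH]; first by rewrite addn0 subrr mul0r sumr_ge0 // => i _; rewrite mulr_ge0 ?sqr_ge0 ?pois_ge0.
  rewrite addnS /poisV /poisQ !(big_ord_recr (k + I).+1) /= -/(poisV l (k + I)) -/(poisQ l (k + I)).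
  rewrite addrAC mulrDl; apply: lerD => //; apply: ler_wpM2l; first exact: pois_ge0.
  have : k%:R <= (k + I).+1%:R :> R by rewrite ler_nat -addnS leq_addr.
  move=> ik; rewrite /D lerXn2r ?nnegrE; (move: h ik; drop; lra).
have : e / (D + 1) * D <= e.
  rewrite mulrAC ler_pdivrMr; last lra.
  by rewrite ler_pM2l //; (drop; lra).
have : (1 - poisQ l k) * D <= (poisQ l (k + I0) - poisQ l k + e / (D + 1)) * D by rewrite ler_wpM2r //; lra.
rewrite mulrDl -/D; lra.
Qed.

(** The at most 2 D + 1 indices within D of the mean count 1 each; all others are covered by
    [pois_dev]. *)
Lemma pois_dev_sum l D K : 0 <= l -> 0 < D ->
  \sum_(k < K) `|poisQ l k - (l <= k%:R)%R%:R| <= 2 * D + 1 + K%:R * (l / D ^+ 2).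
Proof.
move=> l0 D0.
apply: (@le_trans _ _ (\sum_(k < K) (((l - D <= k%:R <= l + D)%R%:R : R) + l / D ^+ 2))).
  apply: ler_sum => k _; have q0 := poisQ_ge0 k l0; have q1 := poisQ_le1 k l0.
  have D2 : 0 < D ^+ 2 by rewrite exprn_gt0.
  have lD : 0 <= l / D ^+ 2 by rewrite divr_ge0 // ltW.
  have [h|h] := boolP (l - D <= k%:R <= l + D).
    apply: (@le_trans _ _ 1); last by rewrite lerDl.
    case: (l <= k%:R) => /=; rewrite ler_norml; apply/andP; split; (move: q0 q1; drop; lra).
  rewrite /= add0r ler_pdivlMr //; apply: le_trans (pois_dev k l0).
  rewrite ler_wpM2l // -[leRHS]real_normK ?num_real // lerXn2r ?nnegrE //; first exact: ltW.
  move: h; rewrite negb_and -!ltNge => /orP[h|h].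
    by rewrite ltr0_norm; lra.
  by rewrite gtr0_norm; lra.
rewrite big_split /= sumr_const card_ord -[(l / _) *+ _]mulr_natl lerD2r.
apply: le_trans (count_interval K _) _; lra.
Qed.

(** Chernoff's bound: l^i <= 2^k (l / 2)^i for i <= k, and the exponential series of l / 2 is
    completed. *)
Lemma poisQ_small l k : 0 <= l -> poisQ l k <= 2 ^+ k * expR (- (l / 2)).
Proof.
move=> l0; have l2 : 0 <= l / 2 by lra.
rewrite poisQE.
have -> : - (l / 2) = - l + l / 2 by lra.
rewrite expRD mulrCA ler_wpM2l ?expR_ge0 //.
apply: le_trans (ler_wpM2l (exprn_ge0 k (ler0n R 2)) (exp_partial_le k.+1 l2)).
rewrite mulr_sumr; apply: ler_sum => i _; rewrite expr_div_n.
have ik : (i <= k)%N by rewrite -ltnS.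
have i2 : 0 < (2 : R) ^+ i by rewrite exprn_gt0.
have k2 : (2 : R) ^+ i <= 2 ^+ k by rewrite ler_weXn2l // ler1n.
have -> : 2 ^+ k * (l ^+ i / 2 ^+ i / i`!%:R) = (l ^+ i / i`!%:R) * (2 ^+ k / 2 ^+ i) by ring.
by rewrite ler_peMr ?divr_ge0 ?exprn_ge0 // ler_pdivlMr // mul1r.
Qed.

End Poisson.

(** * Taylor coefficients of [hh] at the origin *)

Section Coefficients.
Variable R : realType.
Local Notation C := R[i].
Variables (q : nat) (psi : nat -> C).
Hypothesis q0 : (0 < q)%N.
Hypothesis psiq : forall n, psi (n + q)%N = psi n.
Hypothesis psi1 : forall n, cm (psi n) <= 1.
Hypothesis psi0 : \sum_(k < q) psi k = 0.
Hypothesis psi_one : psi 1%N = 1.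
Hypothesis psiM : forall m n, psi (m * n)%N = psi m * psi n.
Variables (mm G0 : C).
Local Notation F := (@Fw R psi).
Implicit Types (s z w : C) (x y t e : R).

Definition cN (n : nat) : C := (vM R n)%:C * (psi n * npow_neg n (hlf R)).
(* [rcoef a N k] approximates the k-th Taylor coefficient of [hh a]: 1/(1 - z) turns the Poisson weights
   e^(-l) l^i / i!, with l = a log n, into their partial sums. *)
Definition hh (a : R) z : C := (F (a%:C * (1 - z)) + mm / (a%:C * (1 - z)) - G0) / (1 - z).
Definition rcoef (a : R) (N k : nat) : C :=
  \sum_(1 <= n < N.+1) cN n * (poisQ (a * ln n%:R) k)%:C - G0 + mm / a%:C * k.+1%:R.

Lemma cN_le n : (0 < n)%N -> cm (cN n) <= 2.
Proof.
move=> n0; rewrite !cmM cm_real ger0_norm ?vM_ge0 // cm_npow /=.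
have h1 : cm (psi n) * npw n 2^-1 <= npw n (2^-1 : R) by rewrite ler_piMl ?expR_ge0.
have h2 : vM R n <= 2 * npw n (- 2^-1 : R).
  apply: (le_trans (vM_le R n)); have := @ln_le_npw R n 2^-1; rewrite invrK; apply; lra.
apply: (@le_trans _ _ (2 * npw n (- 2^-1 : R) * npw n (2^-1 : R))).
  by apply: ler_pM => //; rewrite ?vM_ge0 // mulr_ge0 ?cm_ge0 ?expR_ge0.
by rewrite -mulrA -(npwD n (- 2^-1) 2^-1) addNr /npw mul0r oppr0 expR0 mulr1.
Qed.

Definition geoX (I : nat) : {poly C} := \poly_(i < I.+1) 1.
(** The Taylor polynomial of degree I in z of [Fpart] N at w = a (1 - z); likewise [geoX] truncates
    1 / (1 - z). *)
Definition PhiX (a : R) (N I : nat) : {poly C} :=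
  \poly_(i < I.+1) \sum_(1 <= n < N.+1) cN n * (pois (a * ln n%:R) i)%:C.

Lemma conv_geo I k (p : {poly C}) : (k <= I)%N -> (geoX I * p)`_k = \sum_(j < k.+1) p`_j.
Proof.
move=> kI; rewrite coefMr; apply: eq_bigr => j _.
by rewrite coef_poly ltnS (leq_trans (leq_subr _ _) kI) mul1r.
Qed.

Lemma RX_coef a N I k : (k <= I)%N ->
  (geoX I * (PhiX a N I - G0%:P + (mm / a%:C)%:P * geoX I))`_k = rcoef a N k.
Proof.
move=> kI; rewrite conv_geo // /rcoef.
under eq_bigr => j _ do rewrite coefD coefB coefCM coefC !coef_poly ltnS (leq_trans _ kI) ?mulr1 -1?ltnS //.
rewrite !big_split /= sumrN sumr_const card_ord mulr_natr; congr (_ + _).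
rewrite exchange_big /=; congr (_ - _); last by rewrite big_ord_recl /= big1 ?addr0.
by apply: eq_bigr => n _; rewrite /poisQ rmorph_sum /= mulr_sumr.
Qed.

Lemma geoX_val I z : cm z <= 4^-1 -> cm ((geoX I).[z] - (1 - z)^-1) <= 2 * 4^-1 ^+ I.+1.
Proof.
move=> z4; have z1 : 3/4 <= cm (1 - z) by have := cm_rev 1 z; rewrite cm1; lra.
have zn : 1 - z != 0 by rewrite -cm_gt0; lra.
have E : (geoX I).[z] = \sum_(i < I.+1) z ^+ i.
  by rewrite horner_poly; apply: eq_bigr => i _; rewrite mul1r.
have S := subrX1 z I.+1; rewrite -E in S.
have -> : (geoX I).[z] - (1 - z)^-1 = - (z ^+ I.+1 / (1 - z)).
  have -> : z ^+ I.+1 = (z - 1) * (geoX I).[z] + 1 by rewrite -S subrK.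
  by field.
rewrite cmN cmM cmV cmX mulrC; apply: ler_pM; rewrite ?invr_ge0 ?exprn_ge0 ?cm_ge0 //.
  by rewrite -[leRHS]invrK lef_pV2 ?posrE ?invr_gt0 //; lra.
by rewrite lerXn2r ?nnegrE ?cm_ge0.
Qed.

Lemma PhiX_val a N I z (L e : R) : 0 <= a -> cm z <= 4^-1 -> (forall n, (0 < n)%N -> (n <= N)%N -> a * ln (n%:R : R) <= L) ->
  L ^+ I.+1 / I`!%:R <= e ->
  cm ((PhiX a N I).[z] - Fpart psi N (hlf R + a%:C * (1 - z))) <= 2 * N%:R * e.
Proof.
move=> a0 z4 HL He.
have -> : (PhiX a N I).[z] = \sum_(1 <= n < N.+1) cN n * \sum_(i < I.+1) (pois (a * ln n%:R) i)%:C * z ^+ i.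
  rewrite horner_poly; under eq_bigr => i _ do rewrite mulr_suml.
  rewrite exchange_big /=; apply: eq_bigr => n _; rewrite mulr_sumr; apply: eq_bigr => i _; ring.
rewrite /Fpart -sumrB; apply: (le_trans (cm_sum _ _ _)).
apply: (@le_trans _ _ (\sum_(1 <= n < N.+1) 2 * e)); last first.
  by rewrite sumr_const_nat subn1 /= -mulr_natl; apply: le_eq; ring.
rewrite !big_nat; apply: ler_sum => n /andP[n0]; rewrite ltnS => nN.
set l := a * ln n%:R; have l0 : 0 <= l by rewrite mulr_ge0 // ln_nat_ge0.
have lL : l <= L by apply: HL.
have -> : (vM R n)%:C * (psi n * npow_neg n (hlf R + a%:C * (1 - z))) = cN n * ((expR (- l))%:C * cexp (l%:C * z)).
  rewrite npowD /cN -!mulrA; congr (_ * (_ * (_ * _))).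
  rewrite npow_negE -cexp_real -cexpD; congr cexp.
  by rewrite /l rmorphN rmorphM /=; ring.
have -> : \sum_(i < I.+1) (pois l i)%:C * z ^+ i = (expR (- l))%:C * \sum_(i < I.+1) (l%:C * z) ^+ i / i`!%:R.
  rewrite mulr_sumr; apply: eq_bigr => i _.
  rewrite /pois rmorphM rmorphM /= rmorphV ?unitfE ?pnatr_eq0 -?lt0n ?fact_gt0 // rmorphXn rmorph_nat /= exprMn; ring.
rewrite -mulrBr -mulrBr cmM; apply: ler_pM; rewrite ?cm_ge0 ?cN_le //.
rewrite cmM cm_real ger0_norm ?expR_ge0 // cmB.
apply: (le_trans (ler_wpM2l (expR_ge0 _) (cexp_taylor _ _))).
rewrite (cmM l%:C z) (cm_real l) (ger0_norm l0) -(mulrA (expR _) _ _^-1) (mulrA (expR _) (expR _)) -expRD.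
(* Here |z| <= 1/4 enters: the factor e^(-l) outweighs the e^(2 l |z|) of the Taylor remainder. *)
have e1 : expR (- l + 2 * (l * cm z)) <= 1.
  have : l * cm z <= l * 4^-1 by rewrite ler_wpM2l.
  move=> h; have : expR (- l + 2 * (l * cm z)) <= expR 0 by rewrite ler_expR; lra.
  by rewrite expR0.
have lz : l * cm z <= L by apply: le_trans lL; rewrite ler_piMr //; lra.
have e2 : (l * cm z) ^+ I.+1 / I`!%:R <= e.
  apply: le_trans He; rewrite ler_pM2r ?invr_gt0 ?ltr0n ?fact_gt0 //.
  by rewrite lerXn2r ?nnegrE //; [rewrite mulr_ge0 ?cm_ge0|exact: le_trans l0 lL].
have e3 : 0 <= (l * cm z) ^+ I.+1 / I`!%:R by rewrite divr_ge0 // exprn_ge0 // mulr_ge0 ?cm_ge0.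
apply: le_trans e2; rewrite ler_piMl //.
Qed.

Local Ltac drop := clear -R q psi q0 psiq psi1 psi0 psi_one psiM mm G0.

(** For |z| <= 1/4 and a >= 4 the argument s = 1/2 + a (1 - z) has Re s >= 3, where the Dirichlet
    series converges absolutely. Hence p and the explicit polynomial [RX] are close on |z| = 1/4,
    and so are their coefficients. *)
Lemma coef_approx (a e : R) K : 4 <= a -> 0 < e -> exists (d : R) (N1 : nat), 0 < d /\ forall N, (N1 <= N)%N ->
  forall p : {poly C}, (forall z, cm z <= 4^-1 -> cm (p.[z] - hh a z) <= d) ->
  forall k, (k <= K)%N -> cm (p`_k - rcoef a N k) <= e.
Proof.
move=> a4 e0; have a0 : 0 < a by lra.
(* Reading off a coefficient of index k <= K on the circle of radius 1/4 loses a factor of at most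
   4^K. *)
pose eta := e * 4^-1 ^+ K.
have p4 n : 0 < 4^-1 ^+ n :> R by rewrite exprn_gt0 // invr_gt0.
have eta0 : 0 < eta by rewrite mulr_gt0.
have [D [D0 HD]] := @F_tail R q psi q0 psiq psi1 psi0 psi_one psiM (1 + 2 * a).
have d8 : 0 < eta / 8 by rewrite divr_gt0.
have h2 : 0 < 2^-1 :> R by rewrite invr_gt0.
have D1 : 0 < D + 1 by lra.
have [N1 HN1] := @npw_small R 2^-1 (eta / 8 / (D + 1)) h2 (divr_gt0 d8 D1).
exists (eta / 4), N1.+1; split; first by rewrite divr_gt0.
move=> N N1N p Hp k kK.
have N0 : (0 < N)%N by apply: leq_trans N1N.
pose L := a * ln (N%:R : R).
have L0 : 0 <= L by rewrite mulr_ge0 ?ln_nat_ge0 // ltW.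
have HL n : (0 < n)%N -> (n <= N)%N -> a * ln (n%:R : R) <= L.
  by move=> n0 nN; rewrite ler_pM2l // ler_ln ?posrE ?ltr0n // ler_nat.
have NR : 0 < N%:R :> R by rewrite ltr0n.
have x0 : 0 < eta / 16 / N%:R by rewrite divr_gt0 // divr_gt0.
have [I1 HI1] := fact_small L0 x0.
pose be := mm / a%:C.
pose W := 2 + cm G0 + 3 * cm be + 1.
have W0 : 0 < W by have := cm_ge0 G0; have := cm_ge0 be; rewrite /W; (drop; lra).
have q4 : 0 <= 4^-1 :> R by rewrite invr_ge0.
have q41 : 4^-1 < 1 :> R by (drop; lra).
have y0 : 0 < eta / 32 / W by rewrite divr_gt0 // divr_gt0.
have [I2 HI2] := small_pow q4 q41 y0.
pose I := maxn (maxn K 1) (maxn I1 I2).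
have IK : (k <= I)%N by rewrite (leq_trans kK) // /I !leq_max leqnn.
have I10 : (0 < I)%N by rewrite /I !leq_max orbT.
have e1 : L ^+ I.+1 / I`!%:R <= eta / 16 / N%:R by apply: HI1; rewrite /I !leq_max leqnn !orbT.
have e2 : 4^-1 ^+ I.+1 <= eta / 32 / W by apply: HI2; rewrite leqW // /I !leq_max leqnn !orbT.
pose RX := geoX I * (PhiX a N I - G0%:P + (mm / a%:C)%:P * geoX I).
have main z : cm z <= 4^-1 -> cm (RX.[z] - hh a z) <= 3 / 4 * eta.
  move=> z4; set w := a%:C * (1 - z); set s := hlf R + w.
  have rz : complex.Re z <= 4^-1 by apply: le_trans z4; apply: le_trans (cm_Re z); exact: ler_norm.
  have rs : 3 <= complex.Re s.
    rewrite reD reMr reD reN /=; have : a * (3/4) <= a * (1 - complex.Re z) by rewrite ler_pM2l //; (move: rz; drop; lra).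
    (move: a4; drop; lra).
  have cs : cm s <= 1 + 2 * a.
    apply: (le_trans (cm_D _ _)); apply: lerD; first by rewrite cm_real ger0_norm //; (drop; lra).
    rewrite cmM cm_real ger0_norm ?(ltW a0) // mulrC ler_pM2r //.
    apply: (le_trans (cm_subD _ _)); rewrite cm1; (move: z4; drop; lra).
  have t1 := HD s N N0 rs cs.
  have t1' : cm (Fpart psi N s - F w) <= eta / 8.
    rewrite /Fw opprK; apply: (le_trans t1).
    have := HN1 N (ltnW N1N); rewrite ler_pdivlMr // => h; have := expR_ge0 (- (2^-1 * ln (N%:R : R))); rewrite -/(npw N (2^-1 : R)) => h3.
    (move: h h3; drop; lra).
  have t2 := PhiX_val (ltW a0) z4 HL e1; rewrite -/w -/s in t2.
  have t2' : 2 * N%:R * (eta / 16 / N%:R) = eta / 8 by field; exact: lt0r_neq0.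
  rewrite t2' in t2.
  have t3 := cm_tri (PhiX a N I).[z] (F w) (Fpart psi N s).
  have fb : cm (F w) <= 2 by rewrite /Fw cmN; apply: (@F_bound R q psi q0 psiq psi1 psi0 psi_one psiM).
  have g1 := geoX_val I z4.
  have z1 : 3/4 <= cm (1 - z) by have := cm_rev 1 z; rewrite cm1; (move: z4; drop; lra).
  have zn : 1 - z != 0 by rewrite -cm_gt0; (move: z1; drop; lra).
  have gb : cm (1 - z)^-1 <= 3/2.
    by rewrite cmV -[leRHS]invrK lef_pV2 ?posrE ?invr_gt0 //; (move: z1; drop; lra).
  set g := (1 - z)^-1 in g1 gb *; set G := (geoX I).[z] in g1 *.
  set x4 := 4^-1 ^+ I.+1 in e2 g1; have x40 : 0 <= x4 := ltW (p4 I.+1).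
  have x4s : x4 <= 8^-1.
    rewrite /x4 exprS; have : 4^-1 ^+ I <= 4^-1 :> R.
      by rewrite -{2}[4^-1]expr1 ler_wiXn2l //; exact: ltW.
    (drop; lra).
  have Gb : cm G <= 2.
    have := cm_rev G g; (move: gb g1 x4s; drop; lra).
  have an : a%:C != 0 :> C by rewrite -cm_gt0 cm_real gtr0_norm.
  have -> : RX.[z] - hh a z = (G - g) * (F w - G0 + be * g) + G * ((PhiX a N I).[z] - F w + be * (G - g)).
    rewrite /RX /hh !hornerE -/G -/w /be /g; rewrite /w; field; by rewrite an zn.
  apply: (le_trans (cm_D _ _)); rewrite !cmM.
  have b1 : cm (F w - G0 + be * g) <= 2 + cm G0 + 3/2 * cm be.
    apply: (le_trans (cm_D _ _)); apply: lerD; last by rewrite cmM mulrC ler_wpM2r ?cm_ge0.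
    by apply: (le_trans (cm_subD _ _)); rewrite lerD2r.
  have b2 : cm ((PhiX a N I).[z] - F w + be * (G - g)) <= eta / 4 + cm be * (2 * x4).
    apply: (le_trans (cm_D _ _)); apply: lerD; first (move: t1' t2 t3; drop; lra).
    by rewrite cmM ler_wpM2l ?cm_ge0.
  have c1 : cm (G - g) * cm (F w - G0 + be * g) <= 2 * x4 * (2 + cm G0 + 3/2 * cm be).
    by apply: ler_pM; rewrite ?cm_ge0.
  have c2 : cm G * cm ((PhiX a N I).[z] - F w + be * (G - g)) <= 2 * (eta / 4 + cm be * (2 * x4)).
    by apply: ler_pM; rewrite ?cm_ge0.
  have e2' : x4 * W <= eta / 32 by rewrite -ler_pdivlMr.
  move: e2'; rewrite /W; have : 0 <= x4 * cm G0 by rewrite mulr_ge0 ?cm_ge0.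
  have : 0 <= x4 * cm be by rewrite mulr_ge0 ?cm_ge0.
  (move: x40 c1 c2; drop; lra).
have : cm (p - RX)`_k * 4^-1 ^+ k <= eta.
  apply: coef_le_sup => // z zr; have z4 : cm z <= 4^-1 by rewrite zr.
  rewrite hornerD hornerN; have := cm_tri p.[z] RX.[z] (hh a z); have := main z z4; have := Hp z z4.
  rewrite (cmB RX.[z] (hh a z)); (drop; lra).
rewrite coefB /RX RX_coef // /eta => h.
have kk : 4^-1 ^+ K <= 4^-1 ^+ k :> R by rewrite ler_wiXn2l //; (drop; lra).
rewrite -(ler_pM2r (p4 k)); apply: (le_trans h); by rewrite ler_pM2l.
Qed.

End Coefficients.

(** * Mean values over logarithmic blocks *)

Section KeyBound.
Variable R : realType.
Local Notation C := R[i].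
Implicit Types (s z w : C) (a u rho x y t e : R).

Lemma Hol_Pap_deriv r (f g : C -> C) : Hol r f g -> Pap r g.
Proof.
move=> H e e0; have [p Hp] := H e e0; exists p^`() => z zr.
by have [_ h] := Hp z zr.
Qed.

Lemma Pap_scale r r' (c : C) (f : C -> C) : 0 <= r -> cm c * r <= r' -> Pap r' f -> Pap r (fun z => f (c * z)).
Proof.
move=> r0 cr H e e0; have [p Hp] := H e e0; exists (p \Po (c *: 'X)) => z zr.
rewrite horner_comp hornerZ hornerX; apply: Hp; rewrite cmM; apply: le_trans cr.
by rewrite ler_wpM2l ?cm_ge0.
Qed.

(* The filter: it is close to 1 for |1 - z| << 1/J and decays like 1/(J |1 - z|). *)
Definition avgX (J : nat) : {poly C} := (J%:R^-1)%:P * \sum_(i < J) 'X^i.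

Lemma avgX_val J z : (avgX J).[z] = J%:R^-1 * \sum_(i < J) z ^+ i.
Proof.
rewrite /avgX hornerM hornerC horner_sum; congr (_ * _).
by apply: eq_bigr => i _; rewrite hornerXn.
Qed.

Lemma avgX_le1 J z : (0 < J)%N -> cm z <= 1 -> cm (avgX J).[z] <= 1.
Proof.
move=> J0 z1; rewrite avgX_val cmM cmV cm_nat mulrC ler_pdivrMr ?ltr0n // mul1r.
apply: (le_trans (cm_sum _ _ _)); apply: (@le_trans _ _ (\sum_(i < J) 1)).
  by apply: ler_sum => i _; rewrite cmX exprn_ile1 ?cm_ge0.
by rewrite sumr_const card_ord.
Qed.

Lemma avgX_decay J z : (0 < J)%N -> cm z <= 1 -> cm (avgX J).[z] * (J%:R * cm (1 - z)) <= 2.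
Proof.
move=> J0 z1; have Jn : J%:R != 0 :> C by rewrite pnatr_eq0 -lt0n.
rewrite -cm_nat -!cmM avgX_val.
have -> : J%:R^-1 * (\sum_(i < J) z ^+ i) * (J%:R * (1 - z)) = - ((z - 1) * \sum_(i < J) z ^+ i) by field.
rewrite -subrX1 cmN; apply: (le_trans (cm_subD _ _)); rewrite cm1 cmX.
have := exprn_ile1 J (cm_ge0 z) z1; lra.
Qed.

Lemma avgX_compl J z : (0 < J)%N -> cm z <= 1 -> cm (1 - (avgX J).[z]) <= J%:R * cm (1 - z).
Proof.
move=> J0 z1; have Jn : J%:R != 0 :> C by rewrite pnatr_eq0 -lt0n.
have JR : 0 < J%:R :> R by rewrite ltr0n.
have -> : 1 - (avgX J).[z] = J%:R^-1 * \sum_(i < J) (1 - z ^+ i).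
  rewrite sumrB sumr_const card_ord avgX_val mulrBr; congr (_ - _).
  by rewrite mulVf.
rewrite cmM cmV cm_nat mulrC ler_pdivrMr //.
apply: (le_trans (cm_sum _ _ _)); apply: (@le_trans _ _ (\sum_(i < J) J%:R * cm (1 - z))); last first.
  by rewrite sumr_const card_ord mulr_natr.
apply: ler_sum => i _; rewrite -opprB subrX1 -mulNr opprB cmM mulrC ler_wpM2r ?cm_ge0 //.
apply: (le_trans (cm_sum _ _ _)); apply: (@le_trans _ _ (\sum_(j < i) 1)).
  by apply: ler_sum => j _; rewrite cmX exprn_ile1 ?cm_ge0.
by rewrite sumr_const card_ord ler_nat ltnW.
Qed.

Lemma expR_le_1sub x : 0 <= x -> x <= 1/2 -> expR (- (2 * x)) <= 1 - x.
Proof.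
move=> x0 x1; have h := expR_ge1Dx (2 * x).
have p : 0 < 1 + 2 * x by lra.
rewrite expRN; apply: (@le_trans _ _ (1 + 2 * x)^-1).
  by rewrite lef_pV2 ?posrE // expR_gt0.
rewrite -div1r ler_pdivrMr //; nra.
Qed.

Lemma count_lower x y K : 0 <= x -> y <= K%:R -> y - x - 1 <= \sum_(k < K) ((x <= k%:R < y)%R%:R : R).
Proof.
move=> x0 yK; suff : Num.min K%:R y - x - 1 <= \sum_(k < K) ((x <= k%:R < y)%R%:R : R) by rewrite (min_r yK).
elim: K {yK} => [|K IH].
  rewrite big_ord0; have : Num.min 0%:R y <= 0 :> R by rewrite ge_min lexx.
  lra.
have s0 : 0 <= \sum_(k < K) ((x <= k%:R < y)%R%:R : R) by apply: sumr_ge0.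
rewrite big_ord_recr /=.
have m1 : Num.min K.+1%:R y <= K.+1%:R :> R by rewrite ge_min lexx.
have m2 : Num.min K.+1%:R y <= y :> R by rewrite ge_min lexx orbT.
rewrite -[K.+1%:R]natr1 in m1 m2 *.
have [h1|h1] := leP x K%:R; have [h2|h2] := ltP K%:R y => /=.
- rewrite (min_l (ltW h2)) in IH; lra.
- rewrite (min_r h2) in IH; lra.
- lra.
- lra.
Qed.

Lemma count_disjoint (f : nat -> R) x M : (forall n, (0 < n)%N -> f n <= f n.+1) ->
  \sum_(1 <= n < M) ((f n <= x < f n.+1)%R%:R : R) <= 1.
Proof.
move=> fm; case: M => [|M]; first by rewrite big_geq.
have : \sum_(1 <= n < M.+1) ((f n <= x < f n.+1)%R%:R : R) = (f 1%N <= x)%R%:R - (f M.+1 <= x)%R%:R.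
  elim: M => [|M IH]; first by rewrite big_geq // subrr.
  rewrite big_nat_recr //= IH; have := fm M.+1 isT => h.
  have [h1|h1] := leP (f M.+1) x; have [h2|h2] := leP (f M.+2) x => /=; try ring.
  by move: (le_trans h h2); rewrite leNgt h1.
move=> ->; case: (f 1%N <= x) => /=; case: (f M.+1 <= x) => /=; lra.
Qed.

Lemma half_step x y t : 1 <= x -> x + x <= y -> y <= t -> x <= t - 1.
Proof. lra. Qed.

Lemma sum_if_le N M (T : R) : 0 <= T -> \sum_(1 <= n < N.+1) (if (n <= M)%N then T else 0) <= M%:R * T.
Proof.
move=> T0; suff : \sum_(1 <= n < N.+1) (if (n <= M)%N then T else 0) <= (minn N M)%:R * T.
  move=> h; apply: (le_trans h); rewrite ler_wpM2r // ler_nat geq_minr //.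
elim: N => [|N IH]; first by rewrite big_geq // min0n mul0r.
rewrite big_nat_recr //=; case: ifP => h.
  rewrite (minn_idPl h); rewrite (minn_idPl (ltnW h)) in IH; rewrite -[N.+1%:R]natr1 mulrDl mul1r.
  by rewrite lerD2r.
by rewrite addr0; apply: (le_trans IH); rewrite ler_wpM2r // ler_nat leq_min geq_minr (leq_trans (geq_minl _ _)).
Qed.

Section Fixed.
Variables (q : nat) (psi : nat -> C).
Hypothesis q0 : (0 < q)%N.
Hypothesis psiq : forall n, psi (n + q)%N = psi n.
Hypothesis psi1 : forall n, cm (psi n) <= 1.
Hypothesis psi0 : \sum_(k < q) psi k = 0.
Hypothesis psi_one : psi 1%N = 1.
Hypothesis psiM : forall m n, psi (m * n)%N = psi m * psi n.
Hypothesis grh : forall s : C, 2^-1 < complex.Re s -> Defs.Lfun psi s != 0.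
Variables (m : nat) (G0 : C).
Local Notation mm := (m%:R : C).
Local Notation F := (@Fw R psi).
Local Notation hha := (hh psi mm G0).
Local Notation H := (HH F mm G0).

Lemma HH_Pap a r : 0 <= r -> r < a -> Pap r (fun z => H (a%:C + z)).
Proof.
move=> r0 ra; have a0 : 0 < a by lra.
have s0 : r < complex.Re (hlf R + a%:C) by rewrite reD /=; lra.
have HL := @L_Hol R q psi q0 psiq psi1 psi0 _ _ r0 s0.
have nz z : cm z <= r -> Defs.Lfun psi (hlf R + a%:C + z) != 0.
  move=> zr; apply: grh; rewrite !reD /=; have := cm_Re z; rewrite ler_norml => /andP[]; lra.
have Pi := Hol_inv r0 HL nz; have Pg := Hol_Pap_deriv HL.
have ra' : r < cm (- a%:C) by rewrite cmN cm_real gtr0_norm.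
have Pw : Pap r (fun z => (z - - a%:C)^-1) := Pap_inv_linear r0 ra'.
have P1 := Pap_opp (Pap_mul r0 Pg Pi).
have P2 := Pap_mul r0 (@Pap_const R r mm) Pw.
have P3 := Pap_add (Pap_add P1 P2) (@Pap_const R r (- G0)).
apply: Pap_ext (Pap_mul r0 P3 Pw) => z _.
by rewrite /HH /Fw opprK (addrC z) -!addrA.
Qed.

Lemma hh_HH a z : a != 0 -> hha a z = a%:C * H (a%:C * (1 - z)).
Proof.
move=> an; have an' : a%:C != 0 by rewrite -cm_gt0 cm_real normr_gt0.
(* At z = 1 both sides are 0, because the inverse of 0 is 0. *)
rewrite /hh /HH; case: (eqVneq (1 - z) 0) => [->|zn]; first by rewrite !(mulr0, invr0).
set X := F _ + _ - G0; by field; rewrite an' zn.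
Qed.

Lemma hh_Pap a r : 0 < a -> 0 <= r -> r < 1 -> Pap r (hha a).
Proof.
move=> a0 r0 r1; have ar0 : 0 <= a * r by rewrite mulr_ge0 // ltW.
have ar1 : a * r < a by rewrite -[ltRHS]mulr1 ltr_pM2l.
have cr : cm (- a%:C) * r <= a * r by rewrite cmN cm_real gtr0_norm.
have P1 := Pap_scale r0 cr (HH_Pap ar0 ar1).
apply: Pap_ext (Pap_mul r0 (@Pap_const R r a%:C) P1) => z _.
rewrite hh_HH ?lt0r_neq0 //; congr (_ * H _); ring.
Qed.

Variables (w0 KF KL K0 : R).
Hypothesis w00 : 0 < w0.
Hypothesis w01 : w0 <= 1.
Hypothesis KF0 : 0 <= KF.
Hypothesis crude : forall w, 0 < complex.Re w -> cm (F w) <= KF * lg (complex.Im w) * (1 + (complex.Re w) ^- 2).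
Hypothesis KL0 : 0 <= KL.
Hypothesis local : forall t sg, 0 < sg -> exists cs : seq C,
  [/\ (size cs)%:R <= KL * lg t,
   forall c, c \in cs -> complex.Re c <= sg / 2,
   forall w c, c \in cs -> 0 < complex.Re w -> complex.Re w <= 64^-1 -> `|complex.Im w - t| <= 64^-1 -> cm (w - c) <= 1 &
   forall w, sg <= complex.Re w -> complex.Re w <= 64^-1 -> `|complex.Im w - t| <= 64^-1 ->
     cm (F w) <= \sum_(c <- cs) (cm (w - c))^-1 + KL * lg t].
Hypothesis K00 : 0 <= K0.
Hypothesis zero : forall w, 0 < complex.Re w -> cm w <= w0 -> cm (F w + mm / w - G0) <= K0 * cm w.

Local Ltac drop := clear -R q psi q0 psiq psi1 psi0 psi_one psiM grh m G0 w0 KF KL K0 w00 w01 KF0 crude KL0 local K00 zero.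

(** The choice a = J u^16 places the cutoff J |1 - z| = 1 of the filter at |w| = u^16, and rho gives
    a (1 - rho) = 1/u, so the circle lies in Re w >= 1/u. The coefficients of the low part are
    bounded by its mean, those of the high part by Parseval; the gain u^(-4) is weakened to 1/u. *)
Lemma low_high : exists C1 C2, 0 <= C1 /\ 0 <= C2 /\ forall u a rho J (p : {poly C}),
  4 <= u -> (0 < J)%N -> a = J%:R * u ^+ 16 -> rho = 1 - (a * u)^-1 ->
  (forall z, cm z <= rho -> cm (p.[z] - hha a z) <= 1) ->
  exists lo hi : {poly C}, [/\ p = lo + hi, forall k, cm lo`_k * rho ^+ k <= C1 * ln u ^+ 3 &
    forall K, \sum_(k < K) (cm hi`_k * rho ^+ k) ^+ 2 <= C2 * (a / u)].
Proof.
have w00' := w00; have w01' := w01; have KF0' := KF0; have K00' := K00; have KL0' := KL0.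
set B1 := 24 * K0 + 160 * KH mm G0 w0 KF * Kd w0 + 24 / w0 * 35 * (KF * 33 * (1 + 64 ^+ 2) + (cm mm / w0 + cm G0)) + Cw w0 * (2 * Cbl KL) * 40.
set B2 := 24 * K0 ^+ 2 + 160 * Kd w0 * KH mm G0 w0 KF ^+ 2.
pose C1 := Num.max 0 (B1 + 1); pose C2 := Num.max 0 (2 * B2 + 8).
exists C1, C2; split; first by rewrite le_max lexx.
split; first by rewrite le_max lexx.
move=> u a rho J p u4 J0 Ea Er Hp.
have u0 : 0 < u by (move: u4; drop; lra).
have u1 : 1 <= u by (move: u4; drop; lra).
have uu : u ^+ 1 <= u ^+ 16 by apply: ler_weXn2l.
rewrite expr1 in uu; have u16 : 4 <= u ^+ 16 by (move: u4 uu; drop; lra).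
have J1 : 1 <= J%:R :> R by rewrite ler1n.
have a4 : 4 <= a by rewrite Ea; apply: (le_trans u16); rewrite ler_peMl //; (move: u1 uu; drop; lra).
have a0 : 0 < a by (move: a4; drop; lra).
have au : u <= a by rewrite Ea; apply: (le_trans uu); rewrite ler_peMl //; (move: u16; drop; lra).
have au0 : 0 < a * u by rewrite mulr_gt0.
have aui : (a * u)^-1 <= 2^-1.
  rewrite lef_pV2 ?posrE //; apply: (@le_trans _ _ (1 * a)); first (move: a4; drop; lra).
  by rewrite mulrC ler_pM2l //; lra.
have aui0 : 0 < (a * u)^-1 by rewrite invr_gt0.
have rho0 : 2^-1 <= rho by rewrite Er; (move: aui; drop; lra).
have rho1 : rho <= 1 by rewrite Er; (move: aui0; drop; lra).
have rhop : 0 <= rho by (move: rho0; drop; lra).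
have arho : a * (1 - rho) = u^-1.
  by rewrite Er opprB addrC subrK invfM mulrA divff ?mul1r // lt0r_neq0.
have lu : 1 <= ln u by apply: lnu1.
pose lo := avgX J * p; pose hi := (1 - avgX J) * p.
exists lo, hi.
have zc N l : cm (rho%:C * om R N ^+ l) = rho by rewrite cmM cm_omX mulr1 cm_real ger0_norm.
have zcl N l : cm (rho%:C * om R N ^+ l) <= rho by rewrite zc.
have zcl1 N l : cm (rho%:C * om R N ^+ l) <= 1 by rewrite zc.
have pb N l : cm p.[rho%:C * om R N ^+ l] <= a * cm (H (cpt a rho N l)) + 1.
  have h := Hp _ (zcl N l); rewrite hh_HH ?lt0r_neq0 // in h.
  have := cm_rev p.[rho%:C * om R N ^+ l] (a%:C * H (a%:C * (1 - rho%:C * om R N ^+ l))).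
  rewrite -/(cpt a rho N l) in h *; rewrite (cmM a%:C) cm_real gtr0_norm //; (move: h; drop; lra).
have cw N l : a * cm (1 - rho%:C * om R N ^+ l) = cm (cpt a rho N l).
  by rewrite /cpt cmM cm_real gtr0_norm.
(* N must exceed the degrees, so that averages over N-th roots of unity are exact, and 2 a u, so
   that neighbouring points are closer than 1/u, the scale of the polar terms. *)
have bigN K : exists N : nat, [/\ (0 < N)%N, (K <= N)%N, (size lo <= N)%N, (size hi <= N)%N & 2 * a * u <= N%:R].
  have [N1 HN1] := big_nat_ex (2 * a * u).
  exists (maxn N1.+1 (maxn K (maxn (size lo) (size hi)))); split; rewrite ?leq_max ?leqnn ?orbT //.
  by apply: (le_trans HN1); rewrite ler_nat leq_max leqnn.
split.
- by rewrite /lo /hi -mulrDl addrC subrK mul1r.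
- move=> k; have [N [N0 kN slo shi Nau]] := bigN k.+1.
  have NR : 0 < N%:R :> R by rewrite ltr0n.
  apply: (le_trans (coef_le_mean N0 slo kN rhop)).
  pose Av l := cm (avgX J).[rho%:C * om R N ^+ l].
  have Av1 l : Av l <= 1 by apply: avgX_le1.
  have Av0 l : 0 <= Av l := cm_ge0 _.
  have Avw l : Av l * cm (cpt a rho N l) <= 4 * u ^+ 16.
    have h := avgX_decay J0 (zcl1 N l); rewrite -cw -/(Av l) in h *.
    have -> : Av l * (a * cm (1 - rho%:C * om R N ^+ l)) = (Av l * (J%:R * cm (1 - rho%:C * om R N ^+ l))) * u ^+ 16.
      by rewrite {1}Ea; ring.
    rewrite ler_wpM2r //; (move: u1 uu h; drop; lra).
  have LB := low_bound w00 w01 KF0 crude KL0 local K00 zero a0 rho0 rho1 N0 arho u4 Nau Av0 Av1 Avw.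
  rewrite -/B1 in LB.
  apply: (@le_trans _ _ (N%:R^-1 * \sum_(l < N) (a * (cm (H (cpt a rho N l)) * Av l) + 1))).
    rewrite ler_wpM2l ?invr_ge0 ?(ltW NR) //; apply: ler_sum => l _.
    rewrite /lo hornerM cmM -/(Av l); have := pb N l => hp.
    apply: (@le_trans _ _ (Av l * (a * cm (H (cpt a rho N l)) + 1))); first by rewrite ler_wpM2l.
    by rewrite mulrDr mulr1 lerD // mulrC mulrA.
  rewrite big_split /= sumr_const card_ord -mulr_sumr mulrDr mulVf ?lt0r_neq0 //.
  have -> : N%:R^-1 * (a * \sum_(l < N) cm (H (cpt a rho N l)) * Av l) = a / N%:R * \sum_(l < N) cm (H (cpt a rho N l)) * Av l by ring.
  have l3 : 1 <= ln u ^+ 3 by rewrite expr_ge1 //; (move: lu; drop; lra).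
  have c1 : B1 + 1 <= C1 by rewrite le_max lexx orbT.
  have : (B1 + 1) * ln u ^+ 3 <= C1 * ln u ^+ 3 by rewrite ler_wpM2r //; (move: l3; drop; lra).
  rewrite mulrDl mul1r; (move: LB l3; drop; lra).
move=> K; have [N [N0 kN slo shi Nau]] := bigN K.
have NR : 0 < N%:R :> R by rewrite ltr0n.
apply: (@le_trans _ _ (\sum_(k < N) (cm hi`_k * rho ^+ k) ^+ 2)).
  rewrite -!(big_mkord xpredT (fun k => (cm hi`_k * rho ^+ k) ^+ 2)) [leRHS](big_cat_nat (leq0n K) kN) /= lerDl.
  by apply: sumr_ge0 => k _; exact: sqr_ge0.
rewrite (parseval N0 shi rhop).
pose Bv l := cm (1 - (avgX J).[rho%:C * om R N ^+ l]).
have Bv0 l : 0 <= Bv l := cm_ge0 _.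
have Bv2 l : Bv l <= 2.
  by apply: (le_trans (cm_subD _ _)); rewrite cm1; have := avgX_le1 J0 (zcl1 N l); (drop; lra).
have Bvw l : Bv l <= cm (cpt a rho N l) / u ^+ 16.
  rewrite -cw; set y := cm (1 - _); have -> : a * y / u ^+ 16 = J%:R * y by rewrite Ea; field; exact: lt0r_neq0.
  exact: (avgX_compl J0 (zcl1 N l)).
have Na' : a <= N%:R by apply: le_trans Nau; rewrite mulrAC ler_peMl //; (move: u1 a4; drop; lra).
have HB := high_bound w00 w01 KF0 crude K00 zero a0 rho0 rho1 N0 arho u1 Na' Bv0 Bv2 Bvw.
rewrite -/B2 in HB.
apply: (@le_trans _ _ (N%:R^-1 * \sum_(l < N) (2 * a ^+ 2 * (cm (H (cpt a rho N l)) ^+ 2 * Bv l ^+ 2) + 8))).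
  rewrite ler_wpM2l ?invr_ge0 ?(ltW NR) //; apply: ler_sum => l _.
  have -> : hi.[rho%:C * om R N ^+ l] = (1 - (avgX J).[rho%:C * om R N ^+ l]) * p.[rho%:C * om R N ^+ l].
    by rewrite /hi hornerM hornerD hornerN hornerC.
  rewrite cmM -/(Bv l) exprMn.
  have hp := pb N l; set h := cm (H _) in hp *; set b := Bv l; set P := cm p.[_] in hp *.
  have P0 : 0 <= P := cm_ge0 _.
  have e1 : P ^+ 2 <= 2 * (a * h) ^+ 2 + 2.
    have : P ^+ 2 <= (a * h + 1) ^+ 2 by rewrite lerXn2r ?nnegrE //; (move: hp P0; drop; lra).
    have := sqr_ge0 (a * h - 1); rewrite !expr2; (drop; lra).
  have b4 : b ^+ 2 <= 4.
    have : b ^+ 2 <= 2 ^+ 2 by rewrite lerXn2r ?nnegrE ?Bv0 ?Bv2.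
    by rewrite [2 ^+ 2]expr2; (drop; lra).
  have := ler_wpM2l (sqr_ge0 b) e1; rewrite exprMn; (move: b4; drop; lra).
rewrite big_split /= sumr_const card_ord -mulr_sumr mulrDr -[8 *+ N]mulr_natl mulKf ?lt0r_neq0 //.
have -> : N%:R^-1 * (2 * a ^+ 2 * \sum_(l < N) cm (H (cpt a rho N l)) ^+ 2 * Bv l ^+ 2) =
  2 * a * (a / N%:R * \sum_(l < N) cm (H (cpt a rho N l)) ^+ 2 * Bv l ^+ 2) by ring.
have a2 : 0 <= 2 * a by (move: a4; drop; lra).
have B20 : 0 <= B2.
  apply: addr_ge0; apply: mulr_ge0; try exact: sqr_ge0; first exact: ler0n.
  by apply: mulr_ge0; [exact: ler0n|exact: expR_ge0].
have u4i : u ^- 4 <= u^-1.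
  have u14 : u ^+ 1 <= u ^+ 4 by apply: ler_weXn2l.
  by rewrite lef_pV2 ?posrE ?exprn_gt0 // -{1}[u]expr1.
have au1 : 1 <= a / u by rewrite ler_pdivlMr // mul1r.
have c2 : 2 * B2 + 8 <= C2 by rewrite le_max lexx orbT.
have e1 := ler_wpM2l a2 HB.
have e2 : B2 * u ^- 4 <= B2 * u^-1 by rewrite ler_wpM2l.
have e3 := ler_wpM2l a2 e2.
have : (2 * B2 + 8) * (a / u) <= C2 * (a / u) by rewrite ler_wpM2r //; (move: au1; drop; lra).
have : 2 * a * (B2 * u^-1) = 2 * B2 * (a / u) by ring.
rewrite mulrDl; (move: au1 e1 e3; drop; lra).
Qed.

(* The limit shape of [rcoef], with the Poisson law replaced by a point mass at its mean. *)
Definition bcoef a (N k : nat) : C :=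
  \sum_(1 <= n < N.+1) cN psi n * (a * ln n%:R <= k%:R)%R%:R - G0 + mm / a%:C * k.+1%:R.

Lemma two_pow_le k : 2 ^+ k <= expR (k%:R) :> R.
Proof.
rewrite -[k%:R]mulr1 expRM_natl lerXn2r ?nnegrE ?expR_ge0 //; have := expR_ge1Dx (1 : R); lra.
Qed.

(** Replacing the Poisson distribution function by a step costs o(a) in total. For n up to e^V this
    follows from Chebyshev's inequality with window eta a; larger n have mean l > 4 k, and
    Chernoff's bound gives at most e^(k - l/2) <= n^(-a/4), which is summable. *)
Lemma rb_close (U : nat) e : 0 < e -> exists A0, forall a N K, A0 <= a -> K%:R <= a * (U%:R + 2) ->
  \sum_(k < K) cm (rcoef psi mm G0 a N k - bcoef a N k) <= e * a.
Proof.
move=> e0; pose V : R := 4 * (U%:R + 2).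
have U0 : 0 <= U%:R :> R by [].
have V0 : 8 <= V by rewrite /V; lra.
pose M := Num.truncn (expR V); have /andP[M1 M2] := truncn_itv (expR_ge0 V).
have Mp : 0 <= M%:R :> R by [].
(* At most M integers lie below e^V; each contributes about 4 eta a, together at most e a / 4. *)
pose eta := e / (16 * (M%:R + 1)).
have eta0 : 0 < eta by rewrite divr_gt0 // mulr_gt0 //; lra.
pose Z := 2 * M%:R * (1 + (U%:R + 2) * V / eta ^+ 2) + 8.
have eta2 : 0 < eta ^+ 2 by rewrite exprn_gt0.
exists (16 + 2 * Z / e) => a N K aA KU.
have Z0 : 0 <= Z by rewrite /Z addr_ge0 // mulr_ge0 ?mulr_ge0 // addr_ge0 // divr_ge0 ?(ltW eta2) // mulr_ge0; (move: U0 V0; drop; lra).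
have Ze : 0 <= 2 * Z / e by rewrite divr_ge0 ?(ltW e0) //; (move: Z0; drop; lra).
have a16 : 16 <= a by (move: aA Ze; drop; lra).
have a0 : 0 < a by (move: a16; drop; lra).
have aZ : 2 * Z <= e * a by rewrite [e * a]mulrC -ler_pdivrMr //; (move: aA; drop; lra).
pose dv n k := `|poisQ (a * ln n%:R) k - (a * ln n%:R <= k%:R)%R%:R|.
pose T1 := 2 * (eta * a) + 1 + (U%:R + 2) * V / eta ^+ 2.
have T10 : 0 <= T1.
  have : 0 < eta * a by rewrite mulr_gt0.
  have : 0 <= (U%:R + 2) * V / eta ^+ 2 by rewrite divr_ge0 ?(ltW eta2) // mulr_ge0; (move: U0 V0; drop; lra).
  rewrite /T1; (drop; lra).
pose c := a * (U%:R + 2) * expR (- ((a / 4 - 2) * V)).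
have c0 : 0 <= c by rewrite mulr_ge0 ?expR_ge0 // mulr_ge0; (move: U0 aA Ze; drop; lra).
have S n : (0 < n)%N -> \sum_(k < K) dv n k <= (if (n <= M)%N then T1 else 0) + c * npw n 2.
  move=> n0; have l0 : 0 <= a * ln (n%:R : R) by rewrite mulr_ge0 ?ln_nat_ge0 // ltW.
  have cn0 : 0 <= c * npw n 2 by rewrite mulr_ge0 ?expR_ge0.
  case: leqP => nM.
    have D0 : 0 < eta * a by rewrite mulr_gt0.
    apply: (le_trans (pois_dev_sum K l0 D0)); apply: ler_wpDr => //; rewrite /T1 lerD2l.
    have lnV : ln (n%:R : R) <= V.
      rewrite -[leRHS]expRK ler_ln ?posrE ?ltr0n ?expR_gt0 //; apply: le_trans M1; by rewrite ler_nat.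
    have D2 : 0 < (eta * a) ^+ 2 by rewrite exprn_gt0.
    apply: (@le_trans _ _ (a * (U%:R + 2) * (a * V / (eta * a) ^+ 2))).
      apply: ler_pM => //; first by rewrite divr_ge0 // ltW.
      by rewrite ler_pM2r ?invr_gt0 // ler_pM2l.
    by apply: le_eq; rewrite exprMn; field; rewrite !lt0r_neq0.
  rewrite add0r.
  have lnV : V <= ln (n%:R : R).
    rewrite -[leLHS]expRK ler_ln ?posrE ?ltr0n ?expR_gt0 //; apply: ltW; apply: (lt_le_trans M2); by rewrite ler_nat.
  have npb : npw n (a / 4) <= expR (- ((a / 4 - 2) * V)) * npw n 2.
    have -> : npw n (a / 4) = npw n (a / 4 - 2) * npw n 2 by rewrite -npwD; congr npw; (drop; lra).
    rewrite ler_wpM2r ?expR_ge0 // /npw ler_expR lerN2 ler_wpM2l //; (move: a16; drop; lra).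
  apply: (@le_trans _ _ (\sum_(k < K) (expR (- ((a / 4 - 2) * V)) * npw n 2))); last first.
    rewrite sumr_const card_ord -[leLHS]mulr_natl /c -[leRHS]mulrA.
    by apply: ler_wpM2r => //; rewrite mulr_ge0 ?expR_ge0.
  apply: ler_sum => k _; apply: le_trans npb.
  have kK : k%:R < a * ln (n%:R : R) / 4.
    have : k%:R < K%:R :> R by rewrite ltr_nat.
    have : a * V <= a * ln (n%:R : R) by rewrite ler_pM2l.
    rewrite /V; (move: KU; drop; lra).
  have kf : (a * ln (n%:R : R) <= k%:R) = false by apply/negbTE; rewrite -ltNge; (move: l0 kK; drop; lra).
  rewrite /dv kf subr0 ger0_norm ?poisQ_ge0 //.
  apply: (le_trans (poisQ_small k l0)); apply: (le_trans (ler_wpM2r (expR_ge0 _) (two_pow_le k))).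
  rewrite -expRD /npw ler_expR; (move: kK; drop; lra).
have main : \sum_(k < K) cm (rcoef psi mm G0 a N k - bcoef a N k) <= \sum_(1 <= n < N.+1) 2 * ((if (n <= M)%N then T1 else 0) + c * npw n 2).
  apply: (@le_trans _ _ (\sum_(k < K) \sum_(1 <= n < N.+1) 2 * dv n k)).
    apply: ler_sum => k _.
    have -> : rcoef psi mm G0 a N k - bcoef a N k = \sum_(1 <= n < N.+1) cN psi n * (poisQ (a * ln n%:R) k - (a * ln n%:R <= k%:R)%R%:R)%:C.
      rewrite /rcoef /bcoef.
      have -> : forall X Y g0 g1 : C, X - g0 + g1 - (Y - g0 + g1) = X - Y by move=> X Y g0' g1; ring.
      rewrite -sumrB; apply: eq_bigr => n _; rewrite -mulrBr rmorphB /=; congr (_ * (_ - _)).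
      by rewrite rmorph_nat.
    apply: (le_trans (cm_sum _ _ _)); rewrite !big_nat; apply: ler_sum => n /andP[n0 _].
    rewrite cmM cm_real ler_wpM2r //; exact: cN_le.
  rewrite exchange_big /= !big_nat; apply: ler_sum => n /andP[n0 _].
  by rewrite -mulr_sumr ler_wpM2l //; exact: S.
apply: (le_trans main); rewrite -mulr_sumr big_split /= -mulr_sumr.
have t1 := @sum_if_le N M T1 T10.
have t2 := @npw_tail R 1 1 N.+1 ltr01 isT; rewrite invr1 in t2.
have n1 : npw 1 (1 : R) <= 1 by apply: npw_le1.
have t3 : \sum_(1 <= n < N.+1) npw n (2 : R) <= 2 by (move: t2 n1; drop; lra).
have t4 : c * 2 <= 4.
  have x0 : 0 < (a / 4 - 2) * V by rewrite mulr_gt0 //; (move: V0 a16; drop; lra).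
  have : expR (- ((a / 4 - 2) * V)) * ((a / 4 - 2) * V) <= 1.
    rewrite expRN mulrC ler_pdivrMr ?expR_gt0 // mul1r; have := expR_ge1Dx ((a / 4 - 2) * V); (drop; lra).
  set E := expR _ => hE.
  have : c * (4 * (a / 4 - 2)) <= a by rewrite -[leRHS]mulr1; apply: le_trans (ler_wpM2l (ltW a0) hE); apply: le_eq; rewrite /c -/E /V; ring.
  move=> h; have : c * (a / 2) <= c * (4 * (a / 4 - 2)) by rewrite ler_wpM2l //; (move: a16; drop; lra).
  move=> h2; have : c * (a / 2) <= a by (move: h h2; drop; lra).
  rewrite mulrCA -[leRHS]mulr1 ler_pM2l //; (drop; lra).
have t5 := ler_wpM2l c0 t3.
have t6 : 4 * M%:R * eta * a <= e / 4 * a.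
  rewrite ler_pM2r // /eta; have -> : 4 * M%:R * (e / (16 * (M%:R + 1))) = e / 4 * (M%:R / (M%:R + 1)).
    by field; rewrite natr1 pnatr_eq0.
  rewrite ler_piMr ?divr_ge0 ?(ltW e0) // ler_pdivrMr; (move: Mp; drop; lra).
have t7 : 0 <= e * a by rewrite mulr_ge0 // ltW.
move: t1; rewrite /T1 => t1.
have : 2 * M%:R * (1 + (U%:R + 2) * V / eta ^+ 2) + 8 <= e * a / 2 by rewrite -/Z; (move: aZ; drop; lra).
have -> : 2 * M%:R * (1 + (U%:R + 2) * V / eta ^+ 2) = 2 * (M%:R * (1 + (U%:R + 2) * V / eta ^+ 2)) by ring.
have E1 : M%:R * (2 * (eta * a) + 1 + (U%:R + 2) * V / eta ^+ 2) = 2 * (M%:R * eta * a) + M%:R * (1 + (U%:R + 2) * V / eta ^+ 2) by ring.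
rewrite E1 in t1.
have E2 : 4 * M%:R * eta * a = 4 * (M%:R * eta * a) by ring.
rewrite E2 in t6; (move: t4 t5 t7 t1 t6; drop; lra).
Qed.

Definition beta (n : nat) : C := \sum_(1 <= j < n.+1) cN psi j + mm * (ln n%:R)%:C - G0.

(** The sums over j agree, because log j <= k / a holds exactly for j <= n. Only m log n and m (k+1)
    / a differ, by at most m (1/n + 1/a). *)
Lemma bcoef_beta a N k n : 1 <= a -> (0 < n)%N -> (n <= N)%N -> a * ln n%:R <= k%:R -> k%:R < a * ln n.+1%:R ->
  cm (beta n - bcoef a N k) <= 2 * m%:R.
Proof.
move=> a1 n0 nN k1 k2; have a0 : 0 < a by lra.
have E : \sum_(1 <= j < N.+1) cN psi j * (a * ln j%:R <= k%:R)%R%:R = \sum_(1 <= j < n.+1) cN psi j.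
  rewrite (big_cat_nat (n := n.+1)) //= [X in _ + X]big1_seq ?addr0.
    rewrite !big_nat; apply: eq_bigr => j /andP[j0 jn].
    have -> : (a * ln j%:R <= k%:R) = true; last by rewrite mulr1.
    by apply: le_trans k1; rewrite ler_pM2l // ler_ln ?posrE ?ltr0n // ler_nat -ltnS.
  move=> j /andP[_]; rewrite mem_index_iota => /andP[nj _].
  have -> : (a * ln j%:R <= k%:R) = false; last by rewrite mulr0.
  apply/negbTE; rewrite -ltNge; apply: (lt_le_trans k2).
  by rewrite ler_pM2l // ler_ln ?posrE ?ltr0n ?(ltn_trans _ nj) // ler_nat.
have an : a%:C != 0 by rewrite -cm_gt0 cm_real gtr0_norm.
rewrite /bcoef E /beta.
have -> : \sum_(1 <= j < n.+1) cN psi j + mm * (ln n%:R)%:C - G0 - (\sum_(1 <= j < n.+1) cN psi j - G0 + mm / a%:C * k.+1%:R) =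
  mm * (ln n%:R - k.+1%:R / a)%:C.
  rewrite rmorphB rmorphM /= fmorphV rmorph_nat; ring.
rewrite cmM cm_nat cm_real mulrC ler_wpM2r //.
have h := @ln_succ_le R n n0; have n1 : n%:R^-1 <= 1 :> R by rewrite invf_le1 ?ler1n ?ltr0n.
have : k.+1%:R / a = k%:R / a + a^-1 by rewrite -natr1 mulrDl mul1r.
have : ln n%:R <= k%:R / a by rewrite ler_pdivlMr // mulrC.
have : k%:R / a < ln n.+1%:R by rewrite ltr_pdivrMr // mulrC.
have : a^-1 <= 1 by rewrite invf_le1.
have : 0 < a^-1 by rewrite invr_gt0.
move=> i1 i2 i3 i4 ->; rewrite ler_norml; apply/andP; split; (move: h n1 i1 i2 i3 i4; drop; lra).
Qed.

Theorem block_bound_beta : exists Cc, 0 <= Cc /\ forall U M : nat, (4 <= U)%N ->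
  \sum_(1 <= n < M | (U%:R <= ln (n%:R : R)) && (ln (n%:R : R) < U%:R + 1))
     Num.max 0 (cm (beta n) - Cc * ln (U%:R : R) ^+ 3) / n%:R <= Cc / U%:R.
Proof.
have [C1 [C2 [C10 [C20 LH]]]] := low_high.
pose E4 : R := expR 4; have E40 : 1 <= E4 by rewrite /E4 -expR0 ler_expR.
have E4p : 0 < E4 by lra.
pose C3 := C1 * E4 + 2 + 2 * m%:R; pose C4 := 4 * (C2 * E4 ^+ 2 + 1).
have C30 : 0 <= C3 by rewrite /C3 !addr_ge0 // mulr_ge0 //; (move: E40; drop; lra).
have C40 : 0 <= C4 by rewrite /C4 mulr_ge0 // addr_ge0 // mulr_ge0 // sqr_ge0.
exists (C3 + C4); split; first lra.
move=> U M U4.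
set u : R := U%:R.
have u4 : 4 <= u by rewrite /u ler_nat.
have u0 : 0 < u by (move: u4; drop; lra).
have lu : 1 <= ln u by apply: lnu1.
have l3 : 1 <= ln u ^+ 3 by rewrite expr_ge1 //; (move: lu; drop; lra).
have [A0 HA0] := @rb_close U u^-1 (ltac:(by rewrite invr_gt0)).
(* J makes a exceed A0, as the Poisson comparison requires, and 4 M, so that for n < M the interval
   from a log n to a log (n+1) contains at least a / (4 n) integers. *)
have [J0 HJ0] := big_nat_ex (Num.max 0 A0 + 16 + 4 * M%:R).
pose J := J0.+1; pose a := J%:R * u ^+ 16.
have u1 : 1 <= u by (move: u4; drop; lra).
have uu : u ^+ 1 <= u ^+ 16 by apply: ler_weXn2l.
rewrite expr1 in uu; have u16 : 4 <= u ^+ 16 by (move: u4 uu; drop; lra).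
have Ja : J%:R <= a by rewrite /a ler_peMr //; (move: u16; drop; lra).
have M0 : 0 <= M%:R :> R by [].
have aA : Num.max 0 A0 + 16 + 4 * M%:R <= a by exact: le_trans HJ0 Ja.
have mA : 0 <= Num.max 0 A0 by rewrite le_max lexx.
have mA2 : A0 <= Num.max 0 A0 by rewrite le_max lexx orbT.
have a0 : 0 < a by (move: M0 aA mA; drop; lra).
have a1 : 1 <= a by (move: M0 aA mA; drop; lra).
have aM : 4 * M%:R <= a by (move: aA mA; drop; lra).
have au : u <= a by apply: (le_trans uu); rewrite /a ler_peMl ?ler1n //; (move: u16; drop; lra).
pose rho := 1 - (a * u)^-1.
have au0 : 0 < a * u by rewrite mulr_gt0.
have aui0 : 0 < (a * u)^-1 by rewrite invr_gt0.
have auih : (a * u)^-1 <= 4^-1.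
  rewrite lef_pV2 ?posrE //; apply: (@le_trans _ _ (1 * u)); first (move: u4; drop; lra).
  by rewrite ler_wpM2r // ltW.
have rho0 : 0 <= rho by rewrite /rho; (move: auih; drop; lra).
have rho1 : rho < 1 by rewrite /rho; (move: aui0; drop; lra).
have rho4 : 4^-1 <= rho by rewrite /rho; (move: auih; drop; lra).
pose K := (J * U ^ 16 * (U + 2))%N.
have KE : K%:R = a * (u + 2) by rewrite /K (natrM _ _ (U + 2)) (natrM _ J) natrD natrX.
have a4 : 4 <= a by (move: M0 aA mA; drop; lra).
have [d [N1 [d0 HC]]] := @coef_approx R q psi q0 psiq psi1 psi0 psi_one psiM mm G0 a 1 K a4 ltr01.
pose N := maxn N1 M.
have N1N : (N1 <= N)%N by rewrite leq_max leqnn.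
have MN : (M <= N)%N by rewrite leq_max leqnn orbT.
have e10 : 0 < Num.min 1 d by rewrite lt_min ltr01.
have [p Hp] := hh_Pap a0 rho0 rho1 e10.
have Hp1 z : cm z <= rho -> cm (p.[z] - hha a z) <= 1.
  by move=> zr; apply: (le_trans (Hp z zr)); rewrite ge_min lexx.
have Hpd z : cm z <= 4^-1 -> cm (p.[z] - hha a z) <= d.
  move=> zr; apply: (le_trans (Hp z (le_trans zr rho4))); by rewrite ge_min lexx orbT.
have {}HC k : (k <= K)%N -> cm (p`_k - rcoef psi mm G0 a N k) <= 1 := HC N N1N p Hpd k.
have [lo [hi [pE Hlo Hhi]]] := LH u a rho J p u4 isT (erefl _) (erefl _) Hp1.
(* All k up to a (U + 2) <= 2 a U are covered, and (1 - 1/(a U))^k >= e^(-2 k / (a U)) >= e^(-4):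
   passing from the circle to the coefficients costs only a constant. *)
have rk k : (k < K)%N -> E4^-1 <= rho ^+ k.
  move=> kK; have h2 : (a * u)^-1 <= 1/2 by (move: auih; drop; lra).
  have h := expR_le_1sub (ltW aui0) h2; rewrite -/rho in h.
  apply: (@le_trans _ _ (expR (- (2 * (a * u)^-1)) ^+ k)); last first.
    by rewrite lerXn2r ?nnegrE ?expR_ge0.
  rewrite -expRM_natl /E4 -expRN ler_expR mulrN lerN2.
  have kK' : k%:R <= a * (u + 2) by rewrite -KE ler_nat ltnW.
  have -> : k%:R * (2 * (a * u)^-1) = 2 * k%:R / (a * u) by ring.
  rewrite ler_pdivrMr //; have : a * (u + 2) <= a * (2 * u) by rewrite ler_pM2l //; (move: u4; drop; lra).
  (move: kK'; drop; lra).
(* The excess of |beta n| over the level L is bounded by s k for every k attached to n; the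
   inequality x <= 1 + x^2 makes the high part accessible to Parseval. *)
pose s k := cm hi`_k ^+ 2 + cm (rcoef psi mm G0 a N k - bcoef a N k).
have s0 k : 0 <= s k by rewrite addr_ge0 ?sqr_ge0 ?cm_ge0.
have Ssum : \sum_(k < K) s k <= (C2 * E4 ^+ 2 + 1) * (a / u).
  rewrite big_split /= mulrDl mul1r; apply: lerD; last first.
    have aA0 : A0 <= a by (move: M0 aA mA2; drop; lra).
    by have := HA0 a N K aA0 (le_eq KE); rewrite mulrC.
  apply: (@le_trans _ _ (\sum_(k < K) E4 ^+ 2 * (cm hi`_k * rho ^+ k) ^+ 2)).
    apply: ler_sum => k _; rewrite -exprMn lerXn2r ?nnegrE ?cm_ge0 //.
      by rewrite mulr_ge0 ?mulr_ge0 ?cm_ge0 ?exprn_ge0 // ltW.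
    have := rk k (ltn_ord k); rewrite -div1r ler_pdivrMr // => h.
    have := cm_ge0 hi`_k; set x := cm _; set y := rho ^+ k in h *; (move: h; drop; nra).
  rewrite -mulr_sumr; apply: (le_trans (ler_wpM2l (sqr_ge0 E4) (Hhi K))); apply: le_eq; ring.
pose L := C3 * ln u ^+ 3.
have ptw n k : (0 < n)%N -> (n < M)%N -> (k < K)%N -> a * ln n%:R <= k%:R -> k%:R < a * ln n.+1%:R ->
    cm (beta n) - L <= s k.
  move=> n0 nM kK k1 k2; have nN : (n <= N)%N by rewrite (leq_trans _ MN) // ltnW.
  have h1 := bcoef_beta a1 n0 nN k1 k2.
  have h2 := cm_rev (beta n) (bcoef a N k).
  have h3 := cm_rev (bcoef a N k) (rcoef psi mm G0 a N k); rewrite cmB in h3.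
  have h4 := cm_rev (rcoef psi mm G0 a N k) p`_k; have h5 := HC k (ltnW kK); rewrite cmB in h5.
  have h6 : cm p`_k <= cm lo`_k + cm hi`_k by rewrite pE coefD; exact: cm_D.
  have h7 : cm lo`_k <= C1 * E4 * ln u ^+ 3.
    have := Hlo k; have := rk k kK; rewrite -div1r ler_pdivrMr // => h h8.
    have : cm lo`_k * 1 <= cm lo`_k * (rho ^+ k * E4) by rewrite ler_wpM2l ?cm_ge0.
    have : cm lo`_k * rho ^+ k * E4 <= C1 * ln u ^+ 3 * E4 by rewrite ler_wpM2r // ltW.
    (drop; lra).
  have h8 : cm hi`_k <= 1 + cm hi`_k ^+ 2 by have := sqr_ge0 (cm hi`_k - 1); rewrite !expr2; have := cm_ge0 hi`_k; (drop; lra).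
  have h9 : C1 * E4 * ln u ^+ 3 + 2 + 2 * m%:R <= L.
    have -> : L = C1 * E4 * ln u ^+ 3 + (2 + 2 * m%:R) * ln u ^+ 3 by rewrite /L /C3; ring.
    have : 2 + 2 * m%:R <= (2 + 2 * m%:R) * ln u ^+ 3 by rewrite ler_peMr // addr_ge0 // mulr_ge0.
    (drop; lra).
  rewrite /s; (move: h1 h2 h3 h4 h5 h6 h7 h8 h9; drop; lra).
have cnt n : (0 < n)%N -> (n < M)%N -> u <= ln (n%:R : R) -> ln (n%:R : R) < u + 1 ->
    a / (4 * n%:R) * Num.max 0 (cm (beta n) - L) <= \sum_(k < K) s k * (a * ln n%:R <= k%:R < a * ln n.+1%:R)%R%:R.
  move=> n0 nM un nu; have nR : 0 < n%:R :> R by rewrite ltr0n.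
  have n1 : 1 <= n%:R :> R by rewrite ler1n.
  set x := Num.max _ _; have x0 : 0 <= x by rewrite le_max lexx.
  have d1 := @ln_succ_le R n n0; have d2 := @ln_succ_ge R n n0.
  have i1 : n%:R^-1 <= 1 :> R by rewrite invf_le1.
  have yK : a * ln n.+1%:R <= K%:R by rewrite KE ler_pM2l //; (move: nu d1 i1; drop; lra).
  have xx0 : 0 <= a * ln (n%:R : R) by rewrite mulr_ge0 ?ln_nat_ge0 // ltW.
  have cl := count_lower xx0 yK.
  have cb : a / (4 * n%:R) <= \sum_(k < K) ((a * ln n%:R <= k%:R < a * ln n.+1%:R)%R%:R : R).
    apply: le_trans cl; rewrite -mulrBr.
    have : a * n.+1%:R^-1 <= a * (ln n.+1%:R - ln n%:R) by rewrite ler_pM2l.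
    have nM' : 4 * n%:R <= a by apply: le_trans aM; rewrite ler_pM2l // ler_nat ltnW.
    have : a * (2 * n%:R)^-1 <= a * n.+1%:R^-1.
      by rewrite ler_pM2l // lef_pV2 ?posrE ?ltr0n ?mulr_gt0 // -natr1; (move: n1; drop; lra).
    have -> : a * (2 * n%:R)^-1 = a / (4 * n%:R) + a / (4 * n%:R) by field; rewrite lt0r_neq0.
    have : 1 <= a / (4 * n%:R) by rewrite ler_pdivlMr ?mulr_gt0 // mul1r.
    exact: half_step.
  apply: (le_trans (ler_wpM2r x0 cb)); rewrite mulr_suml; apply: ler_sum => k _.
  have [/andP[k1 k2]|h] := boolP (a * ln n%:R <= k%:R < a * ln n.+1%:R); last by rewrite mul0r mulr0.
  by rewrite mul1r mulr1 ge_max s0 ptw.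
have fm n : (0 < n)%N -> a * ln (n%:R : R) <= a * ln n.+1%:R.
  by move=> n0; rewrite ler_pM2l // ler_ln ?posrE ?ltr0n // ler_nat.
(* Each n owns at least a / (4 n) indices k, and no k belongs to two different n, so the logarithmic
   sum over n is bounded by the sum of s k. *)
have tot : a / 4 * \sum_(1 <= n < M | (u <= ln (n%:R : R)) && (ln (n%:R : R) < u + 1)) Num.max 0 (cm (beta n) - L) / n%:R <= \sum_(k < K) s k.
  rewrite mulr_sumr big_mkcond /=.
  apply: (@le_trans _ _ (\sum_(1 <= n < M) \sum_(k < K) s k * (a * ln n%:R <= k%:R < a * ln n.+1%:R)%R%:R)).
    rewrite !big_nat; apply: ler_sum => n /andP[n0 nM]; case: ifP => [/andP[h1 h2]|_].
      apply: le_trans (cnt n n0 nM h1 h2); apply: le_eq; field.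
      by rewrite pnatr_eq0 -lt0n.
    by apply: sumr_ge0 => k _; rewrite mulr_ge0.
  rewrite exchange_big /=; apply: ler_sum => k _; rewrite -mulr_sumr.
  have := ler_wpM2l (s0 k) (@count_disjoint (fun n => a * ln n%:R) k%:R M fm); rewrite mulr1.
  exact: le_trans.
have fin : \sum_(1 <= n < M | (u <= ln (n%:R : R)) && (ln (n%:R : R) < u + 1)) Num.max 0 (cm (beta n) - L) / n%:R <= C4 / u.
  have := le_trans tot Ssum; set S := \sum_(_ <= _ < _ | _) _ => h.
  have a4p : 0 < a / 4 by rewrite divr_gt0.
  rewrite -(ler_pM2l a4p); apply: (le_trans h); apply: le_eq; rewrite /C4; field; exact: lt0r_neq0.
apply: le_trans (_ : C4 / u <= _); last by rewrite ler_pM2r ?invr_gt0 // lerDr.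
apply: le_trans fin; rewrite big_nat_cond [leRHS]big_nat_cond; apply: ler_sum => n /andP[/andP[n0 nM] _].
rewrite ler_pM2r ?invr_gt0 ?ltr0n // ge_max !le_max lexx /=; apply/orP; right.
by rewrite lerD2l lerN2 /L; apply: ler_wpM2r; [(move: l3; drop; lra)|rewrite lerDl].
Qed.

End Fixed.
End KeyBound.

(** * Summation by parts *)

Section AbelLog.
Variable R : realType.
Local Notation C := R[i].
Implicit Types (x y e : R) (k n N : nat).

Lemma ln_nat_ge1 n : (4 <= n)%N -> 1 <= ln (n%:R : R).
Proof.
move=> n4; rewrite -[leLHS]expRK ler_ln ?posrE ?expR_gt0 ?ltr0n ?(leq_trans _ n4) //.
by apply: (le_trans (@exp1_le4 R)); rewrite ler_nat.
Qed.

Lemma inv_ln_diff k : (4 <= k)%N ->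
  0 <= (ln (k%:R : R))^-1 - (ln k.+1%:R)^-1 /\
  (ln (k%:R : R))^-1 - (ln k.+1%:R)^-1 <= k%:R^-1 * (ln (k%:R : R)) ^- 2.
Proof.
move=> k4; have k0 : (0 < k)%N by rewrite (leq_trans _ k4).
have l1 := ln_nat_ge1 k4; have l2 := @ln_succ_le R k k0; have l3 := @ln_succ_ge R k k0.
have ki : 0 < k.+1%:R^-1 :> R by rewrite invr_gt0.
set l := ln _ in l1 l2 l3 *; set l' := ln _ in l2 l3 *; set w := _^-1 in l3 ki.
have l0 : 0 < l by lra. have l0' : 0 < l' by lra.
have -> : l^-1 - l'^-1 = (l' - l) / (l * l') by field; rewrite !lt0r_neq0.
have ll : 0 < l * l' by rewrite mulr_gt0.
split; first by rewrite divr_ge0 ?(ltW ll) //; lra.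
apply: ler_pM => //; [lra|by rewrite invr_ge0 ltW|].
by rewrite lef_pV2 ?posrE ?exprn_gt0 // expr2 ler_pM2l //; lra.
Qed.

Local Ltac drop := clear -R.

(** Applying log x <= x - 1 to the ratio of consecutive logarithms and to its inverse gives both
    bounds; the upper one is (log (k+1) - log k)^2 / (log k log (k+1)). *)
Lemma lnln_step k : (4 <= k)%N ->
  let r := ln (ln (k.+1%:R : R)) - ln (ln (k%:R : R)) - 1 + ln (k%:R : R) / ln k.+1%:R in 0 <= r /\ r <= npw k 2.
Proof.
move=> k4 r; have k0 : (0 < k)%N by rewrite (leq_trans _ k4).
have l1 := ln_nat_ge1 k4; have l2 := @ln_succ_le R k k0; have l3 := @ln_succ_ge R k k0.
have ki : 0 < k.+1%:R^-1 :> R by rewrite invr_gt0.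
rewrite /r {r} npw_sq //; set v := k%:R^-1 in l2 *.
set l := ln (k%:R) in l1 l2 l3 *; set l' := ln (k.+1%:R) in l2 l3 *; set w := _^-1 in l3 ki.
have l0 : 0 < l by lra. have l0' : 0 < l' by lra.
have y0 : 0 < l / l' by rewrite divr_gt0.
have z0 : 0 < l' / l by rewrite divr_gt0.
have E : ln l' - ln l = ln (l' / l) by rewrite ln_div ?posrE.
have E2 : ln l - ln l' = ln (l / l') by rewrite ln_div ?posrE.
have h1 := ln_sublinear; have le_sub (x : R) : 0 < x -> ln x <= x - 1.
  by move=> x0; have := expR_ge1Dx (ln x); rewrite lnK ?posrE //; lra.
have := le_sub _ y0; have := le_sub _ z0.
rewrite -E -E2 => a1 a2; split; first lra.
apply: (@le_trans _ _ (l' / l - 1 - 1 + l / l')); first lra.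
have -> : l' / l - 1 - 1 + l / l' = (l' - l) ^+ 2 / (l * l') by field; rewrite !lt0r_neq0.
rewrite ler_pdivrMr ?mulr_gt0 //; apply: (@le_trans _ _ (v ^+ 2)).
  by rewrite lerXn2r ?nnegrE //; (move: l2 l3 ki; drop; lra).
by rewrite ler_peMr ?sqr_ge0 //; nra.
Qed.

Variables (B T : nat -> C) (mc g0 : C).
Hypothesis step : forall k, (1 < k)%N -> T k.+1 - T k = (B k.+1 - B k) * ((ln (k.+1%:R : R))^-1)%:C.

(* Summation by parts gives T = be / log - mc log log + ga, where [ga] has summable increments when [be] is small. *)
Definition be k : C := B k + mc * (ln (k%:R : R))%:C - g0.
Definition ga k : C := T k + mc * (ln (ln (k%:R : R)))%:C - be k * ((ln (k%:R : R))^-1)%:C.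

Lemma ga_step k : (4 <= k)%N ->
  cm (ga k.+1 - ga k) <= cm (be k) * ((ln (k%:R : R))^-1 - (ln k.+1%:R)^-1) + cm mc * npw k 2.
Proof.
move=> k4; have k1 : (1 < k)%N by rewrite (leq_trans _ k4).
have l1 := ln_nat_ge1 k4; have l1' := ln_nat_ge1 (leqW k4).
have [i0 _] := inv_ln_diff k4; have [r0 r1] := lnln_step k4.
have E : ga k.+1 - ga k = be k * ((ln (k%:R : R))^-1 - (ln k.+1%:R)^-1)%:C +
   mc * (ln (ln (k.+1%:R : R)) - ln (ln (k%:R : R)) - 1 + ln (k%:R : R) / ln k.+1%:R)%:C.
  have -> : ga k.+1 - ga k = (T k.+1 - T k) + mc * ((ln (ln (k.+1%:R : R)))%:C - (ln (ln (k%:R : R)))%:C) -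
      be k.+1 * ((ln (k.+1%:R : R))^-1)%:C + be k * ((ln (k%:R : R))^-1)%:C by rewrite /ga; ring.
  have cB (x y : R) : (x - y)%:C = x%:C - y%:C :> C by rewrite rmorphB.
  have cD (x y : R) : (x + y)%:C = x%:C + y%:C :> C by rewrite rmorphD.
  have cM (x y : R) : (x * y)%:C = x%:C * y%:C :> C by rewrite rmorphM.
  have c1 : (1 : R)%:C = 1 :> C by [].
  rewrite step // /be !(cB, cD, cM).
  have I1 : (ln (k.+1%:R : R))%:C * ((ln (k.+1%:R : R))^-1)%:C = 1 :> C.
    by rewrite -rmorphM /= mulfV ?rmorph1 // lt0r_neq0 //; lra.
  set L := (ln (k.+1%:R : R))%:C in I1 *; set I := ((ln (k.+1%:R : R))^-1)%:C in I1 *.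
  have -> : (B k.+1 + mc * L - g0) * I = (B k.+1 - g0) * I + mc * (L * I) by ring.
  rewrite I1; ring.
rewrite E; apply: (le_trans (cm_D _ _)); rewrite !cmM !cm_real (ger0_norm i0) (ger0_norm r0).
by rewrite lerD2l ler_wpM2l ?cm_ge0.
Qed.

Lemma ga_tail n n' : (4 <= n)%N -> (n <= n')%N ->
  cm (ga n' - ga n) <= \sum_(n <= k < n') cm (be k) * ((ln (k%:R : R))^-1 - (ln k.+1%:R)^-1) + 2 * cm mc * n%:R^-1.
Proof.
move=> n4 nn; have n0 : (0 < n)%N by rewrite (leq_trans _ n4).
have -> : ga n' - ga n = \sum_(n <= k < n') (ga k.+1 - ga k) by rewrite telescope_sumr.
apply: (le_trans (cm_sum _ _ _)).
apply: (@le_trans _ _ (\sum_(n <= k < n') (cm (be k) * ((ln (k%:R : R))^-1 - (ln k.+1%:R)^-1) + cm mc * npw k 2))).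
  by rewrite !big_nat; apply: ler_sum => k /andP[nk _]; apply: ga_step; exact: leq_trans nk.
rewrite big_split /= lerD2l -mulr_sumr [2 * _]mulrC -mulrA ler_wpM2l ?cm_ge0 //.
have := @npw_tail R 1 n n' ltr01 n0; rewrite invr1 npw_inv //.
Qed.

Lemma ga_tail_bounded K n n' : (4 <= n)%N -> (n <= n')%N -> (forall k, cm (be k) <= K) ->
  cm (ga n' - ga n) <= (K + 2 * cm mc) / ln n%:R.
Proof.
move=> n4 nn HK; have K0 : 0 <= K by apply: le_trans (HK n); exact: cm_ge0.
have l1 := ln_nat_ge1 n4; have n0 : (0 < n)%N by rewrite (leq_trans _ n4).
apply: (le_trans (ga_tail n4 nn)); rewrite [leRHS]mulrDl; apply: lerD; last first.
  rewrite ler_wpM2l ?mulr_ge0 ?cm_ge0 // lef_pV2 ?posrE ?ltr0n //; last lra.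
  exact: ln_le_nat.
apply: (@le_trans _ _ (\sum_(n <= k < n') K * ((ln (k%:R : R))^-1 - (ln k.+1%:R)^-1))).
  rewrite !big_nat; apply: ler_sum => k /andP[nk _]; apply: ler_wpM2r => //.
  by have [] := inv_ln_diff (leq_trans n4 nk).
rewrite -mulr_sumr ler_wpM2l //.
have -> : \sum_(n <= k < n') ((ln (k%:R : R))^-1 - (ln k.+1%:R)^-1) = (ln (n%:R : R))^-1 - (ln n'%:R)^-1.
  rewrite -[RHS]opprB -(telescope_sumr (fun k => (ln (k%:R : R))^-1) nn) -sumrN.
  by apply: eq_bigr => k _; rewrite opprB.
by rewrite lerBlDr lerDl invr_ge0 ln_nat_ge0.
Qed.

Variable Cc : R.
Hypothesis Cc0 : 0 <= Cc.
Hypothesis blk : forall U M : nat, (4 <= U)%N ->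
  \sum_(1 <= n < M | (U%:R <= ln (n%:R : R)) && (ln (n%:R : R) < U%:R + 1))
     Num.max 0 (cm (be n) - Cc * ln (U%:R : R) ^+ 3) / n%:R <= Cc / U%:R.

Lemma block_harm (U M : nat) :
  \sum_(1 <= n < M | (U%:R <= ln (n%:R : R)) && (ln (n%:R : R) < U%:R + 1)) (n%:R^-1 : R) <= 4.
Proof.
(* This is log n confined to [U, U + 2]. For n in the block its increment is that of log, since log
   (n+1) < U + 2; the total increase is at most 2, and 1/n <= 2/(n+1). *)
pose phi (n : nat) : R := Num.min (Num.max (ln n%:R) U%:R) (U%:R + 2).
have pm n : (0 < n)%N -> phi n <= phi n.+1.
  move=> n0; have h : ln (n%:R : R) <= ln n.+1%:R by rewrite ler_ln ?posrE ?ltr0n // ler_nat.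
  rewrite /phi le_min !ge_min lexx orbT andbT; apply/orP; left.
  by rewrite ge_max !le_max lexx h orbT.
apply: (@le_trans _ _ (\sum_(1 <= n < M) 2 * (phi n.+1 - phi n))).
  rewrite big_mkcond /= !big_nat; apply: ler_sum => n /andP[n0 _].
  have pn := pm n n0.
  case: ifP => [/andP[h1 h2]|_]; last by lra.
  have nR : 0 < n%:R :> R by rewrite ltr0n.
  have d1 := @ln_succ_le R n n0; have d2 := @ln_succ_ge R n n0.
  have i1 : n%:R^-1 <= 1 :> R by rewrite invf_le1 // ler1n.
  have E1 : phi n = ln n%:R by rewrite /phi (max_l h1) min_l //; lra.
  have n1' : n.+1%:R^-1 > 0 :> R by rewrite invr_gt0.
  have E2 : phi n.+1 = ln n.+1%:R.
    move: d1 d2 h1 h2 i1 n1'; rewrite /phi; set l := ln n%:R; set l' := ln n.+1%:R; set v := n%:R^-1; set w := n.+1%:R^-1.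
    move=> d1 d2 h1 h2 i1 n1'; rewrite max_l ?min_l //; lra.
  rewrite E1 E2; apply: (@le_trans _ _ (2 * n.+1%:R^-1)); last by rewrite ler_pM2l.
  rewrite -[leLHS]div1r ler_pdivrMr // mulrAC ler_pdivlMr ?ltr0n // mul1r -natr1.
  have : 1 <= n%:R :> R by rewrite ler1n.
  lra.
rewrite -mulr_sumr; case: M => [|M]; first by rewrite big_geq // mulr0.
rewrite telescope_sumr //.
have : phi M.+1 <= U%:R + 2 by rewrite /phi ge_min lexx orbT.
have : U%:R <= phi 1%N by rewrite /phi le_min le_max lexx orbT /= lerDl.
lra.
Qed.

(** The cube of a logarithm grows at most like a square root: with log V = log U + 6 x and log U >=
    6, log V <= (1 + x) log U <= e^x log U, and e^(3 x) = (V / U)^(1/2). *)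
Lemma ln_cube (U V : nat) : (0 < U)%N -> (U <= V)%N -> 6 <= ln (U%:R : R) ->
  ln (V%:R : R) ^+ 3 <= ln (U%:R : R) ^+ 3 * (npw U 2^-1 * npw V (- 2^-1)).
Proof.
move=> U0 UV l6; have lUV : ln (U%:R : R) <= ln V%:R.
  by rewrite ler_ln ?posrE ?ltr0n ?(leq_trans U0) // ler_nat.
pose x := (ln (V%:R : R) - ln U%:R) / 6.
have x0 : 0 <= x by rewrite /x divr_ge0 // subr_ge0.
have -> : npw U 2^-1 * npw V (- 2^-1) = expR x ^+ 3.
  by rewrite -expRM_natl /npw -expRD; congr expR; rewrite /x; field.
rewrite -exprMn lerXn2r ?nnegrE ?mulr_ge0 ?expR_ge0 ?ln_nat_ge0 //.
apply: (@le_trans _ _ (ln (U%:R : R) * (1 + x))); last by rewrite ler_wpM2l ?ln_nat_ge0 ?expR_ge1Dx.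
have E : ln (V%:R : R) = ln U%:R + 6 * x by rewrite /x; field.
rewrite {1}E; nra.
Qed.

Lemma sum_cube (U W : nat) : (0 < U)%N -> 6 <= ln (U%:R : R) ->
  \sum_(U <= V < W) ln (V%:R : R) ^+ 3 / V%:R ^+ 2 <= 3 * ln (U%:R : R) ^+ 3 / U%:R.
Proof.
move=> U0 l6; apply: (@le_trans _ _ (\sum_(U <= V < W) ln (U%:R : R) ^+ 3 * npw U 2^-1 * npw V (1 + 2^-1))).
  rewrite !big_nat; apply: ler_sum => V /andP[UV _].
  have V0 : (0 < V)%N by rewrite (leq_trans U0).
  have -> : V%:R ^- 2 = npw V 2 :> R by rewrite npw_sq // exprVn.
  have -> : npw V (1 + 2^-1) = npw V (- 2^-1) * npw V 2 :> R by rewrite -npwD; congr npw; lra.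
  rewrite mulrA ler_wpM2r ?expR_ge0 // -mulrA; exact: ln_cube.
rewrite -mulr_sumr; have h2 : 0 < 2^-1 :> R by rewrite invr_gt0.
have l0 : 0 <= ln (U%:R : R) ^+ 3 by rewrite exprn_ge0 // ln_nat_ge0.
have := @npw_tail R 2^-1 U W h2 U0; rewrite invrK => h.
apply: (le_trans (ler_wpM2l _ h)); first by rewrite mulr_ge0 ?expR_ge0.
have E : npw U 2^-1 * npw U 2^-1 = U%:R^-1 :> R by rewrite -npwD -(@npw_inv R U) //; congr npw; lra.
apply: le_eq; rewrite -E; ring.
Qed.

Local Ltac drop' := clear -R B T mc g0 step Cc Cc0 blk.

(** The sum is cut into blocks V <= log k < V + 1, on which the weight is at most 1 / (k V^2). With
    Q = Cc (log V)^3, the excess of |be| over Q contributes at most Q by [blk] and Q itself at most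
    4 Q by [block_harm], hence the 5; the sum over V brings the factor 3. *)
Lemma be_tail (U n n' : nat) : (4 <= U)%N -> 6 <= ln (U%:R : R) -> (4 <= n)%N -> U%:R <= ln (n%:R : R) ->
  \sum_(n <= k < n') cm (be k) * ((ln (k%:R : R))^-1 - (ln k.+1%:R)^-1) <= 15 * Cc * ln (U%:R : R) ^+ 3 / U%:R.
Proof.
move=> U4 l6 n4 Un; have Cc0' := Cc0.
have U0 : (0 < U)%N by rewrite (leq_trans _ U4).
have U0R : 0 < U%:R :> R by rewrite ltr0n.
pose W := (Num.truncn (ln (n'%:R : R))).+1.
pose f k := cm (be k) * ((ln (k%:R : R))^-1 - (ln k.+1%:R)^-1).
pose inb (V k : nat) := (V%:R <= ln (k%:R : R)) && (ln (k%:R : R) < V%:R + 1).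
have f0 k : (4 <= k)%N -> 0 <= f k by move=> k4; rewrite mulr_ge0 ?cm_ge0 //; have [] := inv_ln_diff k4.
have n0 : (0 < n)%N by rewrite (leq_trans _ n4).
apply: (@le_trans _ _ (\sum_(n <= k < n') \sum_(U <= V < W) (if inb V k then f k else 0))).
  rewrite !big_nat; apply: ler_sum => k /andP[nk kn].
  have k0 : (0 < k)%N by rewrite (leq_trans n0).
  have lk0 := @ln_nat_ge0 R k; have /andP[V1 V2] := truncn_itv lk0.
  set V := Num.truncn _ in V1 V2.
  have lnk : ln (n%:R : R) <= ln k%:R by rewrite ler_ln ?posrE ?ltr0n // ler_nat.
  have UV : (U <= V)%N by rewrite -ltnS -(ltr_nat R); (move: Un V2 lnk; drop'; lra).
  have VW : (V < W)%N.
    rewrite ltnS; apply: le_truncn; rewrite ler_ln ?posrE ?ltr0n ?(leq_trans k0) ?(ltnW kn) // ler_nat.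
    exact: ltnW.
  rewrite (bigD1_seq V) ?iota_uniq ?mem_index_iota ?UV ?VW //=.
  have -> : inb V k by rewrite /inb V1 natr1.
  rewrite lerDl; apply: sumr_ge0 => V' _; case: ifP => // _; apply: f0; exact: leq_trans nk.
rewrite exchange_big /=.
apply: (@le_trans _ _ (\sum_(U <= V < W) 5 * Cc * (ln (V%:R : R) ^+ 3 / V%:R ^+ 2))); last first.
  rewrite -mulr_sumr; have := sum_cube W U0 l6 => h.
  have C5 : 0 <= 5 * Cc by rewrite mulr_ge0.
  apply: (le_trans (ler_wpM2l C5 h)); apply: le_eq; ring.
rewrite !big_nat; apply: ler_sum => V /andP[UV _].
have V4 : (4 <= V)%N by rewrite (leq_trans U4).
have V0 : 0 < V%:R :> R by rewrite ltr0n (leq_trans _ V4).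
have lV : 1 <= ln (V%:R : R) := ln_nat_ge1 V4.
have l3 : 1 <= ln (V%:R : R) ^+ 3 by rewrite expr_ge1 //; lra.
pose g k := Num.max 0 (cm (be k) - Cc * ln (V%:R : R) ^+ 3) / k%:R + Cc * ln (V%:R : R) ^+ 3 * k%:R^-1.
have g0' k : 0 <= g k.
  by apply: addr_ge0; rewrite mulr_ge0 ?invr_ge0 // ?le_max ?lexx // mulr_ge0 // exprn_ge0 // ln_nat_ge0.
apply: (@le_trans _ _ (V%:R ^- 2 * \sum_(1 <= k < n' | inb V k) g k)).
  have V2 : 0 <= V%:R ^- 2 :> R by rewrite invr_ge0 exprn_ge0 // ltW.
  have pos (k : nat) : 0 <= V%:R ^- 2 * (if inb V k then g k else 0) by apply: mulr_ge0 => //; case: ifP.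
  rewrite [in leRHS]big_mkcond /= mulr_sumr; case: (leqP n n') => nn; last first.
    by rewrite big_geq 1?ltnW //; apply: sumr_ge0.
  rewrite [leRHS](big_cat_nat (n := n)) //=.
  apply: ler_wpDl; first by apply: sumr_ge0.
  rewrite !big_nat; apply: ler_sum => k /andP[nk _]; case: ifP => [/andP[h1 h2]|_]; last by rewrite mulr0.
  have k4 : (4 <= k)%N by rewrite (leq_trans n4).
  have kR : 0 < k%:R :> R by rewrite ltr0n (leq_trans _ k4).
  have [i0 i1] := inv_ln_diff k4; have lk := ln_nat_ge1 k4.
  have i2 : (ln (k%:R : R)) ^- 2 <= V%:R ^- 2.
    rewrite lef_pV2 ?posrE ?exprn_gt0 //; last (move: V0 g0' h1; drop'; lra).
    by rewrite lerXn2r ?nnegrE //; (move: V0 g0' h1; drop'; lra).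
  apply: (@le_trans _ _ (cm (be k) * (k%:R^-1 * V%:R ^- 2))).
    rewrite /f ler_wpM2l ?cm_ge0 //; apply: (le_trans i1); rewrite ler_wpM2l // invr_ge0 ltW.
  have -> : V%:R ^- 2 * g k = (Num.max 0 (cm (be k) - Cc * ln (V%:R : R) ^+ 3) + Cc * ln (V%:R : R) ^+ 3) * (k%:R^-1 * V%:R ^- 2).
    by rewrite /g; ring.
  apply: ler_wpM2r; first by rewrite mulr_ge0 // invr_ge0 // ?exprn_ge0 // ltW.
  by rewrite -lerBlDr le_max lexx orbT.
have -> : 5 * Cc * (ln (V%:R : R) ^+ 3 / V%:R ^+ 2) = V%:R ^- 2 * (5 * Cc * ln (V%:R : R) ^+ 3) by ring.
apply: ler_wpM2l; first by rewrite invr_ge0 exprn_ge0 // ltW.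
rewrite big_split /=; have h1 := blk n' V4; have h2 := block_harm V n'.
rewrite -mulr_sumr.
have c3 : 0 <= Cc * ln (V%:R : R) ^+ 3 by rewrite mulr_ge0 //; (move: l3; drop'; lra).
have h3 := ler_wpM2l c3 h2.
have v1 : Cc / V%:R <= Cc.
  by rewrite ler_pdivrMr // ler_peMr // ler1n (leq_trans _ V4).
have : Cc <= Cc * ln (V%:R : R) ^+ 3 by rewrite ler_peMr.
move: h1 h3; rewrite -/(inb V _); set S1 := \sum_(_ <= _ < _ | _) _; set S2 := \sum_(_ <= _ < _ | _) _.
set Q := Cc * _ ^+ 3 => h1 h3 h4; have -> : 5 * Cc * ln (V%:R : R) ^+ 3 = 5 * Q by rewrite /Q; ring.
move: h1 h3 h4 v1; clear; lra.
Qed.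

Definition Ctail : R := 15 * Cc + 2 * cm mc.

Lemma Ctail_ge0 : 0 <= Ctail.
Proof. by rewrite addr_ge0 // mulr_ge0 ?cm_ge0 ?Cc0. Qed.

Lemma ga_diff (U n n' : nat) : (4 <= U)%N -> 6 <= ln (U%:R : R) -> (4 <= n)%N -> (n <= n')%N -> U%:R <= ln (n%:R : R) ->
  cm (ga n' - ga n) <= Ctail * (ln (U%:R : R) ^+ 3 / U%:R).
Proof.
move=> U4 l6 n4 nn Un; apply: (le_trans (ga_tail n4 nn)).
have U0 : 0 < U%:R :> R by rewrite ltr0n (leq_trans _ U4).
have n0 : 0 < n%:R :> R by rewrite ltr0n (leq_trans _ n4).
rewrite /Ctail [leRHS]mulrDl; apply: lerD; first by rewrite mulrA; exact: be_tail.
apply: ler_wpM2l; first by rewrite mulr_ge0 ?cm_ge0.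
apply: (@le_trans _ _ U%:R^-1).
  by rewrite lef_pV2 ?posrE //; apply: (le_trans Un); exact: ln_le_nat.
by rewrite ler_peMl ?invr_ge0 ?(ltW U0) // expr_ge1 //; lra.
Qed.

Lemma cube_small e : 0 < e -> exists U0, forall U, (U0 <= U)%N -> ln (U%:R : R) ^+ 3 / U%:R <= e.
Proof.
move=> e0; have q4 : 0 < 4^-1 :> R by rewrite invr_gt0.
have e64 : 0 < e / 64 by rewrite divr_gt0.
have [N HN] := @npw_small R 4^-1 (e / 64) q4 e64; exists N.+1 => U NU.
have U0 : (0 < U)%N by apply: leq_trans NU.
have h := HN U (ltnW NU); have l := @ln_le_npw R U 4^-1 q4; rewrite invrK in l.
apply: (@le_trans _ _ ((4 * npw U (- 4^-1)) ^+ 3 * npw U 1)).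
  rewrite (@npw_inv R U U0); apply: ler_wpM2r; first by rewrite invr_ge0.
  by apply: lerXn2r => //; rewrite nnegrE ?ln_nat_ge0 // mulr_ge0 ?expR_ge0.
have -> : (4 * npw U (- 4^-1)) ^+ 3 * npw U 1 = 64 * npw U 4^-1 :> R.
  rewrite exprMn -expRM_natl -mulrA /npw -expRD; congr (_ * expR _); first by rewrite !exprS expr0; lra.
  by field.
lra.
Qed.

(** The sequence is Cauchy because the tail bound [ga_diff] tends to 0 with U; letting n' tend to
    infinity in it gives the rate. *)
Lemma ga_limit : exists (l : C) (U0 : nat), (4 <= U0)%N /\ forall U n : nat, (U0 <= U)%N -> U%:R <= ln (n%:R : R) ->
  cm (ga n - l) <= Ctail * (ln (U%:R : R) ^+ 3 / U%:R).
Proof.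
have [U1 HU1] : exists U1 : nat, expR 6 <= U1.+1%:R :> R := big_nat_ex _.
pose U0 := (maxn 4 U1.+1).
have P (U : nat) : (U0 <= U)%N -> (4 <= U)%N /\ 6 <= ln (U%:R : R).
  rewrite geq_max => /andP[h1 h2]; split=> //.
  rewrite -[leLHS]expRK ler_ln ?posrE ?expR_gt0 ?ltr0n ?(leq_trans _ h1) //.
  by apply: (le_trans HU1); rewrite ler_nat.
have P2 (U n : nat) : (U0 <= U)%N -> U%:R <= ln (n%:R : R) -> (4 <= n)%N.
  move=> /P [U4 _] Un; rewrite -(ler_nat R); apply: le_trans (ln_le_nat R n); apply: le_trans Un.
  by rewrite ler_nat.
have big (U : nat) : exists N, forall n : nat, (N <= n)%N -> U%:R <= ln (n%:R : R).
  have [N HN] := big_nat_ex (expR U%:R : R); exists N.+1 => n Nn.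
  rewrite -[leLHS]expRK ler_ln ?posrE ?expR_gt0 ?ltr0n ?(leq_trans _ Nn) //.
  by apply: (le_trans HN); rewrite ler_nat.
have C1 : 0 < Ctail + 1 by have := Ctail_ge0; lra.
have [l Hl] : exists l : C, ga @ \oo --> l.
  apply: ccauchy => e e0; have d0 : 0 < e / 2 / (Ctail + 1) by rewrite !divr_gt0.
  have [U2 HU2] := cube_small d0; pose U := maxn U0 U2.
  have UU : (U0 <= U)%N by rewrite leq_max leqnn.
  have [U4 l6] := P U UU; have [N HN] := big U.
  have h := HU2 U (leq_maxr _ _).
  have h2 : Ctail * (ln (U%:R : R) ^+ 3 / U%:R) <= e / 2.
    have := ler_wpM2l (ltW C1) h; rewrite [_ * (e / 2 / _)]mulrC divfK ?lt0r_neq0 //.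
    have : 0 <= ln (U%:R : R) ^+ 3 / U%:R by rewrite divr_ge0 // exprn_ge0 //; lra.
    set y := _ / U%:R; lra.
  exists N => n k Nn Nk; apply: (le_trans (cm_tri _ _ (ga N))); rewrite (cmB (ga N) (ga k)).
  have hN := HN N (leqnn N); have N4 := P2 U N UU hN.
  have := ga_diff U4 l6 N4 Nn hN; have := ga_diff U4 l6 N4 Nk hN; rewrite (cmB (ga k)); rewrite (cmB (ga N)); lra.
exists l, U0; split; first by rewrite leq_maxl.
move=> U n UU Un; have [U4 l6] := P U UU; have n4 := P2 U n UU Un.
apply/ler_addgt0Pr => e e0; have [N HN] := ccvgE Hl e0.
have := HN (maxn N n) (leq_maxl _ _); have := ga_diff U4 l6 n4 (leq_maxr N n) Un.
have := cm_tri (ga n) l (ga (maxn N n)); rewrite (cmB (ga n) (ga (maxn N n))); lra.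
Qed.

End AbelLog.

(** * Chebyshev and Mertens estimates *)

Section Chebyshev.
Variable R : realType.
Local Notation C := R[i].
Implicit Types (x y e : R) (k n d N M p : nat).

(** Chebyshev's psi function: prime powers are included. *)
Definition theta N : R := \sum_(1 <= d < N.+1) vM R d.

Lemma ln_fact N : \sum_(1 <= n < N.+1) ln (n%:R : R) = ln N`!%:R.
Proof.
elim: N => [|N IH]; first by rewrite big_geq // fact0 ln1.
rewrite big_nat_recr //= IH factS natrM lnM ?posrE ?ltr0n ?fact_gt0 //; exact: addrC.
Qed.

Lemma ln_fact_vM N : ln (N`!%:R : R) = \sum_(1 <= d < N.+1) vM R d * (N %/ d)%:R.
Proof.
have := f_equal (@complex.Re R) (@sum_conv_vM R N (fun=> 1)).
rewrite !re_sum -ln_fact => h.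
have -> : \sum_(1 <= n < N.+1) ln (n%:R : R) = \sum_(1 <= i < N.+1) complex.Re ((ln (i%:R : R))%:C * 1).
  by apply: eq_bigr => i _; rewrite mulr1.
rewrite h; apply: eq_bigr => d _.
by rewrite reMr sumr_const_nat subn1 /= re_nat.
Qed.

Lemma bin_mid_le n : ('C(n.*2, n) <= 4 ^ n)%N.
Proof.
have := expnDn 1 1 n.*2; rewrite -mul2n expnM => ->.
rewrite mul2n; have h : (n < n.*2.+1)%N by rewrite ltnS -addnn leq_addl.
by rewrite (bigD1 (Ordinal h)) //= !exp1n !muln1 leq_addr.
Qed.

(** The logarithm of the central binomial coefficient is the sum of [vM] d times the difference of N
    %/ d at N = 2 n and twice its value at n. These factors are nonnegative, and 1 for n < d <= 2 n;
    the binomial is at most 4^n. *)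
Lemma theta_double n : theta n.*2 - theta n <= 2 * n%:R.
Proof.
have nn : (n <= n.*2)%N by rewrite -addnn leq_addl.
have E : ln (n.*2`!%:R : R) = ln ('C(n.*2, n)%:R) + 2 * ln n`!%:R.
  have h := bin_fact nn; rewrite -h !natrM !lnM ?posrE ?mulr_gt0 ?ltr0n ?fact_gt0 ?bin_gt0 //.
  rewrite -addnn addnK; ring.
have B : ln ('C(n.*2, n)%:R : R) <= 2 * n%:R.
  apply: (@le_trans _ _ (ln (4 ^ n)%:R)).
    by rewrite ler_ln ?posrE ?ltr0n ?bin_gt0 ?expn_gt0 // ler_nat bin_mid_le.
  have -> : (4 ^ n)%:R = 4%:R ^+ n :> R by rewrite natrX.
  rewrite lnXn // -[leLHS]mulr_natr ler_wpM2r //.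
  have -> : 4 = 2 * 2 :> R by ring.
  rewrite lnM ?posrE //; have := @ln_succ_le R 1 isT; rewrite ln1 invr1 => h; lra.
rewrite !ln_fact_vM in E.
have W : \sum_(1 <= d < n.+1) vM R d * (n %/ d)%:R = \sum_(1 <= d < n.*2.+1) vM R d * (n %/ d)%:R.
  rewrite [RHS](big_cat_nat (n := n.+1)) //= [X in _ + X]big1_seq ?addr0 // => d /andP[_].
  by rewrite mem_index_iota => /andP[nd _]; rewrite divn_small // mulr0.
rewrite W mulr_sumr in E.
have : theta n.*2 - theta n <= \sum_(1 <= d < n.*2.+1) vM R d * (n.*2 %/ d)%:R - \sum_(1 <= d < n.*2.+1) 2 * (vM R d * (n %/ d)%:R).
  rewrite /theta (big_cat_nat (n := n.+1) (p := n.*2.+1)) //= addrAC subrr add0r -sumrB [leRHS](big_cat_nat (n := n.+1)) //=.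
  apply: ler_wpDl.
    rewrite big_nat; apply: sumr_ge0 => d /andP[d0 _].
    have : (2 * (n %/ d) <= n.*2 %/ d)%N by rewrite leq_divRL // -mul2n -mulnA leq_mul2l /= leq_divM.
    rewrite -(ler_nat R) natrM => h; have := ler_wpM2l (vM_ge0 R d) h; lra.
  rewrite !big_nat; apply: ler_sum => d /andP[nd dn]; rewrite ltnS in dn.
  have d0 : (0 < d)%N by apply: leq_ltn_trans nd.
  rewrite (divn_small nd) mulr0 mulr0 subr0 ler_peMr ?vM_ge0 // ler1n divn_gt0 //.
lra.
Qed.

Lemma theta_le N : theta N <= 4 * N%:R.
Proof.
elim/ltn_ind: N => N IH; case: N IH => [|N] IH; first by rewrite /theta big_geq // mulr0.
set M := N.+1 in IH *; set h := M./2.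
have hM : (h < M)%N by rewrite /h /M; lia.
have h1 := IH h hM; have h2 := theta_double h.
have E := odd_double_half M; rewrite -/h in E.
have : theta M <= theta h.*2 + 2 * h%:R * (odd M)%:R.
  rewrite -{1}E; case: (odd M); last by rewrite add0n mulr0 addr0.
  rewrite add1n /theta big_nat_recr //= mulr1 lerD2l; apply: (le_trans (vM_le R _)).
  have := expR_ge1Dx (ln (h.*2.+1%:R : R)); rewrite lnK ?posrE ?ltr0n // -natr1 -muln2 natrM; lra.
have -> : M%:R = (odd M)%:R + 2 * h%:R :> R by rewrite -{1}E natrD -muln2 natrM mulrC.
have : 0 <= h%:R :> R by [].
case: (odd M) => /=; lra.
Qed.

Lemma vM_prime p : prime p -> ln (p%:R : R) <= vM R p.
Proof.
move=> pp; have p1 : (1 < p)%N := prime_gt1 pp.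
rewrite /vM big_mkcond (bigD1_seq p) ?mem_index_iota ?iota_uniq ?ltnSn //= pp.
rewrite (bigD1_seq 1%N) ?mem_index_iota ?iota_uniq //=; last by rewrite ltnS ltnW.
rewrite expn1 eqxx -addrA lerDl addr_ge0 //; first by apply: sumr_ge0 => k _; case: ifP => // _; exact: ln_nat_ge0.
apply: sumr_ge0 => r _; case: ifP => // _; apply: sumr_ge0 => k _; case: ifP => // _; exact: ln_nat_ge0.
Qed.

Local Ltac drop := clear -R.

(** Primes up to the square root of s are counted trivially; the others satisfy log p >= (log s) /
    2, so [theta] bounds their number. *)
Lemma prime_count_le s : (2 <= s)%N -> \sum_(1 <= p < s.+1 | prime p) (1 : R) <= 10 * (s%:R / ln s%:R).
Proof.
move=> s2; have s0 : (0 < s)%N by rewrite ltnW.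
have l0 : 0 < ln (s%:R : R).
  by apply: lt_le_trans (_ : ln (2 : R) <= _); [rewrite ln_gt0 // ltr1n|rewrite ler_ln ?posrE ?ltr0n // ler_nat].
pose X := npw s (- 2^-1 : R); have X0 : 0 <= X := expR_ge0 _.
pose M := Num.truncn X; have /andP[M1 M2] := truncn_itv X0.
apply: (@le_trans _ _ (\sum_(1 <= p < s.+1) ((if (p <= M)%N then 1 else 0) + 2 / ln s%:R * vM R p))).
  rewrite big_mkcond /= !big_nat; apply: ler_sum => p /andP[p0 ps].
  have v0 := vM_ge0 R p; have c0 : 0 <= 2 / ln (s%:R : R) by rewrite divr_ge0 // ltW.
  have cv : 0 <= 2 / ln s%:R * vM R p by rewrite mulr_ge0.
  case: ifP => [pp|_]; last by case: ifP => _; lra.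
  case: leqP => pM; first by lra.
  rewrite add0r; have vp := vM_prime pp.
  have Xp : X <= p%:R by apply: ltW; apply: lt_le_trans M2 _; rewrite ler_nat.
  have : 2^-1 * ln (s%:R : R) <= ln p%:R.
    rewrite -[leLHS]expRK ler_ln ?posrE ?expR_gt0 ?ltr0n //; apply: le_trans Xp.
    by rewrite /X /npw mulNr opprK.
  move=> h; rewrite mulrAC ler_pdivlMr // mul1r; (move: vp h; drop; lra).
rewrite big_split /= -mulr_sumr -/(theta s).
have h1 := @sum_if_le R s M 1 ler01; have h2 := theta_le s.
have h3 : X <= 2 * (s%:R / ln s%:R).
  rewrite mulrA ler_pdivlMr //; have h2' : 0 < 2^-1 :> R by rewrite invr_gt0.
  have := @ln_le_npw R s 2^-1 h2'; rewrite invrK -/X => h.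
  have -> : 2 * s%:R = X * (2 * X) :> R.
    have : X * X = s%:R.
      rewrite /X -npwD /npw; have -> : - ((- 2^-1 + - 2^-1) * ln s%:R) = ln (s%:R : R) by field.
      by rewrite lnK // posrE ltr0n.
    by move=> <-; ring.
  by rewrite ler_wpM2l.
have h4 : 2 / ln (s%:R : R) * theta s <= 8 * (s%:R / ln s%:R).
  have -> : 8 * (s%:R / ln s%:R) = 2 / ln s%:R * (4 * s%:R) :> R by ring.
  by rewrite ler_wpM2l // divr_ge0 // ltW.
rewrite mulr1 in h1; lra.
Qed.

(** By summation by parts, an inequality between all partial sums is inherited by sums with
    nonnegative decreasing weights. *)
Lemma abel_compare (u v g : nat -> R) N : (forall n, \sum_(1 <= d < n.+1) u d <= \sum_(1 <= d < n.+1) v d) ->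
  (forall d, (0 < d)%N -> 0 <= g d) -> (forall d, (0 < d)%N -> g d.+1 <= g d) ->
  \sum_(1 <= d < N.+1) u d * g d <= \sum_(1 <= d < N.+1) v d * g d.
Proof.
move=> H g0 gd.
have W n : 0 <= \sum_(1 <= d < n.+1) (v d - u d) by rewrite sumrB subr_ge0.
rewrite -subr_ge0 -sumrB.
have E : \sum_(1 <= d < N.+1) (v d * g d - u d * g d) = \sum_(1 <= d < N.+1) (v d - u d) * g d.
  by apply: eq_bigr => d _; rewrite mulrBl.
rewrite E; case: N {E} => [|N]; first by rewrite big_geq.
suff : (\sum_(1 <= d < N.+2) (v d - u d)) * g N.+1 <= \sum_(1 <= d < N.+2) (v d - u d) * g d.
  by apply: le_trans; rewrite mulr_ge0 ?g0.
elim: N => [|N IH]; first by rewrite !big_nat1.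
rewrite [in leRHS]big_nat_recr //= [in leLHS]big_nat_recr //= mulrDl lerD2r.
by apply: le_trans IH; rewrite ler_wpM2l ?W ?gd.
Qed.

Lemma half_sum N : \sum_(1 <= d < N.+1) npw d (2^-1 : R) <= 2 * npw N (- 2^-1).
Proof.
elim: N => [|N IH]; first by rewrite big_geq // mulr_ge0 ?expR_ge0.
rewrite big_nat_recr //=; case: N IH => [|N] IH.
  by rewrite big_geq // add0r /npw ln1 !mulr0 oppr0 expR0; lra.
set x := npw N.+1 (- 2^-1 : R) in IH; set y := npw N.+2 (- 2^-1 : R).
have sq n : (0 < n)%N -> npw n (- 2^-1 : R) * npw n (- 2^-1) = n%:R.
  move=> n0; rewrite -npwD /npw; have -> : - ((- 2^-1 + - 2^-1) * ln n%:R) = ln (n%:R : R) by field.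
  by rewrite lnK // posrE ltr0n.
have x2 := sq N.+1 isT; have y2 := sq N.+2 isT; rewrite -/x -/y in x2 y2.
have y0 : 0 < y := expR_gt0 _.
have z1 : npw N.+2 (2^-1 : R) * y = 1 by rewrite /y -npwD subrr /npw mul0r oppr0 expR0.
have yx : y * y = x * x + 1 by rewrite x2 y2 natr1.
apply: (le_trans (lerD IH (lexx _))); rewrite -(ler_pM2r y0) mulrDl z1.
have := sqr_ge0 (y - x); rewrite expr2; lra.
Qed.

Lemma vM_half_sum N : \sum_(1 <= d < N.+1) vM R d * npw d 2^-1 <= 8 * npw N (- 2^-1).
Proof.
apply: (@le_trans _ _ (\sum_(1 <= d < N.+1) 4 * npw d 2^-1)).
  apply: abel_compare => [n|d d0|d d0]; last by apply: npw_anti => //; rewrite invr_ge0.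
    by rewrite [leRHS]sumr_const_nat subn1 /= -[leRHS]mulr_natr; exact: theta_le.
  exact: expR_ge0.
rewrite -mulr_sumr; have := half_sum N; lra.
Qed.

Lemma ln_fact_bounds N : (0 < N)%N -> N%:R * ln (N%:R : R) - N%:R <= ln N`!%:R /\ ln (N`!%:R : R) <= N%:R * ln N%:R.
Proof.
elim: N => // N IH _; case: N IH => [|N] IH; first by rewrite ln1 mulr0; split; lra.
have [h1 h2] := IH isT; rewrite factS natrM lnM ?posrE ?ltr0n ?fact_gt0 //.
have n0 : 0 < N.+1%:R :> R by rewrite ltr0n.
have l1 := @ln_succ_le R N.+1 isT; have l2 := @ln_succ_ge R N.+1 isT.
have i0 : 0 < N.+2%:R^-1 :> R by rewrite invr_gt0.
have a1 : N.+1%:R * (ln (N.+2%:R : R) - ln N.+1%:R) <= 1.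
  by have := ler_wpM2l (ltW n0) l1; rewrite mulfV ?lt0r_neq0.
have d0 : 0 <= ln (N.+2%:R : R) - ln N.+1%:R := le_trans (ltW i0) l2.
have a2 : 0 <= N.+1%:R * (ln (N.+2%:R : R) - ln N.+1%:R) by rewrite mulr_ge0 ?(ltW n0).
move: a1 a2 h1 h2 {l1 l2 i0}; rewrite -[N.+2%:R]natr1; set n := N.+1%:R; set l := ln n; set l' := ln (n + 1).
set f := ln _; move=> a1 a2 h1 h2; split; lra.
Qed.

(** In log N!, written as the sum of [vM] d times N %/ d, replacing N %/ d by N / d costs at most
    [theta] N <= 4 N, and log N! is N log N + O(N). *)
Lemma mertens_one N : (0 < N)%N -> `|\sum_(1 <= d < N.+1) vM R d * d%:R^-1 - ln N%:R| <= 4.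
Proof.
move=> N0; have NR : 0 < N%:R :> R by rewrite ltr0n.
have [b1 b2] := ln_fact_bounds N0; have th := theta_le N.
set S := \sum_(_ <= _ < _) _.
have u : ln (N`!%:R : R) <= N%:R * S.
  rewrite ln_fact_vM mulr_sumr !big_nat; apply: ler_sum => d /andP[d0 _].
  rewrite mulrCA ler_wpM2l ?vM_ge0 // ler_pdivlMr ?ltr0n // -natrM ler_nat; exact: leq_divM.
have l : N%:R * S - theta N <= ln (N`!%:R : R).
  rewrite ln_fact_vM mulr_sumr -sumrB !big_nat; apply: ler_sum => d /andP[d0 _].
  have dR : 0 < d%:R :> R by rewrite ltr0n.
  have h : N%:R / d%:R <= (N %/ d)%:R + 1 :> R.
    by rewrite ler_pdivrMr // natr1 -natrM ler_nat ltnW // -ltn_divLR // ltnSn.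
  have := ler_wpM2l (vM_ge0 R d) h; rewrite mulrCA; lra.
rewrite ler_norml; apply/andP; split; rewrite -(ler_pM2l NR); lra.
Qed.

End Chebyshev.

(** * The Moebius function *)

Section Moebius.
Variable R : realType.
Local Notation C := R[i].
Implicit Types (p n m d : nat).

Lemma bigD1_seq_cond (r : seq nat) (P : pred nat) (G : nat -> C) j : j \in r -> uniq r -> P j ->
  \prod_(i <- r | P i) G i = G j * \prod_(i <- r | P i && (i != j)) G i.
Proof.
move=> jr ur Pj; rewrite -big_filter (bigD1_seq j) ?mem_filter ?Pj ?filter_uniq //=.
by rewrite big_filter_cond.
Qed.

Definition mug (e : nat) : C := if e == 0%N then 1 else if e == 1%N then -1 else 0.
Definition mu n : C := \prod_(0 <= p < n.+1 | prime p) mug (logn p n).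

Lemma mu_wide n B : (0 < n)%N -> (n <= B)%N -> mu n = \prod_(0 <= p < B.+1 | prime p) mug (logn p n).
Proof.
move=> n0 nB; rewrite /mu [RHS](big_cat_nat (n := n.+1)) //= [X in _ * X]big1_seq ?mulr1 // => p /andP[pp].
rewrite mem_index_iota => /andP[np _]; rewrite (_ : logn p n = 0%N) //.
by apply/eqP; rewrite -leqn0 leqNgt logn_gt0 mem_primes pp n0 /=; apply/negP => /(dvdn_leq n0); rewrite leqNgt np.
Qed.

Lemma cm_mug e : cm (mug e) <= 1.
Proof. by rewrite /mug; case: ifP => _; [rewrite cm1|case: ifP => _; [rewrite cmN cm1|rewrite cm0]]. Qed.

Lemma cm_mu n : cm (mu n) <= 1.
Proof.
rewrite /mu cm_prod; elim/big_rec: _ => // p x _ x1.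
have h := cm_mug (logn p n); have h0 := cm_ge0 (mug (logn p n)).
by apply: le_trans (ler_wpM2l h0 x1) _; rewrite mulr1.
Qed.

Lemma mu1 : mu 1 = 1.
Proof. by rewrite /mu big1 // => p _; rewrite logn1. Qed.

Lemma mu_pM p m : prime p -> (0 < m)%N -> mu (p * m) = if (p %| m)%N then 0 else - mu m.
Proof.
move=> pp m0; have p0 := prime_gt0 pp; have pm0 : (0 < p * m)%N by rewrite muln_gt0 p0.
have pB : (p <= p * m)%N by rewrite leq_pmulr.
have mB : (m <= p * m)%N by rewrite leq_pmull.
have pi : p \in index_iota 0 (p * m).+1 by rewrite mem_index_iota ltnS pB.
have D (G : nat -> C) := @bigD1_seq_cond (index_iota 0 (p * m).+1) prime G p pi (iota_uniq _ _) pp.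
rewrite (mu_wide m0 mB) /mu !D.
rewrite lognM // logn_prime // eqxx.
have E : \prod_(0 <= r < (p * m).+1 | prime r && (r != p)) mug (logn r (p * m)) =
         \prod_(0 <= r < (p * m).+1 | prime r && (r != p)) mug (logn r m).
  apply: eq_bigr => r /andP[pr rp]; rewrite lognM // logn_prime // (negbTE rp) //.
rewrite E; case: ifP => pdm.
  have : (0 < logn p m)%N by rewrite logn_gt0 mem_primes pp m0.
  by case: (logn p m) => // e _; rewrite /mug /= mul0r.
have -> : logn p m = 0%N.
  by apply/eqP; rewrite -leqn0 leqNgt logn_gt0 mem_primes pp m0 pdm.
by rewrite /mug /= mul1r mulN1r.
Qed.

(** With p the least prime factor of n, the divisors prime to p are paired with their multiples by
    p; multiples of p^2 contribute 0. *)
Lemma mu_sum n N : (0 < n)%N -> (n <= N)%N -> \sum_(1 <= d < N.+1 | (d %| n)%N) mu d = (if n == 1%N then 1 else 0).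
Proof.
move=> n0 nN.
have -> : \sum_(1 <= d < N.+1 | (d %| n)%N) mu d = \sum_(1 <= d < n.+1 | (d %| n)%N) mu d.
  rewrite (big_cat_nat (n := n.+1)) //= [X in _ + X]big1_seq ?addr0 // => d /andP[dn].
  by rewrite mem_index_iota => /andP[nd _]; have := dvdn_leq n0 dn; rewrite leqNgt nd.
case: eqP => [->|/eqP n1]; first by rewrite big_mkcond /= big_nat1 dvd1n mu1.
have n2 : (1 < n)%N by rewrite ltn_neqAle eq_sym n1.
pose p := pdiv n; have pp : prime p := pdiv_prime n2; have pn : (p %| n)%N := pdiv_dvd n.
have p0 := prime_gt0 pp.
rewrite (bigID (fun d => (p %| d)%N)) /=.
have -> : \sum_(1 <= d < n.+1 | (d %| n)%N && (p %| d)%N) mu d =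
   \sum_(1 <= d < n.+1 | (p %| d)%N) (if (d %| n)%N then mu d else 0).
  by rewrite [RHS]big_mkcond [LHS]big_mkcond; apply: eq_bigr => d _; case: (d %| n)%N => /=; case: (p %| d)%N.
rewrite (sum_dvd _ _ p0).
have -> : \sum_(1 <= d < n.+1 | (d %| n)%N && ~~ (p %| d)%N) mu d =
   \sum_(1 <= m < (n %/ p).+1 | (m %| n)%N && ~~ (p %| m)%N) mu m.
  have le : ((n %/ p).+1 <= n.+1)%N by rewrite ltnS leq_div.
  rewrite (big_cat_nat (n := (n %/ p).+1)) //= [X in _ + X]big1_seq ?addr0 // => d /andP[/andP[dn pd]].
  rewrite mem_index_iota => /andP[nd _].
  have : (p * d %| n)%N by rewrite Gauss_dvd ?pn // prime_coprime.
  move=> /(dvdn_leq n0); rewrite mulnC -leq_divRL // leqNgt nd //.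
rewrite [X in _ + X]big_mkcond -big_split /= big_nat big1 // => m /andP[m0 _].
rewrite mu_pM //; case: (boolP (p %| m)%N) => pm /=; first by rewrite andbF addr0; case: ifP.
rewrite andbT Gauss_dvd ?pn ?prime_coprime // /=; case: (m %| n)%N; last by rewrite addr0.
by rewrite addNr.
Qed.

End Moebius.

(** * Mertens' theorem with a character *)

Section Mertens.
Variable R : realType.
Local Notation C := R[i].
Variables (q : nat) (psi : nat -> C).
Hypothesis q0 : (0 < q)%N.
Hypothesis psiq : forall n, psi (n + q)%N = psi n.
Hypothesis psi1 : forall n, cm (psi n) <= 1.
Hypothesis psi_one : psi 1%N = 1.
Hypothesis psiM : forall m n, psi (m * n)%N = psi m * psi n.
Implicit Types (n d N M p : nat) (x t : R).

Definition Fd n : C := psi n * (n%:R^-1)%:C.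
Definition Sp N : C := \sum_(1 <= n < N.+1) (vM R n)%:C * Fd n.

Lemma FdM n m : Fd (n * m) = Fd n * Fd m.
Proof. by rewrite /Fd psiM natrM invfM rmorphM /=; ring. Qed.

Lemma cm_Fd n : cm (Fd n) <= n%:R^-1.
Proof. by rewrite /Fd cmM cm_real ger0_norm ?invr_ge0 // ler_piMl ?invr_ge0. Qed.

Lemma npow_one n : (0 < n)%N -> npow_neg n 1 = (n%:R^-1)%:C :> C.
Proof.
move=> n0; rewrite npow_negE mul1r -rmorphN cexp_real expRN lnK // posrE ltr0n //.
Qed.

Lemma inv_npw d t : (0 < d)%N -> d%:R^-1 * npw d t = npw d (1 + t) :> R.
Proof. by move=> d0; rewrite npwD npw_inv. Qed.

Section NonPrincipal.
Hypothesis psi0 : \sum_(k < q) psi k = 0.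

Definition lM M : C := \sum_(1 <= m < M.+1) Fd m.
Definition kM M : C := \sum_(1 <= m < M.+1) (ln m%:R)%:C * Fd m.
Local Notation LL := (Defs.Lfun psi (1 : C)).
Local Notation KK := (- L1fun psi (1 : C)).

Lemma lM_bound : exists K, 0 <= K /\ forall M, cm (LL - lM M) <= K * npw M.+1 1.
Proof.
exists (q%:R * (1 + 5 * cm (1 : C)) * (2 + 1^-1)); split.
  by rewrite !mulr_ge0 // addr_ge0 ?mulr_ge0 ?cm_ge0 ?invr_ge0.
move=> M; have := @L_tail R q psi q0 psiq psi1 psi0 1 1 ltr01 (lexx _) M.+1 isT.
rewrite /Lpart (_ : \sum_(1 <= n < M.+1) psi n * npow_neg n 1 = lM M) //.
by rewrite /lM !big_nat; apply: eq_bigr => m /andP[m0 _]; rewrite npow_one.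
Qed.

Lemma kM_bound : exists K, 0 <= K /\ forall M, cm (KK - kM M) <= K * npw M.+1 2^-1.
Proof.
exists (q%:R * (1 + (2 + 10 * cm (1 : C)) / 1) * (2 + (1 / 2)^-1)); split.
  have : 0 <= cm (1 : C) by exact: cm_ge0.
  move=> h; apply: mulr_ge0; last by apply: addr_ge0 => //; rewrite invr_ge0; lra.
  by apply: mulr_ge0 => //; apply: addr_ge0 => //; apply: divr_ge0 => //; apply: addr_ge0 => //; exact: mulr_ge0.
move=> M; have := @L1_tail R q psi q0 psiq psi1 psi0 1 1 ltr01 (lexx _) M.+1 isT.
rewrite /L1part; have -> : \sum_(1 <= n < M.+1) psi n * lnpow n 1 = - kM M.
  rewrite /kM -sumrN !big_nat; apply: eq_bigr => m /andP[m0 _].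
  by rewrite /lnpow npow_one // /Fd; ring.
have -> : - L1fun psi 1 - kM M = - (L1fun psi 1 - - kM M) by ring.
by rewrite cmN div1r.
Qed.

Lemma div_npw N d t K z : 0 <= t -> 0 <= K -> (0 < d)%N -> (0 < N)%N -> cm z <= K * npw (N %/ d).+1 t ->
  cm z <= K * (npw d (- t) * npw N t).
Proof.
move=> t0 K0 d0 N0 h; apply: (le_trans h); rewrite ler_wpM2l //; exact: npw_ratio.
Qed.

Lemma conv_Fd N : kM N = \sum_(1 <= d < N.+1) (vM R d)%:C * (Fd d * lM (N %/ d)).
Proof.
rewrite /kM sum_conv_vM; apply: eq_bigr => d _; congr (_ * _).
by rewrite /lM mulr_sumr; apply: eq_bigr => m _; rewrite FdM.
Qed.

(** In the identity [conv_Fd] each inner sum [lM] is replaced by L(1). The error for d is O(d / N),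
    so after the weight 1/d the total is O([theta] N / N), which Chebyshev's bound makes O(1). *)
Lemma LS_bound : exists K, forall N, (0 < N)%N -> cm (LL * Sp N) <= K.
Proof.
have [K1 [K10 H1]] := lM_bound; have [K2 [K20 H2]] := kM_bound.
exists (cm KK + K2 + 4 * K1) => N N0.
have -> : LL * Sp N = kM N + \sum_(1 <= d < N.+1) (vM R d)%:C * (Fd d * (LL - lM (N %/ d))).
  rewrite conv_Fd -big_split /= /Sp mulr_sumr; apply: eq_bigr => d _; ring.
apply: (le_trans (cm_D _ _)); apply: lerD.
  have h := H2 N; have h2 := npw_le1 N.+1 (ltac:(by rewrite invr_ge0) : 0 <= 2^-1 :> R).
  have := cm_rev (kM N) KK; rewrite cmB; have : K2 * npw N.+1 2^-1 <= K2 by rewrite ler_piMr.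
  lra.
apply: (le_trans (cm_sum _ _ _)).
apply: (@le_trans _ _ (\sum_(1 <= d < N.+1) vM R d * (K1 * npw N 1))).
  rewrite !big_nat; apply: ler_sum => d /andP[d0 _].
  rewrite cmM cm_real ger0_norm ?vM_ge0 // ler_wpM2l ?vM_ge0 // cmM.
  have h := div_npw ler01 K10 d0 N0 (H1 (N %/ d)%N).
  apply: (le_trans (ler_pM (cm_ge0 _) (cm_ge0 _) (cm_Fd d) h)).
  have E1 : d%:R^-1 * npw d (-1) = 1 :> R by rewrite inv_npw // subrr /npw mul0r oppr0 expR0.
  have -> : d%:R^-1 * (K1 * (npw d (-1) * npw N 1)) = d%:R^-1 * npw d (-1) * (K1 * npw N 1) by ring.
  by rewrite E1 mul1r.
rewrite -mulr_suml -/(theta R N) npw_inv //.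
have NR : 0 < N%:R :> R by rewrite ltr0n.
rewrite mulrA ler_pdivrMr //; have := ler_wpM2r K10 (theta_le R N); lra.
Qed.

(** The sum over m <= N/d of psi(m)/m times log (N / (d m)). If L(1) = 0 it tends to L'(1) as N/d
    grows. *)
Definition JJ N d : C := (ln (N%:R : R) - ln d%:R)%:C * lM (N %/ d) - kM (N %/ d).

Lemma ln_ratio N d : (0 < d)%N -> (0 < N)%N -> ln (N%:R : R) - ln d%:R <= 2 * (npw d 2^-1 * npw N (- 2^-1)).
Proof.
move=> d0 N0; rewrite /npw -expRD; set y := (X in expR X).
have := expR_ge1Dx y; rewrite /y; lra.
Qed.

Lemma JJ_bound : LL = 0 -> exists K, 0 <= K /\ forall N d, (0 < d)%N -> (d <= N)%N ->
  cm (JJ N d + KK) <= K * (npw d (- 2^-1) * npw N 2^-1).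
Proof.
move=> L0; have [K1 [K10 H1]] := lM_bound; have [K2 [K20 H2]] := kM_bound.
exists (2 * K1 + K2); split; first by rewrite addr_ge0 // mulr_ge0.
move=> N d d0 dN; have N0 : (0 < N)%N by apply: leq_trans dN.
have h20 : 0 <= 2^-1 :> R by rewrite invr_ge0.
have h1 := div_npw ler01 K10 d0 N0 (H1 (N %/ d)%N).
have h2 := div_npw h20 K20 d0 N0 (H2 (N %/ d)%N).
rewrite L0 sub0r cmN in h1.
have -> : JJ N d + KK = (ln (N%:R : R) - ln d%:R)%:C * lM (N %/ d) + (KK - kM (N %/ d)) by rewrite /JJ; ring.
apply: (le_trans (cm_D _ _)); rewrite mulrDl; apply: lerD => //.
have lnd : ln (d%:R : R) <= ln N%:R by rewrite ler_ln ?posrE ?ltr0n // ler_nat.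
rewrite cmM cm_real ger0_norm ?subr_ge0 //.
apply: (le_trans (ler_pM _ (cm_ge0 _) (ln_ratio d0 N0) h1)); first by rewrite subr_ge0.
have E1 : npw d 2^-1 * npw d (-1) = npw d (- 2^-1) :> R by rewrite -npwD; congr npw; lra.
have E2 : npw N (- 2^-1) * npw N 1 = npw N 2^-1 :> R by rewrite -npwD; congr npw; lra.
by apply: le_eq; rewrite -E1 -E2; ring.
Qed.

Definition GN N n : C := Fd n * (ln (N%:R : R) - ln n%:R)%:C.

Lemma GN_sum N d : (0 < d)%N -> \sum_(1 <= m < (N %/ d).+1) GN N (d * m) = Fd d * JJ N d.
Proof.
move=> d0; rewrite /JJ mulrBr mulrCA [Fd d * lM _]mulr_sumr mulr_sumr [Fd d * kM _]mulr_sumr -sumrB.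
rewrite !big_nat; apply: eq_bigr => m /andP[m0 _].
rewrite /GN FdM natrM lnM ?posrE ?ltr0n // !(rmorphB, rmorphD) /=; ring.
Qed.

Lemma inv_half d : (0 < d)%N -> d%:R^-1 * npw d (- 2^-1) = npw d 2^-1 :> R.
Proof. by move=> d0; rewrite inv_npw //; congr npw; lra. Qed.

Lemma half_cancel N : npw N 2^-1 * npw N (- 2^-1) = 1 :> R.
Proof. by rewrite -npwD subrr /npw mul0r oppr0 expR0. Qed.

(** If L(1) and L'(1) both vanished, [JJ] would tend to 0. Moebius inversion writes log N as the sum
    of mu(d) psi(d)/d times [JJ] N d, which would then be bounded. *)
Lemma KK_neq0 : LL = 0 -> KK != 0.
Proof.
move=> L0; apply/eqP => Kz; have [K [K0 HJ]] := JJ_bound L0.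
have B N : (0 < N)%N -> ln (N%:R : R) <= 2 * K.
  move=> N0; have E := sum_conv N (mu R) (GN N).
  have E1 : \sum_(1 <= n < N.+1) (\sum_(1 <= d < N.+1 | (d %| n)%N) mu R d) * GN N n = (ln N%:R)%:C.
    rewrite big_ltn //= mu_sum // eqxx mul1r big_nat big1 ?addr0; last first.
      move=> n /andP[n1 nN]; rewrite mu_sum ?(ltn_trans _ n1) // ifF ?mul0r //.
      by apply/eqP => n1'; rewrite n1' in n1.
    by rewrite /GN /Fd psi_one invr1 ln1 subr0 !mul1r.
  have : cm (ln (N%:R : R))%:C <= 2 * K.
    rewrite -E1 E; apply: (le_trans (cm_sum _ _ _)).
    apply: (@le_trans _ _ (\sum_(1 <= d < N.+1) K * npw N 2^-1 * npw d 2^-1)).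
      rewrite !big_nat; apply: ler_sum => d /andP[d0 dN]; rewrite ltnS in dN.
      rewrite GN_sum // cmM; have h := HJ N d d0 dN; rewrite Kz addr0 in h.
      apply: (@le_trans _ _ (1 * (d%:R^-1 * (K * (npw d (- 2^-1) * npw N 2^-1))))).
        apply: ler_pM; rewrite ?cm_ge0 ?cm_mu // cmM; apply: ler_pM; rewrite ?cm_ge0 ?cm_Fd //.
      by apply: le_eq; rewrite -(@inv_half d) //; ring.
    rewrite -mulr_sumr -mulrA mulrC ler_wpM2r //.
    apply: (le_trans (ler_wpM2l (expR_ge0 _) (half_sum R N))).
    by rewrite mulrCA half_cancel mulr1.
  by rewrite cm_real ger0_norm ?ln_nat_ge0.
have [N HN] := big_nat_ex (expR (2 * K + 1)).
have := B N.+1 isT; apply/negP; rewrite -ltNge.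
apply: (@lt_le_trans _ _ (ln (expR (2 * K + 1)))); first by rewrite expRK ltrDl.
by rewrite ler_ln ?posrE ?expR_gt0 ?ltr0n.
Qed.

(** A partial sum of L''(1). *)
Definition QN N : C := \sum_(1 <= n < N.+1) psi n * ((ln n%:R) ^+ 2 / n%:R)%:C.

Local Ltac drop := clear -R q psi q0 psiq psi1 psi_one psiM psi0.

Lemma QN_bound : exists K, forall N, cm (QN N) <= K.
Proof.
pose g n : C := ((ln (n%:R : R)) ^+ 2 / n%:R)%:C.
have h2 : 0 < 2^-1 :> R by rewrite invr_gt0.
have q4 : 0 < 4^-1 :> R by rewrite invr_gt0.
have l2 n : (0 < n)%N -> ln (n%:R : R) ^+ 2 <= 16 * npw n (- 2^-1).
  move=> n0; have := @ln_le_npw R n 4^-1 q4; rewrite invrK => h.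
  have -> : 16 * npw n (- 2^-1) = (4 * npw n (- 4^-1)) ^+ 2 :> R.
    rewrite exprMn -expRM_natl /npw; congr (_ * expR _); [by rewrite expr2; ring|by field].
  by rewrite lerXn2r ?nnegrE ?ln_nat_ge0 // mulr_ge0 ?expR_ge0.
have gK n : (0 < n)%N -> cm (g n) <= 34 * npw n 2^-1.
  move=> n0; rewrite /g cm_real ger0_norm ?divr_ge0 ?sqr_ge0 //.
  apply: (@le_trans _ _ (16 * npw n (- 2^-1) * n%:R^-1)); first by rewrite ler_wpM2r ?invr_ge0 // l2.
  rewrite -mulrA [npw _ _ * _]mulrC inv_half // ler_wpM2r ?expR_ge0 //; lra.
have gD n : (0 < n)%N -> cm (g n.+1 - g n) <= 34 * npw n (1 + 2^-1).
  move=> n0; rewrite /g -rmorphB /= cm_real.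
  have d1 := @ln_succ_le R n n0; have d2 := @ln_succ_ge R n n0.
  have nR : 1 <= n%:R :> R by rewrite ler1n.
  have L2 := l2 n n0; have l0 := @ln_nat_ge0 R n.
  have i2 : npw n 2 = n%:R^-1 ^+ 2 :> R by apply: npw_sq.
  have b : `|ln (n.+1%:R : R) ^+ 2 / n.+1%:R - ln (n%:R : R) ^+ 2 / n%:R| <= (ln (n%:R : R) + 1) ^+ 2 * npw n 2.
    rewrite i2; have n1 : 0 < n%:R :> R by lra.
    have E : n.+1%:R = n%:R + 1 :> R by rewrite natr1.
    have i1 : n%:R^-1 <= 1 :> R by rewrite invf_le1.
    rewrite E in d1 d2 *; move: d1 d2 nR l0 i1; set l := ln n%:R; set l' := ln _; set v := (n%:R : R); clear -v => d1 d2 v1 l0 i1.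
    have v0 : 0 < v by lra.
    have v10 : 0 < v + 1 by lra.
    have w0 : 0 <= (v + 1)^-1 by rewrite invr_ge0 ltW.
    have E1 : l' ^+ 2 / (v + 1) - l ^+ 2 / v = ((l' - l) * (l' + l) - l ^+ 2 / v) / (v + 1).
      by field; rewrite !lt0r_neq0.
    rewrite E1 normrM [`|(v + 1)^-1|]ger0_norm // ler_pdivrMr //.
    have vi : 0 < v^-1 by rewrite invr_gt0.
    have t1 : (l' - l) * (l' + l) <= v^-1 * (2 * l + 1) by apply: ler_pM; lra.
    have t2 : 0 <= (l' - l) * (l' + l) by apply: mulr_ge0; lra.
    have t3 : 0 <= l ^+ 2 / v by rewrite mulr_ge0 ?sqr_ge0 // ltW.
    have t4 : (l + 1) ^+ 2 * v^-1 ^+ 2 * (v + 1) = (l + 1) ^+ 2 * v^-1 + (l + 1) ^+ 2 * v^-1 ^+ 2.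
      by field; rewrite lt0r_neq0.
    have t5 : 0 <= (l + 1) ^+ 2 * v^-1 ^+ 2 by rewrite mulr_ge0 ?sqr_ge0.
    have t6 : (l + 1) ^+ 2 * v^-1 = v^-1 * (2 * l + 1) + l ^+ 2 / v by rewrite sqrrD expr2; ring.
    rewrite t4 t6 ler_norml; apply/andP; split.
      have : 0 <= v^-1 * (2 * l + 1) by apply: mulr_ge0; lra.
      lra.
    lra.
  apply: (le_trans b).
  have -> : npw n (1 + 2^-1) = npw n (- 2^-1) * npw n 2 :> R by rewrite -npwD; congr npw; (drop; lra).
  rewrite mulrA ler_wpM2r ?expR_ge0 //.
  have : 1 <= npw n (- 2^-1) :> R by rewrite /npw -[leLHS]expR0 ler_expR mulNr opprK mulr_ge0 ?invr_ge0 ?ln_nat_ge0.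
  have : (ln (n%:R : R) + 1) ^+ 2 <= 2 * ln (n%:R : R) ^+ 2 + 2.
    by have h := sqr_ge0 (ln (n%:R : R) - 1); rewrite !expr2 in h *; (move: h; drop; lra).
  (move: L2; drop; lra).
have n34 : 0 <= 34 :> R by rewrite ler0n.
exists (q%:R * 34 * (2 + 2^-1^-1) * npw 1 2^-1) => N.
exact: (@dser_tail R q psi q0 psiq psi1 psi0 g 34 2^-1 h2 n34 gK gD 1 N.+1 isT isT).
Qed.

(** The sum of psi(n)/n log n log (N/n) is evaluated twice: directly as (log N) [kM] N - [QN] N, and
    through log = [vM] * 1 as the sum of [vM] d psi(d)/d times [JJ] N d, where [JJ] is close to
    L'(1). *)
Lemma KS_bound : LL = 0 -> exists K, forall N, (0 < N)%N -> cm (KK * (Sp N + (ln N%:R)%:C)) <= K.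
Proof.
move=> L0; have [K3 [K30 HJ]] := JJ_bound L0; have [K4 HQ] := QN_bound; have [K2 [K20 H2]] := kM_bound.
exists (8 * K3 + K4 + 2 * K2) => N N0.
have E := sum_conv_vM N (GN N).
have E1 : \sum_(1 <= n < N.+1) (ln n%:R)%:C * GN N n = (ln N%:R)%:C * kM N - QN N.
  rewrite /kM /QN mulr_sumr -sumrB; apply: eq_bigr => n _.
  by rewrite /GN /Fd rmorphB rmorphM rmorphXn /=; ring.
have E2 : \sum_(1 <= d < N.+1) (vM R d)%:C * (\sum_(1 <= m < (N %/ d).+1) GN N (d * m)) =
   - KK * Sp N + \sum_(1 <= d < N.+1) (vM R d)%:C * (Fd d * (JJ N d + KK)).
  rewrite /Sp mulr_sumr -big_split /= !big_nat; apply: eq_bigr => d /andP[d0 _].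
  by rewrite GN_sum //; ring.
rewrite E1 E2 in E; set Er := \sum_(1 <= d < N.+1) _ in E.
have -> : KK * (Sp N + (ln N%:R)%:C) = Er + QN N + (ln N%:R)%:C * (KK - kM N).
  have -> : Er = (ln N%:R)%:C * kM N - QN N + KK * Sp N by rewrite E; ring.
  ring.
apply: (le_trans (cm_D _ _)); apply: lerD; first apply: (le_trans (cm_D _ _)); first apply: lerD => //.
  rewrite /Er; apply: (le_trans (cm_sum _ _ _)).
  apply: (@le_trans _ _ (\sum_(1 <= d < N.+1) K3 * npw N 2^-1 * (vM R d * npw d 2^-1))).
    rewrite !big_nat; apply: ler_sum => d /andP[d0 dN]; rewrite ltnS in dN.
    rewrite cmM cm_real ger0_norm ?vM_ge0 // cmM.
    apply: (@le_trans _ _ (vM R d * (d%:R^-1 * (K3 * (npw d (- 2^-1) * npw N 2^-1))))).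
      rewrite ler_wpM2l ?vM_ge0 //; apply: ler_pM; rewrite ?cm_ge0 ?cm_Fd //; exact: HJ.
    by apply: le_eq; rewrite -(@inv_half d) //; ring.
  rewrite -mulr_sumr -mulrA mulrC ler_wpM2r //.
  apply: (le_trans (ler_wpM2l (expR_ge0 _) (vM_half_sum R N))).
  by rewrite mulrCA half_cancel mulr1.
rewrite cmM cm_real ger0_norm ?ln_nat_ge0 //.
have h2 : 0 < 2^-1 :> R by rewrite invr_gt0.
have l := @ln_le_npw R N 2^-1 h2; rewrite invrK in l.
have k : cm (KK - kM N) <= K2 * npw N 2^-1.
  apply: (le_trans (H2 N)); rewrite ler_wpM2l //; apply: npw_anti => //; exact: ltW.
apply: (le_trans (ler_pM (ln_nat_ge0 R N) (cm_ge0 _) l k)).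
have -> : 2 * npw N (- 2^-1) * (K2 * npw N 2^-1) = 2 * K2 * (npw N 2^-1 * npw N (- 2^-1)) by ring.
by rewrite half_cancel mulr1.
Qed.

(** The two values of L(1) are treated alike: dl = 0 if L(1) is nonzero, and dl = -1 if it
    vanishes. *)
Lemma mertens_np : exists dl K : R, forall N, (0 < N)%N -> cm (Sp N - (dl * ln N%:R)%:C) <= K.
Proof.
have [L0|Ln] := eqVneq LL 0.
  have [K HK] := KS_bound L0; have Kn := KK_neq0 L0; have K0 : 0 < cm KK by rewrite cm_gt0.
  exists (-1), (K / cm KK) => N N0; rewrite mulN1r rmorphN opprK ler_pdivlMr // mulrC -cmM.
  exact: HK.
have [K HK] := LS_bound; have K0 : 0 < cm LL by rewrite cm_gt0.
exists 0, (K / cm LL) => N N0; rewrite mul0r subr0 ler_pdivlMr // mulrC -cmM.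
exact: HK.
Qed.

End NonPrincipal.

(** For the principal character the sum differs from that of [mertens_one] by the powers of primes
    dividing q; there are at most q such primes, and each contributes at most log q. *)
Lemma mertens_pr : (forall n, psi n = if coprime n q then 1 else 0) ->
  exists dl K : R, forall N, (0 < N)%N -> cm (Sp N - (dl * ln N%:R)%:C) <= K.
Proof.
move=> psiP; pose h n : R := if coprime n q then 0 else n%:R^-1.
exists 1, (4 + q%:R * ln q%:R) => N N0; rewrite mul1r.
have -> : Sp N = (\sum_(1 <= d < N.+1) vM R d * d%:R^-1 - \sum_(1 <= d < N.+1) vM R d * h d)%:C.
  rewrite -sumrB /Sp rmorph_sum /=; apply: eq_bigr => d _; rewrite /Fd psiP /h.
  by case: (coprime d q); rewrite rmorphB !rmorphM /= ?rmorph0 ?mulr0 ?mul0r ?mulr0 ?mul1r ?subr0 ?subrr.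
rewrite -rmorphB /= cm_real addrAC; apply: (le_trans (ler_normB _ _)); apply: lerD; first exact: mertens_one.
have h0 n : 0 <= h n by rewrite /h; case: ifP => // _; rewrite invr_ge0.
rewrite ger0_norm; last by apply: sumr_ge0 => d _; rewrite mulr_ge0 ?vM_ge0.
rewrite vM_sumR.
have T0 : 0 <= ln (q%:R : R) := ln_nat_ge0 R q.
apply: le_trans (sum_if_le N q T0).
rewrite big_ltn_cond //= big_mkcond /= !big_nat; apply: ler_sum => p /andP[p0 _].
case: ifP => pp; last by case: ifP.
have p2 : (2 <= p)%N := prime_gt1 pp.
have lp : 0 <= ln (p%:R : R) := ln_nat_ge0 R p.
have pi : p%:R^-1 <= 1/2 :> R by rewrite div1r lef_pV2 ?posrE ?ltr0n // ler_nat.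
have pi0 : 0 <= p%:R^-1 :> R by rewrite invr_ge0.
have S1 : \sum_(1 <= k < N.+1) p%:R^-1 ^+ k <= 1 :> R.
  rewrite big_add1 /= big_mkord; apply: (@le_trans _ _ (p%:R^-1 * \sum_(k < N) p%:R^-1 ^+ k)).
    by rewrite mulr_sumr; apply: ler_sum => k _; rewrite exprS.
  have := geo0_le N pi0 pi; set S := \sum_(_ < _) _ => hS.
  apply: (@le_trans _ _ (p%:R^-1 * 2)); first by rewrite ler_wpM2l.
  lra.
case: (boolP (p %| q)%N) => pq.
  have pq' := dvdn_leq q0 pq; rewrite pq'.
  apply: (@le_trans _ _ (\sum_(1 <= k < N.+1) ln (p%:R : R) * p%:R^-1 ^+ k)).
    rewrite big_mkcond /=; apply: ler_sum => k _.
    have z0 : 0 <= ln (p%:R : R) * p%:R^-1 ^+ k by rewrite mulr_ge0 ?exprn_ge0.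
    case: ifP => // _; rewrite ler_wpM2l // /h; case: ifP => _; first by rewrite exprn_ge0.
    by rewrite natrX exprVn.
  rewrite -mulr_sumr; apply: (@le_trans _ _ (ln p%:R)); first by rewrite ler_piMr.
  by rewrite ler_ln ?posrE ?ltr0n // ler_nat.
rewrite big1; first by case: ifP.
move=> k _; rewrite /h coprimeXl ?mulr0 //.
by rewrite prime_coprime.
Qed.

Hypothesis dich : \sum_(k < q) psi k = 0 \/ (forall n, psi n = if coprime n q then 1 else 0).

Lemma mertens : exists dl K : R, forall N, (0 < N)%N -> cm (Sp N - (dl * ln N%:R)%:C) <= K.
Proof. by case: dich => [h|h]; [exact: mertens_np|exact: mertens_pr]. Qed.

Definition Bp N : C := \sum_(0 <= p < N.+1 | prime p) Fd p * (ln p%:R)%:C.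
Definition Tp N : C := \sum_(0 <= p < N.+1 | prime p) Fd p.

Lemma geo2_le x N : 0 <= x -> x <= 1/2 -> \sum_(2 <= k < N) x ^+ k <= 2 * x ^+ 2.
Proof.
move=> x0 x1; have X0 : 0 <= x ^+ 2 := sqr_ge0 x.
rewrite -{1}[2%N]add0n big_addn big_mkord.
apply: (@le_trans _ _ (x ^+ 2 * \sum_(k < N - 2) x ^+ k)).
  by rewrite mulr_sumr; apply: ler_sum => k _; rewrite -exprD addnC.
by rewrite mulrC ler_wpM2r // geo0_le.
Qed.

(** For each prime the powers from the square on contribute at most 2 (log p) / p^2 <= 4 p^(-3/2),
    and the sum of n^(-3/2) is at most 3. *)
Lemma prime_powers N : cm (Sp N - Bp N) <= 12.
Proof.
rewrite /Sp vM_sum /Bp -sumrB; apply: (le_trans (cm_sum _ _ _)).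
apply: (@le_trans _ _ (\sum_(1 <= p < N.+1) 4 * npw p (1 + 2^-1))).
  rewrite big_ltn_cond //= big_mkcond /= !big_nat; apply: ler_sum => p /andP[p0 pN].
  have np0 : 0 <= 4 * npw p (1 + 2^-1) :> R by rewrite mulr_ge0 ?expR_ge0.
  case: ifP => // pp; have p2 : (2 <= p)%N := prime_gt1 pp.
  have lp : 0 <= ln (p%:R : R) := ln_nat_ge0 R p.
  have N1 : (1 < N.+1)%N by apply: leq_ltn_trans p0 pN.
  have pi : p%:R^-1 <= 1/2 :> R by rewrite div1r lef_pV2 ?posrE ?ltr0n // ler_nat.
  have pi0 : 0 <= p%:R^-1 :> R by rewrite invr_ge0.
  rewrite big_mkcond big_ltn //= expn1 -ltnS pN [_ * Fd p]mulrC addrAC subrr add0r.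
  apply: (le_trans (cm_sum _ _ _)).
  apply: (@le_trans _ _ (\sum_(2 <= k < N.+1) ln (p%:R : R) * p%:R^-1 ^+ k)).
    apply: ler_sum => k _; have z0 : 0 <= ln (p%:R : R) * p%:R^-1 ^+ k by rewrite mulr_ge0 ?exprn_ge0.
    case: ifP => _; last by rewrite cm0.
    rewrite cmM cm_real ger0_norm // ler_wpM2l //; apply: (le_trans (cm_Fd _)).
    by rewrite natrX exprVn.
  rewrite -mulr_sumr; apply: (le_trans (ler_wpM2l lp (geo2_le N.+1 pi0 pi))).
  have h2 : 0 < 2^-1 :> R by rewrite invr_gt0.
  have l := @ln_le_npw R p 2^-1 h2; rewrite invrK in l.
  have -> : 4 * npw p (1 + 2^-1) = 2 * npw p (- 2^-1) * (2 * p%:R^-1 ^+ 2) :> R.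
    have -> : npw p (1 + 2^-1) = npw p (- 2^-1) * npw p 2 :> R by rewrite -npwD; congr npw; lra.
    rewrite npw_sq //; ring.
  by rewrite ler_wpM2r // mulr_ge0 // exprn_ge0.
have h2 : 0 < 2^-1 :> R by rewrite invr_gt0.
rewrite -mulr_sumr; have := @npw_tail R 2^-1 1 N.+1 h2 isT.
rewrite {2}/npw ln1 mulr0 oppr0 expR0 invrK; lra.
Qed.

Lemma Tp_step k : (1 < k)%N -> Tp k.+1 - Tp k = (Bp k.+1 - Bp k) * ((ln (k.+1%:R : R))^-1)%:C.
Proof.
move=> k1; rewrite /Tp /Bp big_mkcond big_nat_recr //= -big_mkcond /= [in RHS]big_mkcond [in RHS]big_nat_recr //= -big_mkcond /=.
rewrite !(addrC (\sum_(_ <= _ < _ | _) _)) !addrK; case: ifP => _; last by rewrite mul0r.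
rewrite -mulrA -rmorphM /= mulfV ?mulr1 // lt0r_neq0 // ln_gt0 // ltr1n //.
exact: leqW.
Qed.

(** Mertens' theorem says that [be] is bounded for the sums [Bp] and mc = -dl; summation by parts
    then yields the sum of psi(p)/p over an interval. *)
Lemma prime_recip : exists dl K : R, 0 <= K /\ forall n n', (4 <= n)%N -> (n <= n')%N ->
  cm (Tp n' - Tp n - (dl * (ln (ln n'%:R) - ln (ln n%:R)))%:C) <= K / ln n%:R.
Proof.
have [dl [K HK]] := mertens.
pose mc : C := (- dl)%:C.
pose K' := Num.max 0 (K + 12).
have K'0 : 0 <= K' by rewrite le_max lexx.
have HB k : cm (be Bp mc 0 k) <= K'.
  rewrite /be subr0 le_max; case: k => [|k].
    rewrite ln0 // mulr0 addr0 /Bp big_mkcond big_nat1 /= cm0.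
    apply/orP; right; have := HK 1%N isT; have := prime_powers 1; rewrite ln1 mulr0 subr0.
    have := cm_ge0 (Sp 1 - Bp 1); have := cm_ge0 (Sp 1); lra.
  apply/orP; right; have h1 := HK k.+1 isT; have h2 := prime_powers k.+1.
  rewrite /mc -rmorphM /= mulNr rmorphN /=.
  have := cm_tri (Bp k.+1) (dl * ln k.+1%:R)%:C (Sp k.+1); rewrite (cmB (Bp k.+1) (Sp k.+1)); lra.
exists dl, (K' + 2 * cm mc + 2 * K'); split.
  by rewrite !addr_ge0 // mulr_ge0 ?cm_ge0.
move=> n n' n4 nn; have h := @ga_tail_bounded R Bp Tp mc 0 Tp_step K' n n' n4 nn HB.
have l1 := @ln_nat_ge1 R n n4; have l1' := @ln_nat_ge1 R n' (leq_trans n4 nn).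
have E : Tp n' - Tp n - (dl * (ln (ln n'%:R) - ln (ln n%:R)))%:C =
  (ga Bp Tp mc 0 n' - ga Bp Tp mc 0 n) + be Bp mc 0 n' * ((ln (n'%:R : R))^-1)%:C - be Bp mc 0 n * ((ln (n%:R : R))^-1)%:C.
  by rewrite /ga /mc rmorphM rmorphB rmorphN /=; ring.
have ln0 : 0 < ln (n%:R : R) by lra.
have lnn : ln (n%:R : R) <= ln n'%:R by rewrite ler_ln ?posrE ?ltr0n ?(leq_trans _ n4) // ?(leq_trans _ nn) ?(leq_trans _ n4) // ler_nat.
rewrite E; apply: (le_trans (cm_subD _ _)); apply: (le_trans (lerD (cm_D _ _) (lexx _))).
have cI z N : cm (z * ((ln (N%:R : R))^-1)%:C) = cm z * (ln N%:R)^-1.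
  by rewrite cmM cm_real ger0_norm // invr_ge0 ln_nat_ge0.
rewrite !cI.
have -> : (K' + 2 * cm mc + 2 * K') / ln n%:R = (K' + 2 * cm mc) / ln n%:R + K' * (ln n%:R)^-1 + K' * (ln n%:R)^-1 by ring.
apply: lerD; first apply: lerD => //.
  apply: ler_pM; rewrite ?cm_ge0 ?invr_ge0 ?ln_nat_ge0 //.
  by rewrite lef_pV2 ?posrE //; lra.
by rewrite ler_wpM2r ?invr_ge0 ?ln_nat_ge0.
Qed.

End Mertens.

(** * The Euler product *)

Section EulerLog.
Variable R : realType.
Local Notation C := R[i].
Variables (q : nat) (chi : nat -> C).
Hypothesis q0 : (0 < q)%N.
Hypothesis chiq : forall n, chi (n + q)%N = chi n.
Hypothesis chi1 : forall n, cm (chi n) <= 1.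
Hypothesis chi_one : chi 1%N = 1.
Hypothesis chiM : forall m n, chi (m * n)%N = chi m * chi n.
Implicit Types (n d N M p s j k : nat) (x t : R).

Definition zp p : C := chi p * npow_neg p (hlf R).

Lemma cm_zp p : cm (zp p) <= npw p (2^-1 : R).
Proof. by rewrite /zp cmM cm_npow /= ler_piMl ?expR_ge0. Qed.

Lemma npw_half_sq n : (0 < n)%N -> npw n (2^-1 : R) ^+ 2 = n%:R^-1.
Proof. by move=> n0; rewrite expr2 -npwD -(@npw_inv R n) //; congr npw; lra. Qed.

Lemma zp_small p : (1 < p)%N -> cm (zp p) <= 3/4.
Proof.
move=> p1; apply: (le_trans (cm_zp p)); have p0 : (0 < p)%N by rewrite ltnW.
have h := npw_half_sq p0; have n0 : 0 <= npw p (2^-1 : R) := expR_ge0 _.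
have : p%:R^-1 <= 2^-1 :> R by rewrite lef_pV2 ?posrE ?ltr0n // ler_nat.
rewrite -h expr2; set x := npw p _ in n0 *; nra.
Qed.

Lemma yp_exists : exists y : nat -> C, forall p, (1 < p)%N ->
  cexp (y p) = (1 - zp p)^-1 /\ forall K, cm (y p - logser K (zp p)) <= 4 * npw p (2^-1 : R) ^+ K.+1.
Proof.
have h p : exists y : C, (1 < p)%N -> cexp y = (1 - zp p)^-1 /\
   forall K, cm (y - logser K (zp p)) <= 4 * npw p (2^-1 : R) ^+ K.+1.
  case: (leqP p 1) => p1; first by exists 0.
  have z := zp_small p1; have z1 : cm (zp p) < 1 by lra.
  have [y [E H]] := clog_exists z1; exists y => _; split=> // K.
  apply: (le_trans (H K)); rewrite mulrC; apply: ler_pM; rewrite ?invr_ge0 ?exprn_ge0 ?cm_ge0 //; first lra.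
    have -> : 4 = (1/4)^-1 :> R by field.
    by rewrite lef_pV2 ?posrE //; lra.
  by rewrite lerXn2r ?nnegrE ?cm_ge0 ?expR_ge0 // cm_zp.
by have [f Hf] := choice h; exists f.
Qed.

Lemma zp_pow p j : (0 < p)%N -> chi (p ^ j) * npow_neg (p ^ j) (hlf R) = zp p ^+ j.
Proof.
move=> p0; elim: j => [|j IH]; first by rewrite expn0 chi_one npow1 mulr1 expr0.
rewrite expnS chiM npowM ?expn_gt0 ?p0 // exprS -IH /zp; ring.
Qed.

Definition Dn N : C := \sum_(1 <= k < N.+1) cN chi k * ((ln (k%:R : R))^-1)%:C.

(** A prime power p^k carries the weight log p / log (p^k) = 1/k, so each prime contributes its
    logarithmic series truncated at p^k <= N. *)
Lemma Dn_primes N : (0 < N)%N -> Dn N = \sum_(0 <= p < N.+1 | prime p) logser (trunc_log p N) (zp p).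
Proof.
move=> N0; have -> : Dn N = \sum_(1 <= n < N.+1) (vM R n)%:C * (chi n * npow_neg n (hlf R) * ((ln (n%:R : R))^-1)%:C).
  by apply: eq_bigr => n _; rewrite /cN !mulrA.
rewrite vM_sum; apply: eq_bigr => p pp.
have p1 := prime_gt1 pp; have p0 := prime_gt0 pp.
have lp : ln (p%:R : R) != 0 by rewrite lt0r_neq0 // ln_gt0 // ltr1n.
set K := trunc_log p N.
have KN : (K <= N)%N.
  apply: ltnW; apply: leq_trans (trunc_logP p1 N0); exact: ltn_expl.
have pk k : (p ^ k <= N)%N = (k <= K)%N.
  apply/idP/idP => h; first exact: trunc_log_max.
  by apply: leq_trans (trunc_logP p1 N0); rewrite leq_exp2l.
rewrite big_mkcond (big_cat_nat (n := K.+1)) //= [X in _ + X]big1_seq ?addr0; last first.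
  by move=> k /andP[_]; rewrite mem_index_iota => /andP[kK _]; rewrite pk leqNgt kK.
rewrite /logser big_add1 /= big_mkord; apply: eq_bigr => k _.
rewrite pk ltn_ord zp_pow // natrX lnXn ?ltr0n // -[ln _ *+ _]mulr_natl invfM rmorphM /=.
have I1 : (ln (p%:R : R))%:C * ((ln (p%:R : R))^-1)%:C = 1 :> C by rewrite -rmorphM /= mulfV.
have -> : ((k.+1%:R : R)^-1)%:C = k.+1%:R^-1 :> C by rewrite fmorphV rmorph_nat.
have -> : (ln (p%:R : R))%:C * (zp p ^+ k.+1 * (k.+1%:R^-1 * ((ln (p%:R : R))^-1)%:C)) =
  ((ln (p%:R : R))%:C * ((ln (p%:R : R))^-1)%:C) * (zp p ^+ k.+1 / k.+1%:R) by ring.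
by rewrite I1 mul1r.
Qed.

Definition chi2 n : C := chi n ^+ 2.

Lemma zp_sq p : (0 < p)%N -> zp p ^+ 2 = Fd chi2 p.
Proof.
move=> p0; rewrite /zp /Fd /chi2 exprMn; congr (_ * _).
rewrite expr2 -npowD npow_negE.
have -> : hlf R + hlf R = 1 by rewrite /hlf -rmorphD /= -[RHS]/((1:R)%:C); congr (_%:C); lra.
by rewrite mul1r -rmorphN cexp_real expRN lnK // posrE ltr0n.
Qed.

Lemma isqrt_exists N : exists s, (s * s <= N)%N /\ (N < s.+1 * s.+1)%N.
Proof.
elim: N => [|N [s [h1 h2]]]; first by exists 0%N.
case: (leqP (s.+1 * s.+1) N.+1) => h; first by exists s.+1; split=> //; nia.
by exists s; split=> //; apply: leq_trans h1 _.
Qed.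

Lemma logser1 (z : C) : logser 1 z = z.
Proof. by rewrite /logser big_ord1 expr1 divr1. Qed.

Lemma logser2 (z : C) : logser 2 z = z + z ^+ 2 / 2.
Proof. by rewrite /logser !big_ord_recr big_ord0 /= add0r expr1 divr1. Qed.

Local Ltac drop := clear -R q chi q0 chiq chi1 chi_one chiM.

(** For p <= s the truncated series misses O(N^(-1/2)), because the next power of p exceeds N; the
    bound for the number of primes up to s makes this O(1 / log s). For s < p <= N only the first
    term was kept: the quadratic term is the one subtracted here, and the rest is O(p^(-3/2)). *)
Lemma euler_compare (y : nat -> C) N s : (4 <= s)%N -> (s * s <= N)%N -> (N < s.+1 * s.+1)%N ->
  (forall p, (1 < p)%N -> forall K, cm (y p - logser K (zp p)) <= 4 * npw p (2^-1 : R) ^+ K.+1) ->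
  cm (\sum_(0 <= p < N.+1 | prime p) y p - Dn N - (2^-1)%:C * (Tp chi2 N - Tp chi2 s)) <= 64 / ln s%:R.
Proof.
move=> s4 sN Ns Hy; have N0 : (0 < N)%N by apply: leq_trans sN; rewrite muln_gt0 (leq_trans _ s4).
have s0 : (0 < s)%N by rewrite (leq_trans _ s4).
have sN1 : (s.+1 <= N.+1)%N by rewrite ltnS; apply: leq_trans sN; rewrite leq_pmulr.
have ls : 1 <= ln (s%:R : R) := @ln_nat_ge1 R s s4.
have lsi : 0 < (ln (s%:R : R))^-1 by rewrite invr_gt0; lra.
have h2 : 0 < 2^-1 :> R by rewrite invr_gt0.
have sp : 0 < s%:R :> R by rewrite ltr0n.
rewrite Dn_primes //.
have -> : (2^-1)%:C * (Tp chi2 N - Tp chi2 s) = \sum_(s.+1 <= p < N.+1 | prime p) zp p ^+ 2 / 2.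
  have -> : Tp chi2 N = Tp chi2 s + \sum_(s.+1 <= p < N.+1 | prime p) Fd chi2 p.
    by rewrite /Tp -big_cat_nat.
  rewrite addrAC subrr add0r mulr_sumr big_nat_cond [RHS]big_nat_cond.
  apply: eq_bigr => p /andP[/andP[sp1 _] _]; rewrite zp_sq ?(leq_trans _ sp1) //.
  by rewrite mulrC; congr (_ * _); rewrite fmorphV rmorph_nat.
rewrite -sumrB (big_cat_nat (n := s.+1)) //= -addrA -sumrB.
apply: (le_trans (cm_D _ _)).
have -> : 64 / ln s%:R = 40 / ln s%:R + 24 / ln (s%:R : R) by ring.
apply: lerD.
  apply: (le_trans (cm_sum _ _ _)); rewrite big_ltn_cond //=.
  have nN : 0 <= npw N (2^-1 : R) := expR_ge0 _.
  apply: (@le_trans _ _ (\sum_(1 <= p < s.+1 | prime p) 4 * npw N 2^-1 * 1)).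
    apply: ler_sum => p pp; have p1 := prime_gt1 pp; rewrite mulr1.
    apply: (le_trans (Hy p p1 _)); rewrite ler_pM2l //.
    have -> : npw p (2^-1 : R) ^+ (trunc_log p N).+1 = npw (p ^ (trunc_log p N).+1) 2^-1.
      rewrite /npw -expRM_natl natrX lnXn ?ltr0n ?prime_gt0 // -[ln _ *+ _]mulr_natl; congr expR; ring.
    by apply: (npw_anti (ltW h2)) => //; apply: ltnW; apply: trunc_log_ltn.
  rewrite -mulr_sumr; have pc := @prime_count_le R s (leq_trans (isT : 2 <= 4)%N s4).
  have sn : s%:R * npw N (2^-1 : R) <= 1.
    have e1 : npw N (2^-1 : R) <= npw (s * s) 2^-1 by apply: (npw_anti (ltW h2)); rewrite ?muln_gt0 ?s0.
    have e2 : npw (s * s) (2^-1 : R) = s%:R^-1.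
      by rewrite /npw natrM lnM ?posrE // -(@npw_inv R s) // /npw; congr expR; field.
    rewrite e2 in e1; have := ler_wpM2l (ltW sp) e1; by rewrite mulfV ?lt0r_neq0.
  have n4 : 0 <= 4 * npw N (2^-1 : R) by rewrite mulr_ge0.
  apply: (le_trans (ler_wpM2l n4 pc)).
  have -> : 4 * npw N 2^-1 * (10 * (s%:R / ln s%:R)) = (s%:R * npw N 2^-1) * (40 / ln (s%:R : R)) by ring.
  by rewrite ler_piMl // mulr_ge0 // ltW.
apply: (le_trans (cm_sum _ _ _)).
apply: (@le_trans _ _ (\sum_(s.+1 <= p < N.+1) 4 * npw p (1 + 2^-1))).
  rewrite big_mkcond /= !big_nat; apply: ler_sum => p /andP[sp1 pN]; rewrite ltnS in pN.
  have p0 : (0 < p)%N by apply: leq_ltn_trans sp1.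
  case: ifP => pp; last by rewrite mulr_ge0 ?expR_ge0.
  have p1 := prime_gt1 pp.
  have -> : trunc_log p N = 1%N.
    apply: trunc_log_eq => //; rewrite expn1 pN /=; apply: (leq_trans Ns); rewrite expnS expn1.
    exact: leq_mul.
  rewrite logser1; have := Hy p p1 2%N; rewrite logser2.
  have -> : y p - zp p - zp p ^+ 2 / 2 = y p - (zp p + zp p ^+ 2 / 2) by ring.
  have -> : npw p (2^-1 : R) ^+ 3 = npw p (1 + 2^-1) by rewrite /npw -expRM_natl; congr expR; field.
  by [].
rewrite -mulr_sumr; have := @npw_tail R 2^-1 s.+1 N.+1 h2 isT; rewrite invrK => h.
have a1 : npw s.+1 (2^-1 : R) <= npw s 2^-1 by apply: (npw_anti (ltW h2)).
have a2 : npw s (2^-1 : R) <= 2 / ln s%:R.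
  rewrite ler_pdivlMr; last lra.
  have := @ln_le_npw R s 2^-1 h2; rewrite invrK => l.
  have := ler_wpM2l (expR_ge0 (- (2^-1 * ln s%:R))) l; rewrite -/(npw s (2^-1 : R)) mulrCA -npwD subrr /npw mul0r oppr0 expR0; (drop; lra).
have -> : 24 / ln (s%:R : R) = 4 * (3 * (2 / ln s%:R)) by ring.
rewrite ler_pM2l //; apply: (le_trans h); (move: a1 a2; drop; lra).
Qed.

Hypothesis dich : \sum_(k < q) chi2 k = 0 \/ (forall n, chi2 n = if coprime n q then 1 else 0).

Local Ltac drop' := clear -R q chi q0 chiq chi1 chi_one chiM dich.

Lemma lnln_sqrt N s : (4 <= s)%N -> (s * s <= N)%N -> (N < s.+1 * s.+1)%N ->
  `|ln (ln (N%:R : R)) - ln (ln s%:R) - ln 2| <= (ln (s%:R : R))^-1.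
Proof.
move=> s4 sN Ns; have s0 : (0 < s)%N by rewrite (leq_trans _ s4).
have N0 : (0 < N)%N by apply: leq_trans sN; rewrite muln_gt0 s0.
have ls : 1 <= ln (s%:R : R) := @ln_nat_ge1 R s s4.
have b1 : 2 * ln (s%:R : R) <= ln N%:R.
  have : ln ((s * s)%:R : R) <= ln N%:R by rewrite ler_ln ?posrE ?ltr0n ?muln_gt0 ?s0 // ler_nat.
  rewrite natrM lnM ?posrE ?ltr0n //; lra.
have b2 : ln (N%:R : R) <= 2 * ln s.+1%:R.
  have : ln (N%:R : R) <= ln (s.+1 * s.+1)%:R by rewrite ler_ln ?posrE ?ltr0n // ler_nat ltnW.
  rewrite natrM lnM ?posrE ?ltr0n //; lra.
have b3 := @ln_succ_le R s s0.
have b4 : s%:R^-1 <= 1 :> R by rewrite invf_le1 ?ltr0n // ler1n.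
have lN : 0 < ln (N%:R : R) by lra.
have E : ln (ln (N%:R : R)) - ln (ln s%:R) - ln 2 = ln (ln N%:R / (2 * ln s%:R)).
  rewrite ln_div ?posrE ?lnM ?posrE ?mulr_gt0 //; (move: ls; drop'; lra).
have le_sub (x : R) : 0 < x -> ln x <= x - 1.
  by move=> x0; have := expR_ge1Dx (ln x); rewrite lnK ?posrE //; (drop'; lra).
have r1 : 1 <= ln (N%:R : R) / (2 * ln s%:R) by rewrite ler_pdivlMr ?mul1r //; (move: ls; drop'; lra).
rewrite E ger0_norm ?ln_ge0 //.
have r0 : 0 < ln (N%:R : R) / (2 * ln s%:R) by (move: r1; drop'; lra).
apply: (le_trans (le_sub _ r0)).
have -> : ln (N%:R : R) / (2 * ln s%:R) - 1 = (ln N%:R / 2 - ln s%:R) / ln s%:R by field; rewrite lt0r_neq0 //; (move: ls; drop'; lra).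
rewrite -[leRHS]mul1r ler_pM2r ?invr_gt0; (move: ls b2 b3 b4; drop'; lra).
Qed.

(** The primes between the square root of N and N contribute half the sum of chi^2(p)/p, that is (dl
    / 2) (log log N - log log s), which tends to (dl / 2) log 2: this is [kap]. The bound N >= 16
    ensures s >= 4. *)
Lemma euler_log : exists (kap : C) (K : R), 0 <= K /\ forall (y : nat -> C),
  (forall p, (1 < p)%N -> forall K, cm (y p - logser K (zp p)) <= 4 * npw p (2^-1 : R) ^+ K.+1) ->
  forall N, (16 <= N)%N -> cm (\sum_(0 <= p < N.+1 | prime p) y p - Dn N - kap) <= K / ln N%:R.
Proof.
have c1 n : cm (chi2 n) <= 1.
  by rewrite /chi2 cmX exprn_ile1 ?cm_ge0.
have cq n : chi2 (n + q)%N = chi2 n by rewrite /chi2 chiq.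
have co : chi2 1%N = 1 by rewrite /chi2 chi_one expr1n.
have cM m n : chi2 (m * n)%N = chi2 m * chi2 n by rewrite /chi2 chiM exprMn.
have [dl [K [K0 HK]]] := @prime_recip R q chi2 q0 cq c1 co cM dich.
exists (2^-1 * (dl * ln 2))%:C, (4 * (64 + K + `|dl|)); split; first by rewrite mulr_ge0 // !addr_ge0.
move=> y Hy N N16; have [s [h1 h2]] := isqrt_exists N.
have s4 : (4 <= s)%N by nia.
have s0 : (0 < s)%N by rewrite (leq_trans _ s4).
have sN : (s <= N)%N by apply: leq_trans h1; rewrite leq_pmulr.
have ls : 1 <= ln (s%:R : R) := @ln_nat_ge1 R s s4.
have E1 := euler_compare s4 h1 h2 Hy; have E2 := HK s N s4 sN; have E3 := lnln_sqrt s4 h1 h2.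
have lN : (ln (s%:R : R))^-1 <= 4 / ln N%:R.
  have lN0 : 1 <= ln (N%:R : R) by apply: (@ln_nat_ge1 R); apply: leq_trans N16.
  rewrite ler_pdivlMr; last (move: lN0; drop'; lra).
  rewrite mulrC ler_pdivrMr; last (move: ls; drop'; lra).
  have : ln (N%:R : R) <= ln (s ^ 4)%:R.
    rewrite ler_ln ?posrE ?ltr0n ?expn_gt0 ?s0 ?(leq_trans _ N16) // ler_nat; apply: ltnW; apply: (leq_trans h2).
    have : (s.+1 <= s * s)%N by nia.
    move=> h; rewrite (_ : s ^ 4 = (s * s) * (s * s))%N; first exact: leq_mul.
    by rewrite !expnS expn0; lia.
  rewrite natrX lnXn ?ltr0n // -mulr_natl; (drop'; lra).
set S := \sum_(_ <= _ < _ | _) _ in E1 *; set T := Tp chi2 N - Tp chi2 s in E1 E2.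
pose w := dl * (ln (ln (N%:R : R)) - ln (ln s%:R)).
have -> : S - Dn N - (2^-1 * (dl * ln 2))%:C = (S - Dn N - (2^-1)%:C * T) + ((2^-1)%:C * (T - w%:C) + (2^-1 * (dl * (ln (ln (N%:R : R)) - ln (ln s%:R) - ln 2)))%:C).
  by rewrite /w !(rmorphM, rmorphB) /=; ring.
apply: (le_trans (cm_D _ _)); apply: (le_trans (lerD E1 (cm_D _ _))).
rewrite cmM !cm_real normrM normrM (ger0_norm (_ : 0 <= 2^-1 :> R)) ?invr_ge0 //.
have i0 : 0 < (ln (s%:R : R))^-1 by rewrite invr_gt0; (move: ls; drop'; lra).
have t1 : 2^-1 * cm (T - w%:C) <= K * (ln (s%:R : R))^-1.
  have c0 := cm_ge0 (T - w%:C); apply: le_trans E2; (move: c0; drop'; lra).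
have t2 : 2^-1 * (`|dl| * `|ln (ln (N%:R : R)) - ln (ln s%:R) - ln 2|) <= `|dl| * (ln (s%:R : R))^-1.
  have := ler_wpM2l (normr_ge0 dl) E3; have : 0 <= `|dl| * `|ln (ln (N%:R : R)) - ln (ln s%:R) - ln 2| by rewrite mulr_ge0.
  (drop'; lra).
have W : 0 <= 64 + K + `|dl| by rewrite !addr_ge0.
have := ler_wpM2l W lN.
have -> : 4 * (64 + K + `|dl|) / ln N%:R = (64 + K + `|dl|) * (4 / ln N%:R) by ring.
(move: t1 t2; drop'; lra).
Qed.

End EulerLog.

(** * Elementary properties of characters *)

Section Characters.
Variable R : realType.
Local Notation C := R[i].
Variables (q : nat) (psi : nat -> C).
Hypothesis q0 : (0 < q)%N.
Hypothesis psiq : forall n, psi (n + q)%N = psi n.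
Hypothesis psi_one : psi 1%N = 1.
Hypothesis psiM : forall m n, psi (m * n)%N = psi m * psi n.
Implicit Types (n k j : nat).

Lemma char_mod n : psi n = psi (n %% q)%N.
Proof.
have P k j : psi (j + k * q)%N = psi j.
  by elim: k => [|k IH]; rewrite ?mul0n ?addn0 // mulSnr addnA psiq IH.
by rewrite {1}(divn_eq n q) addnC P.
Qed.

Lemma char_exp n j : psi (n ^ j)%N = psi n ^+ j.
Proof. by elim: j => [|j IH]; rewrite ?expn0 ?expr0 // expnS psiM IH exprS. Qed.

(** Powers of a value of modulus greater than 1 would be unbounded, yet they are values of psi,
    which takes finitely many. *)
Lemma char_cm_le1 n : cm (psi n) <= 1.
Proof.
rewrite leNgt; apply/negP => h1.
pose S : R := \sum_(k < q) cm (psi k).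
have bd j : cm (psi j) <= S.
  rewrite char_mod /S (bigD1 (Ordinal (ltn_pmod j q0))) //= lerDl.
  by apply: sumr_ge0 => k _; exact: cm_ge0.
set c := cm (psi n) in h1; have c1 : 0 < c - 1 by lra.
have [J HJ] := big_nat_ex (S / (c - 1)).
have bern j : 1 + j%:R * (c - 1) <= c ^+ j.
  elim: j => [|j IH]; first by rewrite mul0r addr0 expr0.
  rewrite exprS -[j.+1%:R]natr1; have j0 : 0 <= j%:R :> R by [].
  have := ler_wpM2l (ltW (lt_trans ltr01 h1)) IH.
  have : 0 <= j%:R * (c - 1) * (c - 1) by rewrite !mulr_ge0 // ltW.
  set t := j%:R in j0 *; nra.
have := bern J.+1; have := bd (n ^ J.+1)%N; rewrite char_exp cmX -/c => h2 h3.
have : S < S; last by rewrite ltxx.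
apply: lt_le_trans h2; apply: lt_le_trans h3.
by move: HJ; rewrite ler_pdivrMr //; lra.
Qed.

(** Multiplication by n0 permutes the residues modulo q, so the sum equals psi n0 times itself. *)
Lemma char_sum0 n0 : coprime n0 q -> psi n0 != 1 -> \sum_(k < q) psi k = 0.
Proof.
move=> co ne.
pose h (k : 'I_q) : 'I_q := Ordinal (ltn_pmod (n0 * k) q0).
have hinj : injective h.
  move=> k k' /(congr1 val) /= /eqP E; apply/val_inj => /=.
  wlog le : k k' E / (k <= k')%N.
    move=> W; case/orP: (leq_total k k') => l; first exact: W.
    by apply/esym/W => //; rewrite eq_sym.
  rewrite eq_sym eqn_mod_dvd ?leq_mul2l ?le ?orbT // -mulnBr Gauss_dvdr 1?coprime_sym // in E.
  have : (k' - k < q)%N by rewrite (leq_ltn_trans (leq_subr _ _)).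
  by case: (posnP (k' - k)) => [/eqP|p /(leq_ltn_trans (dvdn_leq p E))]; [rewrite subn_eq0 => l _; apply/eqP; rewrite eqn_leq le|rewrite ltnn].
have E : psi n0 * (\sum_(k < q) psi k) = \sum_(k < q) psi k.
  rewrite mulr_sumr [RHS](reindex_inj hinj) /=; apply: eq_bigr => k _.
  by rewrite -char_mod psiM.
apply/eqP; have : (psi n0 - 1) * (\sum_(k < q) psi k) = 0 by rewrite mulrBl mul1r E subrr.
by move/eqP; rewrite mulf_eq0 subr_eq0 (negPf ne).
Qed.

End Characters.

(** * Approximation of the Euler product at good integers *)

Section Assembly.
Variable R : realType.
Local Notation C := R[i].
Variables (q : nat) (chi : nat -> C).
Hypothesis q0 : (0 < q)%N.
Hypothesis chiq : forall n, chi (n + q)%N = chi n.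
Hypothesis chi_one : chi 1%N = 1.
Hypothesis chiM : forall m n, chi (m * n)%N = chi m * chi n.
Hypothesis chi_cop : forall n, (chi n == 0) = ~~ coprime n q.
Implicit Types (n U : nat) (x : R).

Lemma chi2_dich : \sum_(k < q) chi2 chi k = 0 \/ (forall n, chi2 chi n = if coprime n q then 1 else 0).
Proof.
have cq n : chi2 chi (n + q)%N = chi2 chi n by rewrite /chi2 chiq.
have cM m n : chi2 chi (m * n)%N = chi2 chi m * chi2 chi n by rewrite /chi2 chiM exprMn.
have [[n0 [co ne]]|h] := pselect (exists n0, coprime n0 q /\ chi2 chi n0 != 1).
  by left; exact: (char_sum0 q0 cq cM co ne).
right=> n; case: ifP => co.
  by apply/eqP; apply: contrapT => /negP ne; apply: h; exists n.
by apply/eqP; rewrite /chi2 expf_eq0 /= chi_cop co.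
Qed.

Lemma npow_half n : (0 < n)%N -> npow_neg n (hlf R) = ((Num.sqrt (n%:R : R))%:C)^-1.
Proof.
move=> n0; rewrite npow_negE /hlf -rmorphM -rmorphN cexp_real -fmorphV; congr (_%:C).
have h := @npw_half_sq R n n0; have p : 0 <= npw n (2^-1 : R) := expR_ge0 _.
have -> : expR (- (2^-1 * ln (n%:R : R))) = npw n 2^-1 by [].
have -> : n%:R = (npw n (2^-1 : R))^-1 ^+ 2 by rewrite exprVn h invrK.
by rewrite sqrtr_sqr ger0_norm ?invr_ge0 // invrK.
Qed.

Lemma euler_prodE (y : nat -> C) x : (forall p, (1 < p)%N -> cexp (y p) = (1 - zp chi p)^-1) ->
  euler_prod chi x = cexp (\sum_(0 <= p < (Num.truncn x).+1 | prime p) y p).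
Proof.
move=> Hy; rewrite cexp_sum; apply: eq_bigr => p pp.
by rewrite Hy ?prime_gt1 // /zp npow_half ?prime_gt0.
Qed.

Lemma lnln_near n x : (4 <= n)%N -> n%:R <= x -> x < n.+1%:R ->
  [/\ 0 <= ln (ln x) - ln (ln n%:R), ln (ln x) - ln (ln n%:R) <= (ln (n%:R : R))^-1 & ln n%:R <= ln x /\ ln x <= ln n%:R + 1].
Proof.
move=> n4 nx xn; have n0 : (0 < n)%N by rewrite (leq_trans _ n4).
have nR : 0 < n%:R :> R by rewrite ltr0n.
have x0 : 0 < x by lra.
have l1 := @ln_nat_ge1 R n n4; have l2 := @ln_succ_le R n n0.
have i1 : n%:R^-1 <= 1 :> R by rewrite invf_le1 // ler1n.
have a1 : ln n%:R <= ln x by rewrite ler_ln ?posrE.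
have a2 : ln x <= ln (n.+1%:R : R) by rewrite ler_ln ?posrE ?ltr0n // ltW.
have lx : 0 < ln x by lra. have ln0 : 0 < ln (n%:R : R) by lra.
split; [by rewrite subr_ge0 ler_ln ?posrE|..|by split; lra].
rewrite -ln_div ?posrE //; have q1 : 0 < ln x / ln n%:R by rewrite divr_gt0.
have := expR_ge1Dx (ln (ln x / ln n%:R)); rewrite lnK ?posrE // => h.
have : ln x / ln n%:R - 1 = (ln x - ln n%:R) / ln (n%:R : R) by field; exact: lt0r_neq0.
have : (ln x - ln n%:R) / ln n%:R <= 1 / ln (n%:R : R) by rewrite ler_pM2r ?invr_gt0 //; lra.
lra.
Qed.

Lemma cube_over_mono (u L : R) : 1 <= ln u -> 1 <= u -> u <= L -> L <= 2 * u ->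
  ln u ^+ 3 / u <= 2 * (ln L ^+ 3 / L).
Proof.
move=> lu u1 uL L2; have u0 : 0 < u by lra. have L0 : 0 < L by lra.
have a : ln u <= ln L by rewrite ler_ln ?posrE.
have b : ln u ^+ 3 <= ln L ^+ 3 by rewrite lerXn2r ?nnegrE //; lra.
have c : u^-1 <= 2 * L^-1.
  by rewrite -[u^-1]mul1r ler_pdivrMr // mulrAC ler_pdivlMr // mul1r.
rewrite mulrCA; apply: ler_pM => //; first by rewrite exprn_ge0 //; lra.
by rewrite invr_ge0 ltW.
Qed.

Hypothesis grh : GRH chi.
Hypothesis np : nonprincipal q chi.

Local Ltac drop := clear -R q chi q0 chiq chi_one chiM chi_cop grh np.

Theorem prod_approx : exists m : nat, vanishing_order chi m /\
  exists l : C, l != 0 /\ exists (G0 : C) (Cc C4 : R) (U0 : nat), [/\ 0 <= Cc, (4 <= U0)%N,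
   (forall U M : nat, (4 <= U)%N ->
     \sum_(1 <= n < M | (U%:R <= ln (n%:R : R)) && (ln (n%:R : R) < U%:R + 1))
       Num.max 0 (cm (beta chi m G0 n) - Cc * ln (U%:R : R) ^+ 3) / n%:R <= Cc / U%:R) &
   forall U n x, (U0 <= U)%N -> U%:R <= ln (n%:R : R) -> ln (n%:R : R) < U%:R + 1 -> n%:R <= x -> x < n.+1%:R ->
     cm (beta chi m G0 n) <= Cc * ln (U%:R : R) ^+ 3 + 1 ->
     cm ((ln x ^+ m)%:C * euler_prod chi x - l) <= C4 * (ln (ln x) ^+ 3 / ln x)].
Proof.
have chi1 n : cm (chi n) <= 1 by exact: (char_cm_le1 q0 chiq chi_one chiM).
have chi0 : \sum_(k < q) chi k = 0.
  by case: np => n0 [co ne]; exact: (char_sum0 q0 chiq chiM co ne).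
have [KF [KF0 crude]] := @F_crude R q chi q0 chiq chi1 chi0 chi_one chiM grh.
have [KL [KL0 local]] := @F_local R q chi q0 chiq chi1 chi0 chi_one grh.
have [m [G0 [w0 [K0 [w00 w01 K00 vo zero]]]]] := @F_zero R q chi q0 chiq chi1 chi0 grh.
exists m; split=> //.
have [Cc [Cc0 blk]] := @block_bound_beta R q chi q0 chiq chi1 chi0 chi_one chiM grh m G0 w0 KF KL K0
   w00 w01 KF0 crude KL0 local K00 zero.
have st k : (1 < k)%N -> Dn chi k.+1 - Dn chi k =
   ((\sum_(1 <= j < k.+2) cN chi j) - \sum_(1 <= j < k.+1) cN chi j) * ((ln (k.+1%:R : R))^-1)%:C.
  have rc (f : nat -> C) i : \sum_(1 <= j < i.+2) f j - \sum_(1 <= j < i.+1) f j = f i.+1.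
    by rewrite big_nat_recr //= addrAC subrr add0r.
  by move=> _; rewrite /Dn !rc.
have [l' [U1 [U14 HG]]] := @ga_limit R (fun n => \sum_(1 <= j < n.+1) cN chi j) (Dn chi) m%:R G0 st Cc Cc0 blk.
have [kap [K [KK0 HE]]] := @euler_log R q chi q0 chiq chi1 chi_one chiM chi2_dich.
have [y Hy] := @yp_exists R chi chi1.
exists (cexp (kap + l')); split; first exact: cexp_neq0.
pose Ct := Ctail (m%:R : C) Cc.
have Ct0 : 0 <= Ct by rewrite /Ct /Ctail addr_ge0 ?mulr_ge0 ?cm_ge0.
pose C5 : R := K + Ct + m%:R + Cc + 1.
have m0 : 0 <= m%:R :> R by [].
have C50 : 1 <= C5 by rewrite /C5; (move: Cc0 KK0 Ct0 m0; drop; lra).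
have [U2 HU2] := @cube_small R C5^-1 (ltac:(rewrite invr_gt0; (move: C50; drop; lra))).
exists G0, Cc, (cm (cexp (kap + l')) * (10 * C5)), (maxn (maxn U1 U2) 16); split=> //.
  by rewrite leq_max orbT.
move=> U n x; rewrite !geq_max => /andP[/andP[UU1 UU2] U16] Un nU nx xn good.
have U4 : (4 <= U)%N by rewrite (leq_trans _ U16).
have n16 : (16 <= n)%N.
  rewrite -(ler_nat R); apply: le_trans (ln_le_nat R n); apply: le_trans Un; by rewrite ler_nat.
have n4 : (4 <= n)%N by rewrite (leq_trans _ n16).
have [d0 d1 [d2 d3]] := lnln_near n4 nx xn.
have u16 : 16 <= U%:R :> R by rewrite ler_nat.
have lu : 1 <= ln (U%:R : R) := @ln_nat_ge1 R U U4.
have ln16 : 16 <= ln (n%:R : R) by (move: Un u16; drop; lra).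
set D : C := \sum_(0 <= p < (Num.truncn x).+1 | prime p) y p + (m%:R * ln (ln x))%:C - (kap + l').
have tx : Num.truncn x = n.
  by apply/eqP; rewrite truncn_eq ?nx ?xn // (le_trans _ nx).
have Dle : cm D <= C5 * (ln (U%:R : R) ^+ 3 / U%:R).
  have E1 := HE y (fun p p1 => (Hy p p1).2) n n16; have E2 := HG U n UU1 Un.
  rewrite -/Ct in E2.
  (* Four errors: the truncation of the Euler product's logarithm, the convergence of [ga], the
     passage from n to x in log log, and the term beta(n) / log n, which is small because n is
     good. *)
  have -> : D = (\sum_(0 <= p < n.+1 | prime p) y p - Dn chi n - kap) +
     (ga (fun n => \sum_(1 <= j < n.+1) cN chi j) (Dn chi) m%:R G0 n - l') +
     (m%:R * (ln (ln x) - ln (ln n%:R)))%:C + beta chi m G0 n * ((ln (n%:R : R))^-1)%:C.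
    rewrite /D tx /ga /beta /be rmorphM rmorphM rmorphB rmorph_nat /=; ring.
  have U0 : 0 < U%:R :> R by (move: u16; drop; lra). have ln0 : 0 < ln (n%:R : R) by (move: ln16; drop; lra).
  have iU : 0 < U%:R^-1 :> R by rewrite invr_gt0.
  have iln : (ln (n%:R : R))^-1 <= U%:R^-1 by rewrite lef_pV2 ?posrE.
  have il0 : 0 < (ln (n%:R : R))^-1 by rewrite invr_gt0.
  have l3 : 1 <= ln (U%:R : R) ^+ 3 by rewrite expr_ge1 //; (move: lu; drop; lra).
  set r := ln U%:R ^+ 3 / U%:R in E2 *.
  have ir : U%:R^-1 <= r by rewrite /r ler_peMl // ltW.
  have b1 : K / ln n%:R <= K * r by rewrite ler_wpM2l //; (move: iln ir; drop; lra).
  have b3 : cm (m%:R * (ln (ln x) - ln (ln n%:R)))%:C <= m%:R * r.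
    by rewrite cm_real normrM !ger0_norm // ler_wpM2l //; (move: d1 iln ir; drop; lra).
  have b4 : cm (beta chi m G0 n * ((ln (n%:R : R))^-1)%:C) <= (Cc + 1) * r.
    rewrite cmM cm_real ger0_norm; last exact: ltW.
    have -> : (Cc + 1) * r = ((Cc + 1) * ln U%:R ^+ 3) / U%:R by rewrite /r mulrA.
    apply: ler_pM => //; [exact: cm_ge0|exact: ltW|(move: good l3; drop; lra)].
  have -> : C5 * r = K * r + Ct * r + m%:R * r + (Cc + 1) * r by rewrite /C5; ring.
  apply: (le_trans (cm_D _ _)); apply: lerD b4; apply: (le_trans (cm_D _ _)); apply: lerD b3.
  by apply: (le_trans (cm_D _ _)); apply: lerD E2; exact: le_trans E1 b1.
have D1 : cm D <= 1.
  apply: (le_trans Dle); have h := HU2 U UU2.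
  by rewrite mulrC -ler_pdivlMr ?div1r //; (move: C50; drop; lra).
have lx0 : 0 < ln x by (move: d2 ln16; drop; lra).
have E : (ln x ^+ m)%:C * euler_prod chi x - cexp (kap + l') = cexp (kap + l') * (cexp D - 1).
  rewrite (@euler_prodE y) => [|p p1]; last by have [] := Hy p p1.
  have -> : (ln x ^+ m)%:C = cexp (m%:R * ln (ln x))%:C.
    by rewrite cexp_real expRM_natl lnK // posrE.
  rewrite mulrBr mulr1 -!cexpD; congr (cexp _ - _); rewrite /D; ring.
have cub : ln (U%:R : R) ^+ 3 / U%:R <= 2 * (ln (ln x) ^+ 3 / ln x).
  by apply: cube_over_mono => //; (move: Un nU d2 d3 u16; drop; lra).
rewrite E cmM -mulrA ler_wpM2l ?cm_ge0 //; apply: (le_trans (cexp_sub1_small D1)).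
have := ler_wpM2l (le_trans ler01 C50) cub; (move: Dle; drop; lra).
Qed.

End Assembly.

(** * Density *)

Section Density.
Variable R : realType.
Implicit Types (x y e : R) (n M U J : nat).

Local Notation leb := (@lebesgue_measure R : set R -> \bar R).

(** [lebesgue_measure] extends to all sets as an outer measure, so monotonicity, like subadditivity
    in the next lemma, holds for arbitrary sets and applies directly to the set whose density is
    sought. *)
Lemma lebesgue_le (A B : set R) : A `<=` B -> (leb A <= leb B)%E.
Proof.
move=> AB; rewrite /lebesgue_measure /lebesgue_stieltjes_measure /measure_extension.
exact: le_mu_ext.
Qed.

Lemma lebesgue_U (A B : set R) : (leb (A `|` B) <= leb A + leb B)%E.
Proof.
rewrite /lebesgue_measure /lebesgue_stieltjes_measure /measure_extension.
exact: (outer_measureU2 (mu_ext (wlength idfun))).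
Qed.

Lemma lebesgue_cc (a b : R) : a <= b -> leb [set x | a <= x <= b] = (b - a)%:E.
Proof.
move=> ab; have -> : [set x | a <= x <= b] = [set` `[a, b]].
  by apply/seteqP; split=> x /=; rewrite in_itv.
rewrite lebesgue_measure_itv /= lte_fin; case: ltP => // ba.
by have -> : a = b; [apply/eqP; rewrite eq_le ab|rewrite subrr].
Qed.

Lemma lebesgue_cells (P : pred nat) M :
  (leb [set x : R | exists n : nat, [/\ (n < M)%N, P n, (n%:R <= x)%R & (x < n.+1%:R)%R]] <= (\sum_(0 <= n < M | P n) 1)%:E)%E.
Proof.
elim: M => [|M IH].
  rewrite big_geq // (_ : [set x | _] = set0) ?measure0 //.
  by apply/seteqP; split=> x //= [n []].
rewrite big_mkcond big_nat_recr //= -big_mkcond /=.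
pose S : set R := [set x : R | exists n : nat, [/\ (n < M)%N, P n, n%:R <= x & x < n.+1%:R]].
case: ifP => PM.
  apply: (@le_trans _ _ (leb (S `|` [set x | M%:R <= x <= M.+1%:R]))).
    apply: lebesgue_le => x /= [n [nM Pn h1 h2]].
    move: nM; rewrite ltnS leq_eqVlt => /orP[/eqP nM|nM]; first by right; rewrite -nM h1 ltW.
    by left; exists n.
  apply: (le_trans (lebesgue_U _ _)); rewrite EFinD; apply: leeD => //.
  by rewrite lebesgue_cc ?ler_nat // lee_fin -natr1 addrC addKr.
rewrite addr0; apply: le_trans IH; apply: lebesgue_le => x /= [n [nM Pn h1 h2]].
exists n; split=> //; move: nM; rewrite ltnS leq_eqVlt => /orP[/eqP nM|//].
by rewrite nM PM in Pn.
Qed.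

Variables (bad : pred nat) (Cd : R) (U1 : nat).
Hypothesis Cd0 : 0 <= Cd.
Hypothesis bad_block : forall U M, (U1 <= U)%N ->
  \sum_(1 <= n < M | [&& U%:R <= ln (n%:R : R), ln (n%:R : R) < U%:R + 1 & bad n]) n%:R^-1 <= Cd / U%:R.

(* Only boundedly many logarithmic blocks meet [e^{-J} M, M], and each carries a proportion O(1/U) of bad integers. *)
Local Ltac drop := clear -R bad Cd U1 Cd0 bad_block.

Lemma bad_count e : 0 < e -> exists M0, forall M, (M0 <= M)%N -> \sum_(0 <= n < M | bad n) (1 : R) <= e * M%:R.
Proof.
move=> e0.
have cb := bad_block; have c0 := Cd0.
(* J is chosen so that the integers up to e^(-J) M make up at most e M / 3 of those below M and can
   be counted trivially. *)
have [J HJ] := big_nat_ex (3 / e).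
have eJ : 3 * expR (- J%:R) <= e.
  have h := expR_ge1Dx J.+1%:R.
  have : 3 / e <= expR J%:R.
    apply: (le_trans HJ); apply: le_trans (expR_ge1Dx _); by rewrite -natr1 addrC.
  by rewrite expRN ler_pdivrMr // mulrC ler_pdivrMr ?expR_gt0.
have [V0 HV] := big_nat_ex (3 * (J.+1%:R * Cd) / e).
pose V1 := (V0.+1 + J + U1)%N.
have [M1 HM1] := big_nat_ex (expR (V1%:R : R)).
have [M2 HM2] := big_nat_ex (3 / e).
exists (maxn M1.+1 M2.+1) => M; rewrite geq_max => /andP[MM1 MM2].
have M0 : (0 < M)%N by apply: leq_trans MM1.
have MR : 0 < M%:R :> R by rewrite ltr0n.
have lM : V1%:R <= ln (M%:R : R).
  rewrite -[leLHS]expRK ler_ln ?posrE ?expR_gt0 //; apply: (le_trans HM1); by rewrite ler_nat.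
have lM0 : 0 <= ln (M%:R : R) by rewrite ln_nat_ge0.
pose V := Num.truncn (ln (M%:R : R)).
have [v1 v2] : V%:R <= ln (M%:R : R) /\ ln (M%:R : R) < V.+1%:R by apply/andP; exact: truncn_itv.
have V1V : (V1 <= V)%N.
  by rewrite -ltnS -(ltr_nat R); apply: le_lt_trans v2.
have JV : (J <= V)%N by apply: leq_trans V1V; rewrite /V1 -addnA addnCA leq_addr.
pose D := Num.truncn (expR (- J%:R) * M%:R : R).
have D0 : 0 <= expR (- J%:R) * M%:R :> R by rewrite mulr_ge0 ?expR_ge0.
have [d1 d2] : D%:R <= expR (- J%:R) * M%:R :> R /\ expR (- J%:R) * M%:R < D.+1%:R :> R.
  by apply/andP; exact: truncn_itv.
pose B n i : R := if [&& (V - J + i)%:R <= ln (n%:R : R), ln (n%:R : R) < (V - J + i)%:R + 1 & bad n] then n%:R^-1 else 0.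
have B0 n i : 0 <= B n i by rewrite /B; case: ifP.
(* A bad n beyond e^(-J) M lies in one of the J+1 last blocks, where it has weight 1/n >= 1/M. *)
have pt n : (0 < n)%N -> (n < M)%N -> bad n -> 1 <= (if (n <= D)%N then 1 else 0) + M%:R * \sum_(i < J.+1) B n i.
  move=> n0 nM bn; have S0 : 0 <= M%:R * \sum_(i < J.+1) B n i.
    by rewrite mulr_ge0 // sumr_ge0 // => i _; exact: B0.
  have nR : 0 < n%:R :> R by rewrite ltr0n.
  case: leqP => nD; first by rewrite lerDl.
  have ln1 : ln (M%:R : R) - J%:R <= ln n%:R.
    have : ln (expR (- J%:R) * M%:R : R) <= ln n%:R.
      rewrite ler_ln ?posrE ?mulr_gt0 ?expR_gt0 //; apply: ltW; apply: (lt_le_trans d2); by rewrite ler_nat.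
    rewrite lnM ?posrE ?expR_gt0 // expRK; (drop; lra).
  have ln2 : ln (n%:R : R) < V%:R + 1.
    rewrite natr1; apply: le_lt_trans v2; rewrite ler_ln ?posrE // ler_nat; exact: ltnW.
  have ln3 : 0 <= ln (n%:R : R) by rewrite ln_nat_ge0.
  pose W := Num.truncn (ln (n%:R : R)).
  have [w1 w2] : W%:R <= ln (n%:R : R) /\ ln (n%:R : R) < W.+1%:R by apply/andP; exact: truncn_itv.
  have VW : (V - J <= W)%N.
    rewrite -ltnS -(ltr_nat R); apply: le_lt_trans w2; apply: le_trans ln1; rewrite natrB //; (move: v1; drop; lra).
  have WV : (W - (V - J) < J.+1)%N.
    have : (W < V.+1)%N by rewrite -(ltr_nat R) -[V.+1%:R]natr1; apply: le_lt_trans ln2.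
    by rewrite !ltnS leq_subLR subnK.
  rewrite add0r (bigD1 (Ordinal WV)) //= {1}/B subnKC // w1 bn natr1 w2 /=.
  rewrite mulrDr -[leLHS]addr0; apply: lerD.
    by rewrite ler_pdivlMr // mul1r ler_nat ltnW.
  by rewrite mulr_ge0 // sumr_ge0 // => i _; exact: B0.
have s1 : \sum_(0 <= n < M | bad n) (1 : R) <= 1 + (D%:R + M%:R * \sum_(i < J.+1) \sum_(1 <= n < M) B n i).
  rewrite big_mkcond big_ltn //=; apply: lerD; first by case: ifP.
  rewrite exchange_big mulr_sumr /=.
  apply: (@le_trans _ _ (\sum_(1 <= n < M) ((if (n <= D)%N then 1 else 0) + M%:R * \sum_(i < J.+1) B n i))).
    rewrite !big_nat; apply: ler_sum => n /andP[n0 nM]; case: ifP => bn; first exact: pt.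
    rewrite addr_ge0 //; first by case: ifP.
    by rewrite mulr_ge0 // sumr_ge0 // => i _; exact: B0.
  rewrite big_split /=; apply: lerD => //.
  by have := @sum_if_le R M.-1 D 1 ler01; rewrite prednK // mulr1.
apply: (le_trans s1).
have VJ : (V0.+1 + U1 <= V - J)%N by rewrite leq_subRL // addnA [(J + _)%N]addnC.
have V0R : V0.+1%:R <= (V - J)%:R :> R by rewrite ler_nat; apply: leq_trans VJ; rewrite leq_addr.
have V0p : 0 < V0.+1%:R :> R by [].
have s2 : \sum_(i < J.+1) \sum_(1 <= n < M) B n i <= J.+1%:R * (Cd / V0.+1%:R).
  rewrite -[X in X%:R * _]card_ord -sum1_card natr_sum mulr_suml; apply: ler_sum => i _; rewrite mul1r.
  rewrite /B -big_mkcond /=; apply: (le_trans (cb _ _ _)).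
    by apply: leq_trans (leq_addr _ _); apply: leq_trans VJ; rewrite leq_addl.
  rewrite ler_wpM2l // lef_pV2 ?posrE //.
    by rewrite natrD (le_trans V0R) // lerDl.
  by rewrite natrD (lt_le_trans (lt_le_trans V0p V0R)) // lerDl.
have s3 : J.+1%:R * (Cd / V0.+1%:R) <= e / 3.
  move: HV; rewrite ler_pdivrMr // => h; rewrite mulrA ler_pdivrMr //; move: h; rewrite -[_ * e]mulrC; (drop; lra).
have s4 : 1 <= e / 3 * M%:R.
  have : 3 / e <= M%:R by apply: (le_trans HM2); rewrite ler_nat.
  rewrite ler_pdivrMr //; (drop; lra).
have s5 : M%:R * \sum_(i < J.+1) \sum_(1 <= n < M) B n i <= M%:R * (e / 3).
  by rewrite ler_pM2l // (le_trans s2).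
have s6 : D%:R <= e / 3 * M%:R by apply: (le_trans d1); rewrite ler_pM2r //; (move: eJ; drop; lra).
(move: s4 s5 s6; drop; lra).
Qed.

Theorem density_one (A : set R) (X0 : R) :
  (forall x, X0 <= x -> ~~ bad (Num.truncn x) -> A x) -> has_natural_density A 1.
Proof.
move=> HA; apply/cvgrPdist_le => e e0.
have e4 : 0 < e / 4 by rewrite divr_gt0.
have [M0 HM] := bad_count e4.
pose Y : R := Num.max 0 X0.
have Y0 : 0 <= Y by rewrite le_max lexx.
near=> X.
have X2 : 2 <= X by near: X; exact: nbhs_pinfty_ge.
have XM : M0%:R <= X by near: X; exact: nbhs_pinfty_ge.
have XY : 4 * (2 + Y) / e <= X by near: X; apply: nbhs_pinfty_ge; exact: num_real.
have X0' : 0 < X by lra.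
set I := A `&` _.
have Ile : (leb I <= (X - 2)%:E)%E.
  by rewrite -lebesgue_cc //; apply: lebesgue_le => x [].
pose n := Num.truncn X.
have [n1 n2] : n%:R <= X /\ X < n.+1%:R by apply/andP; apply: truncn_itv; exact: ltW.
have nM : (M0 <= n.+1)%N by rewrite -(ler_nat R) (le_trans XM) // ltW.
have cell := lebesgue_cells bad n.+1; set S := [set x | _] in cell.
(* What the set misses in [2, X] is covered by an initial interval and by the unit cells of the bad
   integers. *)
have sub : [set x | 2 <= x <= X] `<=` I `|` ([set x | 0 <= x <= Y] `|` S).
  move=> x /= /andP[x2 xX]; have x0 : 0 <= x by lra.
  have [xY|Yx] := leP x Y; first by right; left; rewrite /= x0.
  have [t1 t2] : (Num.truncn x)%:R <= x /\ x < (Num.truncn x).+1%:R by apply/andP; exact: truncn_itv.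
  have [b|nb] := boolP (bad (Num.truncn x)).
    right; right; exists (Num.truncn x); split=> //.
    by rewrite -(ltr_nat R); apply: le_lt_trans t1 (le_lt_trans xX n2).
  left; split; last by rewrite /= x2.
  by apply: HA => //; apply: le_trans (ltW Yx); rewrite le_max lexx orbT.
have low : ((X - 2)%:E <= leb I + (Y%:E + (e / 4 * n.+1%:R)%:E))%E.
  rewrite -lebesgue_cc //; apply: (le_trans (lebesgue_le sub)); apply: (le_trans (lebesgue_U _ _)).
  apply: leeD => //; apply: (le_trans (lebesgue_U _ _)); apply: leeD.
    by rewrite lebesgue_cc // subr0.
  by apply: (le_trans cell); rewrite lee_fin; exact: HM.
have I0 : (0 <= leb I)%E by exact: measure_ge0.
move: Ile low I0; rewrite -/I; case: (leb I) => [r| |] //=.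
rewrite !lee_fin => r1 r2 r0.
have nX : n.+1%:R <= 2 * X by rewrite -natr1; lra.
have q1 : e / 4 * n.+1%:R <= e / 4 * (2 * X) by rewrite ler_pM2l.
have q2 : 4 * (2 + Y) <= X * e by rewrite -ler_pdivrMr.
have -> : 1 - r / X = (X - r) / X by rewrite mulrBl divff // lt0r_neq0.
rewrite ger0_norm; last by rewrite divr_ge0 ?ltW //; lra.
rewrite ler_pdivrMr //; lra.
Unshelve. all: by end_near.
Qed.

End Density.

(** * Conclusion *)

Section Final.
Variable R : realType.
Local Notation C := R[i].

(** The extra eps absorbs the constant: t^eps >= K once t is large. *)
Lemma powR_dominates (K eps : R) : 0 < eps ->
  exists2 t0 : R, 1 <= t0 & forall t, t0 <= t -> K * t ^+ 3 <= t `^ (3 + eps).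
Proof.
move=> e0; pose k : R := Num.max 1 K.
have k1 : 1 <= k by rewrite le_max lexx.
have kK : K <= k by rewrite le_max lexx orbT.
exists (Num.max 1 (k `^ eps^-1)); first by rewrite le_max lexx.
move=> t; rewrite ge_max => /andP[t1 tk]; have t0 : 0 < t by lra.
rewrite powRD; last by rewrite lt0r_neq0 // implybT.
rewrite (powR_mulrn 3 (ltW t0)) mulrC ler_pM2l ?exprn_gt0 //.
apply: (le_trans kK); have -> : k = (k `^ eps^-1) `^ eps by rewrite -powRrM mulVf ?lt0r_neq0 // powRr1 //; lra.
by apply: ge0_ler_powR; rewrite ?nnegrE ?powR_ge0 ?(ltW e0) ?(ltW t0).
Qed.

End Final.

Theorem theorem1p3 (R : realType) (q : nat) (chi : nat -> R[i]) :
  (3 <= q)%N ->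
  is_dirichlet_character q chi ->
  nonprincipal q chi ->
  GRH chi ->
  exists m : nat, vanishing_order chi m /\
    exists l : R[i], l != 0 /\
      forall eps : R, 0 < eps -> has_natural_density (Eset chi m l eps) 1.
Proof.
move=> _ [q0 chi_one chiM chiq chi_cop] np grh.
have [m [vo [l [l0 [G0 [Cc [C4 [U0 [Cc0 U04 blk good]]]]]]]]] :=
  prod_approx q0 chiq chi_one chiM chi_cop grh np.
exists m; split=> //; exists l; split=> // eps e0.
have [t0 t1 Ht] := powR_dominates C4 e0.
pose lev n := Num.truncn (ln (n%:R : R)).
have levE n U : (U%:R <= ln (n%:R : R)) && (ln (n%:R : R) < U%:R + 1) -> lev n = U.
  by rewrite natr1; exact: truncn_def.
(* An integer is bad if beta exceeds the level of its block by more than 1; the summand of [blk] is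
   then at least 1/n, which bounds the logarithmic mass of the bad integers. *)
pose bad n := ~~ (cm (beta chi m G0 n) <= Cc * ln ((lev n)%:R : R) ^+ 3 + 1).
have bb U M : (U0 <= U)%N ->
    \sum_(1 <= n < M | [&& U%:R <= ln (n%:R : R), ln (n%:R : R) < U%:R + 1 & bad n]) n%:R^-1 <= Cc / U%:R.
  move=> UU; apply: le_trans (blk U M (leq_trans U04 UU)).
  rewrite big_mkcond [leRHS]big_mkcond !big_nat; apply: ler_sum => n _.
  rewrite andbA; case: ifP => [/andP[h b]|_]; last first.
    by case: ifP => // _; rewrite divr_ge0 // le_max lexx.
  rewrite h ler_peMl ?invr_ge0 //; move: b; rewrite /bad (levE n U h) -ltNge => b.
  by rewrite le_max; apply/orP; right; lra.
(* The two exponentials ensure log log x >= t0 and that the integer part n of x lies in a block of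
   index at least U0; the summand 1 compensates for passing from x to n. *)
apply: (density_one Cc0 bb (X0 := expR (expR t0) + expR (U0%:R + 1) + 1)) => x xX nb.
have p1 := expR_gt0 (expR t0); have p2 := expR_gt0 (U0%:R + 1 : R).
have U0p : 4 <= U0%:R :> R by rewrite ler_nat.
have p3 := expR_ge1Dx (U0%:R + 1 : R).
have x0 : 0 < x by lra.
have [n1 n2] : (Num.truncn x)%:R <= x /\ x < (Num.truncn x).+1%:R.
  by apply/andP; apply: truncn_itv; exact: ltW.
set n := Num.truncn x in nb n1 n2.
have nU : U0%:R + 1 <= ln (n%:R : R).
  rewrite -[leLHS]expRK ler_ln ?posrE ?expR_gt0 //; move: n2; rewrite -natr1; lra.
have [w1 w2] : (lev n)%:R <= ln (n%:R : R) /\ ln (n%:R : R) < (lev n).+1%:R.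
  by apply/andP; apply: truncn_itv; lra.
have lU : (U0 <= lev n)%N.
  by rewrite -ltnS -(ltr_nat R); apply: le_lt_trans w2; lra.
have tx : t0 <= ln (ln x).
  have e1 : expR t0 <= ln x by rewrite -[leLHS]expRK ler_ln ?posrE ?expR_gt0 //; lra.
  by rewrite -[leLHS]expRK ler_ln ?posrE ?expR_gt0 //; apply: lt_le_trans e1; exact: expR_gt0.
have lx0 : 0 < ln x by rewrite ln_gt0 //; lra.
split; first by lra.
rewrite cmE lecR; move/negPn: nb => nb; rewrite -natr1 in w2.
apply: (le_trans (good (lev n) n x lU w1 w2 n1 n2 nb)).
by rewrite mulrA ler_pM2r ?invr_gt0 // Ht.
Qed.
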